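(* Let $\mu,\nu,h>0$, $1\le p<3$ and $1\le r\le 2$. Set $$D_1:=\big\{(\mathbf f,\mathbf g): \mathbf f,\ \nabla\times\mathbf g\in \dot B^{3/p-3}_{p,1}(\mathbb R^3)^3,\ \mathbf g\in \dot B^{3/p-3}_{p,r}(\mathbb R^3)^3,\ \operatorname{div}\mathbf g=0\big\},$$ $$S_1:=\big\{(\mathbf u,\mathbf B): \mathbf u,\ \nabla\times\mathbf B\in \dot B^{3/p-1}_{p,1}(\mathbb R^3)^3,\ \mathbf B\in \dot B^{3/p-1}_{p,r}(\mathbb R^3)^3,\ \operatorname{div}\mathbf u=\operatorname{div}\mathbf B=0\big\},$$ with norms the sums of the norms of $\mathbf f,\nabla\times\mathbf g,\mathbf g$ (respectively $\mathbf u,\nabla\times\mathbf B,\mathbf B$) in the indicated spaces. Then the stationary Hall-MHD system $$\begin{cases}\mathbf u\cdot\nabla\mathbf u+\nabla\mathfrak p-\mu\Delta\mathbf u-(\nabla\times\mathbf B)\times\mathbf B=\mathbf f,\\ \operatorname{div}\mathbf u=0,\\ -\nu\Delta\mathbf B-\nabla\times\big((\mathbf u-h\nabla\times\mathbf B)\times\mathbf B\big)=\mathbf g\end{cases}\qquad\text{in }\mathbb R^3$$ is well-posed from $D_1$ to $S_1$.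
   Context: Homogeneous Besov spaces: fix a smooth radial $\varphi$ supported in $\{3/4\le|\xi|\le 8/3\}$ with $\sum_{j\in\mathbb Z}\varphi(2^{-j}\xi)=1$ for $\xi\ne0$, and put $\dot\Delta_j=\varphi(2^{-j}D)$ (Fourier multiplier). For $s\in\mathbb R$, $p,r\in[1,\infty]$, $\dot B^s_{p,r}(\mathbb R^3)$ is the set of $u\in\mathcal S'(\mathbb R^3)$ modulo polynomials with $\|u\|_{\dot B^s_{p,r}}=\big\|2^{js}\|\dot\Delta_ju\|_{L^p}\big\|_{\ell^r(\mathbb Z)}<\infty$. For the indices used here $\sum_j\dot\Delta_ju$ converges in $\mathcal S'$, and $u$ is identified with this sum. Well-posedness: consider an abstract equation $U=LF+N(U,U)$ with datum $F$ in a Banach space $D$, unknown $U$ in a Banach space $S$, $L:D\to S$ densely defined linear and $N:S\times S\to S$ densely defined bilinear. Write $B_X(\rho)$ for the open ball of $X$ of radius $\rho$ centred at $0$. The equation is well-posed from $D$ to $S$ if there are $\varepsilon,\delta>0$ such that (i) for every $F\in B_D(\varepsilon)$ there is a solution $U\in B_S(\delta)$; (ii) two solutions in $B_S(\delta)$ for the same $F\in B_D(\varepsilon)$ coincide; (iii) the resulting solution map $B_D(\varepsilon)\to B_S(\delta)$, $F\mapsto U$, is continuous for the norms of $D$ and $S$. The Hall-MHD system is put in this form, with datum $(\mathbf f,\mathbf g)$ and unknown $(\mathbf u,\mathbf B)$, by eliminating the pressure with the Leray projector $\mathcal P=\mathrm{Id}+\nabla(-\Delta)^{-1}\operatorname{div}$: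 $$\mathbf u=(-\mu\Delta)^{-1}\mathcal P\mathbf f+(-\mu\Delta)^{-1}\mathcal P\operatorname{div}(-\mathbf u\otimes\mathbf u+\mathbf B\otimes\mathbf B),\quad \mathbf B=(-\nu\Delta)^{-1}\mathcal P\mathbf g+(-\nu\Delta)^{-1}\nabla\times\big((\mathbf u-h\nabla\times\mathbf B)\times\mathbf B\big),$$ where $(\operatorname{div}(\mathbf w\otimes\mathbf z))^j=\sum_{k=1}^3\partial_k(w^jz^k)$. *)

(* Defs.v *)
From HB Require Import structures.
From mathcomp Require Import all_boot all_order all_algebra.
From mathcomp Require Import all_classical all_reals all_analysis.

Set Implicit Arguments.
Unset Strict Implicit.
Unset Printing Implicit Defensive.

Import Order.TTheory GRing.Theory Num.Theory.
Import numFieldNormedType.Exports.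

Local Open Scope classical_set_scope.
Local Open Scope ring_scope.

Notation R3 R := (R * R * R)%type.

Section Space.
Variable R : realType.
Local Notation E := (R3 R).

Definition coord (x : E) (i : 'I_3) : R := nth 0 [:: x.1.1; x.1.2; x.2] i.

Definition basis (i : 'I_3) : E :=
  ((i == 0%N :> nat)%:R, (i == 1%N :> nat)%:R, (i == 2%N :> nat)%:R).

Definition dot (x y : E) : R := \sum_(i < 3) coord x i * coord y i.

(* The norm of the product normed module [E] is the max norm, hence this one. *)
Definition enorm (x : E) : R := Num.sqrt (dot x x).

Definition lebesgue3 :
    {measure set (R3 (measurableTypeR R)) -> \bar R} :=
  ((@lebesgue_measure R \x @lebesgue_measure R) \x @lebesgue_measure R)%E.

End Space.

Section Schwartz.
Variable R : realType.
Local Notation E := (R3 R).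
Implicit Types (f g : E -> R) (s : seq 'I_3) (N : nat).

Definition partial (i : 'I_3) f : E -> R := fun x => 'D_(basis R i) f x.

Definition partials s f : E -> R := foldr partial f s.

Definition smooth f : Prop := forall s x,
  {for x, continuous (partials s f)} /\
  forall i, derivable (partials s f) x (basis R i).

Definition schwartz_seminorm N f : \bar R := ereal_sup
  [set y | exists s x, (size s <= N)%N /\
     y = ((1 + enorm x) ^+ N * `|partials s f x|)%:E].

Definition schwartz f : Prop :=
  smooth f /\ forall N, (schwartz_seminorm N f < +oo)%E.

Lemma partials_lin s (a : R) f g : smooth f -> smooth g ->
  partials s (a *: f + g) = a *: partials s f + partials s g.
Proof.
move=> sf sg; elim: s => [//|i s IHs] /=.
rewrite IHs; apply/funext => x; rewrite /partial.
have df := (sf s x).2 i; have dg := (sg s x).2 i.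
by rewrite deriveD ?deriveZ//; exact: derivableZ.
Qed.

Lemma smooth_lin (a : R) f g : smooth f -> smooth g -> smooth (a *: f + g).
Proof.
move=> sf sg s x; rewrite partials_lin//; split=> [|i].
  apply: continuousD; last exact: (sg s x).1.
  by apply: continuousZr; exact: (sf s x).1.
by apply: derivableD; [apply: derivableZ; exact: (sf s x).2|exact: (sg s x).2].
Qed.

Lemma le_seminorm N f s x : (size s <= N)%N ->
  (((1 + enorm x) ^+ N * `|partials s f x|)%:E <= schwartz_seminorm N f)%E.
Proof. by move=> sN; apply: ereal_sup_ubound; exists s, x. Qed.

Lemma seminorm_ge0 N f : (0 <= schwartz_seminorm N f)%E.
Proof.
apply: le_trans (@le_seminorm N f [::] 0 _) => //.
by rewrite lee_fin mulr_ge0// exprn_ge0// addr_ge0// sqrtr_ge0.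
Qed.

Lemma schwartz_lin (a : R) f g :
  schwartz f -> schwartz g -> schwartz (a *: f + g).
Proof.
move=> [sf nf] [sg ng]; split=> [|N]; first exact: smooth_lin.
apply: (@le_lt_trans _ _
  (`|a|%:E * schwartz_seminorm N f + schwartz_seminorm N g)%E).
  apply: ge_ereal_sup => _ [s [x [sN ->]]]; rewrite partials_lin//.
  have w0 : 0 <= (1 + enorm x) ^+ N by rewrite exprn_ge0// addr_ge0// sqrtr_ge0.
  apply: le_trans (leeD (lee_wpmul2l _ (le_seminorm f x sN))
                        (le_seminorm g x sN)); last by rewrite lee_fin.
  rewrite -EFinM -EFinD lee_fin mulrCA -mulrDr ler_wpM2l//.
  by rewrite (le_trans (ler_normD _ _))// lerD2r normrM.
rewrite lte_add_pinfty// lte_mul_pinfty// ?lee_fin//.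
Qed.

Lemma schwartz_partial i f : schwartz f -> schwartz (partial i f).
Proof.
move=> [sf nf].
have E s : partials s (partial i f) = partials (rcons s i) f.
  by rewrite /partials foldr_rcons.
split=> [s x|N]; first by rewrite E; exact: sf.
apply: le_lt_trans (nf N.+1); apply: ge_ereal_sup => _ [s [x [sN ->]]].
rewrite E; apply: le_trans (@le_seminorm N.+1 f (rcons s i) x _); last first.
  by rewrite size_rcons.
by rewrite lee_fin ler_wpM2r// ler_weXn2l// lerDl sqrtr_ge0.
Qed.

End Schwartz.

Section Distributions.
Variable R : realType.
Local Notation E := (R3 R).
Implicit Types (f g : E -> R).

(* Real tempered distributions, as functionals on all of [E -> R] that vanish
   outside the Schwartz class, so that two distributions are Leibniz equal as
   soon as they agree on Schwartz functions. *)
Definition is_tempered (T : (E -> R) -> R) : Prop :=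
  [/\ forall (a : R) f g, schwartz f -> schwartz g ->
        T (a *: f + g) = a * T f + T g,
      exists (C : R) (N : nat), forall f, schwartz f ->
        (`|T f|%:E <= C%:E * schwartz_seminorm N f)%E
    & forall f, ~ schwartz f -> T f = 0].

Definition tempered : {pred (E -> R) -> R} := fun T => `[< is_tempered T >].

Lemma tempered_submod : submod_closed tempered.
Proof.
split=> [|c T U /asboolP[lT [C [N bT]] zT] /asboolP[lU [D [M bU]] zU]].
  apply/asboolP; split=> //.
  - by move=> a f g _ _; rewrite /= mulr0 addr0.
  - by exists 0, 0%N => f _; rewrite normr0 mul0e.
have ev f : (c *: T + U) f = c * T f + U f by [].
apply/asboolP; split.
- move=> a f g sf sg; rewrite !ev lT// lU// !mulrDr addrACA.
  by rewrite !addrA [c * (a * _)]mulrCA.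
- have mono K L f : (K <= L)%N ->
      (schwartz_seminorm K f <= schwartz_seminorm L f)%E.
    move=> KL; apply: ge_ereal_sup => _ [s [x [sK ->]]].
    apply: le_trans (le_seminorm f x (leq_trans sK KL)).
    by rewrite lee_fin ler_wpM2r// ler_weXn2l// lerDl sqrtr_ge0.
  exists (`|c| * `|C| + `|D|), (maxn N M) => f sf.
  have bound (V B : R) (K : nat) : (`|V|%:E <= B%:E * schwartz_seminorm K f)%E ->
      (K <= maxn N M)%N ->
      (`|V|%:E <= `|B|%:E * schwartz_seminorm (maxn N M) f)%E.
    move=> VB KL; apply: (le_trans VB).
    apply: (@le_trans _ _ (`|B|%:E * schwartz_seminorm K f)%E).
      by rewrite lee_wpmul2r ?seminorm_ge0// lee_fin ler_norm.
    by rewrite lee_wpmul2l ?lee_fin//; exact: mono.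
  have hT := bound _ _ _ (bT f sf) (leq_maxl N M).
  have hU := bound _ _ _ (bU f sf) (leq_maxr N M).
  rewrite EFinD ge0_muleDl ?lee_fin ?mulr_ge0// EFinM -muleA.
  apply: le_trans (leeD (lee_wpmul2l _ hT) hU); last by rewrite lee_fin.
  rewrite -EFinM -EFinD lee_fin ev.
  by rewrite (le_trans (ler_normD _ _))// normrM.
- by move=> f nf; rewrite ev zT// zU// mulr0 addr0.
Qed.

HB.instance Definition _ :=
  GRing.isSubmodClosed.Build R ((E -> R) -> R) tempered tempered_submod.

Record tdist := TDist {
  tdist_val :> (E -> R) -> R;
  tdist_tempered : tdist_val \in tempered }.

HB.instance Definition _ := [isSub for tdist_val].
HB.instance Definition _ := [Choice of tdist by <:].
HB.instance Definition _ := [SubChoice_isSubLmodule of tdist by <:].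

Definition dpartial_fun (i : 'I_3) (u : tdist) (psi : E -> R) : R :=
  if `[< schwartz psi >] then - u (partial i psi) else 0.

Lemma dpartial_tempered i u : dpartial_fun i u \in tempered.
Proof.
have /asboolP[lu [C [N bu]] zu] := tdist_tempered u.
rewrite /dpartial_fun; apply/asboolP; split.
- move=> a f g sf sg; rewrite !asboolT//; last exact: schwartz_lin.
  have -> : partial i (a *: f + g) = a *: partial i f + partial i g.
    exact: (partials_lin [:: i] a sf.1 sg.1).
  by rewrite lu ?opprD ?mulrN//; exact: schwartz_partial.
- exists `|C|, N.+1 => f sf; rewrite asboolT// normrN.
  apply: (le_trans (bu _ (schwartz_partial i sf))).
  apply: (@le_trans _ _ (`|C|%:E * schwartz_seminorm N (partial i f))%E).
    by rewrite lee_wpmul2r ?seminorm_ge0// lee_fin ler_norm.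
  rewrite lee_wpmul2l ?lee_fin//.
  apply: ge_ereal_sup => _ [s [x [sN ->]]].
  have -> : partials s (partial i f) = partials (rcons s i) f.
    by rewrite /partials foldr_rcons.
  apply: le_trans (@le_seminorm _ N.+1 f (rcons s i) x _); last first.
    by rewrite size_rcons.
  by rewrite lee_fin ler_wpM2r// ler_weXn2l// lerDl sqrtr_ge0.
- by move=> f nf; rewrite asboolF.
Qed.

Definition dpartial i u : tdist := TDist (dpartial_tempered i u).

(* [f] is a regular distribution: the functional psi |-> \int f psi. *)
Definition represents f (u : tdist) : Prop :=
  measurable_fun setT f /\ forall psi, schwartz psi ->
    (lebesgue3 R).-integrable setT (fun x => (f x * psi x)%:E) /\
    u psi = \int[lebesgue3 R]_x (f x * psi x).

(* w = u v, the pointwise product of functions. *)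
Definition is_product (u v w : tdist) : Prop :=
  exists f g, [/\ represents f u, represents g v & represents (f \* g) w].

(* l is the sum of the two-sided series of the a_j, each half converging. *)
Definition sumZ (a : int -> R) (l : R) : Prop := exists l1 l2,
  [/\ series (fun n => a (Posz n)) @ \oo --> l1,
      series (fun n => a (Negz n)) @ \oo --> l2 & l = l1 + l2].

(* w = \sum_(j in Z) v_j in S', for functions v_j of polynomial growth. *)
Definition sums_to (v : int -> E -> R) (w : tdist) : Prop :=
  forall psi, schwartz psi ->
    sumZ (fun j => \int[lebesgue3 R]_x (v j x * psi x)) (w psi).

End Distributions.

Section Besov.
Variable R : realType.
Local Notation E := (R3 R).
Local Notation vfield := ('I_3 -> tdist R).
Variable phi : E -> R.

Definition littlewood_paley : Prop :=
  [/\ smooth phi,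
      forall x y, enorm x = enorm y -> phi x = phi y,
      forall x, phi x != 0 -> 3 / 4 <= enorm x <= 8 / 3
    & forall x, x != 0 -> sumZ (fun j : int => phi (2 ^ (- j) *: x)) 1].

(* Inverse Fourier transform of an even symbol; by parity the sine part of
   e^(i x.xi) does not contribute. *)
Definition inv_fourier (m : E -> R) (x : E) : R :=
  (2 * pi) ^- 3 * \int[lebesgue3 R]_xi (cos (dot x xi) * m xi).

(* m(D) u = (F^-1 m) * u, for m even, smooth and compactly supported. *)
Definition multiplier (m : E -> R) (u : tdist R) (x : E) : R :=
  u (fun y => inv_fourier m (x - y)).

Definition dyadic (j : int) (xi : E) : R := phi (2 ^ (- j) *: xi).

Definition lp_block (j : int) (u : tdist R) : E -> R :=
  multiplier (dyadic j) u.

Definition lr_norm (r : \bar R) (a : int -> \bar R) : \bar R :=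
  match r with
  | r%:E%E => ((\esum_(j in [set: int]) (`|a j| `^ r)) `^ r^-1)%E
  | +oo%E => ereal_sup (range (fun j => `|a j|%E))
  | -oo%E => 0%E
  end.

Definition besov_norm (s : R) (p r : \bar R) (u : tdist R) : \bar R :=
  lr_norm r (fun j : int =>
    ((2 `^ (j%:~R * s))%:E * 'N[lebesgue3 R]_p[EFin \o lp_block j u])%E).

(* The class modulo polynomials is identified with its representative
   \sum_j Delta_j u. *)
Definition besov (s : R) (p r : \bar R) : set (tdist R) :=
  [set u | sums_to (fun j => lp_block j u) u /\
           (besov_norm s p r u < +oo)%E].

Definition vbesov s p r : set vfield := [set u | forall i, besov s p r (u i)].

Definition vbesov_norm s p r (u : vfield) : \bar R :=
  (\sum_(i < 3) besov_norm s p r (u i))%E.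

(* w = (- mu Laplacian)^-1 u, the multiplier 1 / (mu |xi|^2) being applied to
   each block of u = \sum_j Delta_j u. *)
Definition inv_laplacian (mu : R) (u w : tdist R) : Prop :=
  sums_to (fun j => multiplier
    (fun xi => (mu * enorm xi ^+ 2)^-1 * dyadic j xi) u) w.

Definition grad (q : tdist R) : vfield := fun i => dpartial i q.

Definition div (u : vfield) : tdist R := \sum_(i < 3) dpartial i (u i).

(* Indices are computed modulo 3. *)
Definition curl (u : vfield) : vfield := fun i =>
  dpartial (i + 1) (u (i + 2)) - dpartial (i + 2) (u (i + 1)).

Definition is_tensor (u v : vfield) (T : 'I_3 -> vfield) : Prop :=
  forall j k, is_product (u j) (v k) (T j k).

Definition is_cross (u v w : vfield) : Prop := exists2 T,
  is_tensor u v T & w = fun i => T (i + 1) (i + 2) - T (i + 2) (i + 1).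

Definition div_tensor (T : 'I_3 -> vfield) : vfield := fun j =>
  \sum_(k < 3) dpartial k (T j k).

(* v = u + grad (- Laplacian)^-1 div u. *)
Definition is_leray (u v : vfield) : Prop := exists2 q,
  inv_laplacian 1 (div u) q & v = u + grad q.

(* w = (- mu Laplacian)^-1 P u. *)
Definition is_stokes (mu : R) (u w : vfield) : Prop := exists2 v,
  is_leray u v & forall i, inv_laplacian mu (v i) (w i).

End Besov.

(* D, S are the subspaces on which the norms nD, nS are considered; L and N are
   given by the graphs of partially defined maps D -> S and S * S -> S. *)
Section WellPosed.
Variables (R : realType) (VD VS : zmodType).
Variables (D : set VD) (nD : VD -> \bar R) (S : set VS) (nS : VS -> \bar R).
Variables (L : VD -> VS -> Prop) (N : VS -> VS -> VS -> Prop).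

Definition oball (V : zmodType) (X : set V) (nX : V -> \bar R) (rho : R) :
  set V := X `&` [set x | (nX x < rho%:E)%E].

Definition solution (F : VD) (U : VS) : Prop := exists V W,
  [/\ S V, S W, L F V, N U U W & U = V + W].

Definition well_posed : Prop := exists eps delta : R,
  [/\ 0 < eps, 0 < delta,
      forall F, oball D nD eps F -> exists2 U, oball S nS delta U & solution F U,
      forall F U U', oball D nD eps F ->
        oball S nS delta U -> oball S nS delta U' ->
        solution F U -> solution F U' -> U = U'
    & forall Phi : VD -> VS,
        (forall F, oball D nD eps F ->
           oball S nS delta (Phi F) /\ solution F (Phi F)) ->
        forall F, oball D nD eps F -> forall eta : R, 0 < eta ->
          exists2 theta : R, 0 < theta &
            forall F', oball D nD eps F' -> (nD (F' - F) < theta%:E)%E ->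
              (nS (Phi F' - Phi F) < eta%:E)%E].

End WellPosed.

Section HallMHD.
Variables (R : realType) (phi : R3 R -> R).
Local Notation vfield := ('I_3 -> tdist R).
Local Notation pair_field := (vfield * vfield)%type.

Definition D1 (p r : R) : set pair_field := [set F |
  [/\ vbesov phi (3 / p - 3) p%:E 1%:E F.1,
      vbesov phi (3 / p - 3) p%:E 1%:E (curl F.2),
      vbesov phi (3 / p - 3) p%:E r%:E F.2
    & div F.2 = 0]].

Definition D1_norm (p r : R) (F : pair_field) : \bar R :=
  (vbesov_norm phi (3 / p - 3) p%:E 1%:E F.1 +
   vbesov_norm phi (3 / p - 3) p%:E 1%:E (curl F.2) +
   vbesov_norm phi (3 / p - 3) p%:E r%:E F.2)%E.

Definition S1 (p r : R) : set pair_field := [set U |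
  [/\ vbesov phi (3 / p - 1) p%:E 1%:E U.1,
      vbesov phi (3 / p - 1) p%:E 1%:E (curl U.2),
      vbesov phi (3 / p - 1) p%:E r%:E U.2,
      div U.1 = 0
    & div U.2 = 0]].

Definition S1_norm (p r : R) (U : pair_field) : \bar R :=
  (vbesov_norm phi (3 / p - 1) p%:E 1%:E U.1 +
   vbesov_norm phi (3 / p - 1) p%:E 1%:E (curl U.2) +
   vbesov_norm phi (3 / p - 1) p%:E r%:E U.2)%E.

Definition hall_mhd_linear (mu nu : R) (F U : pair_field) : Prop :=
  is_stokes phi mu F.1 U.1 /\ is_stokes phi nu F.2 U.2.

(* With U1 = (u, B) and U2 = (v, C), the bilinear map whose value at
   ((u, B), (u, B)) is the nonlinearity of the system: the first component is
   (- mu Laplacian)^-1 P div (- u (x) v + B (x) C), the second one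
   (- nu Laplacian)^-1 curl ((u - h curl B) x C). *)
Definition hall_mhd_bilinear (mu nu h : R) (U1 U2 W : pair_field) : Prop :=
  (exists Tu TB : 'I_3 -> vfield,
     [/\ is_tensor U1.1 U2.1 Tu, is_tensor U1.2 U2.2 TB
       & is_stokes phi mu (div_tensor (- Tu + TB)) W.1]) /\
  (exists2 X, is_cross (U1.1 - h *: curl U1.2) U2.2 X
     & forall i, inv_laplacian phi nu (curl X i) (W.2 i)).

Definition hall_mhd_well_posed (mu nu h p r : R) : Prop :=
  well_posed (D1 p r) (D1_norm p r) (S1 p r) (S1_norm p r)
    (hall_mhd_linear mu nu) (hall_mhd_bilinear mu nu h).

End HallMHD.

(* Main.v *)
From HB Require Import structures.
From mathcomp Require Import all_boot all_order all_algebra.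
From mathcomp Require Import all_classical all_reals all_analysis.
From mathcomp Require Import measurable_realfun zify ring lra.
Require Import Defs.

Set Implicit Arguments.
Unset Strict Implicit.
Unset Printing Implicit Defensive.

Import Order.TTheory GRing.Theory Num.Theory.
Import numFieldNormedType.Exports.

Local Open Scope classical_set_scope.
Local Open Scope ring_scope.

(** The system is a fixed point equation for a quadratic map, so it is enough to
    bound the Stokes operators from D_1 to S_1 and the quadratic term from
    S_1 * S_1 to S_1; well-posedness then follows by contraction, S_1 being
    complete.  Products are estimated block by block.  By the Fourier supports,
    Delta_k (Delta_l u Delta_j v) vanishes for k >= max(l, j) + 4, and also for
    k far from max(l, j) when |l - j| is large.  If |l - j| is large, the low
    frequency factor is put in L^oo and the other one in L^p; otherwise both
    are put in L^rho, rho = max(p, 2) < 3, and Bernstein brings the product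
    from L^(rho/2) back to L^p.  The result is a Schur kernel in |l - j|, which
    maps l^2 * l^2 to l^1: this is where r <= 2 enters.  The Hall term costs
    one more derivative; it is regained because div B = 0 and
    curl B in B^(3/p-1)_(p,1) put B in B^(3/p)_(p,1), and
    B^(3/p-1)_(p,1) B^(3/p)_(p,1) is contained in B^(3/p-1)_(p,1). *)

(** * Integrals of real functions *)

(** A multiplier is here a distribution paired with a translated kernel, so every fact on symbols
    has to be turned into one on convolutions of kernels; cosine inversion and the exchange of a
    distribution with an integral serve this purpose. The exponent [rho] has four constraints: rho
    >= 2, so that Young's inequality holds in L^(rho/2); rho <= 2p, so that Bernstein goes up from
    L^(rho/2) to L^p; rho >= p, so that blocks in L^p are in L^rho; and rho < 3, so that 3/rho - 1 >
    0 and output frequencies below those of the factors are summable. For 1 <= p < 3, max(p, 2)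
    meets all of them. A product in the system is a pointwise product of representing functions.
    Summing its blocks in S' is therefore not enough: the series of blocks of both factors are shown
    to converge absolutely almost everywhere, and representing functions to be unique up to null
    sets. Constants are not optimized: a norm bound is a sequence of block bounds, for which a sum
    costs a factor 2, and the contraction runs with ratio 1/8 to absorb it. *)

Section RealIntegrals.
Context d (T : measurableType d) (R : realType) (m : {measure set T -> \bar R}).
Implicit Types (f g : T -> R).

Definition rintegrable f := m.-integrable setT (EFin \o f).

Lemma rintegrable_measurable f : rintegrable f -> measurable_fun setT f.
Proof. by move=> /integrableP[/measurable_EFinP]. Qed.

Lemma rintegrable_le f g : measurable_fun setT f -> rintegrable g ->
  (forall x, `|f x| <= g x) -> rintegrable f.
Proof.
move=> mf ig fg; apply: le_integrable ig => //; first exact/measurable_EFinP.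
move=> x _ /=; rewrite lee_fin (le_trans (fg x))// ler_norm//.
Qed.

Lemma eq_rintegrable f g : f =1 g -> rintegrable f -> rintegrable g.
Proof. by move=> fg; rewrite (_ : f = g)//; exact/funext. Qed.

Lemma rintegrableD f g : rintegrable f -> rintegrable g ->
  rintegrable (fun x => f x + g x).
Proof.
move=> fi gi; apply: (eq_integrable measurableT _ _ _ (integrableD measurableT fi gi)).
by move=> x _ /=; rewrite EFinD.
Qed.

Lemma rintegrableZ c f : rintegrable f -> rintegrable (fun x => c * f x).
Proof.
move=> fi; apply: (eq_integrable measurableT _ _ _ (integrableZl measurableT c fi)).
by move=> x _ /=; rewrite EFinM.
Qed.

Lemma rintegrableZr c f : rintegrable f -> rintegrable (fun x => f x * c).
Proof.
by move=> /(rintegrableZ c); apply: eq_integrable => // x _ /=; rewrite mulrC.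
Qed.

Lemma rintegrableN f : rintegrable f -> rintegrable (fun x => - f x).
Proof.
by move=> /(rintegrableZ (-1)); apply: eq_integrable => // x _ /=; rewrite mulN1r.
Qed.

Lemma rintegrableB f g : rintegrable f -> rintegrable g ->
  rintegrable (fun x => f x - g x).
Proof. by move=> fi /rintegrableN; exact: rintegrableD. Qed.

Lemma rintegrable_norm f : rintegrable f -> rintegrable (fun x => `|f x|).
Proof. by move=> fi; apply: (eq_integrable measurableT _ _ _ (integrable_abse fi)). Qed.

Lemma rintegrable0 : rintegrable (fun=> 0).
Proof. exact: integrable0. Qed.

Lemma rintegrable_mul_bounded f g (C : R) : rintegrable f ->
  measurable_fun setT g -> (forall x, `|g x| <= C) ->
  rintegrable (fun x => g x * f x).
Proof.
move=> fi mg gC.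
apply: (rintegrable_le _ (rintegrableZ C (rintegrable_norm fi))).
  by apply: measurable_funM => //; exact: rintegrable_measurable.
by move=> x; rewrite normrM ler_wpM2r.
Qed.

Lemma rintegrable_sum I (r : seq I) (P : pred I) (F : I -> T -> R) :
  (forall i, P i -> rintegrable (F i)) ->
  rintegrable (fun x => \sum_(i <- r | P i) F i x).
Proof.
move=> Fi; elim: r => [|i r IHr].
  by apply: eq_rintegrable rintegrable0 => x; rewrite big_nil.
have [Pi|Pi] := boolP (P i); last first.
  by apply: eq_rintegrable IHr => x; rewrite big_cons (negbTE Pi).
apply: (eq_rintegrable (f := fun x => F i x + \sum_(j <- r | P j) F j x)).
  by move=> x; rewrite big_cons Pi.
by apply: rintegrableD => //; exact: Fi.
Qed.

Lemma Rint_le f g : rintegrable f -> rintegrable g -> (forall x, f x <= g x) ->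
  \int[m]_x f x <= \int[m]_x g x.
Proof. by move=> fi gi fg; apply: le_Rintegral. Qed.

Lemma Rint_eq f g : f =1 g -> \int[m]_x f x = \int[m]_x g x.
Proof. by move=> fg; congr Rintegral; apply/funext. Qed.

Lemma Rint0 : \int[m]_x (0 : R) = 0.
Proof. by rewrite /Rintegral integral0. Qed.

Lemma RintD f g : rintegrable f -> rintegrable g ->
  \int[m]_x (f x + g x) = \int[m]_x f x + \int[m]_x g x.
Proof. by move=> fi gi; apply: RintegralD. Qed.

Lemma RintZ c f : rintegrable f -> \int[m]_x (c * f x) = c * \int[m]_x f x.
Proof. by move=> fi; apply: RintegralZl. Qed.

Lemma RintZr c f : rintegrable f -> \int[m]_x (f x * c) = (\int[m]_x f x) * c.
Proof. by move=> fi; apply: RintegralZr. Qed.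

Lemma RintN f : rintegrable f -> \int[m]_x (- f x) = - \int[m]_x f x.
Proof.
move=> fi; rewrite -mulN1r -RintZ//; apply: Rint_eq => x; by rewrite mulN1r.
Qed.

Lemma RintB f g : rintegrable f -> rintegrable g ->
  \int[m]_x (f x - g x) = \int[m]_x f x - \int[m]_x g x.
Proof. by move=> fi gi; apply: RintegralB. Qed.

Lemma Rint_sum I (r : seq I) (P : pred I) (F : I -> T -> R) :
  (forall i, P i -> rintegrable (F i)) ->
  \int[m]_x (\sum_(i <- r | P i) F i x) = \sum_(i <- r | P i) \int[m]_x F i x.
Proof.
move=> Fi; elim: r => [|i r IHr].
  by rewrite big_nil -[RHS]Rint0; apply: Rint_eq => x; rewrite big_nil.
rewrite big_cons; have [Pi|Pi] := boolP (P i); last first.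
  by rewrite -IHr; apply: Rint_eq => x; rewrite big_cons (negbTE Pi).
rewrite -IHr -RintD; [|exact: Fi|exact: rintegrable_sum].
by apply: Rint_eq => x; rewrite big_cons Pi.
Qed.

Lemma Rint_norm f : rintegrable f -> `|\int[m]_x f x| <= \int[m]_x `|f x|.
Proof. by move=> fi; apply: le_normr_Rintegral. Qed.

Lemma Rint_norm_le f g : rintegrable f -> rintegrable g ->
  (forall x, `|f x| <= g x) -> `|\int[m]_x f x| <= \int[m]_x g x.
Proof.
move=> fi gi fg; apply: (le_trans (Rint_norm fi)).
by apply: Rint_le => //; exact: rintegrable_norm.
Qed.

Lemma Rint_ge0 f : (forall x, 0 <= f x) -> 0 <= \int[m]_x f x.
Proof. by move=> f0; apply: Rintegral_ge0. Qed.

Lemma EFin_Rint f : rintegrable f -> (\int[m]_x f x)%:E = (\int[m]_x (f x)%:E)%E.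
Proof.
move=> fi; rewrite /Rintegral fineK//.
exact: integrable_fin_num.
Qed.

Lemma rintegrable_ge0P f : measurable_fun setT f -> (forall x, 0 <= f x) ->
  (\int[m]_x (f x)%:E < +oo)%E -> rintegrable f.
Proof.
move=> mf f0 foo; apply/integrableP; split; first exact/measurable_EFinP.
by under eq_integral do rewrite /= ger0_norm//.
Qed.

Lemma Rint_dominated (F : nat -> T -> R) f g :
  (forall n, measurable_fun setT (F n)) ->
  (forall x, F n x @[n --> \oo] --> f x) -> rintegrable g ->
  (forall n x, `|F n x| <= g x) ->
  rintegrable f /\ (\int[m]_x F n x) @[n --> \oo] --> \int[m]_x f x.
Proof.
move=> mF Ff ig Fg.
have mf : measurable_fun setT f by apply: measurable_fun_cvg mF _ => x _; exact: Ff.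
have Fi n : rintegrable (F n) by apply: rintegrable_le (ig) _.
have [//|||||fi _ cv] := @dominated_convergence _ _ _ m _ measurableT
  (fun n x => (F n x)%:E) (EFin \o f) (EFin \o g).
- by move=> n; exact/measurable_EFinP.
- exact/measurable_EFinP.
- apply: aeW => x _; apply/fine_cvgP; split; last exact: Ff.
  by apply: nearW.
- by [].
- by apply: aeW => x n _; rewrite lee_fin; exact: Fg.
split=> //; apply: fine_cvg.
by rewrite /Rintegral fineK//; apply: integrable_fin_num.
Qed.

End RealIntegrals.
Arguments Rint_eq {d T R m f} g.

(** * Fubini's theorem for real integrands *)

Section RealFubini.
Context d1 d2 (T1 : measurableType d1) (T2 : measurableType d2) (R : realType).
Variables (m1 : {sigma_finite_measure set T1 -> \bar R}).
Variables (m2 : {sigma_finite_measure set T2 -> \bar R}).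
Variables (F : T1 * T2 -> R) (a : T1 -> R) (b : T2 -> R).
Hypothesis mF : measurable_fun setT F.
Hypothesis ai : rintegrable m1 a.
Hypothesis bi : rintegrable m2 b.
Hypothesis Fab : forall x y, `|F (x, y)| <= a x * b y.

(** Domination by a tensor product a(x) b(y) makes every section integrable, and not just almost
    every one, so the Fubini identities below hold for iterated real integrals without an
    exceptional set. *)
Lemma product_integrable : rintegrable (m1 \x m2)%E F.
Proof.
apply/integrable12ltyP; first exact/measurable_EFinP.
have ma := rintegrable_measurable ai; have mb := rintegrable_measurable bi.
apply: (@le_lt_trans _ _ (\int[m1]_x (`|a x| * \int[m2]_y `|b y|)%:E)%E).
  apply: ge0_le_integral => //.
  - by move=> x _; exact: integral_ge0.
  - apply: (@measurable_fun_fubini_tonelli_F _ _ _ _ _ m2 (fun z => `|(F z)%:E|%E)) => //.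
    by do 2 apply: measurableT_comp => //.
  - by apply/measurable_EFinP; apply: measurable_funM => //; exact: measurableT_comp.
  - move=> x _; rewrite EFinM EFin_Rint; last exact: rintegrable_norm.
    rewrite -ge0_integralZl//; last by apply/measurable_EFinP; exact: measurableT_comp.
    apply: ge0_le_integral => //.
    + apply: measurableT_comp => //; apply/measurable_EFinP.
      exact: measurable_fun_pair2.
    + apply/measurable_EFinP; apply: measurable_funM => //; exact: measurableT_comp.
    + by move=> y _; rewrite -EFinM lee_fin (le_trans (Fab x y))// -normrM ler_norm.
have := rintegrableZr (\int[m2]_y `|b y|) (rintegrable_norm ai).
move=> /integrableP[_]; apply: le_lt_trans; apply: ge0_le_integral => //.
- by move=> x _; rewrite lee_fin mulr_ge0// Rint_ge0.
- by apply/measurable_EFinP; apply: measurable_funM => //; exact: measurableT_comp.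
- apply/measurable_EFinP; apply: measurableT_comp => //.
  by apply: measurable_funM => //; exact: measurableT_comp.
- by move=> x _; rewrite lee_fin ler_norm.
Qed.

Lemma section_integrable1 x : rintegrable m2 (fun y => F (x, y)).
Proof.
apply: rintegrable_le (rintegrableZ (a x) bi) _; first exact: measurable_fun_pair2.
exact: Fab.
Qed.

Lemma section_integrable2 y : rintegrable m1 (fun x => F (x, y)).
Proof.
apply: rintegrable_le (rintegrableZr (b y) ai) _; first exact: measurable_fun_pair1.
by move=> x; exact: Fab.
Qed.

Lemma Rint_section_integrable1 : rintegrable m1 (fun x => \int[m2]_y F (x, y)).
Proof.
have := integrable_fubini_F product_integrable.
apply: eq_integrable => // x _ /=.
by rewrite EFin_Rint//; exact: section_integrable1.
Qed.

Lemma Rint_fubini1 : \int[m1]_x \int[m2]_y F (x, y) = \int[(m1 \x m2)%E]_z F z.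
Proof.
rewrite /Rintegral; congr fine; rewrite -integral12_prod_meas1//; last first.
  exact: product_integrable.
apply: eq_integral => x _; rewrite fineK//; apply: integrable_fin_num => //.
exact: section_integrable1.
Qed.

Lemma Rint_fubini2 : \int[m2]_y \int[m1]_x F (x, y) = \int[(m1 \x m2)%E]_z F z.
Proof.
rewrite /Rintegral; congr fine; rewrite -integral21_prod_meas1//; last first.
  exact: product_integrable.
apply: eq_integral => x _; rewrite fineK//; apply: integrable_fin_num => //.
exact: section_integrable2.
Qed.

Lemma Rint_fubini :
  \int[m1]_x \int[m2]_y F (x, y) = \int[m2]_y \int[m1]_x F (x, y).
Proof. by rewrite Rint_fubini1 Rint_fubini2. Qed.

End RealFubini.

Section Tonelli.
Context d1 d2 (T1 : measurableType d1) (T2 : measurableType d2) (R : realType).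
Variables (m1 : {sigma_finite_measure set T1 -> \bar R}).
Variables (m2 : {sigma_finite_measure set T2 -> \bar R}).

Lemma Rint_tensor (a : T1 -> R) (b : T2 -> R) :
  rintegrable m1 a -> rintegrable m2 b ->
  rintegrable (m1 \x m2)%E (fun z => a z.1 * b z.2) /\
  \int[(m1 \x m2)%E]_z (a z.1 * b z.2) = \int[m1]_x a x * \int[m2]_y b y.
Proof.
move=> ai bi.
have mab : measurable_fun setT (fun z : T1 * T2 => a z.1 * b z.2).
  apply: measurable_funM.
    apply: measurableT_comp; [exact: rintegrable_measurable ai|exact: measurable_fst].
  apply: measurableT_comp; [exact: rintegrable_measurable bi|exact: measurable_snd].
have le x y : `|a x * b y| <= `|a x| * `|b y| by rewrite normrM.
split.
  exact: (product_integrable mab (rintegrable_norm ai) (rintegrable_norm bi)).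
rewrite -(Rint_fubini1 mab (rintegrable_norm ai) (rintegrable_norm bi))//=.
by under Rint_eq do rewrite RintZ//; rewrite RintZr.
Qed.

End Tonelli.

(** * Product and image measures *)

Section ProductMeasure.
Context d1 d2 (T1 : measurableType d1) (T2 : measurableType d2) (R : realType).
Variable m1 : {sigma_finite_measure set T1 -> \bar R}.
Variable m2 : {sigma_finite_measure set T2 -> \bar R}.

(** A name for the product, to which the sigma-finite structure is attached; iterating the product
    up to R^3, and then Fubini on R^3 x R^3, rely on it. *)
Definition product_measure : set (T1 * T2) -> \bar R := (m1 \x m2)%E.

HB.instance Definition _ := Measure.on product_measure.

Let product_measure_sigma_finite : sigma_finite setT product_measure.
Proof.
have /sigma_finiteP[F [TF ndF Foo]] := sigma_finiteT m1.
have /sigma_finiteP[G [TG ndG Goo]] := sigma_finiteT m2.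
exists (fun n => F n `*` G n).
  rewrite -setXTT TF TG predeqE => -[x y]; split.
    move=> [/= [n _ Fnx] [k _ Gky]]; exists (maxn n k) => //; split.
    - by move: x Fnx; exact/subsetPset/ndF/leq_maxl.
    - by move: y Gky; exact/subsetPset/ndG/leq_maxr.
  by move=> [n _ []/= ? ?]; split; exists n.
move=> k; have [? ?] := Foo k; have [? ?] := Goo k.
split; first exact: measurableX.
rewrite /product_measure product_measure1E// lte_mul_pinfty// ge0_fin_numE//.
Qed.

HB.instance Definition _ := Measure_isSigmaFinite.Build _ _ _ product_measure
  product_measure_sigma_finite.

End ProductMeasure.

Section ImageMeasure.
Context d d' (T1 : measurableType d) (T2 : measurableType d') (R : realType).
Variables (m : {measure set T1 -> \bar R}) (f : T1 -> T2).

(** The proof that f is measurable is an argument, so that the structure of measure can be attached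
    to the name. *)
Definition image_measure (mf : measurable_fun setT f) (A : set T2) : \bar R :=
  m (f @^-1` A).

Variable mf : measurable_fun setT f.

Let im0 : image_measure mf set0 = 0%E.
Proof. by rewrite /image_measure preimage_set0 measure0. Qed.

Let im_ge0 A : (0 <= image_measure mf A)%E.
Proof. exact: measure_ge0. Qed.

Let im_sigma_additive : semi_sigma_additive (image_measure mf).
Proof.
move=> F mF tF mUF; rewrite /image_measure preimage_bigcup.
apply: measure_semi_sigma_additive.
- by move=> n; rewrite -[X in measurable X]setTI; exact: mf.
- apply/trivIsetP => /= i j _ _ ij; rewrite -preimage_setI.
  by move/trivIsetP : tF => /(_ _ _ _ _ ij) ->//; rewrite preimage_set0.
- by rewrite -preimage_bigcup -[X in measurable X]setTI; exact: mf.
Qed.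

HB.instance Definition _ := isMeasure.Build _ _ _
  (image_measure mf) im0 im_ge0 im_sigma_additive.

Lemma ge0_integral_image (g : T2 -> \bar R) : measurable_fun setT g ->
  (forall y, 0 <= g y)%E ->
  (\int[image_measure mf]_y g y = \int[m]_x g (f x))%E.
Proof.
move=> mg g0; transitivity (\int[pushforward m f]_y g y)%E; first by [].
by rewrite ge0_integral_pushforward// preimage_setT.
Qed.

End ImageMeasure.

(** A signed f is the difference of |f| + f and |f|, both nonnegative and integrable, to which the
    hypothesis on nonnegative functions applies. *)
Lemma Rint_transport d (T : measurableType d) (R : realType)
    (m : {measure set T -> \bar R}) (phi : T -> T) (k : R) :
  measurable_fun setT phi -> 0 <= k ->
  (forall h : T -> R, measurable_fun setT h -> (forall x, 0 <= h x) ->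
     (\int[m]_x (h (phi x))%:E = k%:E * \int[m]_x (h x)%:E)%E) ->
  forall f : T -> R, rintegrable m f ->
  rintegrable m (fun x => f (phi x)) /\
  \int[m]_x f (phi x) = k * \int[m]_x f x.
Proof.
move=> mphi k0 hk f fi; have mf := rintegrable_measurable fi.
have ni := rintegrable_norm fi; have mn := rintegrable_measurable ni.
have key h : rintegrable m h -> (forall x, 0 <= h x) ->
    rintegrable m (fun x => h (phi x)) /\ \int[m]_x h (phi x) = k * \int[m]_x h x.
  move=> hi h0; have mh := rintegrable_measurable hi.
  have ih : rintegrable m (fun x => h (phi x)).
    apply: rintegrable_ge0P => //; first exact: measurableT_comp.
    by rewrite hk// -EFin_Rint// -EFinM ltry.
  by split => //; apply/EFin_inj; rewrite EFinM !EFin_Rint// hk.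
pose g x := `|f x| + f x.
have gi : rintegrable m g by exact: rintegrableD.
have g0 x : 0 <= g x by rewrite /g addrC -lerBlDr sub0r lerNl ler_normr lexx orbT.
have [ig eg] := key g gi g0.
have [inn en] := key (fun x => `|f x|) ni (fun x => normr_ge0 _).
have fE x : f x = g x - `|f x| by rewrite /g addrAC subrr add0r.
split; first by apply: (eq_rintegrable _ (rintegrableB ig inn)) => x; rewrite -fE.
transitivity (\int[m]_x (g (phi x) - `|f (phi x)|)).
  by apply: Rint_eq => x; rewrite -fE.
by rewrite RintB// eg en -mulrBr -RintB//; congr (_ * _); apply: Rint_eq => x; rewrite -fE.
Qed.

(** Uniqueness of the product measure: the right-hand side is a measure in A which agrees with the
    product on measurable rectangles. It transfers the scaling of Lebesgue measure from one variable
    to three. *)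
Lemma product_scaled_image d1 d2 (T1 : measurableType d1) (T2 : measurableType d2)
    (R : realType) (m1 : {sigma_finite_measure set T1 -> \bar R})
    (m2 : {sigma_finite_measure set T2 -> \bar R}) (f1 : T1 -> T1) (f2 : T2 -> T2)
    (k1 k2 : {nonneg R}) (A : set (T1 * T2)) :
  measurable_fun setT f1 -> measurable_fun setT f2 ->
  (forall X, measurable X -> m1 X = k1%:num%:E * m1 (f1 @^-1` X))%E ->
  (forall X, measurable X -> m2 X = k2%:num%:E * m2 (f2 @^-1` X))%E ->
  measurable A ->
  ((m1 \x m2) A =
   (k1%:num * k2%:num)%:E * (m1 \x m2) ((fun z => (f1 z.1, f2 z.2)) @^-1` A))%E.
Proof.
move=> mf1 mf2 h1 h2 mA.
have mf : measurable_fun setT (fun z : T1 * T2 => (f1 z.1, f2 z.2)).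
  apply: measurable_fun_pair.
    by apply: (measurableT_comp mf1); exact: measurable_fst.
  by apply: (measurableT_comp mf2); exact: measurable_snd.
apply: (@product_measure_unique _ _ _ _ _ m1 m2
   (mscale (k1%:num * k2%:num)%:nng (image_measure (m1 \x m2)%E mf))) => // X Y mX mY.
rewrite -[LHS]/((k1%:num * k2%:num)%:E *
  (m1 \x m2) ((f1 @^-1` X) `*` (f2 @^-1` Y)))%E.
rewrite product_measure1E; last 2 first.
- by rewrite -[X in measurable X]setTI; exact: mf1.
- by rewrite -[X in measurable X]setTI; exact: mf2.
by rewrite EFinM muleACA -h1// -h2.
Qed.

Notation integ f := (rintegrable (lebesgue3 _) f).

(** * Affine changes of variables on R^3 *)

Section AffineMeasure.
Variable R : realType.
Local Notation RM := (measurableTypeR R).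
Local Notation E := (R3 R).

Definition affine1 (a s : R) (x : RM) : RM := a + s * x.

Lemma measurable_affine1 a s : measurable_fun setT (affine1 a s).
Proof.
have : @measurable_fun _ _ R R setT (fun x : R => a + s * x).
  apply: measurable_funD; first exact: measurable_cst.
  by apply: measurable_funM => //; exact: measurable_cst.
by [].
Qed.

Lemma affine1_lebesgue (a s : R) (s0 : s != 0) (A : set RM) : measurable A ->
  (lebesgue_measure A = `|s|%:E * lebesgue_measure (affine1 a s @^-1` A))%E.
Proof.
move=> mA.
apply: (@lebesgue_measure_unique _ (mscale `|s|%:nng
  (image_measure lebesgue_measure (measurable_affine1 a s)))) => // _ [[u v]] _ <-.
rewrite -[RHS]/(`|s|%:E * lebesgue_measure (affine1 a s @^-1` `]u, v]))%E /=.
have [uv|vu] := ltP u v; last first.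
  by rewrite set_itv_ge ?bnd_simp -?leNgt// preimage_set0 !measure0 mule0.
have H t : affine1 a s t = a + s * t by [].
have [sp|sn] : 0 < s \/ s < 0 by apply/orP; rewrite orbC -neq_lt.
- rewrite (_ : _ @^-1` _ = `](u - a) / s, (v - a) / s]%classic); last first.
    apply/seteqP; split => t /=; rewrite !in_itv/= H.
      by rewrite ltr_pdivrMr// ler_pdivlMr// ltrBlDl lerBrDl mulrC.
    by rewrite ltr_pdivrMr// ler_pdivlMr// ltrBlDl lerBrDl mulrC.
  rewrite !lebesgue_measure_itv/= !lte_fin uv ltr_pM2r ?invr_gt0// ltrD2r uv.
  by rewrite gtr0_norm// -!EFinB -EFinM; congr EFin; field; rewrite gt_eqF.
(* A negative s reverses the interval, so the preimage of ]u, v] is closed on the left and open on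
   the right; its length is what counts. *)
- rewrite (_ : _ @^-1` _ = `[(v - a) / s, (u - a) / s[%classic); last first.
    apply/seteqP; split => t /=; rewrite !in_itv/= H.
      by rewrite ler_ndivrMr// ltr_ndivlMr// ltrBlDl lerBrDl mulrC andbC.
    by rewrite ler_ndivrMr// ltr_ndivlMr// ltrBlDl lerBrDl mulrC andbC.
  rewrite !lebesgue_measure_itv/= !lte_fin uv ltr_nM2r ?invr_lt0// ltrD2r uv.
  by rewrite ltr0_norm// -!EFinB -EFinM; congr EFin; field; rewrite lt_eqF.
Qed.

Definition leb1 : {sigma_finite_measure set RM -> \bar R} := @lebesgue_measure R.
Definition leb2 : {sigma_finite_measure set (RM * RM)%type -> \bar R} :=
  product_measure leb1 leb1.
Definition leb3 : {sigma_finite_measure set (R3 RM) -> \bar R} :=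
  product_measure leb2 leb1.

Definition affine3 (a : E) (s : R) (x : R3 RM) : R3 RM :=
  ((affine1 a.1.1 s x.1.1, affine1 a.1.2 s x.1.2), affine1 a.2 s x.2).

Definition affine2 (a : R * R) (s : R) (x : RM * RM) : RM * RM :=
  (affine1 a.1 s x.1, affine1 a.2 s x.2).

Lemma measurable_affine2 a s : measurable_fun setT (affine2 a s).
Proof.
apply: measurable_fun_pair.
  by apply: measurableT_comp; [exact: measurable_affine1|exact: measurable_fst].
by apply: measurableT_comp; [exact: measurable_affine1|exact: measurable_snd].
Qed.

Lemma measurable_affine3 a s : measurable_fun setT (affine3 a s).
Proof.
apply: measurable_fun_pair.
  by apply: (measurableT_comp (measurable_affine2 a.1 s)); exact: measurable_fst.
by apply: measurableT_comp; [exact: measurable_affine1|exact: measurable_snd].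
Qed.

Lemma affine3_lebesgue a (s : R) (s0 : s != 0) (A : set (R3 RM)) : measurable A ->
  (leb3 A = (`|s| ^+ 3)%:E * leb3 (affine3 a s @^-1` A))%E.
Proof.
have h2 X : measurable X -> (leb2 X = (`|s| * `|s|)%:E * leb2 (affine2 a.1 s @^-1` X))%E.
  move=> mX; apply: (@product_scaled_image _ _ _ _ _ leb1 leb1 (affine1 a.1.1 s)
    (affine1 a.1.2 s) `|s|%:nng `|s|%:nng) => //; try exact: measurable_affine1.
  - by move=> Y mY; exact: affine1_lebesgue.
  - by move=> Y mY; exact: affine1_lebesgue.
move=> mA; rewrite (_ : `|s| ^+ 3 = (`|s| * `|s|) * `|s|); last by ring.
apply: (@product_scaled_image _ _ _ _ _ leb2 leb1 (affine2 a.1 s)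
    (affine1 a.2 s) (`|s| * `|s|)%:nng `|s|%:nng) => //.
- exact: measurable_affine2.
- exact: measurable_affine1.
- by move=> Y mY; exact: affine1_lebesgue.
Qed.

(** The type ascription selects the product sigma-algebra on a space which is used elsewhere as a
    normed space. *)
Definition measurable3 (f : E -> R) : Prop := @measurable_fun _ _ (R3 RM) R setT f.
Local Notation mu := (lebesgue3 R).

Lemma affineE (a : E) (s : R) x : affine3 a s x = a + s *: x.
Proof. by case: a x => [[a1 a2] a3] [[x1 x2] x3]. Qed.

Lemma measurable3_affine f (a : E) (s : R) : measurable3 f -> measurable3 (fun x => f (a + s *: x)).
Proof.
move=> mf; under eq_fun do rewrite -affineE.
exact: (measurableT_comp mf (measurable_affine3 a s)).
Qed.

Lemma integral_affine_ge0 (f : E -> R) (a : E) (s : R) : s != 0 -> measurable3 f ->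
  (forall x, 0 <= f x) ->
  (\int[mu]_x (f (a + s *: x))%:E = (`|s| ^- 3)%:E * \int[mu]_x (f x)%:E)%E.
Proof.
move=> s0 mf f0.
have mf' : measurable_fun setT (EFin \o f : R3 RM -> \bar R) by exact/measurable_EFinP.
have f0' x : (0 <= (EFin \o f) x)%E by rewrite lee_fin.
pose m' : {measure set (R3 RM) -> \bar R} :=
  mscale (NngNum (exprn_ge0 3 (normr_ge0 s))) (image_measure leb3 (measurable_affine3 a s)).
have -> : (\int[mu]_x (f x)%:E)%E = (\int[m']_x (f x)%:E)%E.
  by apply: eq_measure_integral => A mA _; exact: (affine3_lebesgue a).
rewrite (ge0_integral_mscale _ measurableT)//; last by move=> x _; exact: f0'.
rewrite (ge0_integral_image leb3 (measurable_affine3 a s) mf')//.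
rewrite muleA -EFinM mulVf ?mul1e ?expf_neq0 ?normr_eq0//. 
Qed.

Lemma integral_affine_transport (f : E -> R) (a : E) (s : R) : s != 0 -> integ f ->
  integ (fun x => f (a + s *: x)) /\
  \int[mu]_x f (a + s *: x) = `|s| ^- 3 * \int[mu]_x f x.
Proof.
move=> s0; have mk : measurable_fun setT (fun x : R3 RM => a + s *: x : R3 RM).
  by have := measurable_affine3 a s; rewrite (_ : affine3 a s = fun x => a + s *: x)//;
    apply/funext => x; rewrite affineE.
apply: (Rint_transport mk); first by rewrite invr_ge0 exprn_ge0.
by move=> h mh h0; exact: integral_affine_ge0.
Qed.

Lemma integrable_affine (f : E -> R) (a : E) (s : R) : s != 0 -> integ f ->
  integ (fun x => f (a + s *: x)).
Proof. by move=> s0 fi; have [] := integral_affine_transport a s0 fi. Qed.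

Lemma Rint_affine (f : E -> R) (a : E) (s : R) : s != 0 -> integ f ->
  \int[mu]_x f (a + s *: x) = `|s| ^- 3 * \int[mu]_x f x.
Proof. by move=> s0 fi; have [] := integral_affine_transport a s0 fi. Qed.

End AffineMeasure.

(** * Weights and measurability on R^3 *)

Section Euclid.
Variable R : realType.
Local Notation E := (R3 R).
Implicit Types (x y : E).

Lemma dotE x y : dot x y = x.1.1 * y.1.1 + x.1.2 * y.1.2 + x.2 * y.2.
Proof. by rewrite /dot !big_ord_recl big_ord0 addr0 /coord /= addrA. Qed.

Lemma enorm_ge0 x : 0 <= enorm x. Proof. exact: sqrtr_ge0. Qed.
Hint Resolve enorm_ge0 : core.

Lemma sqr_enorm x : enorm x ^+ 2 = x.1.1 ^+ 2 + x.1.2 ^+ 2 + x.2 ^+ 2.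
Proof. by rewrite /enorm sqr_sqrtr dotE -?expr2// !addr_ge0// sqr_ge0. Qed.

Lemma ler_sqr_enorm x y : (enorm x <= enorm y) = (enorm x ^+ 2 <= enorm y ^+ 2).
Proof. by rewrite ler_pXn2r// nnegrE. Qed.

Lemma le_coord1 x : `|x.1.1| <= enorm x.
Proof.
rewrite -(@ler_pXn2r _ 2) ?nnegrE// real_normK ?num_real// sqr_enorm.
by rewrite -addrA lerDl addr_ge0// sqr_ge0.
Qed.

Lemma le_coord2 x : `|x.1.2| <= enorm x.
Proof.
rewrite -(@ler_pXn2r _ 2) ?nnegrE// real_normK ?num_real// sqr_enorm.
by rewrite addrAC lerDr addr_ge0// sqr_ge0.
Qed.

Lemma le_coord3 x : `|x.2| <= enorm x.
Proof.
rewrite -(@ler_pXn2r _ 2) ?nnegrE// real_normK ?num_real// sqr_enorm.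
by rewrite lerDr addr_ge0// sqr_ge0.
Qed.

Lemma enorm_le_sum x : enorm x <= `|x.1.1| + `|x.1.2| + `|x.2|.
Proof.
rewrite -(@ler_pXn2r _ 2) ?nnegrE ?addr_ge0// sqr_enorm.
rewrite -(real_normK (num_real x.1.1)) -(real_normK (num_real x.1.2)).
rewrite -(real_normK (num_real x.2)).
have := mulr_ge0 (normr_ge0 x.1.1) (normr_ge0 x.1.2).
have := mulr_ge0 (normr_ge0 x.1.1) (normr_ge0 x.2).
have := mulr_ge0 (normr_ge0 x.1.2) (normr_ge0 x.2).
rewrite !expr2; lra.
Qed.

Lemma normr_dot x y : `|dot x y| <= enorm x * enorm y.
Proof.
rewrite -(@ler_pXn2r _ 2) ?nnegrE ?mulr_ge0// real_normK ?num_real//.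
rewrite exprMn !sqr_enorm dotE.
case: x y => [[a b] c] [[d e] f] /=.
have := sqr_ge0 (a * e - b * d). have := sqr_ge0 (a * f - c * d).
have := sqr_ge0 (b * f - c * e). rewrite !expr2; nra.
Qed.

Lemma enormD x y : enorm (x + y) <= enorm x + enorm y.
Proof.
rewrite -(@ler_pXn2r _ 2) ?nnegrE ?addr_ge0// sqr_enorm.
have := le_trans (ler_norm _) (normr_dot x y); rewrite dotE => h.
rewrite [leRHS]sqrrD !sqr_enorm /= !sqrrD.
by move: h; rewrite !expr2 !mulr2n; lra.
Qed.

Lemma enormZ (c : R) x : enorm (c *: x) = `|c| * enorm x.
Proof.
apply/eqP; rewrite -(@eqrXn2 _ 2) ?mulr_ge0// exprMn !sqr_enorm real_normK ?num_real//.
case: x => [[x1 x2] x3]; rewrite /= /GRing.scale /=; apply/eqP; ring.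
Qed.

Lemma enormN x : enorm (- x) = enorm x.
Proof. by rewrite -scaleN1r enormZ normrN1 mul1r. Qed.

Lemma enormB x y : enorm (x - y) <= enorm x + enorm y.
Proof. by rewrite (le_trans (enormD _ _))// enormN. Qed.

Lemma enorm0 : enorm (0 : E) = 0.
Proof. by rewrite -(scale0r 0) enormZ normr0 mul0r. Qed.

Lemma enorm_dist x y : `|enorm x - enorm y| <= enorm (x - y).
Proof.
have h (u v : E) : enorm u - enorm v <= enorm (u - v).
  by rewrite lerBlDr; apply: le_trans (enormD _ _); rewrite subrK.
rewrite ler_norml; apply/andP; split; last exact: h.
by rewrite lerNl opprB -(enormN (x - y)) opprB h.
Qed.

Lemma enorm_le_max x : enorm x <= 3 * `|x|.
Proof.
apply: le_trans (enorm_le_sum x) _.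
rewrite (_ : 3 * `|x| = `|x| + `|x| + `|x|); last by ring.
by rewrite !lerD// {1}/Num.norm/= !le_max lexx ?orbT.
Qed.

Lemma max_le_enorm x : `|x| <= enorm x.
Proof. by rewrite [leLHS]/Num.norm/= !ge_max le_coord1 le_coord2 le_coord3. Qed.

Lemma continuous_enorm : continuous (@enorm R).
Proof.
move=> x; apply/cvgrPdist_lt => e e0; near=> y.
apply: le_lt_trans (enorm_dist _ _) _; apply: le_lt_trans (enorm_le_max _) _.
rewrite mulrC -ltr_pdivlMr//; near: y.
by apply: cvgr_dist_lt => //; rewrite divr_gt0.
Unshelve. all: end_near. Qed.

Definition wt x := 1 + enorm x.

Lemma wt_ge1 x : 1 <= wt x. Proof. by rewrite lerDl. Qed.
Lemma wt_gt0 x : 0 < wt x. Proof. exact: lt_le_trans (wt_ge1 x). Qed.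
Hint Resolve wt_gt0 : core.
Lemma wt_ge0 x : 0 <= wt x. Proof. exact: ltW. Qed.

Lemma wtD x y : wt (x + y) <= wt x * wt y.
Proof.
apply: (@le_trans _ _ (1 + (enorm x + enorm y))); first by rewrite lerD2l enormD.
rewrite /wt mulrDl mul1r mulrDr mulr1.
have := mulr_ge0 (enorm_ge0 x) (enorm_ge0 y); lra.
Qed.

Lemma wtN x : wt (- x) = wt x. Proof. by rewrite /wt enormN. Qed.

Lemma wtXD n x y : wt (x + y) ^+ n <= wt x ^+ n * wt y ^+ n.
Proof. by rewrite -exprMn lerXn2r ?nnegrE ?mulr_ge0 ?wt_ge0// wtD. Qed.

Lemma wtX_peetre n x y : wt x ^+ n <= wt (x - y) ^+ n * wt y ^+ n.
Proof. by rewrite (le_trans _ (wtXD _ _ _))// subrK. Qed.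

End Euclid.
#[global] Hint Extern 0 (is_true (_ <= enorm _)) => exact: enorm_ge0 : core.
#[global] Hint Extern 0 (is_true (_ < wt _)) => exact: wt_gt0 : core.
#[global] Hint Extern 0 (is_true (0 <= wt _)) => exact: wt_ge0 : core.
#[global] Hint Extern 0 (is_true (1 <= wt _)) => exact: wt_ge1 : core.

Section Measurability.
Variable R : realType.
Local Notation RM := (measurableTypeR R).
Local Notation E := (R3 R).
Implicit Types (f g : E -> R).

Lemma measurable3_cst (c : R) : measurable3 (fun _ : E => c).
Proof. rewrite /measurable3; exact: measurable_cst. Qed.

Lemma measurable3D f g : measurable3 f -> measurable3 g -> measurable3 (fun x => f x + g x).
Proof. rewrite /measurable3; exact: measurable_funD. Qed.

Lemma measurable3B f g : measurable3 f -> measurable3 g -> measurable3 (fun x => f x - g x).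
Proof. rewrite /measurable3; exact: measurable_funB. Qed.

Lemma measurable3M f g : measurable3 f -> measurable3 g -> measurable3 (fun x => f x * g x).
Proof. rewrite /measurable3; exact: measurable_funM. Qed.

Lemma measurable3_norm f : measurable3 f -> measurable3 (fun x => `|f x|).
Proof. by rewrite /measurable3 => mf; apply: measurableT_comp. Qed.

Lemma measurable3X n f : measurable3 f -> measurable3 (fun x => f x ^+ n).
Proof. rewrite /measurable3; exact: measurable_funX. Qed.

Lemma measurable3_comp (h : R -> R) f : measurable_fun setT h -> measurable3 f -> measurable3 (h \o f).
Proof. rewrite /measurable3 => mh mf; apply: (measurableT_comp mh mf). Qed.

Lemma measurable3_sum I (r : seq I) (P : pred I) (F : I -> E -> R) :
  (forall i, P i -> measurable3 (F i)) -> measurable3 (fun x => \sum_(i <- r | P i) F i x).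
Proof.
move=> Fi; elim: r => [|i r IHr].
  rewrite (_ : (fun x => _) = fun=> 0); first exact: measurable3_cst.
  by apply/funext => x; rewrite big_nil.
have [Pi|Pi] := boolP (P i); last first.
  rewrite (_ : (fun x => _) = fun x => \sum_(i <- r | P i) F i x)//.
  by apply/funext => x; rewrite big_cons (negbTE Pi).
rewrite (_ : (fun x => _) = fun x => F i x + \sum_(i <- r | P i) F i x).
  by apply: measurable3D => //; exact: Fi.
by apply/funext => x; rewrite big_cons Pi.
Qed.

(* Rounding to a grid exhibits a continuous function on R^3 as a pointwise limit
   of functions measurable for the product sigma-algebra. *)
Definition grid (n : nat) (t : R) : R := (Num.floor (t * n.+1%:R))%:~R / n.+1%:R.

Lemma grid_dist n t : `|t - grid n t| <= n.+1%:R^-1.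
Proof.
have n0 : 0 < n.+1%:R :> R by [].
have /andP[h1 h2] := floor_itv (t * n.+1%:R).
rewrite ler_norml /grid; apply/andP; split.
  rewrite (@le_trans _ _ 0)// ?oppr_le0 ?invr_ge0// subr_ge0 ler_pdivrMr//.
rewrite lerBlDr -(@ler_pM2r _ n.+1%:R)// mulrDl mulVf// mulfVK//.
by rewrite ltW// addrC (lt_le_trans h2)// intrD.
Qed.

Lemma continuous_measurable3 f : continuous f -> measurable3 f.
Proof.
rewrite /measurable3 => cf.
pose F n (x : E) := f (grid n x.1.1, grid n x.1.2, grid n x.2).
apply: (@measurable_fun_cvg _ (R3 RM) R setT F).
(* The approximation is constant on the cells of the grid. There are countably many cells, each a
   product of half-open intervals, so every preimage is measurable. *)
- move=> n _ Y mY; rewrite setTI.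
  pose fl (t : R) := Num.floor (t * n.+1%:R).
  pose gr (i : int) : R := i%:~R / n.+1%:R.
  have mfl (i : int) : @measurable _ RM [set t | fl t = i].
    rewrite (_ : [set _ | _] = `[i%:~R / n.+1%:R, (i + 1)%:~R / n.+1%:R[%classic).
      exact: measurable_itv.
    apply/seteqP; split => t; rewrite /= in_itv/= /fl.
      move=> <-; have /andP[h1 h2] := floor_itv (t * n.+1%:R).
      by rewrite ler_pdivrMr// h1 ltr_pdivlMr.
    rewrite ler_pdivrMr// ltr_pdivlMr// => h.
    exact: floor_def.
  rewrite (_ : _ @^-1` _ = \bigcup_(k : int * int * int)
    (if `[< Y (f (gr k.1.1, gr k.1.2, gr k.2)) >] then
     ([set t | fl t = k.1.1] `*` [set t | fl t = k.1.2]) `*` [set t | fl t = k.2]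
     else set0)).
    apply: countable_bigcupT_measurable => // k; case: ifPn => // _.
    by do 2! apply: measurableX => //.
  apply/seteqP; split => [x /= Yx|x [k _]] /=.
    by exists (fl x.1.1, fl x.1.2, fl x.2) => //=; rewrite asboolT.
  case: ifPn => // /asboolP Yk /= [[h1 h2] h3].
  by rewrite /F /grid -/(fl _) h1 -/(fl _) h2 -/(fl _) h3.
- move=> x _; apply: (@cvg_comp _ _ _ (fun n => (grid n x.1.1, grid n x.1.2, grid n x.2)) f _ (nbhs x)); last exact: cf.
  have g t : grid n t @[n --> \oo] --> t.
    apply/cvgrPdist_le => e e0; near=> n.
    apply: le_trans (grid_dist n t) _.
    rewrite -[leRHS]invrK lef_pV2 ?posrE ?invr_gt0//.
    apply: (@le_trans _ _ n%:R); last by rewrite ler_nat.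
    near: n; exact: nbhs_infty_ger.
  case: x => [[x1 x2] x3] /=.
  apply: (@cvg_pair _ _ _ _ (nbhs (x1, x2)) (nbhs x3)) (g x3).
  exact: (@cvg_pair _ _ _ _ (nbhs x1) (nbhs x2)) (g x1) (g x2).
Unshelve. all: end_near. Qed.

Lemma measurable3_indic (A : set E) : @measurable _ (R3 RM) A -> measurable3 (\1_A : E -> R).
Proof. rewrite /measurable3 => mA; exact: measurable_indic. Qed.

Lemma measurable3_coord1 : measurable3 (fun x : E => x.1.1).
Proof.
have h : @measurable_fun _ _ (R3 RM) RM setT (fun x => x.1.1).
  apply: measurableT_comp; [exact: measurable_fst|exact: measurable_fst].
by [].
Qed.

Lemma measurable3_coord2 : measurable3 (fun x : E => x.1.2).
Proof.
have h : @measurable_fun _ _ (R3 RM) RM setT (fun x => x.1.2).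
  apply: measurableT_comp; [exact: measurable_snd|exact: measurable_fst].
by [].
Qed.

Lemma measurable3_coord3 : measurable3 (fun x : E => x.2).
Proof.
have h : @measurable_fun _ _ (R3 RM) RM setT (fun x => x.2).
  exact: measurable_snd.
by [].
Qed.

Lemma measurable_wt : measurable3 (@wt R).
Proof.
by apply: measurable3D; [exact: measurable3_cst|apply: continuous_measurable3; exact: continuous_enorm].
Qed.

Lemma measurable_wtVn n : measurable3 (fun x : E => wt x ^- n).
Proof.
apply: continuous_measurable3 => x; apply: (@cvgV _ _ (nbhs x) _ (fun y : E => wt y ^+ n) (wt x ^+ n)).
  by apply: lt0r_neq0; apply: exprn_gt0; exact: wt_gt0.
apply: (@continuous_comp _ _ _ (@wt R) (fun t => t ^+ n)); last exact: exprn_continuous.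
by apply: continuousD; [exact: cvg_cst|exact: continuous_enorm].
Qed.

End Measurability.

(** * An integrable weight on R^3 *)

Section WeightIntegral.
Variable R : realType.
Local Notation RM := (measurableTypeR R).
Local Notation E := (R3 R).
Local Notation l := (@lebesgue_measure R).

Lemma rintegrable_even (f : R -> R) : @measurable_fun _ _ RM R setT f ->
  (forall t, 0 <= f t) -> (forall t, f (- t) = f t) ->
  forall I : R, (\int[l]_(t in `[0%R, +oo[) (f t)%:E = I%:E)%E ->
  rintegrable l f /\ \int[l]_t f t = 2 * I.
Proof.
move=> mf f0 fN I HI.
have mF : measurable_fun setT (EFin \o f : RM -> \bar R) by exact/measurable_EFinP.
have H : (\int[l]_t (f t)%:E = (2 * I)%:E)%E.
  rewrite -(@setUv RM `[0%R, +oo[%classic) ge0_integral_setU//=; last 4 first.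
  - exact: measurableC.
  - by rewrite setUv.
  - by move=> x _; rewrite lee_fin.
  - by rewrite disj_set2E setICr.
  rewrite HI setCitvr/=.
  suff -> : (\int[l]_(x in (`]-oo, 0%R[%classic : set RM)) (f x)%:E)%E = I%:E.
    by rewrite -EFinD; congr EFin; ring.
  rewrite integral_itv_bndo_bndc; last exact: measurable_funS mF.
  rewrite -HI (@ge0_integration_by_substitution0 _ (EFin \o f))//.
  by apply: eq_integral => t _ /=; rewrite fN.
have fi : rintegrable l f by apply: rintegrable_ge0P => //; rewrite H ltry.
by split => //; apply: EFin_inj; rewrite EFin_Rint.
Qed.

Lemma rintegrable_oneDsqrV :
  rintegrable l (fun t : R => (1 + t ^+ 2)^-1) /\
  \int[l]_t (1 + t ^+ 2)^-1 = pi.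
Proof.
have [] := @rintegrable_even (fun t => (1 + t ^+ 2)^-1) _ _ _ (pi / 2).
- have : continuous (fun t : R => (1 + t ^+ 2)^-1) by exact: continuous_oneDsqrV.
  by move/continuous_measurable_fun.
- by move=> t; rewrite invr_ge0 addr_ge0// sqr_ge0.
- by move=> t; rewrite sqrrN.
- exact: integral0y_oneDsqr.
by move=> ? ->; split => //; field.
Qed.

Lemma Rint_tensor3 (a b c : R -> R) :
  rintegrable l a -> rintegrable l b -> rintegrable l c ->
  integ (fun x : E => a x.1.1 * b x.1.2 * c x.2) /\
  \int[lebesgue3 R]_x (a x.1.1 * b x.1.2 * c x.2) =
    \int[l]_t a t * \int[l]_t b t * \int[l]_t c t.
Proof.
move=> ai bi ci.
have [abi abE] := @Rint_tensor _ _ _ _ _ (leb1 R) (leb1 R) a b ai bi.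
have [abci abcE] := @Rint_tensor _ _ _ _ _ (leb2 R) (leb1 R)
  (fun z => a z.1 * b z.2) c abi ci.
split; first exact: abci.
by rewrite -abE; exact: abcE.
Qed.

(** The exponent 6 is 2 for each coordinate: [wt x ^+ 6] dominates the product of the three factors
    1 + x_i^2, whose inverse has a finite integral computed one variable at a time. *)
Definition omega (x : E) : R := wt x ^- 6.

Lemma omega_ge0 x : 0 <= omega x. Proof. by rewrite /omega invr_ge0 exprn_ge0. Qed.
Lemma omega_gt0 x : 0 < omega x. Proof. by rewrite /omega invr_gt0 exprn_gt0. Qed.
Lemma omega_le1 x : omega x <= 1.
Proof. by rewrite /omega invf_le1 ?exprn_gt0// exprn_ege1. Qed.

Lemma integ_omega : integ omega.
Proof.
have [i1 _] := rintegrable_oneDsqrV.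
have [i3 _] := Rint_tensor3 i1 i1 i1.
apply: (rintegrable_le _ i3); first exact: measurable_wtVn.
have h (t w : R) : `|t| <= w -> 1 + t ^+ 2 <= (1 + w) ^+ 2.
  move=> tw; rewrite -(real_normK (num_real t)).
  have : `|t| ^+ 2 <= w ^+ 2 by rewrite lerXn2r// nnegrE (le_trans (normr_ge0 t)).
  have : 0 <= w by exact: le_trans tw.
  rewrite !expr2; lra.
have pos (t : R) : 0 < 1 + t ^+ 2 by rewrite ltr_pwDl// sqr_ge0.
move=> x; rewrite ger0_norm ?omega_ge0// /omega -!invfM.
rewrite lef_pV2 ?posrE ?mulr_gt0 ?exprn_gt0//.
rewrite (_ : wt x ^+ 6 = wt x ^+ 2 * wt x ^+ 2 * wt x ^+ 2); last by rewrite -!exprD.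
rewrite ler_pM ?mulr_ge0 ?(ltW (pos _))//; last exact/h/le_coord3.
by rewrite ler_pM ?(ltW (pos _))//; [exact/h/le_coord1|exact/h/le_coord2].
Qed.

End WeightIntegral.
#[global] Hint Extern 0 (is_true (0 <= omega _)) => exact: omega_ge0 : core.
#[global] Hint Extern 0 (is_true (0 < omega _)) => exact: omega_gt0 : core.
#[global] Hint Resolve integ_omega : core.

Section Fubini3.
Variable R : realType.
Local Notation RM := (measurableTypeR R).
Local Notation E := (R3 R).
Local Notation mu := (lebesgue3 R).

Definition measurable33 (F : E * E -> R) : Prop :=
  @measurable_fun _ _ (R3 RM * R3 RM)%type R setT F.

Lemma measurable33D F G : measurable33 F -> measurable33 G ->
  measurable33 (fun z => F z + G z).
Proof. rewrite /measurable33; exact: measurable_funD. Qed.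

Lemma measurable33M F G : measurable33 F -> measurable33 G ->
  measurable33 (fun z => F z * G z).
Proof. rewrite /measurable33; exact: measurable_funM. Qed.

Lemma measurable33_comp (h : R -> R) F : measurable_fun setT h -> measurable33 F ->
  measurable33 (fun z => h (F z)).
Proof. rewrite /measurable33 => mh mf; apply: (measurableT_comp mh mf). Qed.

Lemma measurable33_fst (f : E -> R) : measurable3 f -> measurable33 (fun z => f z.1).
Proof.
rewrite /measurable33 /measurable3 => mf.
by apply: (measurableT_comp mf); exact: measurable_fst.
Qed.

Lemma measurable33_snd (f : E -> R) : measurable3 f -> measurable33 (fun z => f z.2).
Proof.
rewrite /measurable33 /measurable3 => mf.
by apply: (measurableT_comp mf); exact: measurable_snd.
Qed.

Lemma measurable33_affine (f : E -> R) (s t : R) : measurable3 f ->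
  measurable33 (fun z => f (s *: z.1 + t *: z.2)).
Proof.
rewrite /measurable33 /measurable3 => mf.
have m1 (i : E -> R) : measurable3 i ->
    measurable33 (fun z => s * i z.1 + t * i z.2).
  move=> mi; apply: measurable33D; apply: measurable33M.
  - rewrite /measurable33; exact: measurable_cst.
  - exact: measurable33_fst.
  - rewrite /measurable33; exact: measurable_cst.
  - exact: measurable33_snd.
have h : @measurable_fun _ _ (R3 RM * R3 RM)%type (R3 RM) setT
    (fun z : E * E => ((s * z.1.1.1 + t * z.2.1.1, s * z.1.1.2 + t * z.2.1.2),
                       s * z.1.2 + t * z.2.2)).
  apply: (@measurable_fun_pair _ _ _ _ (RM * RM)%type RM); last first.
    exact: (m1 _ (@measurable3_coord3 R)).
  apply: (@measurable_fun_pair _ _ _ _ RM RM).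
    exact: (m1 _ (@measurable3_coord1 R)).
  exact: (m1 _ (@measurable3_coord2 R)).
exact: (measurableT_comp mf h).
Qed.

Lemma measurable33_sub (f : E -> R) : measurable3 f ->
  measurable33 (fun z => f (z.1 - z.2)).
Proof.
move=> mf; have := measurable33_affine 1 (-1) mf; congr measurable33.
by apply/funext => z; rewrite scale1r scaleN1r.
Qed.

Lemma measurable33_dot : measurable33 (fun z => dot z.1 z.2).
Proof.
rewrite (_ : (fun z => _) = fun z : E * E => z.1.1.1 * z.2.1.1 + z.1.1.2 * z.2.1.2 + z.1.2 * z.2.2); last first.
  by apply/funext => z; rewrite dotE.
have m (i : E -> R) : measurable3 i -> measurable33 (fun z => i z.1 * i z.2).
  by move=> mi; apply: measurable33M; [exact: measurable33_fst|exact: measurable33_snd].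
apply: measurable33D; last exact: (m _ (@measurable3_coord3 R)).
apply: measurable33D; first exact: (m _ (@measurable3_coord1 R)).
exact: (m _ (@measurable3_coord2 R)).
Qed.

Section Fubini3.
Variables (F : E * E -> R) (a b : E -> R).
Hypothesis mF : measurable33 F.
Hypotheses (ai : integ a) (bi : integ b).
Hypothesis Fab : forall x y, `|F (x, y)| <= a x * b y.

Lemma integ_section1 x : integ (fun y => F (x, y)).
Proof. exact: (section_integrable1 (m2 := leb3 R) mF bi Fab). Qed.

Lemma integ_Rint1 : integ (fun x => \int[mu]_y F (x, y)).
Proof. exact: (Rint_section_integrable1 (m1 := leb3 R) (m2 := leb3 R) mF ai bi Fab). Qed.

Lemma fubini3 : \int[mu]_x \int[mu]_y F (x, y) = \int[mu]_y \int[mu]_x F (x, y).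
Proof. exact: (Rint_fubini (m1 := leb3 R) (m2 := leb3 R) mF ai bi Fab). Qed.

End Fubini3.
End Fubini3.

(** * Smooth, rapidly decreasing and Schwartz functions *)

Section LineDerivative.
Variable R : realType.
Local Notation E := (R3 R).
Implicit Types (f g : E -> R) (x v : E).

(** A directional derivative is the ordinary derivative of the restriction to a line; through this
    identity the chain rule and the mean value theorem in one variable apply to functions on R^3. *)
Lemma line_quotient f x v (t : R) :
  (fun h : R => h^-1 *: ((f \o shift (x + t *: v)) (h *: v) - f (x + t *: v))) =
  (fun h : R => h^-1 *: (((fun s => f (x + s *: v)) \o shift t) (h *: (1 : R)) - f (x + t *: v))).
Proof.
apply/funext => h /=; congr (_ *: (f _ - _)).
rewrite (_ : h%:A = h); last by rewrite /GRing.scale /= mulr1.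
by rewrite addrCA -scalerDl.
Qed.

Lemma derivable_line f x v (t : R) :
  derivable f (x + t *: v) v = derivable (fun s : R => f (x + s *: v)) t 1.
Proof. by rewrite /derivable line_quotient. Qed.

Lemma derive_line f x v (t : R) :
  'D_v f (x + t *: v) = 'D_1 (fun s : R => f (x + s *: v)) t.
Proof. by rewrite /derive line_quotient. Qed.

Lemma is_derive_line f x v (t df : R) :
  is_derive (x + t *: v) v f df <-> is_derive t 1 (fun s => f (x + s *: v)) df.
Proof.
split=> -[]; first by rewrite derivable_line derive_line => d e; split.
by rewrite -derivable_line -derive_line => d e; split.
Qed.

Lemma is_derive_line0 f x v (df : R) :
  is_derive x v f df <-> is_derive (0 : R) 1 (fun s => f (x + s *: v)) df.
Proof. by rewrite -is_derive_line scale0r addr0. Qed.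

Lemma is_derive_chain (h : R -> R) f x v (dh df : R) :
  is_derive (f x) 1 h dh -> is_derive x v f df ->
  is_derive x v (fun y => h (f y)) (dh * df).
Proof.
move=> hh /is_derive_line0 hf; apply/is_derive_line0.
have := @is_derive1_comp R h (fun s => f (x + s *: v)) 0 dh df.
by rewrite scale0r addr0; exact.
Qed.

Lemma is_derive_dilate f x v (a df : R) : is_derive (a *: x) v f df ->
  is_derive x v (fun y => f (a *: y)) (a * df).
Proof.
move=> /is_derive_line0 hf; apply/is_derive_line0.
have ha : is_derive (0 : R) 1 (fun s : R => a * s) a.
  have := @is_deriveZ R R R id a 0 1 1 _; rewrite /GRing.scale /= mulr1.
  by apply; exact: is_derive_id.
have := @is_derive1_comp R (fun s => f (a *: x + s *: v)) (fun s => a * s) 0 df a.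
rewrite mulr0 => /(_ hf ha); rewrite mulrC; congr is_derive.
by apply/funext => s /=; rewrite scalerDr scalerA.
Qed.

Lemma is_derive_add f g x v (df dg : R) : is_derive x v f df ->
  is_derive x v g dg -> is_derive x v (fun y => f y + g y) (df + dg).
Proof. exact: is_deriveD. Qed.

Lemma is_derive_mul f g x v (df dg : R) : is_derive x v f df ->
  is_derive x v g dg -> is_derive x v (fun y => f y * g y) (f x * dg + g x * df).
Proof. exact: is_deriveM. Qed.

Lemma is_derive_scale (c : R) f x v (df : R) : is_derive x v f df ->
  is_derive x v (fun y => c * f y) (c * df).
Proof.
move=> hf; have := is_derive_mul (is_derive_cst c x v) hf.
by rewrite mulr0 addr0.
Qed.

Lemma is_derive_coord1 x v : is_derive x v (fun y : E => y.1.1) v.1.1.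
Proof.
apply/is_derive_line0.
have -> : (fun s => (x + s *: v).1.1) = (fun s => x.1.1 + s * v.1.1) by [].
have := @is_deriveD R R R (cst x.1.1) (fun s => s * v.1.1) 0 1 0 v.1.1.
rewrite add0r; apply.
have := @is_deriveM R R id (cst v.1.1) 0 1 1 0 _ _.
by rewrite /GRing.scale /= mulr0 add0r mulr1; apply; exact: is_derive_id.
Qed.

Lemma is_derive_coord2 x v : is_derive x v (fun y : E => y.1.2) v.1.2.
Proof.
apply/is_derive_line0.
have -> : (fun s => (x + s *: v).1.2) = (fun s => x.1.2 + s * v.1.2) by [].
have := @is_deriveD R R R (cst x.1.2) (fun s => s * v.1.2) 0 1 0 v.1.2.
rewrite add0r; apply.
have := @is_deriveM R R id (cst v.1.2) 0 1 1 0 _ _.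
by rewrite /GRing.scale /= mulr0 add0r mulr1; apply; exact: is_derive_id.
Qed.

Lemma is_derive_coord3 x v : is_derive x v (fun y : E => y.2) v.2.
Proof.
apply/is_derive_line0.
have -> : (fun s => (x + s *: v).2) = (fun s => x.2 + s * v.2) by [].
have := @is_deriveD R R R (cst x.2) (fun s => s * v.2) 0 1 0 v.2.
rewrite add0r; apply.
have := @is_deriveM R R id (cst v.2) 0 1 1 0 _ _.
by rewrite /GRing.scale /= mulr0 add0r mulr1; apply; exact: is_derive_id.
Qed.

Lemma is_derive_dotl x v y : is_derive x v (fun z => dot z y) (dot v y).
Proof.
rewrite (_ : (fun z => dot z y) =
  fun z => (y.1.1 * z.1.1 + y.1.2 * z.1.2) + y.2 * z.2); last first.
  by apply/funext => z; rewrite dotE; ring.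
rewrite (_ : dot v y = (y.1.1 * v.1.1 + y.1.2 * v.1.2) + y.2 * v.2); last first.
  by rewrite dotE; ring.
apply: is_derive_add; last by apply: is_derive_scale; exact: is_derive_coord3.
by apply: is_derive_add; apply: is_derive_scale;
  [exact: is_derive_coord1|exact: is_derive_coord2].
Qed.

Lemma dotC x y : dot x y = dot y x.
Proof. by rewrite !dotE; ring. Qed.

Lemma dotDl x y z : dot (x + y) z = dot x z + dot y z.
Proof. by rewrite !dotE /=; ring. Qed.

Lemma dotZl (a : R) x y : dot (a *: x) y = a * dot x y.
Proof. by rewrite !dotE /= /GRing.scale /=; ring. Qed.

Lemma dotZr (a : R) x y : dot x (a *: y) = a * dot x y.
Proof. by rewrite dotC dotZl dotC. Qed.

Lemma dotDr x y z : dot x (y + z) = dot x y + dot x z.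
Proof. by rewrite dotC dotDl !(dotC x). Qed.

Lemma dotNl x y : dot (- x) y = - dot x y.
Proof. by rewrite -scaleN1r dotZl mulN1r. Qed.

Lemma dotNr x y : dot x (- y) = - dot x y.
Proof. by rewrite dotC dotNl dotC. Qed.

Lemma dotBl x y z : dot (x - y) z = dot x z - dot y z.
Proof. by rewrite dotDl dotNl. Qed.

Lemma dotxx x : dot x x = enorm x ^+ 2.
Proof. by rewrite sqr_enorm dotE !expr2. Qed.

Lemma dot_basis i y : dot (basis R i) y = coord y i.
Proof.
rewrite dotE /coord /basis; case: i => [[|[|[|//]]] i] /=;
by rewrite ?mul0r ?mul1r ?addr0 ?add0r.
Qed.

Lemma coordE x i : coord x i = dot x (basis R i).
Proof. by rewrite dotC dot_basis. Qed.

Lemma enorm_basis i : enorm (basis R i) = 1.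
Proof.
apply/eqP; rewrite -(@eqrXn2 _ 2)// sqr_enorm /basis.
by case: i => [[|[|[|//]]] i] /=; rewrite !expr2 ?mulr0 ?mulr1 ?addr0 ?add0r.
Qed.

Lemma normr_coord x i : `|coord x i| <= enorm x.
Proof. by rewrite coordE (le_trans (normr_dot _ _))// enorm_basis mulr1. Qed.

End LineDerivative.

(** * Smooth functions *)

Section Smoothness.
Variable R : realType.
Local Notation E := (R3 R).
Implicit Types (f g : E -> R) (x : E).

Lemma partials_class (A : set (E -> R)) :
  (forall f, A f -> forall i, A (partial i f)) ->
  forall s f, A f -> A (partials s f).
Proof. by move=> h; elim=> [//|i s IHs] f Af /=; apply: h; exact: IHs. Qed.

Lemma partials_rcons s i f : partials (rcons s i) f = partials s (partial i f).
Proof. by rewrite /partials foldr_rcons. Qed.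

(** Smoothness proved by exhibiting a class of functions stable under partial derivatives, which
    spares closed formulas for the iterated derivatives. *)
Lemma smooth_class (A : set (E -> R)) :
  (forall f, A f -> continuous f) ->
  (forall f, A f -> forall i x, derivable f x (basis R i)) ->
  (forall f, A f -> forall i, A (partial i f)) ->
  forall f, A f -> smooth f.
Proof.
move=> h1 h2 h3 f Af s x; have As := partials_class h3 s Af.
by split; [exact: h1|move=> i; exact: h2].
Qed.

Lemma smooth_continuous f : smooth f -> continuous f.
Proof. by move=> sf x; exact: (sf [::] x).1. Qed.

Lemma smooth_derivable f i x : smooth f -> derivable f x (basis R i).
Proof. by move=> sf; exact: (sf [::] x).2. Qed.

Lemma smooth_is_derive f i x : smooth f -> is_derive x (basis R i) f (partial i f x).
Proof. by move=> sf; split => //; exact: smooth_derivable. Qed.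

Lemma smooth_partial i f : smooth f -> smooth (partial i f).
Proof. by move=> sf s x; rewrite -partials_rcons; exact: sf. Qed.

Lemma smooth_measurable f : smooth f -> measurable3 f.
Proof. by move=> sf; apply: continuous_measurable3; exact: smooth_continuous. Qed.

Lemma partial_cst i (c : R) : partial i (fun _ : E => c) = fun=> 0.
Proof. by apply/funext => x; rewrite /partial; exact: derive_cst. Qed.

Lemma smooth_cst (c : R) : smooth (fun _ : E => c).
Proof.
apply: (@smooth_class [set f | exists c : R, f = fun=> c]); last by exists c.
- by move=> _ [d ->] x; exact: cvg_cst.
- by move=> _ [d ->] i x; exact: derivable_cst.
- by move=> _ [d ->] i; exists 0; exact: partial_cst.
Qed.

Lemma partial_coord i j : partial i (fun x : E => coord x j) =
  fun=> coord (basis R i) j.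
Proof.
apply/funext => x; rewrite /partial.
have -> : (fun x : E => coord x j) = fun x => dot x (basis R j).
  by apply/funext => y; rewrite coordE.
by rewrite coordE; apply: derive_val; exact: is_derive_dotl.
Qed.

Lemma continuous_dotl (y : E) : continuous (fun x : E => dot x y).
Proof.
move=> x; apply/cvgrPdist_lt => e e0; near=> z.
rewrite -dotBl (le_lt_trans (normr_dot _ _))//.
apply: (@le_lt_trans _ _ (3 * `|x - z| * (1 + enorm y))).
  by rewrite ler_pM// ?enorm_le_max// lerDr.
rewrite -ltr_pdivlMr ?ltr_pwDl// mulrC -ltr_pdivlMr//; near: z.
by apply: cvgr_dist_lt => //; rewrite !divr_gt0// ltr_pwDl.
Unshelve. all: end_near. Qed.

Lemma smooth_coord i : smooth (fun x : E => coord x i).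
Proof.
apply: (@smooth_class [set f | (exists i, f = fun x => coord x i) \/
                               exists c : R, f = fun=> c]); last by left; exists i.
- move=> f [[j ->]|[d ->]] x; last exact: cvg_cst.
  rewrite (_ : (fun x : E => coord x j) = fun x => dot x (basis R j)).
    exact: continuous_dotl.
  by apply/funext => y; rewrite coordE.
- move=> f [[j ->]|[d ->]] k x; last exact: derivable_cst.
  rewrite (_ : (fun x : E => coord x j) = fun x => dot x (basis R j)).
    by apply: ex_derive; exact: is_derive_dotl.
  by apply/funext => y; rewrite coordE.
- move=> f [[j ->]|[d ->]] k; right; first by rewrite partial_coord; eexists.
  by exists 0; exact: partial_cst.
Qed.

(** The smallest class that contains products and is stable under Leibniz's rule; it is the one
    given to [smooth_class]. *)
Inductive smooth_products : (E -> R) -> Prop :=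
| smooth_products_mul f g : smooth f -> smooth g -> smooth_products (f * g)
| smooth_products_add f g :
    smooth_products f -> smooth_products g -> smooth_products (f + g).

Lemma smooth_productsP f : smooth_products f ->
  [/\ continuous f, forall i x, derivable f x (basis R i)
    & forall i, smooth_products (partial i f)].
Proof.
elim=> {f} [f g sf sg|f g _ [cf df pf] _ [cg dg pg]]; split.
- by move=> x; apply: cvgM; exact: smooth_continuous.
- by move=> i x; apply: derivableM; exact: smooth_derivable.
- move=> i; rewrite (_ : partial i _ = f * partial i g + g * partial i f).
    apply: smooth_products_add; apply: smooth_products_mul.
    - exact: sf.
    - exact: (smooth_partial i sg).
    - exact: sg.
    - exact: (smooth_partial i sf).
  by apply/funext => x; rewrite /partial deriveM//; exact: smooth_derivable.
- by move=> x; apply: cvgD; [exact: cf|exact: cg].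
- by move=> i x; apply: derivableD.
- move=> i; rewrite (_ : partial i _ = partial i f + partial i g).
    exact: smooth_products_add.
  by apply/funext => x; rewrite /partial deriveD.
Qed.

Lemma smoothM f g : smooth f -> smooth g -> smooth (fun x => f x * g x).
Proof.
move=> sf sg; apply: (@smooth_class smooth_products).
- by move=> h /smooth_productsP[].
- by move=> h /smooth_productsP[].
- by move=> h /smooth_productsP[].
- exact: (smooth_products_mul sf sg).
Qed.

Lemma partialM i f g : smooth f -> smooth g ->
  partial i (fun x => f x * g x) = fun x => f x * partial i g x + g x * partial i f x.
Proof.
by move=> sf sg; apply/funext => x; rewrite /partial deriveM//; exact: smooth_derivable.
Qed.

Lemma smoothZ (a : R) f : smooth f -> smooth (fun x => a * f x).
Proof. by move=> sf; apply: smoothM; [exact: smooth_cst|exact: sf]. Qed.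

Lemma smoothD f g : smooth f -> smooth g -> smooth (fun x => f x + g x).
Proof.
move=> sf sg; have := smooth_lin 1 sf sg; congr smooth.
by rewrite scale1r.
Qed.

Lemma partial_dilate i (a : R) f : smooth f ->
  partial i (fun x => f (a *: x)) = fun x => a * partial i f (a *: x).
Proof.
move=> sf; apply/funext => x; apply: derive_val; apply: is_derive_dilate.
exact: smooth_is_derive.
Qed.

Lemma smooth_dilate (a : R) f : smooth f -> smooth (fun x => f (a *: x)).
Proof.
move=> sf; apply: (@smooth_class [set h | exists (c : R) g, smooth g /\
    h = fun x => c * g (a *: x)]).
- move=> _ [c [g [sg ->]]] x; apply: cvgM; first exact: cvg_cst.
  apply: (@continuous_comp _ _ _ (fun y : E => a *: y) g); last exact: smooth_continuous.
  exact: scaler_continuous.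
- move=> _ [c [g [sg ->]]] i x; apply: (@derivableM _ _ (cst c)); first exact: derivable_cst.
  by apply: ex_derive; apply: is_derive_dilate; exact: smooth_is_derive.
- move=> _ [c [g [sg ->]]] i; exists (c * a), (partial i g).
  split; first exact: smooth_partial.
  apply/funext => x; rewrite /partial (@deriveMl _ _ (fun x => g (a *: x)) c).
    rewrite -mulrA; congr (_ * _); apply: derive_val; apply: is_derive_dilate.
    exact: smooth_is_derive.
  by apply: ex_derive; apply: is_derive_dilate; exact: smooth_is_derive.
- by exists 1, f; split => //; apply/funext => x; rewrite mul1r.
Qed.

End Smoothness.

(** * Rapid decrease and compact support *)

Section Rapid.
Variable R : realType.
Local Notation E := (R3 R).
Implicit Types (f g m : E -> R) (x y : E).

(** Decay without smoothness: unlike the Schwartz class, this class is stable under multiplication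
    by indicators of half-spaces and balls, which the proof of [dist_fubini] cuts with. *)
Definition rapid f := measurable3 f /\
  forall N, exists C, forall x, wt x ^+ N * `|f x| <= C.

Definition testfun m := smooth m /\
  exists rho : R, forall x, rho <= enorm x -> m x = 0.

Lemma omega_shift x y : omega (x + y) <= wt y ^+ 6 * omega x.
Proof.
rewrite /omega -[leLHS]mul1r -ler_pdivlMr ?invr_gt0 ?exprn_gt0// invrK.
rewrite mulrAC ler_pdivlMr ?exprn_gt0// mul1r.
by have := wtX_peetre 6 x (- y); rewrite opprK wtN mulrC.
Qed.

Lemma rapid_omega f : rapid f -> exists2 C, 0 <= C & forall x, `|f x| <= C * omega x.
Proof.
move=> [_ /(_ 6%N)[C hC]]; exists `|C| => // x.
rewrite /omega ler_pdivlMr ?exprn_gt0// mulrC.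
by rewrite (le_trans (hC x))// ler_norm.
Qed.

Lemma rapid_integ f : rapid f -> integ f.
Proof.
move=> rf; have [C _ hC] := rapid_omega rf.
exact: (rintegrable_le rf.1 (rintegrableZ C (integ_omega R)) hC).
Qed.

Lemma rapid_ge0 f N : rapid f -> exists2 C, 0 <= C & forall x, wt x ^+ N * `|f x| <= C.
Proof.
move=> [_ /(_ N)[C hC]]; exists `|C| => // x.
by rewrite (le_trans (hC x))// ler_norm.
Qed.

Lemma rapid_bounded f : rapid f -> exists2 C, 0 <= C & forall x, `|f x| <= C.
Proof.
by move=> /(rapid_ge0 0)[C C0 hC]; exists C => // x; have := hC x; rewrite mul1r.
Qed.

Lemma rapidM f g : rapid f -> measurable3 g ->
  (exists N (C : R), forall x, `|g x| <= C * wt x ^+ N) -> rapid (fun x => g x * f x).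
Proof.
move=> rf mg [N [C hC]]; split; first exact: measurable3M mg rf.1.
move=> K; have [D D0 hD] := rapid_ge0 (K + N) rf.
exists (`|C| * D) => x; rewrite normrM mulrA (mulrC (_ ^+ K)) -mulrA.
apply: (@le_trans _ _ ((`|C| * wt x ^+ N) * (wt x ^+ K * `|f x|))).
  rewrite ler_wpM2r ?mulr_ge0 ?exprn_ge0//.
  by rewrite (le_trans (hC x))// ler_wpM2r ?exprn_ge0// ler_norm.
by rewrite -mulrA ler_wpM2l// mulrA -exprD addnC hD.
Qed.

Lemma rapid_affine f (a : E) (s : R) : s != 0 -> rapid f -> rapid (fun x => f (a + s *: x)).
Proof.
move=> s0 rf; split; first exact: measurable3_affine rf.1.
move=> N; have [C C0 hC] := rapid_ge0 N rf.
exists (((1 + `|s|^-1) * wt a) ^+ N * C) => x.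
have k : wt x <= (1 + `|s|^-1) * wt a * wt (a + s *: x).
  rewrite -mulrA; apply: (@le_trans _ _ ((1 + `|s|^-1) * wt (s *: x))); last first.
    rewrite ler_wpM2l ?addr_ge0 ?invr_ge0//.
    rewrite -(wtN a); apply: le_trans (wtD _ _).
    by rewrite addrA addNr add0r.
  rewrite /wt enormZ mulrDl mul1r mulrDr mulr1 mulrA mulVf ?normr_eq0// mul1r.
  have := normr_ge0 s; have : 0 <= `|s|^-1 by rewrite invr_ge0.
  have := enorm_ge0 x; have := mulr_ge0 (normr_ge0 s) (enorm_ge0 x); lra.
apply: (@le_trans _ _ (((1 + `|s|^-1) * wt a) ^+ N * (wt (a + s *: x) ^+ N * `|f (a + s *: x)|))).
  rewrite mulrA -exprMn ler_wpM2r// lerXn2r// nnegrE//.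
  by rewrite !mulr_ge0// addr_ge0// invr_ge0.
by rewrite ler_wpM2l ?hC// exprn_ge0// mulr_ge0// addr_ge0// invr_ge0.
Qed.

Lemma testfun_bounded m : testfun m -> exists2 C, 0 <= C & forall x, `|m x| <= C.
Proof.
move=> [sm [rho hrho]]; have cm := smooth_continuous sm.
pose r := `|rho| + 1.
have cK : compact ((`[- r, r] `*` `[- r, r]) `*` `[- r, r] : set E).
  by apply: compact_setX; [apply: compact_setX|]; exact: segment_compact.
have : compact [set `|m x| | x in ((`[- r, r] `*` `[- r, r]) `*` `[- r, r] : set E)].
  apply: continuous_compact => //; apply: continuous_subspaceT => x.
  by apply: (@continuous_comp _ _ _ m (fun t => `|t|)); [exact: cm|exact: norm_continuous].
move=> /compact_bounded[M [Mr hM]].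
exists (`|M| + 1); first by rewrite addr_ge0.
move=> x; have [xr|xr] := leP rho (enorm x).
  by rewrite hrho// normr0 addr_ge0.
have h t : `|t| <= enorm x -> t \in `[- r, r].
  move=> tx; rewrite in_itv/= -ler_norml (le_trans tx)// (le_trans (ltW xr))//.
  by rewrite (le_trans (ler_norm rho))// lerDl.
rewrite -(normr_id (m x)); apply: (hM (`|M| + 1)).
  by rewrite (le_lt_trans (ler_norm M))// ltrDl.
exists x => //; split; [split|] => /=; apply: h.
- exact: le_coord1.
- exact: le_coord2.
- exact: le_coord3.
Qed.

Lemma testfun_rapid m : testfun m -> rapid m.
Proof.
move=> tm; have [C C0 hC] := testfun_bounded tm.
case: tm => sm [rho hrho]; split; first exact: smooth_measurable.
move=> N; exists ((1 + `|rho|) ^+ N * C) => x.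
have [xr|xr] := leP rho (enorm x).
  by rewrite hrho// normr0 mulr0 mulr_ge0// exprn_ge0// addr_ge0.
rewrite ler_pM ?exprn_ge0// lerXn2r ?nnegrE ?addr_ge0//.
by rewrite lerD2l (le_trans (ltW xr))// ler_norm.
Qed.

Lemma testfun_integ m : testfun m -> integ m.
Proof. by move=> tm; apply: rapid_integ; exact: testfun_rapid. Qed.

Lemma partial_far i m (rho : R) : (forall x, rho <= enorm x -> m x = 0) ->
  forall x, rho < enorm x -> partial i m x = 0.
Proof.
move=> h x xr; apply: derive_val; apply/is_derive_line0.
have hn : \forall s \near (0 : R), rho < enorm (x + s *: basis R i).
  apply/nbhs_ballP; exists (enorm x - rho) => /=; first by rewrite subr_gt0.
  move=> s; rewrite /ball/= sub0r normrN => sl.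
  have := enormB (x + s *: basis R i) (s *: basis R i).
  rewrite addrK enormZ enorm_basis mulr1; move: sl; lra.
apply: (near_eq_is_derive (f := cst (0 : R))) => //.
  by apply: filterS hn => s hs /=; rewrite h// ltW.
Qed.

Lemma testfun_partial i m : testfun m -> testfun (partial i m).
Proof.
move=> [sm [rho h]]; split; first exact: smooth_partial.
(* [partial_far] gives zero only strictly outside the old radius, where a whole neighbourhood is
   available; hence the enlarged radius. *)
exists (rho + 1) => x xr; apply: (partial_far (rho := rho) i h).
by rewrite (lt_le_trans _ xr)// ltrDl.
Qed.

Lemma testfunM f m : smooth f -> testfun m -> testfun (fun x => f x * m x).
Proof.
move=> sf [sm [rho h]]; split; first exact: smoothM.
by exists rho => x xr; rewrite h// mulr0.
Qed.

Lemma testfunD f m : testfun f -> testfun m -> testfun (fun x => f x + m x).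
Proof.
move=> [sf [rho h]] [sm [rho' h']]; split; first exact: smoothD.
by exists (Num.max rho rho') => x; rewrite ge_max => /andP[? ?]; rewrite h// h'// addr0.
Qed.

Lemma testfun_dilate (s : R) m : s != 0 -> testfun m -> testfun (fun x => m (s *: x)).
Proof.
move=> s0 [sm [rho h]]; split; first exact: smooth_dilate.
by exists (rho / `|s|) => x; rewrite ler_pdivrMr ?normr_gt0// => hx; rewrite h// enormZ mulrC.
Qed.

(** Stability under partial derivatives lets all seminorms be bounded by induction on the number of
    derivatives, each stage using one constant for each of the three first derivatives. *)
Lemma schwartz_class (A : set (E -> R)) :
  (forall f, A f -> continuous f) ->
  (forall f, A f -> forall i x, derivable f x (basis R i)) ->
  (forall f, A f -> forall i, A (partial i f)) ->
  (forall f, A f -> forall N, exists C, forall x, wt x ^+ N * `|f x| <= C) ->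
  forall f, A f -> schwartz f.
Proof.
move=> h1 h2 h3 h4 f Af; split; first exact: (smooth_class h1 h2 h3).
move=> N.
have key K : exists C, forall s x, (size s <= K)%N -> wt x ^+ N * `|partials s f x| <= C.
  elim: K f Af => [|K IHK] f Af.
    by have [C hC] := h4 f Af N; exists C => -[|//] x _.
  have [C0 hC0] := h4 f Af N.
  have IH (i : 'I_3) : {C | forall s x, (size s <= K)%N ->
      wt x ^+ N * `|partials s (partial i f) x| <= C}.
    by apply: cid; apply: IHK; exact: h3.
  exists (`|C0| + \sum_(i < 3) `|sval (IH i)|) => s x; case/lastP: s => [|s i] sK.
    by rewrite (le_trans (hC0 x))// (le_trans (ler_norm _))// lerDl sumr_ge0.
  rewrite partials_rcons; rewrite size_rcons ltnS in sK.
  have := svalP (IH i) s x sK => /le_trans; apply.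
  rewrite (le_trans (ler_norm _))// (bigD1 i)//= addrCA lerDl addr_ge0//.
  by rewrite sumr_ge0.
have [C hC] := key N; apply: (@le_lt_trans _ _ C%:E); last by rewrite ltry.
by apply: ge_ereal_sup => _ [s [x [sN ->]]]; rewrite lee_fin; exact: hC.
Qed.

Lemma schwartz_partials_bound f s N : schwartz f ->
  exists C, forall x, wt x ^+ N * `|partials s f x| <= C.
Proof.
move=> [sf nf]; pose K := maxn N (size s).
have K0 := seminorm_ge0 K f.
exists (fine (schwartz_seminorm K f)) => x; rewrite -lee_fin fineK; last first.
  by rewrite ge0_fin_numE.
apply: le_trans (@le_seminorm _ K f s x _); last exact: leq_maxr.
by rewrite lee_fin ler_wpM2r// ler_weXn2l// leq_maxl.
Qed.

Lemma schwartz_smooth f : schwartz f -> smooth f. Proof. by case. Qed.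

Lemma schwartz_rapid f : schwartz f -> rapid f.
Proof.
move=> sf; split; first by apply: smooth_measurable; case: sf.
by move=> N; exact: (schwartz_partials_bound [::] N sf).
Qed.

Lemma schwartz_seminormE f N s x : schwartz f -> (size s <= N)%N ->
  wt x ^+ N * `|partials s f x| <= fine (schwartz_seminorm N f).
Proof.
move=> sf sN; rewrite -lee_fin fineK; first exact: le_seminorm.
by rewrite ge0_fin_numE ?seminorm_ge0//; case: sf => _; exact.
Qed.

End Rapid.

Lemma lipschitz_continuous (R : realType) (K : R) (f : R3 R -> R) : 0 <= K ->
  (forall x y, `|f x - f y| <= K * enorm (x - y)) -> continuous f.
Proof.
move=> K0 h x; apply/cvgrPdist_lt => e e0.
have K1 : 0 < 1 + K by rewrite ltr_pwDl.
have d0 : 0 < e / (1 + K) / 3 by apply: divr_gt0 => //; exact: divr_gt0.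
have hb := @nbhsx_ballx R (R3 R) x _ d0.
apply: filterS hb => y; rewrite -ball_normE /= => xy.
rewrite (le_lt_trans (h x y))//.
apply: (@le_lt_trans _ _ ((1 + K) * (3 * `|x - y|))).
  by rewrite ler_pM// ?enorm_le_max// lerDr.
by rewrite mulrC -ltr_pdivlMr// mulrC -ltr_pdivlMr.
Qed.

Lemma eq_integ (R : realType) (f g : R3 R -> R) : f =1 g -> integ f -> integ g.
Proof. by move=> fg; rewrite (_ : f = g)//; exact/funext. Qed.

(** * The trigonometric transform and its inversion *)

Section DiffIntegral.
Variable R : realType.
Local Notation E := (R3 R).
Local Notation mu := (lebesgue3 R).

Lemma is_derive_integral (F dF : R -> E -> R) (G : E -> R) :
  (forall t : R, `|t| < 1 -> integ (F t)) ->
  (forall (t : R) x, `|t| < 1 -> is_derive t (1 : R) (F^~ x) (dF t x)) ->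
  integ G -> (forall (t : R) x, `|t| < 1 -> `|dF t x| <= G x) ->
  is_derive (0 : R) 1 (fun t => \int[mu]_x F t x) (\int[mu]_x dF 0 x).
Proof.
move=> Fi dFi Gi dFG.
have I0 : (`]-1, 1[%classic : set R) 0 by rewrite /= in_itv/= ltrN10 ltr01.
have IE t : (`]-1, 1[%classic : set R) t -> `|t| < 1.
  by rewrite /= in_itv/= ltr_norml.
have G0 x : 0 <= G x by apply: le_trans (dFG 0 x _); rewrite ?normr0.
have d1 t x : `|t| < 1 -> partial1of2 F t x = dF t x.
  by move=> t1; rewrite partial1of2E; apply: derive_val; exact: dFi.
have h1 t x : (`]-1, 1[%classic : set R) t -> setT x -> derivable (F^~ x) t 1.
  by move=> /IE t1 _; apply: ex_derive; exact: dFi.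
have h2 t x : (`]-1, 1[%classic : set R) t -> setT x -> `|partial1of2 F t x| <= G x.
  by move=> /IE t1 _; rewrite d1//; exact: dFG.
have h3 t : (`]-1, 1[%classic : set R) t -> mu.-integrable setT (EFin \o F t).
  by move=> /IE; exact: Fi.
split.
  exact: (derivable_under_integral measurableT I0 h3 h1 G0 Gi h2).
rewrite -derive1E (differentiation_under_integral measurableT I0 h3 h1 G0 Gi h2).
by apply: Rint_eq => x; rewrite d1// normr0.
Qed.

(** By translation invariance the integral of F(x + t e_i) does not depend on t, and its derivative
    at t = 0, taken under the integral, is the integral of [dF]. This is integration by parts
    without boundary terms. *)
Lemma Rint_partial0 (F dF : E -> R) (i : 'I_3) (C : R) :
  integ F -> (forall x, is_derive x (basis R i) F (dF x)) ->
  (forall x, `|dF x| <= C * omega x) -> \int[mu]_x dF x = 0.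
Proof.
move=> Fi dFi dFC.
have C0 : 0 <= C.
  by have := le_trans (normr_ge0 _) (dFC 0); rewrite pmulr_lge0.
have shiftE t : (fun x => F (t *: basis R i + 1 *: x)) = (fun x => F (x + t *: basis R i)).
  by apply/funext => x; rewrite scale1r addrC.
(* The factor 2^6 bounds the ratio of [omega] at x + t e_i and at x: the weight of t e_i is at most
   2 when |t| < 1. *)
have := @is_derive_integral (fun t x => F (x + t *: basis R i))
  (fun t x => dF (x + t *: basis R i)) (fun x => (C * 2 ^+ 6) * omega x) _ _ _ _.
have h t : `|t| < 1 -> integ (fun x => F (x + t *: basis R i)).
  by move=> _; rewrite -shiftE; apply: integrable_affine => //; exact: oner_neq0.
move=> /(_ h) h1.
have {}h1 : is_derive (0 : R) 1 (fun t => \int[mu]_x F (x + t *: basis R i))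
    (\int[mu]_x dF (x + 0 *: basis R i)).
  apply: h1.
  - by move=> t x _; apply/is_derive_line; exact: dFi.
  - exact: rintegrableZ.
  - move=> t x t1; rewrite (le_trans (dFC _))// -mulrA ler_wpM2l//.
    rewrite (le_trans (omega_shift _ _))// ler_wpM2r// lerXn2r ?nnegrE//.
    by rewrite /wt enormZ enorm_basis mulr1; move: t1; lra.
have h2 : is_derive (0 : R) 1 (fun t => \int[mu]_x F (x + t *: basis R i)) 0.
  rewrite (_ : (fun t => _) = cst (\int[mu]_x F x)); first exact: is_derive_cst.
  apply/funext => t; rewrite -shiftE Rint_affine ?oner_neq0//.
  by rewrite normr1 expr1n invr1 mul1r.
have := @derive_val _ _ _ _ _ _ _ h1; rewrite (@derive_val _ _ _ _ _ _ _ h2) => ->.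
by apply: Rint_eq => x; rewrite scale0r addr0.
Qed.

End DiffIntegral.

Section TrigTransform.
Variable R : realType.
Local Notation E := (R3 R).
Local Notation mu := (lebesgue3 R).
Implicit Types (m : E -> R) (x y : E) (c : R).

(* The phase [c] makes the class of these functions stable under derivatives and
   under multiplication by coordinates, each being a shift of [c] by pi/2. *)
Definition trig c m x : R := \int[mu]_xi (cos (dot x xi + c) * m xi).

Lemma measurable_cos_dot x c : measurable3 (fun xi : E => cos (dot x xi + c)).
Proof.
apply: continuous_measurable3 => xi.
apply: (@continuous_comp _ _ _ (fun z : E => dot x z + c) (@cos R)); last exact: continuous_cos.
apply: cvgD; last exact: cvg_cst.
rewrite (_ : dot x = fun z => dot z x); first exact: continuous_dotl.
by apply/funext => z; rewrite dotC.
Qed.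

Lemma cos_norm_le1 (t : R) : `|cos t| <= 1.
Proof. by rewrite ler_norml cos_geN1 cos_le1. Qed.

Lemma integ_cos x c f : integ f -> integ (fun xi => cos (dot x xi + c) * f xi).
Proof.
move=> fi; apply: (rintegrable_mul_bounded fi (measurable_cos_dot x c) (C := 1)).
by move=> xi; exact: cos_norm_le1.
Qed.

Lemma trig_bound c m x : integ m -> `|trig c m x| <= \int[mu]_xi `|m xi|.
Proof.
move=> mi; apply: Rint_norm_le; first exact: integ_cos.
  exact: rintegrable_norm.
by move=> xi; rewrite normrM ler_piMl// cos_norm_le1.
Qed.

Lemma is_derive_cosD (a : R) c : is_derive a (1 : R) (fun t => cos (t + c)) (cos (a + (c + pi / 2))).
Proof.
have h : is_derive a (1 : R) (fun t => t + c) 1.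
  have := @is_deriveD R R R id (cst c) a 1 1 0; by rewrite addr0; apply.
have := @is_derive1_comp R (@cos R) (fun t => t + c) a (- sin (a + c)) 1 (is_derive_cos _) h.
by rewrite mulr1 addrA cosDpihalf.
Qed.

Lemma is_derive_cos_line x v xi c (t : R) :
  is_derive t 1 (fun s : R => cos (dot (x + s *: v) xi + c))
    (cos (dot (x + t *: v) xi + (c + pi / 2)) * dot v xi).
Proof.
have h : is_derive (x + t *: v) v (fun z => dot z xi) (dot v xi).
  exact: is_derive_dotl.
have := @is_derive_chain R (fun t => cos (t + c)) (fun z => dot z xi) _ v _ _
  (is_derive_cosD (dot (x + t *: v) xi) c) h.
by move/is_derive_line.
Qed.

Lemma testfun_coordM i m : testfun m -> testfun (fun xi => coord xi i * m xi).
Proof. by move=> tm; apply: testfunM => //; exact: smooth_coord. Qed.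

Lemma is_derive_trig c m x i : testfun m ->
  is_derive x (basis R i) (trig c m) (trig (c + pi / 2) (fun xi => coord xi i * m xi) x).
Proof.
move=> tm; have mi := testfun_integ tm.
have tm' := testfun_coordM i tm; have mi' := testfun_integ tm'.
apply/is_derive_line0.
have := @is_derive_integral R (fun t xi => cos (dot (x + t *: basis R i) xi + c) * m xi)
  (fun t xi => cos (dot (x + t *: basis R i) xi + (c + pi / 2)) * (coord xi i * m xi))
  (fun xi => `|coord xi i * m xi|) _ _ _ _.
rewrite scale0r addr0; apply.
- by move=> t _; exact: integ_cos.
- move=> t xi _; have := is_derive_cos_line x (basis R i) xi c t.
  rewrite dot_basis => h; have := @is_deriveM R R _ (cst (m xi)) t 1 _ 0 h (is_derive_cst _ _ _).
  rewrite /GRing.scale /= mulr0 add0r => {}h.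
  by rewrite mulrA (mulrC _ (m xi)); exact: h.
- exact: rintegrable_norm.
- by move=> t xi _; rewrite normrM ler_piMl// cos_norm_le1.
Qed.

Lemma cos_lip (a b : R) : `|cos a - cos b| <= `|a - b|.
Proof.
wlog ab : a b / a < b.
  move=> h; have [ab|ba|->] := ltgtP a b; [exact: h| |by rewrite !subrr].
  by rewrite distrC (distrC a); exact: h.
have h1 : forall t : R, t \in `]a, b[ -> is_derive t 1 (@cos R) (- sin t).
  by move=> t _; exact: is_derive_cos.
have h2 : {within `[a, b], continuous (@cos R)}.
  by apply: continuous_subspaceT => t; exact: continuous_cos.
have [z _ e] := MVT ab h1 h2.
 rewrite distrC e normrM normrN (distrC a) ler_piMl//.
by rewrite ler_norml sin_geN1 sin_le1.
Qed.

Lemma trig_lip c m x y : testfun m ->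
  `|trig c m x - trig c m y| <= enorm (x - y) * \int[mu]_xi (wt xi * `|m xi|).
Proof.
move=> tm; have mi := testfun_integ tm.
have wi : integ (fun xi => wt xi * `|m xi|).
  have rm := testfun_rapid tm.
  have ra : rapid (fun xi => `|m xi|).
    split; first exact: measurable3_norm rm.1.
    by move=> N; have [C hC] := rm.2 N; exists C => z; rewrite normr_id.
  apply: rapid_integ; apply: rapidM => //; first exact: measurable_wt.
  by exists 1%N, 1 => z; rewrite ger0_norm// mul1r expr1.
rewrite /trig -RintB; [|exact: integ_cos|exact: integ_cos].
rewrite -RintZ//; apply: Rint_norm_le.
- by apply: rintegrableB; exact: integ_cos.
- exact: rintegrableZ.
- move=> xi; rewrite -mulrBl normrM mulrA ler_wpM2r//.
  rewrite (le_trans (cos_lip _ _))// opprD addrACA subrr addr0 -dotBl.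
  by rewrite (le_trans (normr_dot _ _))// ler_wpM2l// /wt lerDr.
Qed.

Lemma continuous_trig c m : testfun m -> continuous (trig c m).
Proof.
move=> tm; apply: (@lipschitz_continuous _ (\int[mu]_xi (wt xi * `|m xi|))).
  by apply: Rint_ge0 => z; rewrite mulr_ge0.
by move=> x y; rewrite mulrC; exact: trig_lip.
Qed.

(** Integration by parts in xi: x_i cos(x.xi + c) is the derivative in xi_i of cos(x.xi + c - pi/2).
    A coordinate in x is thus exchanged for a derivative of the symbol. *)
Lemma trig_coord c m x i : testfun m ->
  coord x i * trig c m x = - trig (c - pi / 2) (partial i m) x.
Proof.
move=> tm; have mi := testfun_integ tm.
have tm' := testfun_partial i tm; have mi' := testfun_integ tm'.
have [C C0 hC] := rapid_omega (testfun_rapid tm).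
have [D D0 hD] := rapid_omega (testfun_rapid tm').
pose dF xi := cos (dot x xi + (c - pi / 2)) * partial i m xi +
              m xi * (coord x i * cos (dot x xi + c)).
have : \int[mu]_xi dF xi = 0.
  apply: (@Rint_partial0 R (fun xi => cos (dot x xi + (c - pi / 2)) * m xi) dF i
     (D + `|coord x i| * C)).
  - exact: integ_cos.
  - move=> xi; apply: is_derive_mul; last by apply: smooth_is_derive; exact: tm.1.
    apply/is_derive_line0.
    have := is_derive_cos_line xi (basis R i) x (c - pi / 2) 0.
    rewrite scale0r addr0 dot_basis subrK (dotC xi) [cos _ * _]mulrC.
    have -> // : (fun s : R => cos (dot (xi + s *: basis R i) x + (c - pi / 2))) =
        (fun s : R => cos (dot x (xi + s *: basis R i) + (c - pi / 2))).
    by apply/funext => s; rewrite dotC.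
  - move=> xi; rewrite /dF [leRHS]mulrDl; apply: (le_trans (ler_normD _ _)).
    apply: lerD.
      by rewrite normrM (le_trans _ (hD xi))// ler_piMl// cos_norm_le1.
    rewrite mulrCA normrM -mulrA ler_wpM2l//.
    by rewrite (le_trans _ (hC xi))// normrM ler_piMr// cos_norm_le1.
rewrite RintD; [|exact: integ_cos|]; last first.
  apply: (@eq_integ R (fun xi : E => coord x i * (cos (dot x xi + c) * m xi))).
    by move=> xi; rewrite [RHS]mulrC -mulrA.
  by apply: rintegrableZ; exact: integ_cos.
move/eqP; rewrite addrC addr_eq0 => /eqP <-.
rewrite -RintZ; last exact: integ_cos.
by apply: Rint_eq => xi; rewrite [RHS]mulrC -mulrA.
Qed.

(** Derivatives stay in the class by [is_derive_trig], and powers of coordinates are absorbed by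
    [trig_coord]. Decay in |x| follows because [wt x] is at most four times the largest of 1 and the
    absolute values of the coordinates. *)
Lemma trig_schwartz c m : testfun m -> schwartz (trig c m).
Proof.
pose A := [set f | exists c m, testfun m /\ f = trig c m].
move=> tm; apply: (@schwartz_class _ A); last by exists c, m.
- by move=> _ [d [n [tn ->]]]; exact: continuous_trig.
- by move=> _ [d [n [tn ->]]] i x; apply: ex_derive; exact: is_derive_trig.
- move=> _ [d [n [tn ->]]] i; exists (d + pi / 2), (fun xi => coord xi i * n xi).
  split; first exact: testfun_coordM.
  by apply/funext => x; apply: derive_val; exact: is_derive_trig.
- move=> _ [d [n [tn ->]]] N.
  have key i : exists C, 0 <= C /\ forall x, `|coord x i| ^+ N * `|trig d n x| <= C.
    elim: N d n tn => [|N IHN] d n tn.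
      exists (\int[mu]_xi `|n xi|); split; first exact: Rint_ge0.
      by move=> x; rewrite mul1r; apply: trig_bound; exact: testfun_integ.
    have [C [C0 hC]] := IHN (d - pi / 2) (partial i n) (testfun_partial i tn).
    exists C; split => // x; rewrite exprSr -mulrA -normrM trig_coord// normrN.
    exact: hC.
  have [C1 [C10 h1]] := key ord0.
  have [C2 [C20 h2]] := key (inord 1).
  have [C3 [C30 h3]] := key (inord 2).
  have mi := testfun_integ tn.
  exists (4 ^+ N * (\int[mu]_xi `|n xi| + C1 + C2 + C3)) => x.
  set a := `|x.1.1|; set b := `|x.1.2|; set e := `|x.2|.
  have {}h1 : a ^+ N * `|trig d n x| <= C1 by exact: h1.
  have {}h2 : b ^+ N * `|trig d n x| <= C2.
    by have := h2 x; rewrite /coord inordK.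
  have {}h3 : e ^+ N * `|trig d n x| <= C3.
    by have := h3 x; rewrite /coord inordK.
  have h0 : 1 ^+ N * `|trig d n x| <= \int[mu]_xi `|n xi|.
    by rewrite expr1n mul1r; exact: trig_bound.
  pose M := Num.max (Num.max 1 a) (Num.max b e).
  have wM : wt x <= 4 * M.
    have : wt x <= 1 + a + b + e.
      by rewrite /wt -!addrA lerD2l addrA; exact: enorm_le_sum.
    have : 1 <= M by rewrite /M !le_max lexx.
    have : a <= M by rewrite /M !le_max lexx orbT.
    have : b <= M by rewrite /M !le_max lexx !orbT.
    have : e <= M by rewrite /M !le_max lexx !orbT.
    lra.
  have M0 : 0 <= M by rewrite /M !le_max ler01.
  apply: (@le_trans _ _ ((4 * M) ^+ N * `|trig d n x|)).
    by rewrite ler_wpM2r// lerXn2r// nnegrE// mulr_ge0.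
  rewrite exprMn -mulrA ler_wpM2l ?exprn_ge0//.
  have I0 : 0 <= \int[mu]_xi `|n xi| by exact: Rint_ge0.
  rewrite /M; case: (leP (Num.max 1 a)) => _.
    by case: (leP b) => _; [move: h3|move: h2]; lra.
  by case: (leP 1) => _; [move: h1|move: h0]; lra.
Qed.

End TrigTransform.

(** * Fourier transform of the Abel regularizer *)

Section LaplaceKernel.
Variable R : realType.
Local Notation RM := (measurableTypeR R).
Local Notation E := (R3 R).
Local Notation l := (@lebesgue_measure R).
Local Notation mu := (lebesgue3 R).

Lemma rderive_mul (f g : R -> R) (x df dg : R) : is_derive x (1 : R) f df ->
  is_derive x (1 : R) g dg -> is_derive x (1 : R) (fun y => f y * g y) (f x * dg + g x * df).
Proof. exact: is_deriveM. Qed.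

Lemma rderive_add (f g : R -> R) (x df dg : R) : is_derive x (1 : R) f df ->
  is_derive x (1 : R) g dg -> is_derive x (1 : R) (fun y => f y + g y) (df + dg).
Proof. exact: is_deriveD. Qed.

Lemma rderive_scale (c : R) (f : R -> R) (x df : R) : is_derive x (1 : R) f df ->
  is_derive x (1 : R) (fun y => c * f y) (c * df).
Proof.
move=> hf; have := rderive_mul (is_derive_cst c x 1) hf.
by rewrite mulr0 addr0.
Qed.

Lemma rderive_comp_scale (h : R -> R) (c x dh : R) : is_derive (c * x) (1 : R) h dh ->
  is_derive x (1 : R) (fun y => h (c * y)) (c * dh).
Proof.
move=> hh; have hc : is_derive x (1 : R) (fun y : R => c * y) (c * 1).
  by apply: rderive_scale; exact: is_derive_id.
by have := @is_derive1_comp R h _ x _ _ hh hc; rewrite mulr1 mulrC.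
Qed.

(** A primitive of exp(-t) (1 + cos(z t)). The summand 1 makes the integrand nonnegative, as the
    fundamental theorem on a half-line requires; its contribution is subtracted in [lap_cos]. *)
Let F (z t : R) : R := (- 1) * expR (- 1 * t) + expR (- 1 * t) *
  (z * sin (z * t) + (- 1) * cos (z * t)) * (1 + z ^+ 2)^-1.

Let den_gt0 (z : R) : 0 < 1 + z ^+ 2.
Proof. by rewrite ltr_pwDl// sqr_ge0. Qed.

Let is_derive_F z (t : R) :
  is_derive t (1 : R) (F z) (expR (- t) * (1 + cos (z * t))).
Proof.
have de : is_derive t (1 : R) (fun t => expR (- 1 * t)) (- 1 * expR (- 1 * t)).
  by apply: rderive_comp_scale; exact: is_derive_expR.
have ds : is_derive t (1 : R) (fun t => sin (z * t)) (z * cos (z * t)).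
  by apply: rderive_comp_scale; exact: is_derive_sin.
have dc : is_derive t (1 : R) (fun t => cos (z * t)) (z * - sin (z * t)).
  by apply: rderive_comp_scale; exact: is_derive_cos.
have h1 := rderive_add (rderive_scale z ds) (rderive_scale (- 1) dc).
have h2 := rderive_mul (rderive_mul de h1) (is_derive_cst ((1 + z ^+ 2)^-1) t 1).
have h3 := rderive_add (rderive_scale (- 1) de) h2.
have E1 : expR (- 1 * t) = expR (- t) by rewrite mulN1r.
apply: (is_derive_eq h3); rewrite /cst !E1; field.
by rewrite gt_eqF.
Qed.

Let cvg_F z : F z t @[t --> +oo%R] --> (0 : R).
Proof.
apply: norm_cvg0; pose K := 1 + (`|z| + 1).
apply: (@squeeze_cvgr _ _ _ _ (fun=> 0) (fun t => expR (- t) * K)).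
- have E1 t : expR (- 1 * t) = expR (- t) :> R by rewrite mulN1r.
  apply: nearW => t; rewrite normr_ge0/= /F !E1.
  apply: (le_trans (ler_normD _ _)).
  rewrite /K [leRHS]mulrDr [X in _ <= X + _]mulr1 lerD//; first by rewrite mulN1r normrN ger0_norm// expR_ge0.
  rewrite !normrM (ger0_norm (expR_ge0 _)) -mulrA ler_wpM2l ?expR_ge0//.
  rewrite (@ger0_norm _ ((1 + z ^+ 2)^-1)) ?invr_ge0 ?(ltW (den_gt0 z))//.
  rewrite -[leRHS]mulr1 ler_pM//.
  + by rewrite invr_ge0 ltW.
  + apply: (le_trans (ler_normD _ _)); rewrite lerD//.
      by rewrite normrM ler_piMr// ler_norml sin_geN1 sin_le1.
    by rewrite mulN1r normrN cos_norm_le1.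
  + by rewrite invf_le1// lerDl sqr_ge0.
- exact: cvg_cst.
- rewrite -(mul0r K); apply: cvgM; last exact: cvg_cst.
  exact: cvgr_expR.
Qed.

Lemma integral_exp_cos z :
  (\int[l]_(t in `[0%R, +oo[) (expR (- t) * (1 + cos (z * t)))%:E =
   (1 + (1 + z ^+ 2)^-1)%:E)%E.
Proof.
have cf : continuous (fun t : R => expR (- t) * (1 + cos (z * t))).
  move=> t; apply: cvgM.
    apply: (@continuous_comp _ _ _ (fun t : R => - t) (@expR R)).
      exact: opp_continuous.
    exact: continuous_expR.
  apply: cvgD; first exact: cvg_cst.
  apply: (@continuous_comp _ _ _ (fun t : R => z * t) (@cos R)).
    exact: mulrl_continuous.
  exact: continuous_cos.
have cF : continuous (F z).
  move=> t; apply/differentiable_continuous/derivable1_diffP.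
  by apply: ex_derive; exact: is_derive_F.
rewrite (@ge0_continuous_FTC2y R _ (F z) 0 0).
- rewrite /F !mulr0 expR0 sin0 cos0 -EFinB; congr EFin; ring.
- by move=> t _; rewrite mulr_ge0 ?expR_ge0// -lerBlDl sub0r cos_geN1.
- exact: continuous_subspaceT.
- exact: cvg_F.
- by move=> t _; apply: ex_derive; exact: is_derive_F.
- by apply/cvg_at_right_filter; exact: cF.
- by move=> t _; rewrite derive1E; apply: derive_val; exact: is_derive_F.
Qed.

(* [lap3] is the Abel regularizer of the inversion formula, and [poisson3] its
   explicit Fourier transform. *)
Definition lap (t : R) : R := expR (- `|t|).

Lemma lap_ge0 t : 0 <= lap t. Proof. exact: expR_ge0. Qed.
Lemma lap_le1 t : lap t <= 1.
Proof. by rewrite /lap -expR0 ler_expR oppr_le0. Qed.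

Lemma continuous_lap : continuous lap.
Proof.
move=> t; apply: (@continuous_comp _ _ _ (fun t : R => - `|t|) (@expR R)).
  by apply: cvgN; exact: norm_continuous.
exact: continuous_expR.
Qed.

Lemma lap_cos z : rintegrable l (fun t : RM => lap t * cos (z * t)) /\
  \int[l]_t (lap t * cos (z * t)) = 2 * (1 + z ^+ 2)^-1.
Proof.
have key z' : rintegrable l (fun t : RM => lap t * (1 + cos (z' * t))) /\
    \int[l]_t (lap t * (1 + cos (z' * t))) = 2 * (1 + (1 + z' ^+ 2)^-1).
  apply: rintegrable_even.
  - apply: continuous_measurable_fun => t; apply: cvgM; first exact: continuous_lap.
    apply: cvgD; first exact: cvg_cst.
    apply: (@continuous_comp _ _ _ (fun t : R => z' * t) (@cos R)).
      exact: mulrl_continuous.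
    exact: continuous_cos.
  - by move=> t; rewrite mulr_ge0 ?lap_ge0// -lerBlDl sub0r cos_geN1.
  - by move=> t; rewrite /lap normrN mulrN cosN.
  - rewrite -integral_exp_cos; apply: eq_integral => t; rewrite inE/= in_itv/= andbT => t0.
    by rewrite /lap ger0_norm.
have [i0 e0] := key 0; have [iz ez] := key z.
have i1 : rintegrable l (fun t : RM => lap t).
  have := rintegrableZ 2^-1 i0; apply: eq_rintegrable => t.
  by rewrite mul0r cos0; field.
have e1 : \int[l]_t lap t = 2.
  transitivity (\int[l]_t (2^-1 * (lap t * (1 + cos (0 * t))))).
    by apply: Rint_eq => t; rewrite mul0r cos0; field.
  by rewrite (RintZ 2^-1 i0) e0 expr0n/= addr0 invr1; lra.
split.
  have := rintegrableB iz i1; apply: eq_rintegrable => t; ring.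
transitivity (\int[l]_t (lap t * (1 + cos (z * t)) - lap t)).
  by apply: Rint_eq => t; ring.
by rewrite RintB// ez e1; ring.
Qed.

Lemma lebesgue_opp (f : R -> R) : rintegrable l f ->
  rintegrable l (fun t : RM => f (- t)) /\ \int[l]_t f (- t) = \int[l]_t f t.
Proof.
move=> fi; rewrite -[X in _ /\ _ = X]mul1r.
have mN : measurable_fun setT (-%R : RM -> RM).
  have : @measurable_fun _ _ R R setT (fun t : R => - t).
    by apply: continuous_measurable_fun; exact: opp_continuous.
  by [].
apply: (Rint_transport mN) => // h mh h0; rewrite mul1e.
have mh' : measurable_fun setT (EFin \o h : RM -> \bar R) by exact/measurable_EFinP.
rewrite -(ge0_integral_image l mN mh' (fun t => h0 t)).
by apply: eq_measure_integral => A mA _; exact: lebesgue_measureN.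
Qed.

Lemma lap_sin z : rintegrable l (fun t : RM => lap t * sin (z * t)) /\
  \int[l]_t (lap t * sin (z * t)) = 0.
Proof.
have i1 : rintegrable l lap.
  have [+ _] := lap_cos 0; apply: eq_rintegrable => t.
  by rewrite mul0r cos0 mulr1.
have iz : rintegrable l (fun t : RM => lap t * sin (z * t)).
  apply: (eq_rintegrable (f := fun t : RM => sin (z * t) * lap t)).
    by move=> t; rewrite mulrC.
  apply: (rintegrable_mul_bounded i1 _ (C := 1)).
    apply: continuous_measurable_fun.
    move=> t; apply: (@continuous_comp _ _ _ (fun t : R => z * t) (@sin R)).
      exact: mulrl_continuous.
    exact: continuous_sin.
  by move=> t; rewrite ler_norml sin_geN1 sin_le1.
split => //; have [_] := lebesgue_opp iz.
rewrite (_ : \int[l]_t (lap (- t) * sin (z * - t)) = - \int[l]_t (lap t * sin (z * t))).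
  lra.
rewrite -RintN//; apply: Rint_eq => t.
by rewrite /lap normrN mulrN sinN mulrN.
Qed.

Definition lap3 (x : E) : R := lap x.1.1 * lap x.1.2 * lap x.2.

Definition poisson3 (z : E) : R := (2 * (1 + z.1.1 ^+ 2)^-1) *
  (2 * (1 + z.1.2 ^+ 2)^-1) * (2 * (1 + z.2 ^+ 2)^-1).

Lemma integ_lap3 : integ lap3.
Proof.
have i1 : rintegrable l lap.
  have [+ _] := lap_cos 0; apply: eq_rintegrable => t.
  by rewrite mul0r cos0 mulr1.
by have [] := Rint_tensor3 i1 i1 i1.
Qed.

Lemma lap3_ge0 x : 0 <= lap3 x. Proof. by rewrite !mulr_ge0 ?lap_ge0. Qed.
Lemma lap3_le1 x : lap3 x <= 1.
Proof.
rewrite /lap3 !mulr_ile1 ?mulr_ge0 ?lap_ge0 ?lap_le1//.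
Qed.

Lemma measurable_lap3 : measurable3 lap3.
Proof. exact: rintegrable_measurable integ_lap3. Qed.

(** The cosine of a sum of three terms expands into four products. Three of them contain two sines
    and integrate to 0 by parity; the remaining one is a product of three one-dimensional
    transforms. *)
Lemma lap3_cos (z : E) : \int[mu]_x (lap3 x * cos (dot x z)) = poisson3 z.
Proof.
have [c1 C1] := lap_cos z.1.1; have [s1 S1] := lap_sin z.1.1.
have [c2 C2] := lap_cos z.1.2; have [s2 S2] := lap_sin z.1.2.
have [c3 C3] := lap_cos z.2; have [s3 S3] := lap_sin z.2.
have [i1 I1] := Rint_tensor3 c1 c2 c3.
have [i2 I2] := Rint_tensor3 c1 s2 s3.
have [i3 I3] := Rint_tensor3 s1 c2 s3.
have [i4 I4] := Rint_tensor3 s1 s2 c3.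
rewrite S2 mulr0 mul0r in I2; rewrite S1 !mul0r in I3; rewrite S1 !mul0r in I4.
rewrite C1 C2 C3 in I1; rewrite /poisson3 -I1.
rewrite -[RHS]subr0 -{1}I2 -RintB//.
rewrite -[RHS]subr0 -{1}I3 -RintB//; last exact: rintegrableB.
rewrite -[RHS]subr0 -{1}I4 -RintB//; last by do 2! apply: rintegrableB => //.
apply: Rint_eq => x; rewrite /lap3 dotE !cosD !sinD !(mulrC z.1.1) !(mulrC z.1.2) !(mulrC z.2).
ring.
Qed.

Lemma integ_poisson3 : integ poisson3 /\ \int[mu]_z poisson3 z = (2 * pi) ^+ 3.
Proof.
have [i1 e1] := rintegrable_oneDsqrV R.
have i2 := rintegrableZ 2 i1.
have [? ->] := Rint_tensor3 i2 i2 i2; split => //.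
by rewrite RintZ// e1; ring.
Qed.

Lemma poisson3_ge0 z : 0 <= poisson3 z.
Proof. by rewrite /poisson3 !mulr_ge0// invr_ge0 addr_ge0// sqr_ge0. Qed.

Lemma poisson3N z : poisson3 (- z) = poisson3 z.
Proof. by rewrite /poisson3 /= !sqrrN. Qed.

End LaplaceKernel.

(** * Fourier inversion for even symbols, and convolution of cosine transforms *)

Section Inversion.
Variable R : realType.
Local Notation E := (R3 R).
Local Notation mu := (lebesgue3 R).
Implicit Types (m n f : E -> R) (x y z : E).

Definition even_fun f := forall x, f (- x) = f x.

Lemma Rint_shift f a : integ f -> \int[mu]_x f (a + x) = \int[mu]_x f x.
Proof.
move=> fi; have := Rint_affine a (oner_neq0 R) fi.
rewrite normr1 expr1n invr1 mul1r => <-.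
by apply: Rint_eq => x; rewrite scale1r.
Qed.

Lemma Rint_reflect f a : integ f -> \int[mu]_x f (a - x) = \int[mu]_x f x.
Proof.
move=> fi; have N1 : (-1 : R) != 0 by rewrite oppr_eq0 oner_neq0.
have := Rint_affine a N1 fi.
rewrite normrN1 expr1n invr1 mul1r => <-.
by apply: Rint_eq => x; rewrite scaleN1r.
Qed.

Lemma integ_shift f a : integ f -> integ (fun x => f (a + x)).
Proof.
move=> fi; apply: (eq_integ _ (integrable_affine a (oner_neq0 R) fi)) => x.
by rewrite scale1r.
Qed.

Lemma integ_reflect f a : integ f -> integ (fun x => f (a - x)).
Proof.
move=> fi; have N1 : (-1 : R) != 0 by rewrite oppr_eq0 oner_neq0.
by apply: (eq_integ _ (integrable_affine a N1 fi)) => x; rewrite scaleN1r.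
Qed.

Lemma integ_cosr f z c : integ f -> integ (fun y => f y * cos (dot y z + c)).
Proof.
move=> fi; apply: (eq_integ _ (integ_cos z c fi)) => y.
by rewrite mulrC dotC.
Qed.

Lemma Rint_even_cos f z c : integ f -> even_fun f ->
  \int[mu]_y (f y * cos (dot y z + c)) =
  cos c * \int[mu]_y (f y * cos (dot y z)).
Proof.
move=> fi fe; have ic := integ_cosr z c fi.
have ic0 : integ (fun y => f y * cos (dot y z)).
  by apply: (eq_integ _ (integ_cosr z 0 fi)) => y; rewrite addr0.
have r := Rint_reflect 0 ic.
have ir := integ_reflect 0 ic.
apply: (@mulfI _ 2) => //; rewrite mulr_natl mulr2n -{1}r -RintD//.
rewrite mulrA -RintZ//; apply: Rint_eq => y.
rewrite sub0r fe dotNl !cosD cosN sinN; ring.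
Qed.

Lemma measurable33_cos (g : E -> R) : measurable3 g ->
  measurable33 (fun z : E * E => cos (dot z.1 z.2 + g z.2)).
Proof.
move=> mg; apply: measurable33_comp.
  by apply: continuous_measurable_fun; exact: continuous_cos.
by apply: measurable33D; [exact: measurable33_dot|exact: measurable33_snd].
Qed.

Lemma trig_even m : even_fun (trig 0 m).
Proof.
by move=> x; apply: Rint_eq => xi; rewrite dotNl !addr0 cosN.
Qed.

Lemma trig_integ c m : testfun m -> integ (trig c m).
Proof. by move=> tm; apply: rapid_integ; apply: schwartz_rapid; exact: trig_schwartz. Qed.

Lemma lap3_cos_scaled (e : R) z : 0 < e ->
  \int[mu]_y (lap3 (e *: y) * cos (dot y z)) = e ^- 3 * poisson3 (e^-1 *: z).
Proof.
move=> e0; have e1 : e != 0 by rewrite gt_eqF.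
have i1 : integ (fun y => lap3 y * cos (dot y (e^-1 *: z))).
  by apply: (eq_integ _ (integ_cosr (e^-1 *: z) 0 (integ_lap3 R))) => y; rewrite addr0.
rewrite -lap3_cos; have := Rint_affine 0 e1 i1; rewrite (gtr0_norm e0) => <-.
apply: Rint_eq => y; rewrite add0r.
by rewrite dotZl dotZr mulrA mulfV// mul1r.
Qed.

(** Fubini, with the regularizer making the integral in y absolutely convergent jointly with xi:
    that integral becomes a Poisson kernel of width e, and the left-hand side an average of m around
    z. The product of two cosines gives kernels centred at z and at -z, which contribute equally
    because m is even. *)
Let approx_eq m z (e : R) : testfun m -> even_fun m -> 0 < e ->
  \int[mu]_y (lap3 (e *: y) * trig 0 m y * cos (dot y z)) =
  \int[mu]_t (m (z + e *: t) * poisson3 t).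
Proof.
move=> tm me e0; have e1 : e != 0 by rewrite gt_eqF.
have mi := testfun_integ tm; have mm := rintegrable_measurable mi.
have li : integ (fun y => lap3 (e *: y)).
  by apply: (eq_integ _ (integrable_affine 0 e1 (integ_lap3 R))) => y; rewrite add0r.
have ml : measurable3 (fun y => lap3 (e *: y)) by exact: rintegrable_measurable li.
pose F (p : E * E) := lap3 (e *: p.1) * cos (dot z p.1 + 0) * (cos (dot p.1 p.2 + 0) * m p.2).
have mF : measurable33 F.
  apply: measurable33M; apply: measurable33M.
  - exact: measurable33_fst ml.
  - exact: measurable33_fst (measurable_cos_dot z 0).
  - exact: (measurable33_cos (measurable3_cst 0)).
  - exact: measurable33_snd mm.
have mni := rintegrable_norm mi.
have Fb x y : `|F (x, y)| <= lap3 (e *: x) * `|m y|.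
  rewrite /F/= -mulrA normrM ger0_norm ?lap3_ge0// ler_wpM2l ?lap3_ge0//.
  by rewrite mulrA normrM ler_piMl// normrM mulr_ile1 ?cos_norm_le1.
transitivity (\int[mu]_y \int[mu]_xi F (y, xi)).
  apply: Rint_eq => y; rewrite /F/= RintZ; last exact: integ_cos.
  by rewrite addr0 mulrAC (dotC z).
rewrite (fubini3 mF li mni Fb).
have iP := (integ_poisson3 R).1.
have mP : measurable3 (@poisson3 R) by exact: rintegrable_measurable iP.
have iPs w : integ (fun xi => m xi * poisson3 (e^-1 *: (xi + w))).
  have [C C0 hC] := testfun_bounded tm.
  apply: (rintegrable_mul_bounded _ mm hC).
  have ei1 : e^-1 != 0 by rewrite invr_eq0.
  apply: (eq_integ _ (integrable_affine (e^-1 *: w) ei1 iP)) => xi.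
  by rewrite scalerDr addrC.
transitivity (\int[mu]_xi (2^-1 * e ^- 3 * (m xi * poisson3 (e^-1 *: (xi + z)) +
                                     m xi * poisson3 (e^-1 *: (xi + - z))))).
  apply: Rint_eq => xi; rewrite /F/=.
  have ic w : integ (fun y => lap3 (e *: y) * cos (dot y w)).
    by apply: (eq_integ _ (integ_cosr w 0 li)) => y; rewrite addr0.
  transitivity (\int[mu]_y ((2^-1 * m xi) * (lap3 (e *: y) * cos (dot y (xi + z)) +
                   lap3 (e *: y) * cos (dot y (xi - z))))).
    apply: Rint_eq => y; rewrite !addr0 (dotC z) !dotDr dotNr.
    by rewrite !cosD cosN sinN; field.
  rewrite RintZ; last exact: rintegrableD.
  rewrite RintD// !lap3_cos_scaled//; ring.
rewrite RintZ; last exact: rintegrableD.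
rewrite RintD//.
have key w : \int[mu]_xi (m xi * poisson3 (e^-1 *: (xi + w))) =
    e ^+ 3 * \int[mu]_t (m (- w + e *: t) * poisson3 t).
  have := Rint_affine (- w) e1 (iPs w); rewrite (gtr0_norm e0) => h.
  have -> : \int[mu]_t (m (- w + e *: t) * poisson3 t) =
    \int[mu]_t (m (- w + e *: t) * poisson3 (e^-1 *: (- w + e *: t + w))).
    apply: Rint_eq => t; rewrite addrAC addNr add0r scalerA mulVf// scale1r//.
  by rewrite h mulrA mulfV ?mul1r// expf_neq0.
rewrite !key opprK.
have -> : \int[mu]_t (m (- z + e *: t) * poisson3 t) =
    \int[mu]_t (m (z + e *: t) * poisson3 t).
  have i : integ (fun t => m (- z + e *: t) * poisson3 t).
    have [C C0 hC] := testfun_bounded tm.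
    apply: (rintegrable_mul_bounded iP _ (C := C)) => //.
    exact: (measurable3_affine (- z) e mm).
  rewrite -(Rint_reflect 0 i); apply: Rint_eq => t.
  by rewrite sub0r scalerN -opprD me poisson3N.
have : e ^+ 3 != 0 by rewrite expf_neq0.
by move=> h; field.
Qed.

(** Abel summation: e tends to 0 in [approx_eq]. The left side is dominated by |trig 0 m| and the
    right side by a multiple of the Poisson kernel, whose total mass is the factor (2 pi)^3. *)
Lemma trig_inversion0 m z : testfun m -> even_fun m ->
  \int[mu]_y (trig 0 m y * cos (dot y z)) = (2 * pi) ^+ 3 * m z.
Proof.
move=> tm me; have mi := testfun_integ tm; have mm := rintegrable_measurable mi.
have ti := trig_integ 0 tm; have mt := rintegrable_measurable ti.
pose e (k : nat) : R := k.+1%:R^-1.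
have e0 k : 0 < e k by rewrite invr_gt0.
have e_cvg : e k @[k --> \oo] --> (0 : R) by exact: cvg_harmonic.
have ic : integ (fun y => trig 0 m y * cos (dot y z)).
  by apply: (eq_integ _ (integ_cosr z 0 ti)) => y; rewrite addr0.
have lap_cvg t : lap (e k * t) @[k --> \oo] --> (1 : R).
  have -> : 1 = lap (0 * t) :> R by rewrite mul0r /lap normr0 oppr0 expR0.
  apply: (@cvg_comp _ _ _ (fun k => e k * t) (@lap R) _ (nbhs (0 * t))).
    by apply: cvgM => //; exact: cvg_cst.
  exact: continuous_lap.
have h1 : \int[mu]_y (lap3 (e k *: y) * trig 0 m y * cos (dot y z)) @[k --> \oo] -->
    \int[mu]_y (trig 0 m y * cos (dot y z)).
  apply: (@Rint_dominated _ _ _ mu _ _ (fun y => `|trig 0 m y|) _ _ _ _).2.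
  - move=> k; apply: measurable3M; last first.
      by have := rintegrable_measurable (integ_cosr z 0 (integ_omega R));
        have := measurable_cos_dot z 0; rewrite (_ : (fun xi => _) = fun x => cos (dot x z))//;
        apply/funext => x; rewrite addr0 dotC.
    apply: measurable3M => //.
    have := measurable3_affine 0 (e k) (@measurable_lap3 R).
    by rewrite (_ : (fun x : E => lap3 (0 + _)) = fun x => lap3 (e k *: x))//;
      apply/funext => x; rewrite add0r.
  - move=> y; have -> : trig 0 m y * cos (dot y z) =
        1 * 1 * 1 * trig 0 m y * cos (dot y z) by rewrite !mul1r.
    apply: cvgM; last exact: cvg_cst.
    apply: cvgM; last exact: cvg_cst.
    by apply: cvgM; [apply: cvgM|]; exact: lap_cvg.
  - exact: rintegrable_norm.
  - move=> k y; rewrite -mulrA normrM ger0_norm ?lap3_ge0//.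
    rewrite (le_trans (ler_piMl _ (lap3_le1 _)))//.
    by rewrite normrM ler_piMr// cos_norm_le1.
have [iP eP] := integ_poisson3 R.
have [C C0 hC] := testfun_bounded tm.
have h2 : \int[mu]_t (m (z + e k *: t) * poisson3 t) @[k --> \oo] -->
    \int[mu]_t (m z * poisson3 t).
  apply: (@Rint_dominated _ _ _ mu _ _ (fun t => C * poisson3 t) _ _ _ _).2.
  - move=> k; apply: measurable3M; last exact: rintegrable_measurable iP.
    exact: measurable3_affine.
  - move=> t; apply: cvgM; last exact: cvg_cst.
    apply: (@cvg_comp _ _ _ (fun k => z + e k *: t) m _ (nbhs z)); last first.
      exact: (smooth_continuous tm.1).
    rewrite -[X in _ `=>` nbhs X]addr0 -[X in _ `=>` nbhs (z + X)](scale0r t).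
    apply: cvgD; first exact: cvg_cst.
    exact: cvgZr_tmp.
  - exact: rintegrableZ.
  - move=> k t; rewrite normrM (ger0_norm (poisson3_ge0 _)).
    by rewrite ler_wpM2r ?poisson3_ge0.
rewrite RintZ// eP in h2.
have hE : (fun k => \int[mu]_y (lap3 (e k *: y) * trig 0 m y * cos (dot y z))) =
    (fun k => \int[mu]_t (m (z + e k *: t) * poisson3 t)).
  by apply/funext => k; exact: approx_eq.
rewrite hE in h1; rewrite mulrC; exact: cvg_unique h1 h2.
Qed.

(** Plane waves are eigenfunctions of the convolution, with the symbol as eigenvalue. Any phase is
    allowed, since the kernel is even and the sine part drops out. *)
Lemma trig_conv_cos m z c x : testfun m -> even_fun m ->
  \int[mu]_y (trig 0 m (x - y) * cos (dot y z + c)) =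
  (2 * pi) ^+ 3 * m z * cos (dot x z + c).
Proof.
move=> tm me; have ti := trig_integ 0 tm.
have i : integ (fun y => trig 0 m (x - y) * cos (dot y z + c)).
  exact: (integ_cosr z c (integ_reflect x ti)).
rewrite -(Rint_reflect x i).
transitivity (\int[mu]_y (trig 0 m y * cos (dot y z + - (dot x z + c)))).
  apply: Rint_eq => y; rewrite subKr; congr (_ * _).
  by rewrite dotBl -cosN; congr cos; ring.
rewrite Rint_even_cos//; last exact: trig_even.
by rewrite trig_inversion0// cosN mulrC.
Qed.

Lemma measurable33_reflect m x : measurable3 m -> measurable3 (fun y => m (x - y)).
Proof.
move=> mm; have := measurable3_affine x (-1) mm.
rewrite (_ : (fun y => m (x + _)) = fun y => m (x - y))//.
by apply/funext => y; rewrite scaleN1r.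
Qed.

(** The bounded factor [B] and the phase [g], which may vary with xi, are meant for a product of two
    translated transforms: one of them plays the role of [B] while the other is expanded, and a
    translation by w adds -w.xi to the phase. *)
Lemma trig_conv_fubini (B : E -> R) (C : R) (g n : E -> R) (x : E) m :
  testfun m -> testfun n -> measurable3 g ->
  measurable3 B -> (forall y, `|B y| <= C) ->
  \int[mu]_y (trig 0 m (x - y) * B y * \int[mu]_xi (cos (dot y xi + g xi) * n xi)) =
  \int[mu]_xi (n xi * \int[mu]_y (trig 0 m (x - y) * B y * cos (dot y xi + g xi))).
Proof.
move=> tm tn mg mB BC; have ti := trig_integ 0 tm; have ni := testfun_integ tn.
have iK := integ_reflect x ti.
have mK : measurable3 (fun y => trig 0 m (x - y)) by exact: rintegrable_measurable iK.
have mn : measurable3 n by exact: rintegrable_measurable ni.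
have mgc y : measurable3 (fun xi => cos (dot y xi + g xi)).
  apply: (@measurable3_comp R (@cos R)).
    by apply: continuous_measurable_fun; exact: continuous_cos.
  apply: measurable3D => //.
  by apply: smooth_measurable; rewrite (_ : dot y = fun z => y.1.1 * coord z ord0 + y.1.2 * coord z (inord 1) + y.2 * coord z (inord 2));
    [apply: smoothD; [apply: smoothD|]; apply: smoothZ; exact: smooth_coord|
     apply/funext => z; rewrite dotE /coord !inordK].
pose F (p : E * E) := trig 0 m (x - p.1) * B p.1 * (cos (dot p.1 p.2 + g p.2) * n p.2).
have mF : measurable33 F.
  apply: measurable33M.
    by apply: measurable33M; [exact: measurable33_fst mK|exact: measurable33_fst mB].
  by apply: measurable33M; [exact: measurable33_cos|exact: measurable33_snd].
have ia : integ (fun y => C * `|trig 0 m (x - y)|).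
  by apply: rintegrableZ; exact: rintegrable_norm.
have ib := rintegrable_norm ni.
have Fb y xi : `|F (y, xi)| <= C * `|trig 0 m (x - y)| * `|n xi|.
  rewrite /F/= !normrM (mulrC C) -!mulrA ler_wpM2l// ler_pM ?mulr_ge0//.
  by rewrite ler_piMl// cos_norm_le1.
have icn y : integ (fun xi => cos (dot y xi + g xi) * n xi).
  by apply: (rintegrable_mul_bounded ni (mgc y) (C := 1)) => xi; exact: cos_norm_le1.
transitivity (\int[mu]_y \int[mu]_xi F (y, xi)).
  by apply: Rint_eq => y; rewrite /F/= RintZ.
rewrite (fubini3 mF ia ib Fb); apply: Rint_eq => xi; rewrite -RintZ.
  by apply: Rint_eq => y; rewrite /F/=; ring.
have iKB : integ (fun y => trig 0 m (x - y) * B y).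
  by apply: (eq_integ _ (rintegrable_mul_bounded iK mB BC)) => y; rewrite mulrC.
exact: integ_cosr.
Qed.

Lemma trig_conv m n c x : testfun m -> even_fun m -> testfun n ->
  \int[mu]_y (trig 0 m (x - y) * trig c n y) =
  (2 * pi) ^+ 3 * trig c (fun xi => m xi * n xi) x.
Proof.
move=> tm me tn.
have := @trig_conv_fubini (fun=> 1) 1 (fun=> c) n x m tm tn (measurable3_cst c)
  (measurable3_cst 1) _.
rewrite normr1 => /(_ (fun _ => lexx _)) h.
transitivity (\int[mu]_y (trig 0 m (x - y) * 1 * \int[mu]_xi (cos (dot y xi + c) * n xi))).
  by apply: Rint_eq => y; rewrite mulr1.
rewrite h /trig -RintZ; last first.
  apply: integ_cos; apply: testfun_integ.
  exact: (testfunM tm.1 tn).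
apply: Rint_eq => xi.
transitivity (n xi * \int[mu]_y (trig 0 m (x - y) * cos (dot y xi + c))).
  by congr (_ * _); apply: Rint_eq => y; rewrite mulr1.
by rewrite trig_conv_cos//; ring.
Qed.

(* The Fourier support of a product lies in the sum of the supports. *)
Lemma trig_conv_product0 m n1 n2 c1 c2 x a b :
  testfun m -> even_fun m -> testfun n1 -> testfun n2 ->
  (forall xi eta, n1 xi != 0 -> n2 eta != 0 -> m (xi + eta) = 0 /\ m (xi - eta) = 0) ->
  \int[mu]_y (trig 0 m (x - y) * (trig c1 n1 (y - a) * trig c2 n2 (y - b))) = 0.
Proof.
move=> tm me t1 t2 h0.
have ti := trig_integ 0 tm.
have shiftE c n w y : trig c n (y - w) =
    \int[mu]_xi (cos (dot y xi + (c - dot w xi)) * n xi).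
  by apply: Rint_eq => xi; rewrite dotBl; congr (cos _ * _); ring.
have mgc c w : measurable3 (fun xi : E => c - dot w xi).
  apply: measurable3B; first exact: measurable3_cst.
  apply: continuous_measurable3; rewrite (_ : dot w = fun z => dot z w).
    exact: continuous_dotl.
  by apply/funext => z; rewrite dotC.
have [C C0 hC] := rapid_bounded (schwartz_rapid (trig_schwartz c2 t2)).
have mB : measurable3 (fun y => trig c2 n2 (y - b)).
  have := measurable3_affine (- b) 1 (smooth_measurable (trig_schwartz c2 t2).1).
  rewrite (_ : (fun y => trig c2 n2 (- b + _)) = fun y => trig c2 n2 (y - b))//.
  by apply/funext => y; rewrite scale1r addrC.
transitivity (\int[mu]_y (trig 0 m (x - y) * trig c2 n2 (y - b) *
    \int[mu]_xi (cos (dot y xi + (c1 - dot a xi)) * n1 xi))).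
  by apply: Rint_eq => y; rewrite (shiftE c1); ring.
rewrite (trig_conv_fubini x tm t1 (mgc c1 a) mB (fun y => hC (y - b))).
rewrite -[RHS](Rint0 mu); apply: Rint_eq => xi.
have [->|n1xi] := eqVneq (n1 xi) 0; first by rewrite mul0r.
set I := (X in _ * X); suff -> : I = 0 by rewrite mulr0.
have mc : measurable3 (fun y => cos (dot y xi + (c1 - dot a xi))).
  have := measurable_cos_dot xi (c1 - dot a xi).
  rewrite (_ : (fun y => cos (dot xi y + _)) = fun y => cos (dot y xi + (c1 - dot a xi)))//.
  by apply/funext => y; rewrite dotC.
rewrite /I; transitivity (\int[mu]_y (trig 0 m (x - y) * cos (dot y xi + (c1 - dot a xi)) *
    \int[mu]_eta (cos (dot y eta + (c2 - dot b eta)) * n2 eta))).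
  by apply: Rint_eq => y; rewrite (shiftE c2); ring.
rewrite (@trig_conv_fubini _ 1 _ _ x m tm t2 (mgc c2 b) mc); last first.
  by move=> y; exact: cos_norm_le1.
rewrite -[RHS](Rint0 mu); apply: Rint_eq => eta.
have [->|n2eta] := eqVneq (n2 eta) 0; first by rewrite mul0r.
have [hp hm] := h0 xi eta n1xi n2eta.
have iK := integ_reflect x ti.
set J := (X in _ * X); suff -> : J = 0 by rewrite mulr0.
pose d1 := c1 - dot a xi; pose d2 := c2 - dot b eta.
rewrite /J; transitivity (\int[mu]_y (2^-1 * (trig 0 m (x - y) * cos (dot y (xi + eta) + (d1 + d2)) +
   trig 0 m (x - y) * cos (dot y (xi - eta) + (d1 - d2))))).
  apply: Rint_eq => y; rewrite -/d1 -/d2 -mulrDr.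
  have -> : dot y (xi + eta) + (d1 + d2) = (dot y xi + d1) + (dot y eta + d2).
    by rewrite dotDr; ring.
  have -> : dot y (xi - eta) + (d1 - d2) = (dot y xi + d1) + - (dot y eta + d2).
    by rewrite dotDr dotNr; ring.
  rewrite (cosD (dot y xi + d1) (dot y eta + d2)) (cosD (dot y xi + d1) (- (dot y eta + d2))).
  by rewrite cosN sinN; field.
rewrite RintZ; last by apply: rintegrableD; exact: integ_cosr.
rewrite RintD; [|exact: integ_cosr|exact: integ_cosr].
by rewrite !trig_conv_cos// hp hm; ring.
Qed.

End Inversion.

(** * Convolution and tempered distributions *)

Section MeanValue.
Variable R : realType.
Local Notation E := (R3 R).
Implicit Types (f : E -> R) (x y p : E).

Lemma mean_value_line f p v (t M : R) :
  (forall s : R, derivable f (p + s *: v) v) ->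
  (forall s : R, `|s| <= `|t| -> `|'D_v f (p + s *: v)| <= M) ->
  `|f (p + t *: v) - f p| <= M * `|t|.
Proof.
move=> df bf; pose g (s : R) := f (p + s *: v).
have dg (s : R) : is_derive s 1 g ('D_v f (p + s *: v)).
  by apply/is_derive_line; split.
have cg : continuous g.
  move=> s; apply/differentiable_continuous/derivable1_diffP.
  by apply: ex_derive; exact: dg.
have M0 : 0 <= M by apply: le_trans (bf 0 _); rewrite ?normr0.
have -> : f p = g 0 by rewrite /g scale0r addr0.
have [t0|t0|->] := ltgtP 0 t.
- have [z zI ->] := MVT t0 (fun s _ => dg s) (continuous_subspaceT cg).
  rewrite subr0 normrM ler_wpM2r// bf//; move: zI; rewrite in_itv/= => /andP[? ?].
  by rewrite !gtr0_norm// ltW.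
- have [z zI e] := MVT t0 (fun s _ => dg s) (continuous_subspaceT cg).
  rewrite distrC e sub0r normrM normrN ler_wpM2r// bf//; move: zI.
  rewrite in_itv/= => /andP[? ?].
  by rewrite !ltr0_norm// lerN2 ltW.
- by rewrite /g subrr normr0 mulr_ge0.
Qed.

(** The path from x to x + h moves one coordinate at a time, and each of its points is within |h| of
    x, where the partial derivatives are controlled. The factor 3 counts the steps. *)
Lemma mean_value f x h (M : R) :
  (forall i p, derivable f p (basis R i)) ->
  (forall i p, enorm (p - x) <= enorm h -> `|partial i f p| <= M) ->
  `|f (x + h) - f x| <= 3 * M * enorm h.
Proof.
move=> df bf.
have hE : h = coord h ord0 *: basis R ord0 + coord h (inord 1) *: basis R (inord 1) +
    coord h (inord 2) *: basis R (inord 2).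
  case: h {bf} => [[h1 h2] h3]; rewrite /coord /basis !inordK//=.
  by congr (_, _, _); rewrite /= /GRing.scale /= ?mulr0 ?mulr1 ?addr0 ?add0r.
pose p1 := x + coord h ord0 *: basis R ord0.
pose p2 := p1 + coord h (inord 1) *: basis R (inord 1).
have M0 : 0 <= M by apply: le_trans (bf ord0 x _); rewrite ?subrr ?enorm0.
have e3 : x + h = p2 + coord h (inord 2) *: basis R (inord 2).
  by rewrite /p2 /p1 {1}hE !addrA.
have sq (a b : R) : `|a| <= `|b| -> a ^+ 2 <= b ^+ 2.
  by move=> ab; rewrite -[a ^+ 2]real_normK ?num_real// -[b ^+ 2]real_normK ?num_real// lerXn2r ?nnegrE.
have key (a b c : R) : `|a| <= `|h.1.1| -> `|b| <= `|h.1.2| -> `|c| <= `|h.2| ->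
    enorm ((a, b, c) : E) <= enorm h.
  move=> ha hb hc; rewrite ler_sqr_enorm !sqr_enorm /=.
  by rewrite !lerD// sq.
have step (i : 'I_3) p : (forall s : R, `|s| <= `|coord h i| ->
     enorm (p + s *: basis R i - x) <= enorm h) ->
    `|f (p + coord h i *: basis R i) - f p| <= M * enorm h.
  move=> hp; apply: (le_trans (@mean_value_line f p (basis R i) (coord h i) M _ _)).
  - by move=> s; exact: df.
  - by move=> s hs; apply: bf; exact: hp.
  - by rewrite ler_wpM2l// normr_coord.
have h1 : `|f p1 - f x| <= M * enorm h.
  apply: step => s hs; rewrite addrAC subrr add0r.
  rewrite (_ : s *: basis R ord0 = ((s, 0, 0) : E)) ?key ?normr0//.
  by congr (_, _, _); rewrite /= /GRing.scale /= ?mulr0 ?mulr1.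
have h2 : `|f p2 - f p1| <= M * enorm h.
  apply: step => s hs; rewrite /p1 addrAC (addrAC x) subrr add0r.
  rewrite (_ : _ + _ = ((h.1.1, s, 0) : E)).
    by rewrite key ?normr0//; move: hs; rewrite /coord inordK.
  rewrite /coord /basis !inordK//=.
  by congr (_, _, _); rewrite /= /GRing.scale /= ?mulr0 ?mulr1 ?addr0 ?add0r.
have h3 : `|f (x + h) - f p2| <= M * enorm h.
  rewrite e3; apply: step => s hs; rewrite /p2 /p1 addrAC (addrAC _ _ (- x)) (addrAC x) subrr add0r.
  rewrite (_ : _ + _ = ((h.1.1, h.1.2, s) : E)).
    by rewrite key//; move: hs; rewrite /coord inordK.
  rewrite /coord /basis !inordK//=.
  by congr (_, _, _); rewrite /= /GRing.scale /= ?mulr0 ?mulr1 ?addr0 ?add0r.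
rewrite (_ : f (x + h) - f x = (f (x + h) - f p2) + (f p2 - f p1) + (f p1 - f x)); last by ring.
rewrite (_ : 3 * M * enorm h = M * enorm h + M * enorm h + M * enorm h); last by ring.
by do 2! (apply: (le_trans (ler_normD _ _)); apply: lerD => //).
Qed.

Lemma bounded_partials_continuous f (M : R) :
  (forall i p, derivable f p (basis R i)) -> (forall i p, `|partial i f p| <= M) ->
  continuous f.
Proof.
move=> df bf; have M0 : 0 <= M by exact: le_trans (bf ord0 0).
apply: (@lipschitz_continuous _ (3 * M)); first by rewrite mulr_ge0.
move=> x y; have -> : x = y + (x - y) by rewrite addrC subrK.
by rewrite [X in enorm X]addrAC subrr add0r; apply: mean_value => // i p _; exact: bf.
Qed.

End MeanValue.

Section SchwartzConvolution.
Variable R : realType.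
Local Notation E := (R3 R).
Local Notation mu := (lebesgue3 R).
Implicit Types (f g N a : E -> R) (x y z : E).

Lemma partial_affine i (a : E) (s : R) f : smooth f ->
  partial i (fun x => f (a + s *: x)) = fun x => s * partial i f (a + s *: x).
Proof.
move=> sf; apply/funext => x; apply: derive_val.
have h : is_derive (s *: x) (basis R i) (fun y => f (a + y)) (partial i f (a + s *: x)).
  apply/is_derive_line0; have /is_derive_line0 := smooth_is_derive i (a + s *: x) sf.
  have -> // : (fun t : R => f (a + s *: x + t *: basis R i)) =
    (fun t : R => f (a + (s *: x + t *: basis R i))).
  by apply/funext => t; rewrite addrA.
exact: (is_derive_dilate h).
Qed.

Lemma schwartz_affine (a : E) (s : R) f : s != 0 -> schwartz f ->
  schwartz (fun x => f (a + s *: x)).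
Proof.
move=> s0 sf; pose A := [set g | exists (c : R) f, schwartz f /\ g = fun x => c * f (a + s *: x)].
have dA f' i x : schwartz f' -> is_derive x (basis R i) (fun x => f' (a + s *: x))
    (s * partial i f' (a + s *: x)).
  move=> sf'; have h : is_derive (s *: x) (basis R i) (fun y => f' (a + y)) (partial i f' (a + s *: x)).
    apply/is_derive_line0; have /is_derive_line0 := smooth_is_derive i (a + s *: x) sf'.1.
    have -> // : (fun t : R => f' (a + s *: x + t *: basis R i)) =
      (fun t : R => f' (a + (s *: x + t *: basis R i))).
    by apply/funext => t; rewrite addrA.
  exact: (is_derive_dilate h).
apply: (@schwartz_class _ A).
- move=> _ [c [g [sg ->]]] x; apply: cvgM; first exact: cvg_cst.
  apply: (@continuous_comp _ _ _ (fun y : E => a + s *: y) g).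
    by apply: cvgD; [exact: cvg_cst|exact: scaler_continuous].
  exact: smooth_continuous sg.1 _.
- move=> _ [c [g [sg ->]]] i x; apply: ex_derive; apply: is_derive_scale.
  exact: dA.
- move=> _ [c [g [sg ->]]] i; exists (c * s), (partial i g).
  split; first exact: schwartz_partial.
  apply/funext => x; rewrite -mulrA; apply: derive_val; apply: is_derive_scale.
  exact: dA.
- move=> _ [c [g [sg ->]]] M.
  have [C hC] := (rapid_affine a s0 (schwartz_rapid sg)).2 M.
  exists (`|c| * C) => x; rewrite normrM mulrCA ler_wpM2l//; exact: hC.
- by exists 1, f; split => //; apply/funext => x; rewrite mul1r.
Qed.

Lemma schwartz_reflect x f : schwartz f -> schwartz (fun y => f (x - y)).
Proof.
move=> sf; have N1 : (-1 : R) != 0 by rewrite oppr_eq0 oner_neq0.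
have := schwartz_affine x N1 sf.
by rewrite (_ : (fun y => f (x + _)) = fun y => f (x - y))//; apply/funext => y; rewrite scaleN1r.
Qed.

Lemma schwartz_translate z f : schwartz f -> schwartz (fun y => f (y - z)).
Proof.
move=> sf; have := schwartz_affine (- z) (oner_neq0 R) sf.
by rewrite (_ : (fun y => f (_ + _)) = fun y => f (y - z))//; apply/funext => y; rewrite scale1r addrC.
Qed.

Lemma partials_translate s z f : smooth f ->
  partials s (fun y => f (y - z)) = fun y => partials s f (y - z).
Proof.
elim/last_ind: s f => [//|s i IHs] f sf; rewrite !partials_rcons.
rewrite -IHs; last exact: smooth_partial.
congr partials; have := partial_affine i (- z) 1 sf.
have e g : (fun x => g (- z + 1 *: x)) = (fun y => g (y - z)) :> (E -> R).
  by apply/funext => y; rewrite scale1r addrC.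
by rewrite e => ->; apply/funext => y; rewrite mul1r scale1r addrC.
Qed.

Definition sconv N a y : R := \int[mu]_x (N (y - x) * a x).

Lemma sconv_integ N a y : rapid N -> integ a -> integ (fun x => N (y - x) * a x).
Proof.
move=> rN ai; have [C _ hC] := rapid_bounded rN.
apply: (rintegrable_mul_bounded ai _ (C := C)) => //.
exact: measurable33_reflect rN.1.
Qed.

Lemma is_derive_sconv N a y i : schwartz N -> integ a ->
  is_derive y (basis R i) (sconv N a) (sconv (partial i N) a y).
Proof.
move=> sN ai; have sN' := schwartz_partial i sN.
have [C C0 hC] := rapid_bounded (schwartz_rapid sN').
apply/is_derive_line0.
have := @is_derive_integral R (fun t x => N (y + t *: basis R i - x) * a x)
  (fun t x => partial i N (y + t *: basis R i - x) * a x)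
  (fun x => C * `|a x|) _ _ _ _.
rewrite scale0r addr0; apply.
- by move=> t _; apply: sconv_integ => //; exact: schwartz_rapid.
- move=> t x _; have h := smooth_is_derive i (y + t *: basis R i - x) sN.1.
  rewrite addrAC in h *; move/is_derive_line : h => h.
  have := rderive_scale (a x) h.
  rewrite mulrC; congr is_derive; apply/funext => s; rewrite mulrC.
  by rewrite addrAC.
- by apply: rintegrableZ; exact: rintegrable_norm.
- by move=> t x _; rewrite normrM ler_wpM2r.
Qed.

Lemma rapid_norm f : rapid f -> rapid (fun x => `|f x|).
Proof.
move=> rf; split; first exact: measurable3_norm rf.1.
by move=> M; have [C hC] := rf.2 M; exists C => x; rewrite normr_id.
Qed.

Lemma rapid_wtM k f : rapid f -> rapid (fun x => wt x ^+ k * f x).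
Proof.
move=> rf; apply: rapidM => //; first by apply: measurable3X; exact: measurable_wt.
by exists k, 1 => x; rewrite mul1r ger0_norm// exprn_ge0.
Qed.

Lemma sconv_bound N a y k (B : R) : rapid N -> rapid a ->
  (forall x, wt x ^+ k * `|N x| <= B) ->
  wt y ^+ k * `|sconv N a y| <= B * \int[mu]_x (wt x ^+ k * `|a x|).
Proof.
move=> rN ra hB; have iw : integ (fun x => wt x ^+ k * `|a x|).
  by apply: rapid_integ; apply: rapid_wtM; exact: rapid_norm.
have ic := sconv_integ y rN (rapid_integ ra).
rewrite -(ger0_norm (exprn_ge0 k (wt_ge0 y))) -normrM -RintZ// -RintZ//.
apply: Rint_norm_le; [exact: rintegrableZ|exact: rintegrableZ|].
move=> x; rewrite !normrM (ger0_norm (exprn_ge0 k (wt_ge0 y))).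
rewrite !mulrA ler_wpM2r//.
apply: (@le_trans _ _ (wt (y - x) ^+ k * wt x ^+ k * `|N (y - x)|)).
  by rewrite ler_wpM2r// wtX_peetre.
by rewrite mulrAC ler_wpM2r// exprn_ge0.
Qed.

(** All derivatives fall on [N], so decay is all that is asked of the other factor. *)
Lemma sconv_schwartz N a : schwartz N -> rapid a -> schwartz (sconv N a).
Proof.
move=> sN ra; have ai := rapid_integ ra.
pose A := [set f | exists N, schwartz N /\ f = sconv N a].
apply: (@schwartz_class _ A); last by exists N.
- move=> _ [M [sM ->]].
  have bd i : {C | forall x, `|partial i M x| <= C}.
    by apply: cid; have [C _ hC] := rapid_bounded (schwartz_rapid (schwartz_partial i sM)); exists C.
  pose B := \sum_(i < 3) `|sval (bd i)|.
  have hB i x : `|partial i M x| <= B.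
    rewrite (le_trans (svalP (bd i) x))// (le_trans (ler_norm _))//.
    by rewrite /B (bigD1 i)//= lerDl sumr_ge0.
  apply: (@bounded_partials_continuous _ _ (B * \int[mu]_x `|a x|)).
    by move=> i p; apply: ex_derive; exact: is_derive_sconv.
  move=> i p; have -> : partial i (sconv M a) p = sconv (partial i M) a p.
    by apply: derive_val; exact: is_derive_sconv.
  have sM' := schwartz_partial i sM.
  rewrite -RintZ; last exact: rintegrable_norm.
  apply: Rint_norm_le.
  + by apply: sconv_integ => //; exact: schwartz_rapid.
  + by apply: rintegrableZ; exact: rintegrable_norm.
  + by move=> x; rewrite normrM ler_wpM2r.
- by move=> _ [M [sM ->]] i x; apply: ex_derive; exact: is_derive_sconv.
- move=> _ [M [sM ->]] i; exists (partial i M); split; first exact: schwartz_partial.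
  by apply/funext => x; apply: derive_val; exact: is_derive_sconv.
- move=> _ [M [sM ->]] k; have rM := schwartz_rapid sM.
  have [B hB] := rM.2 k; exists (B * \int[mu]_x (wt x ^+ k * `|a x|)) => y.
  exact: sconv_bound.
Qed.

Lemma partials_sconv s N a : schwartz N -> integ a ->
  partials s (sconv N a) = sconv (partials s N) a.
Proof.
elim/last_ind: s N => [//|s i IHs] N sN ai; rewrite !partials_rcons -IHs//.
  congr partials; apply/funext => y; apply: derive_val; exact: is_derive_sconv.
exact: schwartz_partial.
Qed.

Lemma schwartz_partials s f : schwartz f -> schwartz (partials s f).
Proof. by move=> sf; elim: s => [//|i s IHs] /=; exact: schwartz_partial. Qed.

End SchwartzConvolution.

(** * Exchange of a distribution with an integral *)

Section DistributionFubini.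
Variable R : realType.
Local Notation E := (R3 R).
Local Notation mu := (lebesgue3 R).
Implicit Types (f g N a : E -> R) (x y z : E) (u : tdist R).

Lemma tdist_tempered' u : is_tempered u.
Proof. by have /asboolP := tdist_tempered u. Qed.

Lemma tdist_lin u (c : R) f g : schwartz f -> schwartz g ->
  u (fun y => c * f y + g y) = c * u f + u g.
Proof. by have [lu _ _] := tdist_tempered' u; exact: lu. Qed.

Lemma schwartz_cst0 : schwartz (fun _ : E => 0 : R).
Proof.
pose A : set (E -> R) := [set fun=> 0].
apply: (@schwartz_class _ A) => //.
- by move=> _ -> x; exact: cvg_cst.
- by move=> _ -> i x; exact: derivable_cst.
- by move=> _ -> i; exact: partial_cst.
- by move=> _ -> M; exists 0 => x; rewrite normr0 mulr0.
Qed.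

Lemma schwartz_linE (c : R) f g : schwartz f -> schwartz g ->
  schwartz (fun y => c * f y + g y).
Proof. exact: schwartz_lin. Qed.

Lemma tdist0 u : u (fun=> 0) = 0.
Proof.
have := tdist_lin u 1 schwartz_cst0 schwartz_cst0; rewrite mulr0 addr0 mul1r.
by move/eqP; rewrite -subr_eq0 opprD addrA subrr sub0r oppr_eq0 => /eqP.
Qed.

Lemma schwartzZ (c : R) f : schwartz f -> schwartz (fun y => c * f y).
Proof.
move=> sf; have := schwartz_linE c sf schwartz_cst0.
by rewrite (_ : (fun y => _ + 0) = fun y => c * f y)//; apply/funext => y; rewrite addr0.
Qed.

Lemma schwartzD f g : schwartz f -> schwartz g -> schwartz (fun y => f y + g y).
Proof.
move=> sf sg; have := schwartz_linE 1 sf sg.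
by rewrite (_ : (fun y => 1 * f y + g y) = fun y => f y + g y)//; apply/funext => y; rewrite mul1r.
Qed.

Lemma schwartzB f g : schwartz f -> schwartz g -> schwartz (fun y => f y - g y).
Proof.
move=> sf /(schwartzZ (-1)) sg; have := schwartzD sf sg.
by rewrite (_ : (fun y => f y + -1 * g y) = fun y => f y - g y)//; apply/funext => y; rewrite mulN1r.
Qed.

Lemma tdistZ u (c : R) f : schwartz f -> u (fun y => c * f y) = c * u f.
Proof.
move=> sf; have := tdist_lin u c sf schwartz_cst0; rewrite tdist0 addr0 => <-.
by congr (tdist_val u); apply/funext => y; rewrite addr0.
Qed.

Lemma tdistD u f g : schwartz f -> schwartz g -> u (fun y => f y + g y) = u f + u g.
Proof.
move=> sf sg; have := tdist_lin u 1 sf sg; rewrite mul1r => <-.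
by congr (tdist_val u); apply/funext => y; rewrite mul1r.
Qed.

Lemma tdistB u f g : schwartz f -> schwartz g -> u (fun y => f y - g y) = u f - u g.
Proof.
move=> sf sg; have := tdist_lin u (-1) sg sf; rewrite mulN1r addrC => <-.
by congr (tdist_val u); apply/funext => y; rewrite mulN1r addrC.
Qed.

Definition seminorm_le M f (B : R) :=
  forall s y, (size s <= M)%N -> wt y ^+ M * `|partials s f y| <= B.

Lemma schwartz_seminorm_le M f : schwartz f -> exists2 B, 0 <= B & seminorm_le M f B.
Proof.
move=> sf; exists (fine (schwartz_seminorm M f)).
  by rewrite fine_ge0// seminorm_ge0.
by move=> s y sM; exact: schwartz_seminormE.
Qed.

Lemma tdist_bound u : exists (C : R) M, 0 <= C /\
  forall f (B : R), schwartz f -> seminorm_le M f B -> `|u f| <= C * B.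
Proof.
have [_ [C [M h]] _] := tdist_tempered' u.
exists `|C|, M; split=> // f B sf fB; rewrite -lee_fin.
apply: (le_trans (h f sf)); rewrite EFinM.
have sB : (schwartz_seminorm M f <= B%:E)%E.
  by apply: ge_ereal_sup => _ [s [y [sM ->]]]; rewrite lee_fin; exact: fB.
apply: (@le_trans _ _ (`|C|%:E * schwartz_seminorm M f)%E).
  by rewrite lee_wpmul2r ?seminorm_ge0// lee_fin ler_norm.
by rewrite lee_wpmul2l// lee_fin.
Qed.

Lemma partials_linE s (c : R) f g : smooth f -> smooth g ->
  partials s (fun y => c * f y + g y) = fun y => c * partials s f y + partials s g y.
Proof. exact: partials_lin. Qed.

Variables (u : tdist R) (N : E -> R).
Hypothesis sN : schwartz N.

Definition tau x y : R := N (y - x).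

Lemma tau_schwartz x : schwartz (tau x).
Proof. exact: schwartz_translate. Qed.

Definition tdist_tau x : R := u (tau x).

Section Bounds.
Variables (C B0 B1 K : R) (M : nat).
Hypotheses (C0 : 0 <= C) (B00 : 0 <= B0) (B10 : 0 <= B1) (K0 : 0 <= K).
Hypothesis uC : forall f (B : R), schwartz f -> seminorm_le M f B -> `|u f| <= C * B.
Hypotheses (hB0 : seminorm_le M N B0) (hB1 : seminorm_le M.+1 N B1).
Hypothesis KE : K = 3 * 2 ^+ M * B1.

(** Mean value theorem for translations of [N]. The constant [K] collects the factor 3 of
    [mean_value], a factor 2^M because the weight varies by at most a factor 2 within distance 1,
    and [B1], a seminorm with one more derivative. *)
Let tau_lip s x z y : (size s <= M)%N -> enorm (x - z) <= 1 ->
  wt y ^+ M * `|partials s N (y - x) - partials s N (y - z)| <=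
  K * enorm (x - z) * wt x ^+ M.
Proof.
move=> sM xz; have ss := schwartz_partials s sN.
have h : `|partials s N (y - z) - partials s N (y - x)| <=
    3 * (B1 * 2 ^+ M * wt (y - x) ^- M) * enorm (x - z).
  have -> : y - z = (y - x) + (x - z) by rewrite addrA subrK.
  apply: mean_value; first by move=> i p; exact: smooth_derivable ss.1.
  move=> i p hp; have hi : wt p ^+ M.+1 * `|partials (i :: s) N p| <= B1.
    by apply: hB1.
  have {}hi : wt p ^+ M * `|partial i (partials s N) p| <= B1.
    apply: le_trans hi; rewrite ler_wpM2r// exprS ler_peMl ?exprn_ge0//.
  have w2 : wt (y - x) <= 2 * wt p.
    have := wtD (y - x - p) p; rewrite subrK => /le_trans; apply.
    rewrite ler_wpM2r// /wt -(enormN (y - x - p)) opprB.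
    rewrite -[leRHS]/(1 + 1) lerD2l; exact: le_trans hp xz.
  rewrite ler_pdivlMr ?exprn_gt0//.
  apply: (@le_trans _ _ (`|partial i (partials s N) p| * (2 * wt p) ^+ M)).
    by rewrite ler_wpM2l// lerXn2r// nnegrE// mulr_ge0.
  by rewrite exprMn mulrCA mulrC ler_wpM2r ?exprn_ge0// mulrC.
rewrite distrC; apply: (le_trans (ler_wpM2l (exprn_ge0 M (wt_ge0 y)) h)).
apply: (@le_trans _ _ ((wt (y - x) ^+ M * wt x ^+ M) * (3 * (B1 * 2 ^+ M * wt (y - x) ^- M) * enorm (x - z)))).
  rewrite ler_wpM2r ?wtX_peetre// !mulr_ge0// ?exprn_ge0// invr_ge0 exprn_ge0//.
rewrite KE le_eqVlt; apply/orP; left; apply/eqP; field.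
by rewrite gt_eqF// exprn_gt0.
Qed.

Lemma growth x : `|tdist_tau x| <= C * B0 * wt x ^+ M.
Proof.
rewrite -mulrA; apply: uC; first exact: tau_schwartz.
move=> s y sM; rewrite /tau partials_translate; last exact: sN.1.
apply: (@le_trans _ _ (wt (y - x) ^+ M * wt x ^+ M * `|partials s N (y - x)|)).
  by rewrite ler_wpM2r// wtX_peetre.
by rewrite mulrAC ler_wpM2r ?exprn_ge0// hB0.
Qed.

Let tdist_tau_lip x z : enorm (x - z) <= 1 ->
  `|tdist_tau x - tdist_tau z| <= C * K * enorm (x - z) * wt x ^+ M.
Proof.
move=> xz; rewrite /tdist_tau -tdistB; [|exact: tau_schwartz|exact: tau_schwartz].
rewrite -2!mulrA; apply: uC; first by apply: schwartzB; exact: tau_schwartz.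
move=> s y sM; rewrite (_ : (fun y => _) = fun y => -1 * tau z y + tau x y); last first.
  by apply/funext => t; rewrite mulN1r addrC.
rewrite partials_linE; [|exact: (tau_schwartz z).1|exact: (tau_schwartz x).1].
rewrite /tau !partials_translate; [|exact: sN.1|exact: sN.1].
by rewrite mulN1r addrC mulrA; exact: tau_lip.
Qed.

Lemma continuous_tdist_tau_bnd : continuous tdist_tau.
Proof.
move=> x; apply/cvgrPdist_lt => e e0.
pose L := 1 + C * K * wt x ^+ M.
have L0 : 0 < L by rewrite ltr_pwDl// !mulr_ge0// exprn_ge0.
pose d := Num.min 1 (e / L) / 3.
have d0 : 0 < d by rewrite divr_gt0// lt_min ltr01 divr_gt0.
have hb := @nbhsx_ballx R E x _ d0.
apply: filterS hb => y; rewrite -ball_normE /= => xy.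
have h3 : enorm (x - y) < Num.min 1 (e / L).
  by rewrite (le_lt_trans (enorm_le_max _))// mulrC -ltr_pdivlMr.
move: h3; rewrite lt_min => /andP[h1 h2].
rewrite (le_lt_trans (tdist_tau_lip (ltW h1)))//.
rewrite mulrAC (le_lt_trans _ (_ : L * enorm (x - y) < e))//.
  by rewrite ler_wpM2r// /L lerDr.
by rewrite mulrC -ltr_pdivlMr.
Qed.

Lemma measurable_tdist_tau_bnd : measurable3 tdist_tau.
Proof. exact: continuous_measurable3 continuous_tdist_tau_bnd. Qed.

Lemma rapid_tdist_tau_bnd a : rapid a -> rapid (fun x => tdist_tau x * a x).
Proof.
move=> ra; apply: rapidM => //; first exact: measurable_tdist_tau_bnd.
by exists M, (C * B0); exact: growth.
Qed.

(* [err] is additive, and bounded by the diameter of the support of [a] times a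
   weighted L^1 norm; cutting the support into small cubes shows that it is 0. *)
Let err a := u (sconv N a) - \int[mu]_x (tdist_tau x * a x).

Let W a := \int[mu]_x (wt x ^+ M * `|a x|).

Let iW a : rapid a -> integ (fun x => wt x ^+ M * `|a x|).
Proof. by move=> ra; apply: rapid_integ; apply: rapid_wtM; exact: rapid_norm. Qed.

Let errD a b : rapid a -> rapid b -> err (fun x => a x + b x) = err a + err b.
Proof.
move=> ra rb; rewrite /err.
have -> : sconv N (fun x => a x + b x) = fun y => sconv N a y + sconv N b y.
  apply/funext => y; rewrite /sconv -RintD; last 2 first.
  - by apply: sconv_integ; [exact: schwartz_rapid|exact: rapid_integ].
  - by apply: sconv_integ; [exact: schwartz_rapid|exact: rapid_integ].
  by apply: Rint_eq => x; rewrite mulrDr.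
rewrite tdistD; [|exact: sconv_schwartz|exact: sconv_schwartz].
have -> : \int[mu]_x (tdist_tau x * (a x + b x)) =
    \int[mu]_x (tdist_tau x * a x) + \int[mu]_x (tdist_tau x * b x).
  rewrite -RintD; last 2 first.
  - by apply: rapid_integ; exact: rapid_tdist_tau_bnd.
  - by apply: rapid_integ; exact: rapid_tdist_tau_bnd.
  by apply: Rint_eq => x; rewrite mulrDr.
ring.
Qed.

Let err_le a : rapid a -> `|err a| <= 2 * (C * B0) * W a.
Proof.
move=> ra; rewrite /err (le_trans (ler_normB _ _))//.
rewrite (_ : 2 * (C * B0) * W a = C * (B0 * W a) + C * B0 * W a); last by ring.
apply: lerD.
  apply: uC; first exact: sconv_schwartz.
  move=> s y sM; rewrite partials_sconv//; last exact: rapid_integ.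
  apply: sconv_bound => //; first by apply: schwartz_rapid; exact: schwartz_partials.
  by move=> x; exact: hB0.
rewrite /W -RintZ; last exact: iW.
apply: Rint_norm_le.
- by apply: rapid_integ; exact: rapid_tdist_tau_bnd.
- by apply: rintegrableZ; exact: iW.
- by move=> x; rewrite normrM mulrA ler_wpM2r// growth.
Qed.

(** If a lives within h of z, both terms of [err a] are close to [tdist_tau z] times the integral of
    a. What is left in each of them is an increment of the translated kernel, of size h. *)
Let err_local a z (h : R) : rapid a -> 0 <= h -> h <= 1 ->
  (forall x, a x != 0 -> enorm (x - z) <= h) -> `|err a| <= 2 * (C * K) * h * W a.
Proof.
move=> ra h0 h1 supp; have ai := rapid_integ ra.
pose c := \int[mu]_x a x.
have itau : integ (fun x => tdist_tau x * a x) by apply: rapid_integ; exact: rapid_tdist_tau_bnd.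
have -> : err a = u (fun y => sconv N a y - c * tau z y) -
    \int[mu]_x ((tdist_tau x - tdist_tau z) * a x).
  rewrite tdistB; [|exact: sconv_schwartz|by apply: schwartzZ; exact: tau_schwartz].
  rewrite tdistZ; last exact: tau_schwartz.
  have -> : \int[mu]_x ((tdist_tau x - tdist_tau z) * a x) =
      \int[mu]_x (tdist_tau x * a x) - tdist_tau z * c.
    rewrite /c -RintZ// -RintB//; last exact: rintegrableZ.
    by apply: Rint_eq => x; rewrite mulrBl.
  by rewrite /err /tdist_tau; ring.
rewrite (le_trans (ler_normB _ _))//.
rewrite (_ : 2 * (C * K) * h * W a = C * (K * h * W a) + C * K * h * W a); last by ring.
apply: lerD.
  apply: uC.
    by apply: schwartzB; [exact: sconv_schwartz|apply: schwartzZ; exact: tau_schwartz].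
  move=> s y sM; rewrite (_ : (fun y => _) = fun y => - c * tau z y + sconv N a y); last first.
    by apply/funext => t; rewrite mulNr addrC.
  rewrite partials_linE; [|exact: (tau_schwartz z).1|exact: (sconv_schwartz sN ra).1].
  rewrite partials_sconv// /tau partials_translate; last exact: sN.1.
  have ss := schwartz_rapid (schwartz_partials s sN).
  have is1 := sconv_integ y ss ai.
  have -> : - c * partials s N (y - z) + sconv (partials s N) a y =
      \int[mu]_x ((partials s N (y - x) - partials s N (y - z)) * a x).
    rewrite addrC mulNr mulrC /c -RintZ// -RintB//; last exact: rintegrableZ.
    by apply: Rint_eq => x; rewrite mulrBl.
  have is2 : integ (fun x => (partials s N (y - x) - partials s N (y - z)) * a x).
    by apply: (eq_integ _ (rintegrableB is1 (rintegrableZ (partials s N (y - z)) ai))) => x; rewrite mulrBl.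
  rewrite -(ger0_norm (exprn_ge0 M (wt_ge0 y))) -normrM -RintZ// /W -RintZ; last exact: iW.
  apply: Rint_norm_le; [exact: rintegrableZ|by apply: rintegrableZ; exact: iW|].
  move=> x; have [->|ax] := eqVneq (a x) 0; first by rewrite !mulr0 normr0 !mulr0.
  have hx := supp x ax.
  rewrite !normrM (ger0_norm (exprn_ge0 M (wt_ge0 y))) !mulrA ler_wpM2r//.
  apply: (le_trans (tau_lip _ sM (le_trans hx h1))).
  by rewrite ler_wpM2r ?exprn_ge0// ler_wpM2l.
rewrite /W -RintZ; last exact: iW.
apply: Rint_norm_le.
- apply: (eq_integ _ (rintegrableB itau (rintegrableZ (tdist_tau z) ai))) => x.
  by rewrite mulrBl.
- by apply: rintegrableZ; exact: iW.
- move=> x; have [->|ax] := eqVneq (a x) 0; first by rewrite !mulr0 normr0 !mulr0.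
  have hx := supp x ax.
  rewrite normrM mulrA ler_wpM2r//.
  apply: (le_trans (tdist_tau_lip (le_trans hx h1))).
  by rewrite ler_wpM2r ?exprn_ge0// ler_wpM2l// mulr_ge0.
Qed.

Let cut (p : E -> R) (t : R) a x : R := if p x < t then a x else 0.
Let cutC (p : E -> R) (t : R) a x : R := if p x < t then 0 else a x.

Let rapid_cut p t a : measurable3 p -> rapid a -> rapid (cut p t a) /\ rapid (cutC p t a).
Proof.
move=> mp ra.
have ms : measurable3 (fun x => (p x < t)%R%:R : R).
  rewrite (_ : (fun x => _) = \1_(p @^-1` `]-oo, t[)); last first.
    apply/funext => x; rewrite indicE; congr (_%:R : R); congr nat_of_bool.
    by apply/idP/idP => [h|]; [apply: mem_set; rewrite /= in_itv|move/set_mem; rewrite /= in_itv].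
  apply: measurable3_indic; rewrite -[X in measurable X]setTI.
  by apply: mp => //; exact: measurable_itv.
split; split.
- have -> : cut p t a = fun x => (p x < t)%R%:R * a x.
    by apply/funext => x; rewrite /cut; case: ifP => _; rewrite ?mul1r ?mul0r.
  exact: measurable3M ms ra.1.
- move=> k; have [D hD] := rapid_ge0 k ra; exists D => x.
  by rewrite /cut; case: ifP => _ //; rewrite normr0 mulr0.
- have -> : cutC p t a = fun x => (1 - (p x < t)%R%:R) * a x.
    by apply/funext => x; rewrite /cutC; case: ifP => _; rewrite ?subrr ?subr0 ?mul1r ?mul0r.
  exact: measurable3M (measurable3B (measurable3_cst 1) ms) ra.1.
- move=> k; have [D hD] := rapid_ge0 k ra; exists D => x.
  by rewrite /cutC; case: ifP => _ //; rewrite normr0 mulr0.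
Qed.

Let W_cut p t a : measurable3 p -> rapid a -> W a = W (cut p t a) + W (cutC p t a).
Proof.
move=> mp ra; have [r1 r2] := rapid_cut t mp ra.
rewrite /W -RintD; [|exact: iW|exact: iW].
by apply: Rint_eq => x; rewrite -mulrDr /cut /cutC; case: ifP => _; rewrite normr0 ?addr0 ?add0r.
Qed.

(** [err] and [W] are both additive over slabs, so a bound by a multiple of [W] passes from slabs of
    width h to slabs of width (n + 1) h. [Q] carries the constraints on the other coordinates; three
    uses cut a box into cubes. *)
Let err_slab (p : E -> R) (Q : E -> Prop) (h L : R) : measurable3 p ->
  (forall a t, rapid a -> (forall x, a x != 0 -> Q x /\ t <= p x < t + h) ->
     `|err a| <= L * W a) ->
  forall n a t, rapid a -> (forall x, a x != 0 -> Q x /\ t <= p x < t + n.+1%:R * h) ->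
     `|err a| <= L * W a.
Proof.
move=> mp H; elim=> [|n IHn] a t ra sa.
  by apply: (H a t) => // x /sa; rewrite mul1r.
have [r1 r2] := rapid_cut (t + n.+1%:R * h) mp ra.
have -> : err a = err (cut p (t + n.+1%:R * h) a) + err (cutC p (t + n.+1%:R * h) a).
  rewrite -errD//; congr err; apply/funext => x; rewrite /cut /cutC.
  by case: ifP => _; rewrite ?addr0 ?add0r.
rewrite (W_cut (t + n.+1%:R * h) mp ra) mulrDr (le_trans (ler_normD _ _))// lerD//.
  apply: (IHn _ t) => // x; rewrite /cut; case: ifPn; rewrite ?eqxx// => px ax.
  by have [Qx /andP[-> _]] := sa x ax; split => //; rewrite px.
apply: (H _ (t + n.+1%:R * h)) => // x; rewrite /cutC; case: ifPn; rewrite ?eqxx// -leNgt => px ax.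
have [Qx /andP[_ hx]] := sa x ax; split => //; rewrite px/=.
by apply: (lt_le_trans hx); rewrite -addrA lerD2l -[X in _ + X]mul1r -mulrDl natr1.
Qed.

Let err_box a (r : R) : rapid a -> 0 < r ->
  (forall x, a x != 0 -> enorm x < r) -> err a = 0.
Proof.
move=> ra r0 sa; apply/eqP; rewrite -normr_le0.
(* Cubes of side h = 2 r / (n + 1) lie within 3 h of a corner, and [err_local] asks for 3 h <= 1,
   which is 6 r <= n + 1. *)
have small n : 6 * r <= n.+1%:R -> `|err a| <= (2 * (C * K) * W a * (6 * r)) / n.+1%:R.
  move=> nr; pose h := 2 * r / n.+1%:R.
  have h0 : 0 < h by rewrite divr_gt0// mulr_gt0.
  have h1 : 3 * h <= 1.
    by rewrite /h mulrA ler_pdivrMr// mul1r; move: nr; lra.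
  have nh : n.+1%:R * h = 2 * r by rewrite /h mulrC divfK.
  pose L := 2 * (C * K) * (3 * h).
  have step3 : forall b t1 t2 t3, rapid b ->
      (forall x, b x != 0 -> ((t1 <= x.1.1 < t1 + h) /\ (t2 <= x.1.2 < t2 + h)) /\ (t3 <= x.2 < t3 + h)) ->
      `|err b| <= L * W b.
    move=> b t1 t2 t3 rb sb; apply: (err_local (z := ((t1, t2), t3))) => //.
      by rewrite mulr_ge0// ltW.
    move=> x /sb[[/andP[a1 a2] /andP[b1 b2]] /andP[c1 c2]].
    apply: (le_trans (enorm_le_sum _)) => /=.
    rewrite !ger0_norm ?subr_ge0//; move: a2 b2 c2; lra.
  have step2 : forall b t1 t2, rapid b ->
      (forall x, b x != 0 -> ((t1 <= x.1.1 < t1 + h) /\ (t2 <= x.1.2 < t2 + h)) /\ (- r <= x.2 < - r + 2 * r)) ->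
      `|err b| <= L * W b.
    move=> b t1 t2 rb sb; rewrite -nh in sb.
    apply: (@err_slab (fun x => x.2) (fun x => (t1 <= x.1.1 < t1 + h) /\ (t2 <= x.1.2 < t2 + h)) h L (@measurable3_coord3 R) _ n b (- r)) => //.
    by move=> b' t rb' sb'; exact: (step3 b' t1 t2 t).
  have step1 : forall b t1, rapid b ->
      (forall x, b x != 0 -> ((t1 <= x.1.1 < t1 + h) /\ (- r <= x.2 < - r + 2 * r)) /\ (- r <= x.1.2 < - r + 2 * r)) ->
      `|err b| <= L * W b.
    move=> b t1 rb sb; rewrite -{2}nh in sb.
    apply: (@err_slab (fun x => x.1.2) (fun x => (t1 <= x.1.1 < t1 + h) /\ (- r <= x.2 < - r + 2 * r)) h L (@measurable3_coord2 R) _ n b (- r)) => //.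
    move=> b' t rb' sb'; apply: (step2 b' t1 t) => // x /sb'[[? ?] ?].
    by split.
  have step0 : forall b, rapid b ->
      (forall x, b x != 0 -> ((- r <= x.1.2 < - r + 2 * r) /\ (- r <= x.2 < - r + 2 * r)) /\ (- r <= x.1.1 < - r + 2 * r)) ->
      `|err b| <= L * W b.
    move=> b rb sb; rewrite -{3}nh in sb.
    apply: (@err_slab (fun x => x.1.1) (fun x => (- r <= x.1.2 < - r + 2 * r) /\ (- r <= x.2 < - r + 2 * r)) h L (@measurable3_coord1 R) _ n b (- r)) => //.
    move=> b' t rb' sb'; apply: (step1 b' t) => // x /sb'[[? ?] ?].
    by split.
  have := step0 a ra _; rewrite /L /h => /(_ _) H.
  apply: (le_trans (H _)).
    move=> x /sa xr.
    have c (t : R) : `|t| <= enorm x -> - r <= t < - r + 2 * r.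
      by move=> /le_lt_trans/(_ xr); rewrite ltr_norml => /andP[? ?]; apply/andP; split; lra.
    by split; [split|]; apply: c; [exact: le_coord2|exact: le_coord3|exact: le_coord1].
  by rewrite le_eqVlt; apply/orP; left; apply/eqP; field.
pose Z := 2 * (C * K) * W a * (6 * r).
have lim : (fun n => Z / n.+1%:R) @ \oo --> (0 : R).
  by rewrite -(mulr0 Z); apply: cvgM; [exact: cvg_cst|exact: cvg_harmonic].
apply: (ler_cvg_to (cvg_cst `|err a|) lim).
near=> n; apply: small.
apply: (@le_trans _ _ n%:R); last by rewrite ler_nat.
by near: n; exact: nbhs_infty_ger.
Unshelve. all: end_near. Qed.

(** The part of a in the ball of radius n + 1 has no error by [err_box]. Outside that ball, one
    spare power of the weight makes [W] of order 1 / (n + 1). *)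
Lemma dist_fubini_bnd a : rapid a -> u (sconv N a) = \int[mu]_x (tdist_tau x * a x).
Proof.
move=> ra; apply/eqP; rewrite -subr_eq0 -normr_le0 -/(err a).
have me : measurable3 (@enorm R) by apply: continuous_measurable3; exact: continuous_enorm.
pose T := \int[mu]_x (wt x ^+ M.+1 * `|a x|).
have iT : integ (fun x => wt x ^+ M.+1 * `|a x|).
  by apply: rapid_integ; apply: rapid_wtM; exact: rapid_norm.
have bd n : `|err a| <= 2 * (C * B0) * T / n.+1%:R.
  have [r1 r2] := rapid_cut n.+1%:R me ra.
  have -> : err a = err (cutC (@enorm R) n.+1%:R a).
    rewrite (_ : err a = err (cut (@enorm R) n.+1%:R a) + err (cutC (@enorm R) n.+1%:R a)).
      rewrite (err_box (r := n.+1%:R)) ?add0r// => x.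
      by rewrite /cut; case: ifP; rewrite ?eqxx.
    rewrite -errD//; congr err; apply/funext => x; rewrite /cut /cutC.
    by case: ifP => _; rewrite ?addr0 ?add0r.
  apply: (le_trans (err_le r2)).
  rewrite -[leRHS]mulrA; apply: ler_wpM2l; first by rewrite !mulr_ge0.
  rewrite ler_pdivlMr// mulrC /W -RintZ; last exact: iW.
  apply: Rint_le => //; first by apply: rintegrableZ; exact: iW.
  move=> x; rewrite /cutC; case: ifPn; first by rewrite normr0 !mulr0 mulr_ge0// exprn_ge0.
  rewrite -leNgt => nx; rewrite exprS mulrA ler_wpM2r// ler_wpM2r ?exprn_ge0//.
  by rewrite (le_trans nx)// lerDr.
have lim : (fun n => 2 * (C * B0) * T / n.+1%:R) @ \oo --> (0 : R).
  by rewrite -(mulr0 (2 * (C * B0) * T)); apply: cvgM; [exact: cvg_cst|exact: cvg_harmonic].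
apply: (ler_cvg_to (cvg_cst `|err a|) lim).
by apply: nearW.
Qed.

End Bounds.

Lemma tau_bounds : exists (C B0 B1 K : R) M, [/\ 0 <= C, 0 <= B0, 0 <= B1, 0 <= K &
  [/\ forall f (B : R), schwartz f -> seminorm_le M f B -> `|u f| <= C * B,
      seminorm_le M N B0, seminorm_le M.+1 N B1 & K = 3 * 2 ^+ M * B1]].
Proof.
have [C [M [C0 uC]]] := tdist_bound u.
have [B0 B00 h0] := schwartz_seminorm_le M sN.
have [B1 B10 h1] := schwartz_seminorm_le M.+1 sN.
exists C, B0, B1, (3 * 2 ^+ M * B1), M; split=> //.
by rewrite !mulr_ge0// exprn_ge0.
Qed.

Lemma measurable_tdist_tau : measurable3 tdist_tau.
Proof.
have [C [B0 [B1 [K [M [C0 B00 B10 K0 [uC h0 h1 KE]]]]]]] := tau_bounds.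
exact: (@measurable_tdist_tau_bnd C B1 K M).
Qed.

Lemma rapid_tdist_tau a : rapid a -> rapid (fun x => tdist_tau x * a x).
Proof.
have [C [B0 [B1 [K [M [C0 B00 B10 K0 [uC h0 h1 KE]]]]]]] := tau_bounds.
exact: (@rapid_tdist_tau_bnd C B0 B1 K M).
Qed.

(** The distribution passes under the integral that defines the convolution. Through this,
    multipliers become functions that can be paired, composed and differentiated on the side of the
    kernel. *)
Lemma dist_fubini a : rapid a -> u (sconv N a) = \int[mu]_x (tdist_tau x * a x).
Proof.
have [C [B0 [B1 [K [M [C0 B00 B10 K0 [uC h0 h1 KE]]]]]]] := tau_bounds.
exact: (@dist_fubini_bnd C B0 B1 K M).
Qed.

End DistributionFubini.

(** * Fourier multipliers *)

Section SumZ.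
Variable R : realType.
Implicit Types (a b : int -> R) (l B : R).

Lemma sumZ_unique a l l' : sumZ a l -> sumZ a l' -> l = l'.
Proof.
move=> [l1 [l2 [h1 h2 ->]]] [k1 [k2 [g1 g2 ->]]].
by rewrite (cvg_unique (@Rhausdorff R) h1 g1) (cvg_unique (@Rhausdorff R) h2 g2).
Qed.

Lemma sumZ_lin (c : R) a b l l' : sumZ a l -> sumZ b l' ->
  sumZ (fun j => c * a j + b j) (c * l + l').
Proof.
move=> [l1 [l2 [h1 h2 ->]]] [k1 [k2 [g1 g2 ->]]].
have E (f g : nat -> R) : series (fun n => c * f n + g n) = fun n => c * series f n + series g n.
  by apply/funext => n; rewrite /series /= big_split /= mulr_sumr.
exists (c * l1 + k1), (c * l2 + k2); split; last by ring.
- by rewrite (E (fun n => a (Posz n)) (fun n => b (Posz n))); apply: cvgD => //; apply: cvgM => //; exact: cvg_cst.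
- by rewrite (E (fun n => a (Negz n)) (fun n => b (Negz n))); apply: cvgD => //; apply: cvgM => //; exact: cvg_cst.
Qed.

Lemma sumZ_ext a b l : a =1 b -> sumZ a l -> sumZ b l.
Proof. by move=> /funext ->. Qed.

Lemma sumZ0 : sumZ (fun=> 0 : R) 0.
Proof.
exists 0, 0; split; last by rewrite addr0.
- rewrite (_ : series _ = cst 0); first exact: cvg_cst.
  by apply/funext => n; rewrite /series /= big1.
- rewrite (_ : series _ = cst 0); first exact: cvg_cst.
  by apply/funext => n; rewrite /series /= big1.
Qed.

Lemma sumZD a b l l' : sumZ a l -> sumZ b l' -> sumZ (fun j => a j + b j) (l + l').
Proof.
move=> h g; have := sumZ_lin 1 h g; rewrite mul1r; apply: sumZ_ext => j.
by rewrite mul1r.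
Qed.

Lemma sumZZ (c : R) a l : sumZ a l -> sumZ (fun j => c * a j) (c * l).
Proof.
move=> h; have := sumZ_lin c h sumZ0; rewrite addr0; apply: sumZ_ext => j.
by rewrite addr0.
Qed.

Lemma cvg_series_single (k : nat) (c : R) :
  series (fun n => if n == k then c else 0) @ \oo --> c.
Proof.
apply: (@cvg_near_cst _ (R : topologicalType)).
exists k.+1 => // n /= kn; rewrite /series /= (big_rem k) /=; last by rewrite mem_index_iota.
rewrite eqxx big1_seq ?addr0// => i /andP[_].
by rewrite mem_rem_uniq ?iota_uniq// inE => /andP[/negPf ->].
Qed.

Lemma cvg_series0 : series (fun _ : nat => 0 : R) @ \oo --> (0 : R).
Proof.
rewrite (_ : series _ = cst 0); first exact: cvg_cst.
by apply/funext => n; rewrite /series /= big1.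
Qed.

Lemma sumZ_single (j : int) (c : R) : sumZ (fun i => if i == j then c else 0) c.
Proof.
case: j => k.
  exists c, 0; split; [exact: cvg_series_single|exact: cvg_series0|by rewrite addr0].
exists 0, c; split; [exact: cvg_series0| |by rewrite add0r].
have -> : (fun n : nat => if Negz n == Negz k then c else 0) = fun n => if n == k then c else 0 by [].
exact: cvg_series_single.
Qed.

Lemma sumZ_fin a (s : seq int) : uniq s -> (forall i, i \notin s -> a i = 0) ->
  sumZ a (\sum_(i <- s) a i).
Proof.
elim: s a => [|j s IHs] a /=.
  by move=> _ h; rewrite big_nil; apply: sumZ_ext sumZ0 => i; rewrite h.
move=> /andP[js us] h; pose b i := if i == j then 0 else a i.
have hb : sumZ b (\sum_(i <- s) b i).
  by apply: IHs => // i is'; rewrite /b; case: eqVneq => // ij; apply: h; rewrite inE negb_or ij.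
have := sumZD (sumZ_single j (a j)) hb.
rewrite big_cons (_ : \sum_(i <- s) b i = \sum_(i <- s) a i); last first.
  apply: eq_big_seq => i is'; rewrite /b; case: eqVneq => // ij.
  by rewrite -ij is' in js.
by apply: sumZ_ext => i; rewrite /b; case: eqVneq => [->|_]; rewrite ?addr0 ?add0r.
Qed.

Lemma series_abs_cvg (f : nat -> R) (B : R) : (forall n, \sum_(i < n) `|f i| <= B) ->
  exists2 l : R, series f @ \oo --> l & `|l| <= B.
Proof.
move=> h.
have hs n : [normed series f] n = \sum_(i < n) `|f i|.
  by rewrite -(big_mkord xpredT (fun i => `|f i|)).
have hn : cvgn [normed series f].
  apply: nondecreasing_is_cvgn.
    move=> m n mn; rewrite !hs -!(big_mkord xpredT (fun i => `|f i|)).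
    by rewrite (big_cat_nat _ mn)//= lerDl sumr_ge0.
  by exists B => _ [n _ <-]; rewrite hs.
have hc := normed_cvg hn.
exists (limn (series f)) => //.
have hl : (fun n => `|series f n|) @ \oo --> `|limn (series f)| by exact: cvg_norm.
apply: (ler_cvg_to hl (cvg_cst B)); apply: nearW => n.
rewrite /series /= big_mkord (le_trans (ler_norm_sum _ _ _))//.
Qed.

Lemma sumZ_abs a B : (forall n, \sum_(i < n) (`|a (Posz i)| + `|a (Negz i)|) <= B) ->
  exists2 l, sumZ a l & `|l| <= B + B.
Proof.
move=> h.
have h1 (n : nat) : \sum_(i < n) `|(fun k => a (Posz k)) i| <= B.
  by apply: le_trans (h n); apply: ler_sum => i _; rewrite lerDl.
have h2 (n : nat) : \sum_(i < n) `|(fun k => a (Negz k)) i| <= B.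
  by apply: le_trans (h n); apply: ler_sum => i _; rewrite lerDr.
have [l1 c1 b1] := @series_abs_cvg (fun k => a (Posz k)) B h1; have [l2 c2 b2] := @series_abs_cvg (fun k => a (Negz k)) B h2.
exists (l1 + l2); first by exists l1, l2.
by rewrite (le_trans (ler_normD _ _))// lerD.
Qed.

(** [Negz i] is -(i + 1), so these are the sums over the indices from -n to n - 1. *)
Definition wsum (V : nmodType) (a : int -> V) n := \sum_(i < n) (a (Posz i) + a (Negz i)).

Lemma sumZ_wsum a l : sumZ a l -> wsum a n @[n --> \oo] --> l.
Proof.
move=> [l1 [l2 [h1 h2 ->]]].
rewrite (_ : wsum a = fun n => series (fun n => a (Posz n)) n + series (fun n => a (Negz n)) n).
  exact: cvgD.
by apply/funext => n; rewrite /wsum big_split /series /= !big_mkord.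
Qed.

End SumZ.

(** * Smoothness of symbols divided by the square of the frequency *)

Section InverseSquare.
Variable R : realType.
Local Notation E := (R3 R).
Implicit Types (f g m : E -> R) (x y : E).

Lemma near_line_lt x i (r : R) : enorm x < r ->
  \forall s \near (0 : R), enorm (x + s *: basis R i) < r.
Proof.
move=> xr; apply/nbhs_ballP; exists (r - enorm x) => /=; first by rewrite subr_gt0.
move=> s; rewrite /ball/= sub0r normrN => sl.
by rewrite (le_lt_trans (enormD _ _))// enormZ enorm_basis mulr1 addrC -ltrBrDr.
Qed.

Lemma partial_near0 i m (r : R) : (forall x, enorm x < r -> m x = 0) ->
  forall x, enorm x < r -> is_derive x (basis R i) m 0.
Proof.
move=> h x xr; apply/is_derive_line0.
apply: (near_eq_is_derive (f := cst (0 : R))) => //.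
by apply: filterS (near_line_lt i xr) => s hs /=; rewrite h.
Qed.

Lemma is_derive_invX k (t : R) : t != 0 ->
  is_derive t (1 : R) (fun s : R => s ^- k) (- k%:R * t ^- k.+1).
Proof.
move=> t0; have hX := @is_deriveX R R id k t 1 1 (is_derive_id _ _).
have tk : t ^+ k != 0 by rewrite expf_neq0.
have := @is_deriveV R (id ^+ k) t _ 1 _ hX.
have E1 (s : R) : ((id : R -> R) ^+ k) s = s ^+ k by elim: k {hX tk} => [|k IH] //; rewrite !exprS -IH.
rewrite E1 => /(_ tk); under eq_fun do rewrite E1.
congr is_derive; rewrite /GRing.scale /= mulr1.
case: k tk {hX E1} => [|k] tk; first by rewrite mulr0n mul0r mulr0 oppr0 mul0r.
rewrite /= !mulNr; congr (- _).
rewrite mulrCA; congr (_ * _).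
apply: (@mulIf _ (t ^+ k.+2)); first by rewrite expf_neq0.
rewrite [RHS]mulVf ?expf_neq0// -mulrA -exprD -exprM.
by rewrite (_ : (k + k.+2 = k.+1 * 2)%N) ?mulVf ?expf_neq0//; lia.
Qed.

(** A class stable under derivatives: differentiation raises the power of |x|^2 by one and keeps a
    smooth numerator that vanishes near the origin, where the quotient would be singular. *)
Inductive inv_pow : set (E -> R) := InvPow f k (r : R) of smooth f & 0 < r &
  (forall x, enorm x < r -> f x = 0) : inv_pow (fun x => f x * (dot x x) ^- k).

Lemma is_derive_sqr x i : is_derive x (basis R i) (fun y : E => dot y y) (2 * coord x i).
Proof.
have c1 := is_derive_coord1 x (basis R i); have c2 := is_derive_coord2 x (basis R i).
have c3 := is_derive_coord3 x (basis R i).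
have := is_derive_add (is_derive_add (is_derive_mul c1 c1) (is_derive_mul c2 c2)) (is_derive_mul c3 c3).
rewrite (_ : (fun y => _) = fun y : E => dot y y); last by apply/funext => y; rewrite dotE.
have <- : x.1.1 * (basis R i).1.1 + x.1.1 * (basis R i).1.1 + (x.1.2 * (basis R i).1.2 + x.1.2 * (basis R i).1.2) + (x.2 * (basis R i).2 + x.2 * (basis R i).2) = 2 * coord x i by rewrite coordE dotE; ring.
by [].
Qed.

Lemma inv_pow_derive f k (r : R) x i : smooth f -> 0 < r ->
  (forall x, enorm x < r -> f x = 0) ->
  is_derive x (basis R i) (fun x => f x * (dot x x) ^- k)
   ((dot x x * partial i f x - 2 * k%:R * coord x i * f x) * (dot x x) ^- k.+1).
Proof.
move=> sf r0 fr; have [xr|rx] := ltP (enorm x) r.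
  have p0 : partial i f x = 0 by apply: derive_val; exact: (partial_near0 i fr xr).
  rewrite p0 fr// !mulr0 subr0 mul0r.
  by apply: (@partial_near0 i _ r) => // y yr; rewrite fr// mul0r.
have q0 : dot x x != 0 by rewrite dotxx expf_neq0// gt_eqF// (lt_le_trans r0).
have h := is_derive_mul (smooth_is_derive i x sf) (@is_derive_chain R (fun s => s ^- k) (fun y : E => dot y y) x _ _ _ (is_derive_invX k q0) (is_derive_sqr x i)).
rewrite (_ : _ * _ ^- k.+1 = f x * (- k%:R * dot x x ^- k.+1 * (2 * coord x i)) + dot x x ^- k * partial i f x)//.
rewrite (exprS _ k); move: (expf_neq0 k q0) => qk; field.
by rewrite qk q0.
Qed.

Lemma smooth_inv_pow f : inv_pow f -> smooth f.
Proof.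
apply: smooth_class.
- move=> _ [g k r sg r0 gr] x; have [xr|rx] := ltP (enorm x) r.
    have hn : \forall y \near x, enorm y < r.
      have := @continuous_enorm R x; move/cvgrPdist_lt => /(_ (r - enorm x)).
      rewrite subr_gt0 => /(_ xr); apply: filterS => y hy.
      by move: hy; rewrite distrC => /(le_lt_trans (ler_norm _)); rewrite ltrD2r.
    rewrite /continuous_at gr// mul0r; apply: (@cvg_near_cst _ (R : topologicalType)).
    by apply: filterS hn => y yr; rewrite gr// mul0r.
  have q0 : dot x x != 0 by rewrite dotxx expf_neq0// gt_eqF// (lt_le_trans r0).
  apply: cvgM; first exact: smooth_continuous.
  apply: (@cvgV _ _ (nbhs x) _ (fun y : E => dot y y ^+ k)); first by rewrite expf_neq0.
  apply: (@continuous_comp _ _ _ (fun y : E => dot y y) (fun t => t ^+ k)); last exact: exprn_continuous.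
  rewrite (_ : (fun y : E => dot y y) = fun y => enorm y * enorm y); last by apply/funext => y; rewrite dotxx expr2.
  by apply: cvgM; exact: continuous_enorm.
- by move=> _ [g k r sg r0 gr] i x; apply: ex_derive; exact: inv_pow_derive sg r0 gr.
- move=> _ [g k r sg r0 gr] i.
  rewrite (_ : partial i _ = fun x => (fun x => dot x x * partial i g x + (- (2 * k%:R)) * (coord x i * g x)) x * dot x x ^- k.+1); last first.
    apply/funext => x; apply: derive_val; have := inv_pow_derive k x i sg r0 gr.
    congr is_derive; congr (_ * _); rewrite mulNr mulrA.
    by [].
  apply: (@InvPow _ k.+1 r) => //.
    apply: smoothD; last by apply: smoothZ; apply: smoothM => //; exact: smooth_coord.
    apply: smoothM; last exact: smooth_partial.
    rewrite (_ : (fun x : E => dot x x) = fun x => coord x ord0 * coord x ord0 + coord x (inord 1) * coord x (inord 1) + coord x (inord 2) * coord x (inord 2)); last first.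
      by apply/funext => x; rewrite dotE /coord /= !inordK.
    by apply: smoothD; [apply: smoothD|]; apply: smoothM; exact: smooth_coord.
  move=> x xr; rewrite gr// (_ : partial i g x = 0); first by rewrite !mulr0 addr0.
  by apply: derive_val; exact: (partial_near0 i gr xr).
Qed.

Lemma testfun_inv_sqr m (r : R) : 0 < r -> testfun m -> (forall x, enorm x < r -> m x = 0) ->
  testfun (fun x => (enorm x ^+ 2)^-1 * m x).
Proof.
move=> r0 [sm [rho h]] mr; split; last by exists rho => x xr; rewrite h// mulr0.
rewrite (_ : (fun x => _) = fun x => m x * dot x x ^- 1).
  by apply: smooth_inv_pow; exact: (@InvPow _ 1 r).
by apply/funext => x; rewrite dotxx expr1 mulrC.
Qed.

End InverseSquare.

(** * Calculus of kernels and multipliers *)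

Section Kernel.
Variable R : realType.
Local Notation E := (R3 R).
Local Notation mu := (lebesgue3 R).
Implicit Types (f m n N a : E -> R) (x y z : E) (u : tdist R).

Definition symbol m := testfun m /\ even_fun m.

Definition ker m : E -> R := inv_fourier m.

Lemma kerE m x : ker m x = (2 * pi) ^- 3 * trig 0 m x.
Proof. by rewrite /ker /inv_fourier /trig; congr (_ * _); apply: Rint_eq => xi; rewrite addr0. Qed.

Lemma schwartz_ker m : testfun m -> schwartz (ker m).
Proof.
move=> tm; have := schwartzZ ((2 * pi) ^- 3) (trig_schwartz 0 tm).
by rewrite (_ : (fun y => _) = ker m)//; apply/funext => x; rewrite kerE.
Qed.

Lemma rapid_ker m : testfun m -> rapid (ker m).
Proof. by move=> tm; apply: schwartz_rapid; exact: schwartz_ker. Qed.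

Lemma even_ker m x : ker m (- x) = ker m x.
Proof. by rewrite !kerE trig_even. Qed.

Lemma ker_sub m x y : ker m (x - y) = ker m (y - x).
Proof. by rewrite -even_ker opprB. Qed.

Lemma twopi_neq0 : (2 * pi : R) != 0.
Proof. by rewrite mulf_neq0// gt_eqF// pi_gt0. Qed.

Lemma sconvC N a : rapid N -> rapid a -> sconv N a = sconv a N.
Proof.
move=> rN ra; apply/funext => y; rewrite /sconv.
have h := sconv_integ y ra (rapid_integ rN).
rewrite -(Rint_reflect y h); apply: Rint_eq => x.
by rewrite subKr mulrC.
Qed.

Lemma sconv_ker m n : symbol m -> testfun n ->
  sconv (ker m) (ker n) = ker (fun xi => m xi * n xi).
Proof.
move=> [tm em] tn; apply/funext => x; rewrite kerE.
have := trig_conv 0 x tm em tn => /(congr1 ( *%R ((2 * pi) ^- 6))) h.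
transitivity ((2 * pi) ^- 6 * \int[mu]_y (trig 0 m (x - y) * trig 0 n y)).
  rewrite -RintZ; last first.
    apply: sconv_integ; first by apply: schwartz_rapid; exact: trig_schwartz.
    exact: trig_integ.
  by apply: Rint_eq => y; rewrite !kerE mulrACA -invfM -exprD.
rewrite h mulrA; congr (_ * _).
by rewrite -[6%N]/(3 + 3)%N exprD invfM -mulrA mulVf ?mulr1// expf_neq0// twopi_neq0.
Qed.

Lemma partial_sconv i N a : schwartz N -> integ a ->
  partial i (sconv N a) = sconv (partial i N) a.
Proof. by move=> sN ai; exact: (partials_sconv [:: i] sN ai). Qed.

Lemma sconv_partial i N a : schwartz N -> schwartz a ->
  sconv (partial i N) a = sconv N (partial i a).
Proof.
move=> sN sa.
have rN := schwartz_rapid sN; have ra := schwartz_rapid sa.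
have rN' := schwartz_rapid (schwartz_partial i sN).
have ra' := schwartz_rapid (schwartz_partial i sa).
rewrite -partial_sconv//; last exact: rapid_integ.
rewrite (sconvC rN ra) (sconvC rN ra') partial_sconv//; exact: rapid_integ.
Qed.

Lemma multiplierE m u : multiplier m u = tdist_tau u (ker m).
Proof.
apply/funext => x; rewrite /multiplier /tdist_tau /tau; congr (tdist_val u).
by apply/funext => y; exact: ker_sub.
Qed.

Lemma measurable_multiplier m u : testfun m -> measurable3 (multiplier m u).
Proof. by move=> tm; rewrite multiplierE; apply: measurable_tdist_tau; exact: schwartz_ker. Qed.

Lemma rapid_multiplier m u a : testfun m -> rapid a -> rapid (fun x => multiplier m u x * a x).
Proof. by move=> tm; rewrite multiplierE; apply: rapid_tdist_tau; exact: schwartz_ker. Qed.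

(** The form of [dist_fubini] that moves a multiplier from the distribution to the test function. *)
Lemma multiplier_pair m u a : testfun m -> rapid a ->
  \int[mu]_x (multiplier m u x * a x) = u (sconv (ker m) a).
Proof. by move=> tm ra; rewrite multiplierE dist_fubini//; exact: schwartz_ker. Qed.

Lemma rapid_reflect N x : rapid N -> rapid (fun y => N (x - y)).
Proof.
move=> rN; have N1 : (-1 : R) != 0 by rewrite oppr_eq0 oner_neq0.
have := rapid_affine x N1 rN.
by rewrite (_ : (fun y => N (x + _)) = fun y => N (x - y))//; apply/funext => y; rewrite scaleN1r.
Qed.

Lemma conv_multiplier N m u x : schwartz N -> testfun m ->
  \int[mu]_y (N (x - y) * multiplier m u y) = u (fun z => sconv N (ker m) (x - z)).
Proof.
move=> sN tm; have rN := schwartz_rapid sN.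
transitivity (\int[mu]_y (multiplier m u y * N (x - y))).
  by apply: Rint_eq => y; rewrite mulrC.
rewrite (multiplier_pair u tm (rapid_reflect x rN)); congr (tdist_val u).
apply/funext => z; rewrite (sconvC rN (rapid_ker tm)) /sconv.
have h := sconv_integ (x - z) (rapid_ker tm) (rapid_integ rN).
rewrite -(Rint_reflect x h); apply: Rint_eq => y.
by congr (_ * _); rewrite ker_sub; congr (ker m _); rewrite opprB [RHS]addrC addrA subrK.
Qed.

Lemma multiplier_comp m n u x : symbol m -> testfun n ->
  \int[mu]_y (ker m (x - y) * multiplier n u y) = multiplier (fun xi => m xi * n xi) u x.
Proof.
move=> sm tn; rewrite conv_multiplier//; last by apply: schwartz_ker; case: sm.
by rewrite sconv_ker.
Qed.

Lemma partial_reflect i N x : smooth N ->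
  partial i (fun y => N (x - y)) = fun y => - partial i N (x - y).
Proof.
move=> sN; have := partial_affine i x (-1) sN.
rewrite (_ : (fun y => N (x + _)) = fun y => N (x - y)); last by apply/funext => y; rewrite scaleN1r.
by move=> ->; apply/funext => y; rewrite scaleN1r mulN1r.
Qed.

Lemma dpartialE i u f : schwartz f -> dpartial i u f = - u (partial i f).
Proof. by move=> sf; rewrite /dpartial /= /dpartial_fun asboolT. Qed.

Lemma multiplier_dpartial m i u x : testfun m ->
  multiplier m (dpartial i u) x = u (fun y => partial i (ker m) (x - y)).
Proof.
move=> tm; have sk := schwartz_ker tm.
rewrite /multiplier dpartialE; last exact: schwartz_reflect.
rewrite partial_reflect; last exact: sk.1.
rewrite -mulN1r -tdistZ; last first.
  have := schwartzZ (-1) (schwartz_reflect x (schwartz_partial i sk)).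
  by under eq_fun do rewrite mulN1r.
by congr (tdist_val u); apply/funext => y; rewrite mulN1r opprK.
Qed.

(** The derivative is carried by the kernel of [m] while [n] still produces the block. With [m]
    equal to 1 on the support of [n], this yields Bernstein's bound on the derivative of a block. *)
Lemma multiplier_dpartial_conv m n i u x : symbol m -> testfun n ->
  multiplier (fun xi => m xi * n xi) (dpartial i u) x =
  \int[mu]_y (partial i (ker m) (x - y) * multiplier n u y).
Proof.
move=> sm tn; have sk := schwartz_ker sm.1; have rn := rapid_ker tn.
rewrite conv_multiplier//; last exact: schwartz_partial.
rewrite multiplier_dpartial.
  by rewrite -sconv_ker// partial_sconv//; exact: rapid_integ.
by apply: testfunM => //; case: sm => -[].
Qed.

Lemma multiplier_parts m i u f : testfun m -> schwartz f ->
  \int[mu]_x (multiplier m (dpartial i u) x * f x) =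
  - \int[mu]_x (multiplier m u x * partial i f x).
Proof.
move=> tm sf; have sk := schwartz_ker tm.
rewrite !multiplier_pair//; [|exact: schwartz_rapid (schwartz_partial i sf)|exact: schwartz_rapid].
rewrite dpartialE; last by apply: sconv_schwartz => //; exact: schwartz_rapid.
rewrite partial_sconv//; last by apply: rapid_integ; exact: schwartz_rapid.
by rewrite sconv_partial.
Qed.

Lemma multiplierD m u v x : multiplier m (u + v) x = multiplier m u x + multiplier m v x.
Proof. by []. Qed.

Lemma multiplierZ m (c : R) u x : multiplier m (c *: u) x = c * multiplier m u x.
Proof. by []. Qed.

Lemma ker_symD m n : testfun m -> testfun n ->
  ker (fun xi => m xi + n xi) = fun x => ker m x + ker n x.
Proof.
move=> tm tn; apply/funext => x; rewrite !kerE -mulrDr; congr (_ * _).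
rewrite /trig -RintD; [|apply: integ_cos; exact: testfun_integ|apply: integ_cos; exact: testfun_integ].
by apply: Rint_eq => xi; rewrite mulrDr.
Qed.

Lemma ker_symZ m (c : R) : testfun m -> ker (fun xi => c * m xi) = fun x => c * ker m x.
Proof.
move=> tm; apply/funext => x; rewrite !kerE mulrCA; congr (_ * _).
rewrite /trig -RintZ; last by apply: integ_cos; exact: testfun_integ.
by apply: Rint_eq => xi; rewrite mulrCA.
Qed.

Lemma multiplier_symD m n u x : testfun m -> testfun n ->
  multiplier (fun xi => m xi + n xi) u x = multiplier m u x + multiplier n u x.
Proof.
move=> tm tn; rewrite /multiplier -tdistD; last 2 first.
- by apply: schwartz_reflect; exact: schwartz_ker.
- by apply: schwartz_reflect; exact: schwartz_ker.
by rewrite -/(ker _) ker_symD.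
Qed.

Lemma multiplier_symZ m (c : R) u x : testfun m ->
  multiplier (fun xi => c * m xi) u x = c * multiplier m u x.
Proof.
move=> tm; rewrite /multiplier -tdistZ; last by apply: schwartz_reflect; exact: schwartz_ker.
by rewrite -/(ker _) ker_symZ.
Qed.

Lemma ker_dyadic m j x : testfun m ->
  ker (dyadic m j) x = (2 ^ j) ^+ 3 * ker m (2 ^ j *: x).
Proof.
move=> tm; rewrite !kerE mulrCA; congr (_ * _).
have l0 : 0 < (2 : R) ^ (- j) by exact: exprz_gt0.
have h := Rint_affine (0 : E) (lt0r_neq0 l0) (integ_cos (2 ^ j *: x) 0 (testfun_integ tm)).
have lE : (2 : R) ^ j = (2 ^ (- j))^-1 by rewrite invr_expz opprK.
move: h; rewrite (gtr0_norm l0) => h.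
transitivity ((2 ^ (- j)) ^- 3 * \int[mu]_xi (cos (dot (2 ^ j *: x) xi + 0) * m xi)); last by rewrite -exprVn -lE.
rewrite -h /trig; apply: Rint_eq => xi; rewrite add0r dotZl dotZr mulrA lE mulVf ?mul1r//.
exact: lt0r_neq0.
Qed.

Lemma symbol_dyadic m j : symbol m -> symbol (dyadic m j).
Proof.
move=> [tm em]; split; first by apply: testfun_dilate => //; rewrite expfz_neq0.
by move=> x; rewrite /dyadic scalerN em.
Qed.

Lemma symbolM m n : symbol m -> symbol n -> symbol (fun xi => m xi * n xi).
Proof.
move=> [tm em] [tn en]; split; last by move=> x; rewrite em en.
by apply: testfunM => //; case: tm.
Qed.

Lemma symbolD m n : symbol m -> symbol n -> symbol (fun xi => m xi + n xi).
Proof.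
move=> [tm em] [tn en]; split; last by move=> x; rewrite em en.
exact: testfunD.
Qed.

End Kernel.

(** * Dyadic symbols *)

Section LittlewoodPaley.
Variables (R : realType) (phi : R3 R -> R).
Hypothesis lp : littlewood_paley phi.
Local Notation E := (R3 R).

Lemma lp_supp x : phi x != 0 -> 3 / 4 <= enorm x <= 8 / 3.
Proof. by case: lp => _ _ h _; exact: h. Qed.

Lemma lp_near0 x : enorm x < 3 / 4 -> phi x = 0.
Proof.
move=> h; apply/eqP; apply: contraLR h => /lp_supp/andP[h _].
by rewrite -leNgt.
Qed.

Lemma lp_symbol : symbol phi.
Proof.
case: lp => sp rp _ _; split; last by move=> x; apply: rp; rewrite enormN.
split=> //; exists 3 => x h; apply/eqP; apply: contraLR h => /lp_supp/andP[_ h].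
by rewrite -ltNge (le_lt_trans h)//; lra.
Qed.

Lemma dyadic_symbol j : symbol (dyadic phi j).
Proof. exact: symbol_dyadic lp_symbol. Qed.

Lemma enorm_dyadic j (x : E) : enorm (2 ^ (- j) *: x) = 2 ^ (- j) * enorm x.
Proof. by rewrite enormZ gtr0_norm// exprz_gt0. Qed.

Lemma dyadic_supp j x : dyadic phi j x != 0 -> 3 / 4 * 2 ^ j <= enorm x <= 8 / 3 * 2 ^ j.
Proof.
have l0 : (0 : R) < 2 ^ j by exact: exprz_gt0.
by move/lp_supp; rewrite enorm_dyadic -invr_expz [_ * enorm x]mulrC ler_pdivlMr// ler_pdivrMr.
Qed.

Lemma exp2_le (j k : int) (i : nat) : j + i%:Z <= k -> (2 : R) ^ j * 2 ^+ i <= 2 ^ k.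
Proof. move=> jk; rewrite -[2 ^+ i]/(2 ^ i%:Z) -expfzDr//.
by rewrite ler_weXz2l// ler1n. Qed.

(** Annuli two indices apart are disjoint because 8/3 < 4 * 3/4. *)
Lemma dyadic_far j k x : j + 2 <= k -> dyadic phi j x != 0 -> dyadic phi k x = 0.
Proof.
move=> jk /dyadic_supp/andP[_ h1]; apply/eqP; apply: contraT => /dyadic_supp/andP[h2 _].
have := exp2_le jk; have : (0 : R) < 2 ^ j by exact: exprz_gt0.
move: h1 h2; rewrite (_ : (2 : R) ^+ 2 = 4); first by lra.
by rewrite expr2; ring.
Qed.

Lemma dyadic_orth j k x : (2 <= `|j - k|)%R -> dyadic phi j x * dyadic phi k x = 0.
Proof.
move=> jk; have [h|h] := leP (j + 2) k.
  have [->|nz] := eqVneq (dyadic phi j x) 0; first by rewrite mul0r.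
  by rewrite (dyadic_far h nz) mulr0.
have {jk}h : k + 2 <= j by lia.
have [->|nz] := eqVneq (dyadic phi k x) 0; first by rewrite mulr0.
by rewrite (dyadic_far h nz) mul0r.
Qed.

(** The sum of the three dyadic functions that can meet the support of [phi]; it equals 1 there, so
    its kernels reproduce blocks. *)
Definition chi (x : E) : R := dyadic phi (-1) x + phi x + dyadic phi 1 x.

Lemma dyadic0 (m : E -> R) : dyadic m 0 = m.
Proof. by apply/funext => x; rewrite /dyadic oppr0 expr0z scale1r. Qed.

Lemma dyadicD (m : E -> R) i j x : dyadic m i (2 ^ (- j) *: x) = dyadic m (i + j) x.
Proof. by rewrite /dyadic scalerA -expfzDr// opprD. Qed.

Lemma chi_symbol : symbol chi.
Proof.
apply: symbolD; last exact: dyadic_symbol.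
by apply: symbolD; [exact: dyadic_symbol|exact: lp_symbol].
Qed.

(** At a point where [phi] does not vanish, the partition of unity reduces to the indices -1, 0 and
    1 by [dyadic_far]. *)
Lemma chi_phi x : chi x * phi x = phi x.
Proof.
have [->|nz] := eqVneq (phi x) 0; first by rewrite mulr0.
have x0 : x != 0.
  apply: contraNneq nz => ->; apply/eqP; apply: lp_near0.
  by rewrite enorm0; lra.
case: lp => _ _ _ /(_ x x0) h.
have nz0 : dyadic phi 0 x != 0 by rewrite dyadic0.
have := @sumZ_fin R (fun j => dyadic phi j x) [:: -1; 0; 1] isT.
rewrite !big_cons big_nil addr0 => /(_ _) h2.
have {}h2 : sumZ (fun j => dyadic phi j x) (chi x).
  have -> : chi x = dyadic phi (-1) x + (dyadic phi 0 x + dyadic phi 1 x) by rewrite /chi dyadic0 addrA.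
  apply: h2 => i; rewrite !inE => hi.
  have [h'|h'] := leP (0 + 2) i; first exact: dyadic_far h' nz0.
  apply/eqP; apply: contraNT nz0 => nzi; apply/eqP; apply: dyadic_far nzi; lia.
by rewrite -(sumZ_unique h h2) mul1r.
Qed.

Lemma dyadic_chi_phi j x : dyadic chi j x * dyadic phi j x = dyadic phi j x.
Proof. exact: chi_phi. Qed.

Lemma dyadic_chiE j x : dyadic chi j x = dyadic phi (j - 1) x + dyadic phi j x + dyadic phi (j + 1) x.
Proof.
rewrite [LHS](_ : _ = dyadic phi (-1) (2 ^ (- j) *: x) + dyadic phi j x + dyadic phi 1 (2 ^ (- j) *: x))//.
by rewrite !dyadicD (addrC (-1)) (addrC 1).
Qed.

Lemma chi_near0 x : enorm x < 3 / 8 -> chi x = 0.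
Proof.
move=> h; have p j : dyadic phi j x != 0 -> j <= -2.
  move=> /dyadic_supp/andP[h1 _]; rewrite leNgt; apply/negP => hj.
  have hj2 : (-1 : int) + 0%:Z <= j by lia.
  have := exp2_le hj2; rewrite expr0 mulr1 exprN1; move: h h1; lra.
have z j : -1 <= j -> dyadic phi j x = 0.
  by move=> hj; apply/eqP; apply: contraT => /p; lia.
by rewrite /chi -{2}(dyadic0 phi) !z// !addr0.
Qed.

Definition invsq (m : E -> R) (x : E) : R := (enorm x ^+ 2)^-1 * m x.

Lemma invsq_symbol m (r : R) : 0 < r -> symbol m -> (forall x, enorm x < r -> m x = 0) ->
  symbol (invsq m).
Proof.
move=> r0 [tm em] mr; split; first exact: testfun_inv_sqr r0 tm mr.
by move=> x; rewrite /invsq enormN em.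
Qed.

Lemma invsq_chi_symbol : symbol (invsq chi).
Proof. by apply: (@invsq_symbol _ (3 / 8)); [lra|exact: chi_symbol|exact: chi_near0]. Qed.

Lemma invsq_phi_symbol j : symbol (invsq (dyadic phi j)).
Proof.
apply: (@invsq_symbol _ (3 / 4 * 2 ^ j)); last first.
- move=> x h; apply/eqP; apply: contraLR h => /dyadic_supp/andP[h _].
  by rewrite -leNgt.
- exact: dyadic_symbol.
- by rewrite mulr_gt0// exprz_gt0.
Qed.

Lemma invsq_dyadic m j x : invsq (dyadic m j) x = (2 ^ j) ^- 2 * dyadic (invsq m) j x.
Proof.
rewrite /invsq {2}/dyadic enorm_dyadic mulrA; congr (_ * _).
by rewrite -invfM exprMn mulrA -exprMn -expfzDr// subrr expr0z expr1n mul1r.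
Qed.

(** On the annulus of index j, the symbol 1 / |xi|^2 is 4^(-j) times a dilate of one fixed compactly
    supported symbol; its kernels therefore obey bounds uniform in j. *)
Lemma invsq_phiE j x : invsq (dyadic phi j) x = (2 ^ j) ^- 2 * dyadic (invsq chi) j x * dyadic phi j x.
Proof.
rewrite -invsq_dyadic /invsq -mulrA; congr (_ * _).
by rewrite -{1}dyadic_chi_phi.
Qed.

End LittlewoodPaley.

(** * Bernstein inequalities *)

Section LpBound.
Variable R : realType.
Local Notation E := (R3 R).
Local Notation mu := (lebesgue3 R).
Implicit Types (f g N : E -> R) (x : E) (p P A B C : R).

(** The inequality is between p-th powers, with no root to take, and measurability and the sign of
    [B] are part of it. [lpb_Lnorm] relates it to the L^p norm of the statement. *)
Definition lpb p f B := [/\ measurable3 f, 0 <= B &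
  (\int[mu]_x (`|f x| `^ p)%:E <= (B `^ p)%:E)%E].

Lemma lpb_measurable p f B : lpb p f B -> measurable3 f. Proof. by case. Qed.
Lemma lpb_ge0 p f B : lpb p f B -> 0 <= B. Proof. by case. Qed.

Lemma measurable_powR_norm p f : measurable3 f -> measurable3 (fun x => `|f x| `^ p).
Proof.
move=> mf; apply: (@measurable3_comp _ (@powR R ^~ p) (fun x => `|f x|)).
  exact: measurable_powR.
exact: measurable3_norm.
Qed.

Lemma lpb_integ p f B : lpb p f B -> integ (fun x => `|f x| `^ p).
Proof.
move=> [mf B0 h]; apply: rintegrable_ge0P.
- exact: measurable_powR_norm.
- by move=> x; exact: powR_ge0.
- by rewrite (le_lt_trans h)// ltry.
Qed.

Lemma lpb_Rint p f B : lpb p f B -> \int[mu]_x (`|f x| `^ p) <= B `^ p.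
Proof.
move=> h; rewrite -lee_fin EFin_Rint; last exact: lpb_integ h.
by case: h.
Qed.

Lemma lpbP p f B : measurable3 f -> 0 <= B -> integ (fun x => `|f x| `^ p) ->
  \int[mu]_x (`|f x| `^ p) <= B `^ p -> lpb p f B.
Proof. by move=> mf B0 fi h; split=> //; rewrite -EFin_Rint// lee_fin. Qed.

Lemma lpb_dom p f g B : integ g -> measurable3 f -> 0 <= B ->
  (forall x, `|f x| `^ p <= g x) -> \int[mu]_x g x <= B `^ p -> lpb p f B.
Proof.
move=> gi mf B0 fg h; have fi : integ (fun x => `|f x| `^ p).
  apply: (rintegrable_le _ gi); first exact: measurable_powR_norm.
  by move=> x; rewrite ger0_norm ?powR_ge0.
by apply: lpbP => //; apply: le_trans h; exact: Rint_le.
Qed.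

Lemma lpb_Lnorm p f B : 0 < p -> measurable3 f -> 0 <= B ->
  lpb p f B <-> ('N[mu]_p%:E[EFin \o f] <= B%:E)%E.
Proof.
move=> p0 mf B0; rewrite unlock /Lnorm.
have i0 : (0 <= \int[mu]_x (`|f x| `^ p)%:E)%E.
  by apply: integral_ge0 => x _; rewrite lee_fin powR_ge0.
have -> : (\int[mu]_x (`|(EFin \o f) x| `^ p) = \int[mu]_x (`|f x| `^ p)%:E)%E.
  by apply: eq_integral => x _.
split=> [[_ _ h]|h].
  apply: (@le_trans _ _ ((B `^ p)%:E `^ p^-1)%E).
    apply: gt0_ler_poweR => //; first by rewrite invr_ge0 ltW.
      by rewrite in_itv /= i0 leey.
    by rewrite in_itv /= leey lee_fin powR_ge0.
  by rewrite poweR_EFin -powRrM mulfV ?gt_eqF// powRr1.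
split=> //; rewrite -poweR_EFin.
rewrite -[leLHS]poweRe1// -(mulVf (lt0r_neq0 p0)) poweRrM.
apply: gt0_ler_poweR => //; first exact: ltW.
  by rewrite in_itv /= poweR_ge0 leey.
by rewrite in_itv /= leey lee_fin B0.
Qed.

Lemma lpb_le p f g B C : 0 <= p -> lpb p f B -> measurable3 g ->
  (forall x, `|g x| <= `|f x|) -> B <= C -> lpb p g C.
Proof.
move=> p0 h mg gf BC; have B0 := lpb_ge0 h.
apply: (lpb_dom (lpb_integ h) mg (le_trans B0 BC)).
  by move=> x; apply: ge0_ler_powR => //; rewrite nnegrE.
apply: (le_trans (lpb_Rint h)); apply: ge0_ler_powR => //; rewrite nnegrE//.
exact: le_trans BC.
Qed.

Lemma lpb_weak p f B C : 0 <= p -> lpb p f B -> B <= C -> lpb p f C.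
Proof. by move=> p0 h BC; apply: (lpb_le p0 h) => //; exact: lpb_measurable h. Qed.

Lemma eq_lpb p f g B : f =1 g -> lpb p f B -> lpb p g B.
Proof. by move=> /funext ->. Qed.

Lemma lpbZ p f B (c : R) : 0 <= p -> lpb p f B -> lpb p (fun x => c * f x) (`|c| * B).
Proof.
move=> p0 h; have B0 := lpb_ge0 h.
apply: (lpb_dom (rintegrableZ (`|c| `^ p) (lpb_integ h))).
- by apply: measurable3M; [exact: measurable3_cst|exact: lpb_measurable h].
- by rewrite mulr_ge0.
- by move=> x; rewrite normrM powRM.
- rewrite RintZ; last exact: lpb_integ h.
  by rewrite powRM// ler_wpM2l ?powR_ge0// (lpb_Rint h).
Qed.

Lemma lpb0 p B : 0 < p -> 0 <= B -> lpb p (fun=> 0) B.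
Proof.
move=> p0 B0; apply: (@lpb_dom p (fun=> 0) (fun=> 0)) => //.
- exact: rintegrable0.
- exact: measurable3_cst.
- by move=> _; rewrite normr0 powR0// gt_eqF.
- by rewrite (Rint0 mu) powR_ge0.
Qed.

Lemma lpbD p f g A B : 1 <= p -> lpb p f A -> lpb p g B ->
  lpb p (fun x => f x + g x) (A + B).
Proof.
move=> p1 hf hg; have p0 : 0 < p by rewrite (lt_le_trans _ p1).
have [mf mg] := (lpb_measurable hf, lpb_measurable hg).
have [A0 B0] := (lpb_ge0 hf, lpb_ge0 hg).
have m := measurable3D mf mg.
apply/(lpb_Lnorm p0 m (addr_ge0 A0 B0)).
apply: (le_trans (@minkowski_EFin _ _ _ mu f g p mf mg p1)).
by rewrite EFinD leeD//; [exact/(lpb_Lnorm p0 mf A0)|exact/(lpb_Lnorm p0 mg B0)].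
Qed.

Lemma lpb_sum p I (r : seq I) (F : I -> E -> R) (B : I -> R) : 1 <= p ->
  (forall i, lpb p (F i) (B i)) ->
  lpb p (fun x => \sum_(i <- r) F i x) (\sum_(i <- r) B i).
Proof.
move=> p1 h; have p0 : 0 < p by rewrite (lt_le_trans _ p1).
elim: r => [|i r IHr].
  rewrite big_nil (_ : (fun x => _) = fun=> 0); first exact: lpb0.
  by apply/funext => x; rewrite big_nil.
rewrite big_cons (_ : (fun x => _) = fun x => F i x + \sum_(i <- r) F i x).
  exact: lpbD.
by apply/funext => x; rewrite big_cons.
Qed.

Lemma cvg_powR_norm p (u : nat -> R) (l : R) : 1 <= p -> u @ \oo --> l ->
  (fun n => `|u n| `^ p) @ \oo --> `|l| `^ p.
Proof.
move=> p1 ul; have p0 : 0 < p by rewrite (lt_le_trans _ p1).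
have nl : (fun n => `|u n|) @ \oo --> `|l| by exact: cvg_norm.
have [l0|l0] := eqVneq l 0.
  rewrite l0 normr0 powR0 ?gt_eqF//; rewrite l0 normr0 in nl.
  apply/cvgrPdist_lt => e e0; near=> n.
  rewrite sub0r normrN ger0_norm ?powR_ge0//.
  have h1 : `|u n| < Num.min 1 e.
    near: n; have := nl; move/cvgrPdist_lt => /(_ (Num.min 1 e)).
    rewrite lt_min ltr01 e0 => /(_ isT); apply: filterS => n.
    by rewrite sub0r normrN normr_id.
  move: h1; rewrite lt_min => /andP[h1 he].
  have [un0|un0] := eqVneq `|u n| 0; first by rewrite un0 powR0 ?gt_eqF.
  rewrite (le_lt_trans _ he)// ge1r_powR// (ltW h1) andbT lt_neqAle eq_sym un0.
  exact: normr_ge0.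
have l1 : 0 < `|l| by rewrite normr_gt0.
have E1 (t : R) : 0 < t -> t `^ p = expR (p * ln t) by move=> t0; rewrite /powR gt_eqF.
rewrite E1//; apply: (@cvg_trans _ ((fun n => expR (p * ln `|u n|)) @ \oo)).
  apply: near_eq_cvg; near=> n; rewrite E1//; near: n.
  exact: (cvgr_gt `|l|).
apply: (@cvg_comp _ _ _ (fun n => p * ln `|u n|) expR _ (nbhs (p * ln `|l|))); last exact: continuous_expR.
apply: cvgM; first exact: cvg_cst.
apply: (@cvg_comp _ _ _ (fun n => `|u n|) (@ln R) _ (nbhs `|l|)) => //.
exact: continuous_ln.
Unshelve. all: end_near. Qed.

Lemma lpb_fatou p (F : nat -> E -> R) f B : 1 <= p ->
  (forall n, lpb p (F n) B) -> (forall x, F n x @[n --> \oo] --> f x) -> lpb p f B.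
Proof.
move=> p1 hF Ff; have B0 := lpb_ge0 (hF 0%N).
have mF n := lpb_measurable (hF n).
have mf : measurable3 f by apply: (measurable_fun_cvg mF) => x _; exact: Ff.
split=> //; have mp n : measurable_fun setT (fun x : R3 (measurableTypeR R) => (`|F n x| `^ p)%:E).
  by apply/measurable_EFinP; exact: measurable_powR_norm.
have := @fatou _ _ _ mu setT measurableT _ mp (fun n x _ => powR_ge0 _ _).
rewrite (_ : (fun x => limn_einf _) = fun x => (`|f x| `^ p)%:E); last first.
  apply/funext => x.
  have h : (fun n => (`|F n x| `^ p)%:E) @ \oo --> (`|f x| `^ p)%:E.
    by apply/fine_cvgP; split; [exact: nearW|exact: cvg_powR_norm].
  by rewrite (cvg_limn_einf_sup h).1.
move=> /le_trans; apply; rewrite limn_einf_lim.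
apply: lime_le; first exact: is_cvg_einfs.
apply: nearW => n; have [_ _] := hF n; apply: le_trans.
by apply: ereal_inf_lbound; exists n => /=.
Qed.

Lemma powR_split (t a b : R) : 0 < t -> t `^ a = t `^ (a - b) * t `^ b.
Proof. by move=> t0; rewrite -powRD ?subrK//; apply/implyP => _; rewrite gt_eqF. Qed.

(* Integrated against a kernel, with the right [b], this replaces Hoelder's
   inequality up to a factor 2. *)
Lemma norm_split p (b t : R) : 1 <= p -> 0 < b -> 0 <= t -> t <= b + b `^ (1 - p) * t `^ p.
Proof.
move=> p1 b0 t0; have [tb|bt] := leP t b.
  by rewrite (le_trans tb)// lerDl mulr_ge0 ?powR_ge0.
have t1 : 0 < t by exact: lt_trans bt.
apply: ler_wpDl; first exact: ltW.
rewrite -[leLHS](powRr1 (ltW t1)) (powR_split 1 p t1).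
rewrite ler_wpM2r ?powR_ge0// -opprB !powRN lef_pV2 ?posrE ?powR_gt0//.
by apply: ge0_ler_powR; rewrite ?nnegrE ?subr_ge0// ltW.
Qed.

(** Jensen's inequality for the measure with density N, of mass at most A, with a factor 2 lost:
    [norm_split] is integrated against N. *)
Lemma weighted_bound p N f A (b : R) : 1 <= p -> 0 <= A -> 0 <= b -> measurable3 f ->
  integ N -> (forall x, 0 <= N x) -> \int[mu]_x N x <= A ->
  integ (fun x => N x * `|f x| `^ p) -> \int[mu]_x (N x * `|f x| `^ p) <= A * b `^ p ->
  integ (fun x => N x * f x) /\ \int[mu]_x (N x * `|f x|) <= 2 * A * b.
Proof.
move=> p1 A0 b0 mf Ni N0 NA fi h.
have sp (e x : _) : 0 < e -> N x * `|f x| <= e * N x + e `^ (1 - p) * (N x * `|f x| `^ p).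
  move=> e0; apply: (le_trans (ler_wpM2l (N0 x) (norm_split p1 e0 (normr_ge0 (f x))))).
  by rewrite mulrDr mulrC mulrCA.
have i e := rintegrableD (rintegrableZ e Ni) (rintegrableZ (e `^ (1 - p)) fi).
have fi1 : integ (fun x => N x * f x).
  apply: (rintegrable_le _ (i 1)).
    by apply: measurable3M => //; exact: rintegrable_measurable Ni.
  by move=> x; rewrite normrM ger0_norm//; exact: sp.
split=> //.
have fi2 : integ (fun x => N x * `|f x|).
  by apply: (eq_integ _ (rintegrable_norm fi1)) => x; rewrite normrM ger0_norm.
(* [norm_split] needs a positive threshold, so it is used at every e > b; letting e decrease to b
   includes the case b = 0. *)
suff H e : b < e -> \int[mu]_x (N x * `|f x|) <= 2 * A * e.
  apply/ler_addgt0Pr => e e0; pose d := e / (2 * A + 1).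
  have A1 : 0 < 2 * A + 1 by rewrite ltr_wpDl// mulr_ge0.
  have d0 : 0 < d by rewrite divr_gt0.
  apply: (le_trans (H (b + d) _)); first by rewrite ltrDl.
  rewrite mulrDr lerD2l /d mulrA ler_pdivrMr// mulrC ler_wpM2l ?lerDl// ltW//.
move=> be; have e0 : 0 < e by exact: le_lt_trans be.
apply: (@le_trans _ _ (e * A + e `^ (1 - p) * (A * e `^ p))); last first.
  rewrite mulrCA -powR_split// powRr1 ?(ltW e0)// le_eqVlt; apply/orP; left; apply/eqP; ring.
apply: (le_trans (Rint_le fi2 (i e) (fun x => sp e x e0))).
rewrite RintD; [|exact: rintegrableZ|exact: rintegrableZ].
rewrite !RintZ// lerD//; first by rewrite ler_wpM2l ?(ltW e0).
rewrite ler_wpM2l ?powR_ge0//.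
apply: (le_trans h); rewrite ler_wpM2l//.
by apply: ge0_ler_powR; rewrite ?nnegrE//; [exact: le_trans p1|exact: ltW|exact: ltW].
Qed.

(** The summand 1 makes this constant at least 1, so that it can be inserted as a factor in upper
    bounds. *)
Definition womega : R := 1 + \int[mu]_x omega x.

Lemma womega_ge1 : 1 <= womega.
Proof. by rewrite lerDl; apply: Rint_ge0 => x; exact: omega_ge0. Qed.

(** L^1 with the weight [omega]: small enough for its elements to be tempered distributions, and
    large enough to contain L^p functions, bounded functions and the products of blocks. *)
Definition wl1 f B := [/\ measurable3 f, integ (fun x => omega x * f x) &
  \int[mu]_x (omega x * `|f x|) <= B].

Lemma lpb_wl1 p f B : 1 <= p -> lpb p f B -> wl1 f (2 * womega * B).
Proof.
move=> p1 h; have mf := lpb_measurable h; have fi := lpb_integ h.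
have W1 := womega_ge1; have W0 : 0 <= womega by exact: le_trans W1.
have mo : measurable3 (@omega R) by exact: measurable_wtVn.
have oi : integ (fun x => omega x * `|f x| `^ p).
  apply: (rintegrable_mul_bounded fi mo (C := 1)) => x.
  by rewrite ger0_norm ?omega_ge0// omega_le1.
have [i1 i2] := @weighted_bound p (@omega R) f womega B p1 W0 (lpb_ge0 h) mf (integ_omega R)
  (@omega_ge0 R) (ler_wpDl ler01 (lexx _)) oi (le_trans (Rint_le oi fi (fun x =>
   ler_piMl (powR_ge0 _ _) (omega_le1 x))) (le_trans (lpb_Rint h) (ler_peMl (powR_ge0 _ _) W1))).
by split.
Qed.

Lemma bounded_wl1 f B : measurable3 f -> (forall x, `|f x| <= B) -> wl1 f (womega * B).
Proof.
move=> mf fB; have B0 : 0 <= B by exact: le_trans (fB 0).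
have i : integ (fun x => omega x * f x).
  apply: (eq_integ _ (rintegrable_mul_bounded (integ_omega R) mf fB)) => x.
  by rewrite mulrC.
split=> //; have i' : integ (fun x => omega x * `|f x|).
  by apply: (eq_integ _ (rintegrable_norm i)) => x; rewrite normrM ger0_norm ?omega_ge0.
apply: (@le_trans _ _ (\int[mu]_x (B * omega x))).
  apply: Rint_le => //; first by apply: rintegrableZ; exact: integ_omega.
  by move=> x; rewrite mulrC ler_wpM2r// omega_ge0.
rewrite RintZ; last exact: integ_omega.
by rewrite mulrC ler_wpM2r// /womega ler_wpDl.
Qed.

Lemma wl1_pair f B (a : E -> R) (K : R) : wl1 f B -> measurable3 a -> 0 <= K ->
  (forall x, wt x ^+ 6 * `|a x| <= K) ->
  integ (fun x => f x * a x) /\ `|\int[mu]_x (f x * a x)| <= K * B.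
Proof.
move=> [mf fi fB] ma K0 aK.
have fi' : integ (fun x => omega x * `|f x|).
  by apply: (eq_integ _ (rintegrable_norm fi)) => x; rewrite normrM ger0_norm ?omega_ge0.
have d x : `|f x * a x| <= K * (omega x * `|f x|).
  rewrite normrM mulrC mulrA ler_wpM2r//.
  by rewrite /omega ler_pdivlMr ?exprn_gt0// mulrC.
have i : integ (fun x => f x * a x).
  by apply: (rintegrable_le _ (rintegrableZ K fi')) => //; exact: measurable3M.
split=> //; apply: (le_trans (Rint_norm_le i (rintegrableZ K fi') d)).
by rewrite RintZ// ler_wpM2l.
Qed.

(** Interpolation between L^p and L^oo through the pointwise bound |f|^P <= S^(P - p) |f|^p. *)
Lemma interp_sup p P f A B (S : R) : 0 < p -> p <= P -> 0 <= S -> lpb p f B ->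
  (forall x, `|f x| <= S) -> S `^ (P - p) * B `^ p <= A `^ P -> 0 <= A -> lpb P f A.
Proof.
move=> p0 pP S0 h fS hA A0.
apply: (lpb_dom (rintegrableZ (S `^ (P - p)) (lpb_integ h)) (lpb_measurable h) A0).
  move=> x; have [f0|f0] := eqVneq `|f x| 0.
    by rewrite f0 powR0 ?gt_eqF ?(lt_le_trans p0)// mulr_ge0 ?powR_ge0.
  rewrite (@powR_split _ P p); last by rewrite lt_neqAle eq_sym f0 normr_ge0.
  by rewrite ler_wpM2r ?powR_ge0// ge0_ler_powR ?nnegrE ?subr_ge0.
rewrite RintZ; last exact: lpb_integ h.
by apply: le_trans hA; rewrite ler_wpM2l ?powR_ge0// (lpb_Rint h).
Qed.

Lemma lpb_bounded_mul p f g B (S : R) : 0 <= p -> measurable3 f -> (forall x, `|f x| <= S) ->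
  lpb p g B -> lpb p (fun x => f x * g x) (S * B).
Proof.
move=> p0 mf fS h; have S0 : 0 <= S by exact: le_trans (fS 0).
have hS : lpb p (fun x => S * g x) (S * B) by rewrite -{2}(ger0_norm S0); exact: lpbZ.
apply: (lpb_le p0 hS) => //; first by apply: measurable3M => //; exact: lpb_measurable h.
by move=> x; rewrite !normrM ler_wpM2r// (le_trans (fS x))// ler_norm.
Qed.

(** Cauchy-Schwarz for |f|^(rho/2) and |g|^(rho/2), which are in L^2. *)
Lemma lpb_mul (rho : R) f g A B : 0 < rho -> lpb rho f A -> lpb rho g B ->
  lpb (rho / 2) (fun x => f x * g x) (A * B).
Proof.
move=> r0 hf hg; have [mf mg] := (lpb_measurable hf, lpb_measurable hg).
have [A0 B0] := (lpb_ge0 hf, lpb_ge0 hg).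
pose s := rho / 2; pose F x := `|f x| `^ s; pose G x := `|g x| `^ s.
have mF : measurable3 F by exact: measurable_powR_norm.
have mG : measurable3 G by exact: measurable_powR_norm.
have sq (t : R) : 0 <= t -> `|t `^ s| `^ 2 = t `^ rho.
  by move=> t0; rewrite ger0_norm ?powR_ge0// -powRrM /s divfK.
have hF : lpb 2 F (A `^ s).
  apply: (lpb_dom (lpb_integ hf)) => //; first exact: powR_ge0.
    by move=> x; rewrite sq.
  by have := sq A A0; rewrite ger0_norm ?powR_ge0// => ->; exact: lpb_Rint.
have hG : lpb 2 G (B `^ s).
  apply: (lpb_dom (lpb_integ hg)) => //; first exact: powR_ge0.
    by move=> x; rewrite sq.
  by have := sq B B0; rewrite ger0_norm ?powR_ge0// => ->; exact: lpb_Rint.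
have h22 : (2^-1 + 2^-1 = 1 :> R) by lra.
have := @hoelder _ _ _ mu F G 2 2 mF mG ltac:(by []) ltac:(by []) h22.
have e1 := (lpb_Lnorm (ltr0n R 2) mF (powR_ge0 A s)).1 hF.
have e2 := (lpb_Lnorm (ltr0n R 2) mG (powR_ge0 B s)).1 hG.
rewrite Lnorm1 => h; split; [exact: measurable3M|exact: mulr_ge0|].
rewrite (_ : (\int[mu]_x _ = \int[mu]_x `|(EFin \o (F \* G)%R) x|)%E); last first.
  apply: eq_integral => x _ /=; congr (_%:E).
  rewrite normrM powRM// -/s [RHS]ger0_norm//; apply: mulr_ge0; exact: powR_ge0.
apply: (le_trans h); rewrite powRM// EFinM.
by apply: lee_pmul => //; exact: Lnorm_ge0.
Qed.

End LpBound.

(** * Convolution with a dilated kernel: Young and Bernstein *)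

Section KernelBound.
Variable R : realType.
Local Notation E := (R3 R).
Local Notation mu := (lebesgue3 R).
Implicit Types (f g N : E -> R) (x y z : E) (p P B C lam : R).

(* The bounds of [lam ^+ 3 * N (lam * x)], uniformly in [lam]. *)
Definition kbound N C lam := [/\ rapid N, 0 < C, forall x, `|N x| <= C * lam ^+ 3 &
  \int[mu]_x `|N x| <= C].

Section Conv.
Variables (N : E -> R) (C lam : R).
Hypotheses (lam0 : 0 < lam) (kN : kbound N C lam).

Let rN : rapid N. Proof. by case: kN. Qed.
Let C0 : 0 < C. Proof. by case: kN. Qed.
Let C0' : 0 <= C. Proof. exact: ltW. Qed.
Let NC x : `|N x| <= C * lam ^+ 3. Proof. by case: kN. Qed.

Lemma rapid_reflect_norm x : rapid (fun y => `|N (x - y)|).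
Proof. by apply: rapid_norm; exact: rapid_reflect. Qed.

Lemma kbound_L1 x : \int[mu]_y `|N (x - y)| <= C.
Proof.
have h := rintegrable_norm (rapid_integ rN).
by rewrite (Rint_reflect x h); case: kN.
Qed.

(** [weighted_bound] with the weight |N(x - .)|. To bound the convolution at x, it remains to
    compare the p-th moment of f for this weight with C b^p; Young and Bernstein differ in the
    choice of b. *)
Lemma sconv_weighted p f B (b : R) x : 1 <= p -> lpb p f B -> 0 <= b ->
  integ (fun y => `|N (x - y)| * `|f y| `^ p) /\
  (\int[mu]_y (`|N (x - y)| * `|f y| `^ p) <= C * b `^ p ->
   integ (fun y => N (x - y) * f y) /\ `|sconv N f x| <= 2 * C * b).
Proof.
move=> p1 h b0; have mf := lpb_measurable h; have fi := lpb_integ h.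
have rx := rapid_reflect_norm x.
have i1 : integ (fun y => `|N (x - y)| * `|f y| `^ p).
  apply: (rintegrable_mul_bounded fi rx.1 (C := C * lam ^+ 3)) => y.
  by rewrite normr_id.
split=> // hb.
have [i2 h2] := weighted_bound p1 (ltW C0) b0 mf (rapid_integ rx) (fun y => normr_ge0 _)
  (kbound_L1 x) i1 hb.
have i3 : integ (fun y => `|N (x - y)| * `|f y|).
  by apply: (eq_integ _ (rintegrable_norm i2)) => y; rewrite normrM normr_id.
have i4 : integ (fun y => N (x - y) * f y).
  apply: (rintegrable_le _ i3); first by apply: measurable3M => //; exact: (rapid_reflect x rN).1.
  by move=> y; rewrite normrM.
split=> //; apply: le_trans h2; apply: Rint_norm_le => // y.
by rewrite normrM.
Qed.

(** Since the kernel is at most C lam^3, the p-th moment is at most C lam^3 B^p, that is C b^p for b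
    = lam^(3/p) B. *)
Lemma sconv_sup p f B x : 1 <= p -> lpb p f B ->
  integ (fun y => N (x - y) * f y) /\ `|sconv N f x| <= 2 * C * (lam `^ (3 / p) * B).
Proof.
move=> p1 h; have B0 := lpb_ge0 h; have p0 : 0 < p by exact: lt_le_trans p1.
have [i1] := @sconv_weighted p f B (lam `^ (3 / p) * B) x p1 h (mulr_ge0 (powR_ge0 _ _) B0).
apply; apply: (@le_trans _ _ (\int[mu]_y (C * lam ^+ 3 * `|f y| `^ p))).
  apply: Rint_le => //; first by apply: rintegrableZ; exact: lpb_integ h.
  by move=> y; rewrite ler_wpM2r ?powR_ge0.
rewrite RintZ; last exact: lpb_integ h.
rewrite powRM ?powR_ge0// -powRrM divfK ?gt_eqF// -mulrA powR_mulrn ?(ltW lam0)//.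
by rewrite ler_wpM2l// ler_wpM2l ?exprn_ge0 ?(ltW lam0)// (lpb_Rint h).
Qed.

(** The integrand is multiplied by [omega x] twice to be dominated by a tensor product: by Peetre's
    inequality one factor turns |N(x - y)| into at most a multiple of [omega y], and the other one
    gives integrability in x. Fubini applies, and the weights are divided out afterwards. *)
Lemma measurable_sconv f B : wl1 f B -> measurable3 (sconv N f).
Proof.
move=> [mf fi _]; have rN' := rN.
have [D D0 hD] := rapid_ge0 6 rN.
pose F (z : E * E) := omega z.1 * omega z.1 * (N (z.1 - z.2) * f z.2).
have mo : measurable3 (@omega R) by exact: measurable_wtVn.
have mF : measurable33 F.
  apply: measurable33M; last by apply: measurable33M; [exact: measurable33_sub rN'.1|exact: measurable33_snd].
  by apply: measurable33M; exact: measurable33_fst.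
have bd x y : `|F (x, y)| <= D * omega x * `|omega y * f y|.
  rewrite /F !normrM !(ger0_norm (omega_ge0 _)) /=.
  rewrite -!mulrA (mulrCA D) ler_wpM2l ?omega_ge0//.
  have -> : D * (omega y * `|f y|) = D * omega y * `|f y| by rewrite mulrA.
  rewrite mulrA ler_wpM2r//.
  have := hD (x - y); rewrite -ler_pdivlMl ?exprn_gt0// => h.
  apply: (le_trans (ler_wpM2l (omega_ge0 x) h)).
  rewrite mulrC -mulrA mulrC -mulrA ler_wpM2l//.
  rewrite /omega -invfM lef_pV2 ?posrE ?mulr_gt0 ?exprn_gt0//.
  by have := wtX_peetre 6 y x; rewrite -(wtN (y - x)) opprB mulrC.
have h := integ_Rint1 mF (rintegrableZ D (integ_omega R)) (rintegrable_norm fi) bd.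
have := measurable3M (measurable3M (measurable3X 6 (@measurable_wt R)) (measurable3X 6 (@measurable_wt R)))
  (rintegrable_measurable h).
congr measurable3; apply/funext => x.
have o0 := omega_gt0 x.
have e : \int[mu]_y F (x, y) = omega x * omega x * sconv N f x.
  rewrite /sconv -RintZ//.
  have i := integ_section1 mF (rintegrable_norm fi) bd x.
  apply: (eq_integ _ (rintegrableZ ((omega x * omega x)^-1) i)) => y.
  by rewrite /F mulrA mulVf ?mul1r// mulf_neq0// gt_eqF.
rewrite e /omega; field.
by rewrite gt_eqF// wt_gt0.
Qed.

(** At each x, b is chosen with C b^p equal to the p-th moment J(x), so that |N * f|^p is at most (2
    C)^p J / C. By Tonelli, the integral of J costs the mass C of the kernel. *)
Lemma sconv_young p f B : 1 <= p -> lpb p f B -> lpb p (sconv N f) (2 * C * B).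
Proof.
move=> p1 h; have B0 := lpb_ge0 h; have p0 : 0 < p by exact: lt_le_trans p1.
have mf := lpb_measurable h.
pose J x := \int[mu]_y (`|N (x - y)| * `|f y| `^ p).
have J0 x : 0 <= J x by apply: Rint_ge0 => y; rewrite mulr_ge0 ?powR_ge0.
have iJ x : integ (fun y => `|N (x - y)| * `|f y| `^ p).
  by have [] := @sconv_weighted p f B 0 x p1 h (lexx 0).
have hJ x : `|sconv N f x| `^ p <= (2 * C) `^ p / C * J x.
  pose b := (J x / C) `^ p^-1.
  have [_] := @sconv_weighted p f B b x p1 h (powR_ge0 _ _).
  rewrite -powRrM mulVf ?gt_eqF// powRr1 ?divr_ge0//.
  rewrite mulrC divfK ?gt_eqF// => /(_ (lexx _))[_ hb].
  have C2 : 0 <= 2 * C by rewrite mulr_ge0.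
  apply: (le_trans (@ge0_ler_powR _ p (ltW p0) _ _ _ _ hb)); rewrite ?nnegrE ?mulr_ge0 ?powR_ge0//.
  rewrite powRM ?powR_ge0// -powRrM mulVf ?gt_eqF// powRr1 ?divr_ge0//.
  by rewrite mulrAC mulrA.
have ms : measurable3 (sconv N f) by exact: measurable_sconv (lpb_wl1 p1 h).
split=> //; first by rewrite !mulr_ge0.
pose F (z : R3 (measurableTypeR R) * R3 (measurableTypeR R)) : \bar R :=
  (`|N (z.1 - z.2)| * `|f z.2| `^ p)%:E.
have mF : measurable_fun setT F.
  apply/measurable_EFinP.
  have : measurable33 (fun z : E * E => `|N (z.1 - z.2)| * `|f z.2| `^ p).
    apply: measurable33M; first by apply: (measurable33_sub (f := fun x => `|N x|)); apply: measurable3_norm; exact: rN.1.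
    by apply: (measurable33_snd (f := fun x => `|f x| `^ p)); exact: measurable_powR_norm.
  by [].
have F0 (z : R3 (measurableTypeR R) * R3 (measurableTypeR R)) : (0%R <= F z)%E.
  by rewrite /F lee_fin; apply: mulr_ge0; [exact: normr_ge0|exact: powR_ge0].
have EJ x : (J x)%:E = (\int[mu]_y F (x, y))%E by rewrite /J EFin_Rint.
have mJ : measurable_fun setT (fun x : R3 (measurableTypeR R) => (J x)%:E).
  have := @measurable_fun_fubini_tonelli_F _ _ _ _ _ (leb3 R) F mF F0.
  congr measurable_fun; apply/funext => x; rewrite EJ; exact: erefl.
have K0 : 0 <= (2 * C) `^ p / C by rewrite divr_ge0 ?powR_ge0.
apply: (@le_trans _ _ (\int[mu]_x (((2 * C) `^ p / C)%:E * (J x)%:E))%E).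
  apply: ge0_le_integral => //.
  - by apply/measurable_EFinP; exact: measurable_powR_norm.
  - by apply: emeasurable_funM => //; exact: measurable_cst.
  - by move=> x _; rewrite -EFinM lee_fin.
rewrite ge0_integralZl//; last by move=> x _; rewrite lee_fin.
have -> : (\int[mu]_x (J x)%:E = \int[mu]_y \int[mu]_x F (x, y))%E.
  transitivity (\int[mu]_x \int[mu]_y F (x, y))%E.
    by apply: eq_integral => x _; exact: EJ.
  exact: (@fubini_tonelli _ _ _ _ _ (leb3 R) (leb3 R) F mF F0).
apply: (@le_trans _ _ (((2 * C) `^ p / C)%:E * \int[mu]_y (C%:E * (`|f y| `^ p)%:E))%E).
  rewrite lee_wpmul2l ?lee_fin//; apply: ge0_le_integral => //.
  - by move=> y _; apply: integral_ge0.
  - exact: (@measurable_fun_fubini_tonelli_G _ _ _ _ _ (leb3 R) F mF F0).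
  - by apply: emeasurable_funM; [exact: measurable_cst|apply/measurable_EFinP; exact: measurable_powR_norm].
  - move=> y _; rewrite /F /=.
    have hN : integ (fun x => `|N (x - y)|).
      have := integ_shift (- y) (rintegrable_norm (rapid_integ rN)).
      by apply: eq_integ => x; rewrite addrC.
    have -> : (\int[mu]_x (`|N (x - y)| * `|f y| `^ p)%:E =
        (`|f y| `^ p)%:E * \int[mu]_x `|N (x - y)|%:E)%E.
      rewrite -ge0_integralZl_EFin//.
      - by apply: eq_integral => x _; rewrite -EFinM mulrC.
      - by apply/measurable_EFinP; exact: rintegrable_measurable hN.
    rewrite -EFin_Rint// -!EFinM lee_fin mulrC ler_wpM2r ?powR_ge0//.
    have := Rint_shift (- y) (rintegrable_norm (rapid_integ rN)).
    rewrite (_ : \int[mu]_x `|N (- y + x)| = \int[mu]_x `|N (x - y)|).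
      by move=> ->; case: kN.
    by apply: Rint_eq => x; rewrite addrC.
rewrite ge0_integralZl//; last first.
  by apply/measurable_EFinP; exact: measurable_powR_norm.
case: h => _ _ h; rewrite muleA -EFinM divfK ?gt_eqF//.
have C2 : 0 <= 2 * C by rewrite mulr_ge0.
by rewrite (powRM p C2 B0) EFinM lee_wpmul2l// lee_fin powR_ge0.
Qed.

Lemma sconv_interp p P f B : 1 <= p -> p <= P -> lpb p f B ->
  lpb P (sconv N f) (2 * C * (lam `^ (3 * (p^-1 - P^-1)) * B)).
Proof.
move=> p1 pP h; have B0 := lpb_ge0 h; have p0 : 0 < p by exact: lt_le_trans p1.
have P0 : 0 < P by exact: lt_le_trans pP.
have C2 : 0 <= 2 * C by rewrite mulr_ge0.
have [_ hs] := all_and2 (fun x => @sconv_sup p f B x p1 h).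
apply: (interp_sup p0 pP _ (sconv_young p1 h) hs); rewrite ?mulr_ge0 ?powR_ge0//.
rewrite !powRM ?mulr_ge0 ?powR_ge0// -!powRrM.
rewrite le_eqVlt; apply/orP; left; apply/eqP.
have e1 : 3 / p * (P - p) = 3 * (p^-1 - P^-1) * P by field; rewrite !gt_eqF.
rewrite e1.
have s (t : R) : 0 <= t -> t `^ (P - p) * t `^ p = t `^ P.
  rewrite le_eqVlt => /predU1P[<-|t0]; last by rewrite -powR_split.
  by rewrite (@powR0 _ p) ?gt_eqF// mulr0 powR0 ?gt_eqF.
by rewrite -(s C)// -?(s B)// -(s 2)// //; ring.
Qed.

End Conv.

Lemma kbound_scale N : schwartz N -> exists2 C, 0 < C &
  forall lam, 0 < lam -> kbound (fun x => lam ^+ 3 * N (lam *: x)) C lam.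
Proof.
move=> sN; have rN := schwartz_rapid sN; have [D D0 hD] := rapid_bounded rN.
pose I := \int[mu]_x `|N x|; have I0 : 0 <= I by exact: Rint_ge0.
(* D bounds N, I is its L^1 norm, which the scaling preserves, and 1 makes the constant positive. *)
exists (1 + D + I); first by rewrite -addrA ltr_pwDl// addr_ge0.
move=> lam l0; have l3 : 0 < lam ^+ 3 by rewrite exprn_gt0.
have r1 : rapid (fun x => N (lam *: x)).
  have := rapid_affine 0 (lt0r_neq0 l0) rN.
  by rewrite (_ : (fun x => N (0 + _)) = fun x => N (lam *: x))//; apply/funext => x; rewrite add0r.
split.
- apply: (rapidM (g := fun=> lam ^+ 3) r1); first exact: measurable3_cst.
  by exists 0%N, `|lam ^+ 3| => x; rewrite expr0 mulr1.
- by rewrite -addrA ltr_pwDl// addr_ge0.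
- move=> x; rewrite normrM (gtr0_norm l3) mulrC ler_wpM2r ?(ltW l3)//.
  by rewrite (le_trans (hD _))// -addrA addrCA lerDl addr_ge0.
- rewrite (_ : \int[mu]_x _ = I); first by rewrite lerDr addr_ge0.
  have h := Rint_affine (0 : E) (lt0r_neq0 l0) (rintegrable_norm (rapid_integ rN)).
  have i := integrable_affine (0 : E) (lt0r_neq0 l0) (rintegrable_norm (rapid_integ rN)).
  transitivity (lam ^+ 3 * \int[mu]_x `|N (0 + lam *: x)|).
    rewrite -RintZ//; apply: Rint_eq => x.
    by rewrite normrM (gtr0_norm l3) add0r.
  by rewrite h gtr0_norm// mulrA mulfV ?mul1r ?gt_eqF.
Qed.

End KernelBound.

(** * Bounds on Littlewood-Paley blocks *)

Section Blocks.
Variables (R : realType) (phi : R3 R -> R).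
Hypothesis lp : littlewood_paley phi.
Local Notation E := (R3 R).
Implicit Types (m : E -> R) (x y : E) (p P B C s t : R) (j k : int) (u : tdist R).

Definition pw s j : R := 2 `^ (j%:~R * s).

Lemma pw_gt0 s j : 0 < pw s j. Proof. exact: powR_gt0. Qed.
Lemma pw_ge0 s j : 0 <= pw s j. Proof. exact: powR_ge0. Qed.
Hint Resolve pw_gt0 pw_ge0 : core.

Lemma pwD s t j : pw (s + t) j = pw s j * pw t j.
Proof. by rewrite /pw mulrDr powRD// pnatr_eq0 implybT. Qed.

Lemma pw0 j : pw 0 j = 1.
Proof. by rewrite /pw mulr0 powRr0. Qed.

Lemma pwN s j : pw (- s) j = (pw s j)^-1.
Proof. by rewrite /pw mulrN powRN. Qed.

Lemma pwK s j : pw s j * pw (- s) j = 1.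
Proof. by rewrite -pwD subrr pw0. Qed.

Lemma pwDz s j k : pw s (j + k) = pw s j * pw s k.
Proof. by rewrite /pw rmorphD mulrDl powRD// pnatr_eq0 implybT. Qed.

Lemma exp2_gt0 j : (0 : R) < 2 ^ j. Proof. exact: exprz_gt0. Qed.
Hint Resolve exp2_gt0 : core.

Lemma pwE s j : (2 ^ j) `^ s = pw s j.
Proof. by rewrite /pw powRrM powR_intmul. Qed.

Lemma pw_nat (n : nat) j : pw n%:R j = (2 ^ j) ^+ n.
Proof. by rewrite -pwE powR_mulrn// ltW. Qed.

Lemma ler_pw s j k : 0 <= s -> j <= k -> pw s j <= pw s k.
Proof. by move=> s0 jk; rewrite /pw ler_powR ?ler1n// ler_wpM2r// ler_int. Qed.

Lemma kb_dyadic m : testfun m ->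
  exists2 C, 0 < C & forall j, kbound (ker (dyadic m j)) C (2 ^ j).
Proof.
move=> tm; have [C C0 h] := kbound_scale (schwartz_ker tm); exists C => // j.
have -> : ker (dyadic m j) = fun x => (2 ^ j) ^+ 3 * ker m (2 ^ j *: x).
  by apply/funext => y; rewrite ker_dyadic.
exact: h.
Qed.

(** Division by 2^j turns the derivative of the dilated kernel into the dilate of a fixed Schwartz
    function, so that [kbound] holds with a constant independent of j. *)
Definition dker i m j x := (2 ^ j)^-1 * partial i (ker (dyadic m j)) x.

Lemma kb_partial i m : testfun m ->
  exists2 C, 0 < C & forall j, kbound (dker i m j) C (2 ^ j).
Proof.
move=> tm; have sk := schwartz_ker tm.
have [C C0 h] := kbound_scale (schwartz_partial i sk); exists C => // j.
suff -> : dker i m j = fun x => (2 ^ j) ^+ 3 * partial i (ker m) (2 ^ j *: x) by exact: h.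
apply/funext => x; rewrite /dker.
have -> : ker (dyadic m j) = fun x => (2 ^ j) ^+ 3 * ker m (2 ^ j *: x).
  by apply/funext => y; rewrite ker_dyadic.
have sd : smooth (fun x => ker m (2 ^ j *: x)) by apply: smooth_dilate; exact: sk.1.
have -> : partial i (fun x => (2 ^ j) ^+ 3 * ker m (2 ^ j *: x)) =
    fun x => (2 ^ j) ^+ 3 * partial i (fun x => ker m (2 ^ j *: x)) x.
  rewrite partialM//; last exact: smooth_cst.
  by rewrite partial_cst; apply/funext => y; rewrite mulr0 addr0.
rewrite partial_dilate; last exact: sk.1.
by field; rewrite gt_eqF.
Qed.

Notation blk := (lp_block phi).

Lemma symphi j : symbol (dyadic phi j). Proof. exact: dyadic_symbol. Qed.
Lemma symchi j : symbol (dyadic (chi phi) j). Proof. by apply: symbol_dyadic; exact: chi_symbol. Qed.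

Lemma blk_measurable j u : measurable3 (blk j u).
Proof. by apply: measurable_multiplier; case: (symphi j). Qed.

Lemma multiplier_sconv m n u : symbol m -> testfun n ->
  multiplier (fun xi => m xi * n xi) u = sconv (ker m) (multiplier n u).
Proof. by move=> sm tn; apply/funext => x; rewrite -multiplier_comp. Qed.

(** Because [chi] is 1 on the support of [phi], a block is its own convolution with a kernel of
    scale 2^(-j); Bernstein's inequalities for blocks come from this identity. *)
Lemma blk_self j u : blk j u = sconv (ker (dyadic (chi phi) j)) (blk j u).
Proof.
rewrite -multiplier_sconv; [|exact: symchi|by case: (symphi j)].
by rewrite /lp_block; congr (multiplier _ u); apply/funext => xi; rewrite dyadic_chi_phi.
Qed.

Lemma inv_self j u : multiplier (invsq (dyadic phi j)) u =
  fun x => (2 ^ j) ^- 2 * sconv (ker (dyadic (invsq (chi phi)) j)) (blk j u) x.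
Proof.
have si : symbol (dyadic (invsq (chi phi)) j) by apply: symbol_dyadic; exact: invsq_chi_symbol.
rewrite -multiplier_sconv; [|exact: si|by case: (symphi j)].
apply/funext => x; rewrite -multiplier_symZ; last by case: (symbolM si (symphi j)).
by congr (multiplier _ u x); apply/funext => xi; rewrite invsq_phiE// mulrA.
Qed.

Lemma der_self i j u : blk j (dpartial i u) =
  fun x => 2 ^ j * sconv (dker i (chi phi) j) (blk j u) x.
Proof.
apply/funext => x; have tp : testfun (dyadic phi j) by case: (symphi j).
have := multiplier_dpartial_conv i u x (symchi j) tp.
rewrite (_ : (fun xi => _) = dyadic phi j); last by apply/funext => xi; rewrite dyadic_chi_phi.
rewrite /lp_block => ->; rewrite /sconv -RintZ.
  by apply: Rint_eq => y; rewrite /dker !mulrA mulfV ?mul1r// gt_eqF.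
have sd : schwartz (partial i (ker (dyadic (chi phi) j))).
  by apply: schwartz_partial; apply: schwartz_ker; case: (symchi j).
have rd := rapid_reflect x (schwartz_rapid sd).
have := rintegrableZ (2 ^ j)^-1 (rapid_integ (rapid_multiplier u tp rd)).
by move=> hh; apply: (eq_integ _ hh) => y; rewrite /dker mulrA mulrAC.
Qed.

Lemma blk_sup p : 1 <= p -> exists2 C, 0 < C & forall u j B, lpb p (blk j u) B ->
  forall x, `|blk j u x| <= C * (pw (3 / p) j * B).
Proof.
move=> p1; have [C C0 kb] := kb_dyadic (chi_symbol lp).1.
exists (2 * C); first by rewrite mulr_gt0.
move=> u j B h x; rewrite blk_self -pwE.
exact: (sconv_sup (exp2_gt0 j) (kb j) x p1 h).2.
Qed.

Lemma blk_interp p P : 1 <= p -> p <= P ->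
  exists2 C, 0 < C & forall u j B, lpb p (blk j u) B ->
  lpb P (blk j u) (C * (pw (3 * (p^-1 - P^-1)) j * B)).
Proof.
move=> p1 pP; have [C C0 kb] := kb_dyadic (chi_symbol lp).1.
exists (2 * C); first by rewrite mulr_gt0.
move=> u j B h; rewrite blk_self -pwE.
exact: (sconv_interp (exp2_gt0 j) (kb j) p1 pP h).
Qed.

Lemma inv_lpb p : 1 <= p -> exists2 C, 0 < C & forall u j B, lpb p (blk j u) B ->
  lpb p (multiplier (invsq (dyadic phi j)) u) (C * (pw (- 2) j * B)).
Proof.
move=> p1; have [C C0 kb] := kb_dyadic (invsq_chi_symbol lp).1.
exists (2 * C); first by rewrite mulr_gt0.
move=> u j B h; rewrite inv_self pwN pw_nat.
have p0 : 0 <= p by rewrite (le_trans _ p1).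
have := lpbZ ((2 ^ j) ^- 2) p0 (sconv_young (kb j) p1 h).
by rewrite ger0_norm ?invr_ge0 ?exprn_ge0 ?ltW// mulrCA.
Qed.

Lemma inv_sup p : 1 <= p -> exists2 C, 0 < C & forall u j B, lpb p (blk j u) B ->
  forall x, `|multiplier (invsq (dyadic phi j)) u x| <= C * (pw (3 / p - 2) j * B).
Proof.
move=> p1; have [C C0 kb] := kb_dyadic (invsq_chi_symbol lp).1.
exists (2 * C); first by rewrite mulr_gt0.
move=> u j B h x; rewrite inv_self pwD pwN pw_nat.
have e0 : 0 <= ((2 : R) ^ j) ^- 2 by rewrite invr_ge0 exprn_ge0// ltW.
rewrite normrM (ger0_norm e0) (mulrC (pw _ _)) -[X in _ <= _ * X]mulrA [leRHS]mulrCA.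
rewrite ler_wpM2l// -pwE.
exact: (sconv_sup (exp2_gt0 j) (kb j) x p1 h).2.
Qed.

Lemma der_lpb p : 1 <= p -> exists2 C, 0 < C & forall i u j B, lpb p (blk j u) B ->
  lpb p (blk j (dpartial i u)) (C * (pw 1 j * B)).
Proof.
move=> p1; have p0 : 0 <= p by rewrite (le_trans _ p1).
have h1 i : {C | 0 < C & forall u j B, lpb p (blk j u) B ->
    lpb p (blk j (dpartial i u)) (C * (pw 1 j * B))}.
  apply: cid2; have [C C0 kb] := kb_partial i (chi_symbol lp).1.
  exists (2 * C); first by rewrite mulr_gt0.
  move=> u j B h; rewrite der_self (pw_nat 1) expr1.
  have := lpbZ (2 ^ j) p0 (sconv_young (kb j) p1 h).
  by rewrite ger0_norm ?ltW// mulrCA.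
pose C := 1 + \sum_(i < 3) s2val (h1 i).
have C_ge i : s2val (h1 i) <= C.
  rewrite /C (bigD1 i)//= addrCA lerDl addr_ge0// sumr_ge0// => k _.
  exact: ltW (s2valP (h1 k)).
have C0 : 0 < C.
  by rewrite ltr_pwDl// sumr_ge0// => i _; exact: ltW (s2valP (h1 i)).
exists C => // i u j B h; apply: (lpb_weak p0 ((s2valP' (h1 i)) _ _ _ h)).
by rewrite ler_wpM2r// mulr_ge0// (lpb_ge0 h).
Qed.

End Blocks.
#[global] Hint Extern 0 (is_true (_ < pw _ _)) => exact: pw_gt0 : core.
#[global] Hint Extern 0 (is_true (_ <= pw _ _)) => exact: pw_ge0 : core.

(** * Besov norms and the inverse Laplacian *)

Section WindowSums.
Variable R : realType.
Implicit Types (a b : int -> R) (B : R).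

Definition window n : seq int := [seq Posz i | i <- iota 0 n] ++ [seq Negz i | i <- iota 0 n].

Lemma window_uniq n : uniq (window n).
Proof.
rewrite cat_uniq !map_inj_uniq ?iota_uniq ?andbT//=; [|by move=> ? ? []|by move=> ? ? []].
by apply/hasPn => _ /mapP[i _ ->]; apply/negP => /mapP[].
Qed.

Lemma mem_window n (j : int) : (absz j < n)%N -> j \in window n.
Proof.
case: j => i h; rewrite mem_cat; apply/orP; [left|right]; apply: map_f; rewrite mem_iota.
  exact: h.
exact: ltnW h.
Qed.

Lemma wsumE (V : nmodType) (a : int -> V) n : wsum a n = \sum_(j <- window n) a j.
Proof.
rewrite /wsum big_split big_cat !big_map /=.
rewrite -(big_mkord xpredT (fun i => a (Posz i))) -(big_mkord xpredT (fun i => a (Negz i))).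
by rewrite /index_iota !subn0.
Qed.

(** A sum of nonnegative terms over Z is a supremum over finite sets, and each finite set is
    contained in a window. *)
Lemma esum_wsum a B : (forall j, 0 <= a j) ->
  (\esum_(j in [set: int]) (a j)%:E <= B%:E)%E <-> forall n, wsum a n <= B.
Proof.
move=> a0; split=> [h n|h].
  rewrite -lee_fin; apply: le_trans h; apply: ereal_sup_ubound.
  exists [set` window n]; first by split=> //; exact: finite_seq.
  by rewrite -fsbig_seq ?window_uniq// sumEFin wsumE.
apply: ge_ereal_sup => _ [X [fX _] <-].
have [n hn] : exists n, X `<=` [set` window n].
  have /finite_seqP[s Xs] := fX; exists (\max_(j <- s) absz j).+1 => j Xj.
  have js : j \in s by move: Xj; rewrite Xs.
  apply: mem_window; rewrite ltnS; exact: leq_bigmax_seq.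
apply: (@le_trans _ _ (\sum_(j \in [set` window n]) (a j)%:E)%E).
  apply: lee_fsum_nneg_subset => //; first exact: finite_seq.
    by move=> j /set_mem/hn hj; exact: mem_set.
  by move=> j _; rewrite lee_fin.
rewrite -fsbig_seq; last exact: window_uniq.
by rewrite sumEFin -wsumE lee_fin.
Qed.

Lemma ler_wsum a b n : (forall j, a j <= b j) -> wsum a n <= wsum b n.
Proof. by move=> ab; apply: ler_sum => i _; exact: lerD. Qed.

Lemma wsumZ (c : R) a n : wsum (fun j => c * a j) n = c * wsum a n.
Proof. by rewrite /wsum mulr_sumr; apply: eq_bigr => i _; rewrite mulrDr. Qed.

Lemma wsum_term a (j : int) B : (forall j, 0 <= a j) -> (forall n, wsum a n <= B) -> a j <= B.
Proof.
move=> a0 h; apply: le_trans (h (absz j).+1); rewrite wsumE.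
rewrite (big_rem j) /=; last by apply: mem_window.
by rewrite lerDl sumr_ge0.
Qed.

Lemma geo_sum (x : R) n : 0 <= x -> x < 1 -> \sum_(i < n) x ^+ i <= (1 - x)^-1.
Proof.
move=> x0 x1; have h : 0 < 1 - x by rewrite subr_gt0.
rewrite -[leRHS]mul1r ler_pdivlMr//.
have := subrXX 1 x n; rewrite expr1n => e.
rewrite mulrC (_ : \sum_(i < n) _ = \sum_(i < n) 1 ^+ (n.-1 - i) * x ^+ i); last first.
  by apply: eq_bigr => i _; rewrite expr1n mul1r.
rewrite (_ : (1 - x) * _ = 1 - x ^+ n).
  by rewrite lerBlDr lerDl exprn_ge0.
rewrite e; congr (_ * _); apply: eq_bigr => i _; congr (1 ^+ _ * _).
Qed.

Lemma geo_wsum (k : R) : 0 < k -> exists2 G, 0 < G &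
  forall n, wsum (fun j => pw (- k) (absz j)%:Z) n <= G.
Proof.
move=> k0; pose x : R := 2 `^ (- k).
have x0 : 0 < x by exact: powR_gt0.
have x1 : x < 1.
  rewrite /x powRN invf_lt1 ?powR_gt0//.
  by have := gt0_ltr_powR k0 ler01 (ler0n R 2) (ltr1n R 2); rewrite powR1; apply.
have h : 0 < (1 - x)^-1 by rewrite invr_gt0 subr_gt0.
exists ((1 - x)^-1 + (1 - x)^-1); first exact: addr_gt0.
move=> n; rewrite /wsum big_split; apply: lerD.
  apply: le_trans (geo_sum n (ltW x0) x1); apply: ler_sum => i _.
  by rewrite /pw mulrC powRrM powR_mulrn ?powR_ge0.
apply: le_trans (geo_sum n (ltW x0) x1); apply: ler_sum => i _.
rewrite /pw mulrC powRrM powR_mulrn ?powR_ge0// -/x exprS.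
by rewrite ler_piMl ?exprn_ge0 ?ltW.
Qed.

End WindowSums.

(** * Distributions defined by series of functions *)

Section Realization.
Variable R : realType.
Local Notation E := (R3 R).
Local Notation mu := (lebesgue3 R).
Implicit Types (f g psi : E -> R) (x : E).

Lemma schwartz_wt6 psi x : schwartz psi ->
  wt x ^+ 6 * `|psi x| <= fine (schwartz_seminorm 6 psi).
Proof. by move=> sp; exact: (@schwartz_seminormE _ psi 6 [::] x sp). Qed.

Variables (v : int -> E -> R) (b : int -> R) (S : R).
Hypothesis vb : forall j, wl1 (v j) (b j).
Hypothesis bS : forall n, wsum b n <= S.

Lemma pairing_bound psi (K : R) : rapid psi -> (forall x, wt x ^+ 6 * `|psi x| <= K) ->
  exists2 l, sumZ (fun j => \int[mu]_x (v j x * psi x)) l & `|l| <= K * S + K * S.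
Proof.
move=> rp hK; have K0 : 0 <= K.
  by apply: le_trans (hK 0); rewrite mulr_ge0// exprn_ge0.
apply: sumZ_abs => n.
apply: (@le_trans _ _ (K * wsum b n)); last by rewrite ler_wpM2l.
by rewrite -wsumZ; apply: ler_sum => i _; apply: lerD; exact: (wl1_pair (vb _) rp.1 K0 hK).2.
Qed.

(** The sum of the series, obtained by choice. With [schwartz psi] inside the set, the default value
    0 is taken outside the Schwartz class, as [tempered] demands. *)
Definition realize_fun psi : R :=
  xget 0 [set l | schwartz psi /\ sumZ (fun j => \int[mu]_x (v j x * psi x)) l].

Lemma realize_funP psi : schwartz psi ->
  sumZ (fun j => \int[mu]_x (v j x * psi x)) (realize_fun psi).
Proof.
move=> sp; have [l hl _] := pairing_bound (schwartz_rapid sp) (fun x => schwartz_wt6 x sp).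
by have [] := xgetPex 0 (ex_intro (fun l => schwartz psi /\ sumZ (fun j => \int[mu]_x (v j x * psi x)) l) l (conj sp hl)).
Qed.

Lemma realize_fun_le psi (K : R) : schwartz psi -> (forall x, wt x ^+ 6 * `|psi x| <= K) ->
  `|realize_fun psi| <= K * S + K * S.
Proof.
move=> sp hK; have [l hl] := pairing_bound (schwartz_rapid sp) hK.
by rewrite (sumZ_unique (realize_funP sp) hl).
Qed.

Lemma realize_tempered : realize_fun \in @tempered R.
Proof.
apply/asboolP; split.
- move=> a f g sf sg; apply: sumZ_unique (realize_funP (schwartz_lin a sf sg)) _.
  have := sumZ_lin a (realize_funP sf) (realize_funP sg).
  apply: sumZ_ext => j; rewrite -RintZ; last first.
    by have [] := wl1_pair (vb j) (schwartz_rapid sf).1 _ (fun x => schwartz_wt6 x sf); rewrite ?fine_ge0 ?seminorm_ge0.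
  rewrite -RintD; last 2 first.
  + apply: rintegrableZ.
    by have [] := wl1_pair (vb j) (schwartz_rapid sf).1 _ (fun x => schwartz_wt6 x sf); rewrite ?fine_ge0 ?seminorm_ge0.
  + by have [] := wl1_pair (vb j) (schwartz_rapid sg).1 _ (fun x => schwartz_wt6 x sg); rewrite ?fine_ge0 ?seminorm_ge0.
  by apply: Rint_eq => x; rewrite mulrDr mulrCA.
- exists (S + S), 6%N => f sf.
  have /fineK <- : schwartz_seminorm 6 f \is a fin_num.
    by rewrite ge0_fin_numE ?seminorm_ge0//; case: sf => _; exact.
  rewrite -EFinM lee_fin mulrC mulrDr.
  exact: realize_fun_le sf (fun x => schwartz_wt6 x sf).
- move=> f nf; rewrite /realize_fun xgetPN// => l [sf _]; exact: nf.
Qed.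

Definition realize := TDist realize_tempered.

Lemma sums_to_realize : sums_to v realize.
Proof. by move=> psi sp; exact: realize_funP. Qed.

End Realization.

Lemma uniq_neighbours (k : int) : uniq [:: k - 1; k; k + 1].
Proof. by rewrite /= !inE; apply/and3P; split=> //; lia. Qed.

Lemma notin_neighbours (j k : int) : j \notin [:: k - 1; k; k + 1] -> (2 <= `|k - j|)%R.
Proof. by rewrite !inE; lia. Qed.

Section Besov.
Variables (R : realType) (phi : R3 R -> R).
Hypothesis lp : littlewood_paley phi.
Local Notation E := (R3 R).
Local Notation mu := (lebesgue3 R).
Notation blk := (lp_block phi).
Implicit Types (f : E -> R) (x y : E) (p r s A B C : R) (j k : int) (u v w : tdist R).

(* The Besov norm of [u] is at most [A], see [besP]; [c j] bounds 2^(js) times the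
   L^p norm of the block of index [j]. *)
Definition bes s p r u A := exists c : int -> R,
  [/\ forall j, 0 <= c j, forall j, lpb p (blk j u) (pw (- s) j * c j), 0 <= A
    & forall n, wsum (fun j => c j `^ r) n <= A `^ r].

(** From the norm to [bes], the witnesses are the terms of the norm themselves; they are finite
    because the sum of their powers is. *)
Lemma besP s p r u A : 1 <= p -> 1 <= r -> 0 <= A ->
  bes s p r u A <-> (besov_norm phi s p%:E r%:E u <= A%:E)%E.
Proof.
move=> p1 r1 A0; have p0 : 0 < p by exact: lt_le_trans p1.
have r0 : 0 < r by exact: lt_le_trans r1.
have rV : 0 < r^-1 by rewrite invr_gt0.
pose a j := ((2 `^ (j%:~R * s))%:E * 'N[mu]_p%:E[EFin \o blk j u])%E.
rewrite (_ : besov_norm phi s p%:E r%:E u = ((\esum_(j in [set: int]) (`|a j| `^ r)) `^ r^-1)%E)//.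
have a0 j : (0 <= a j)%E by rewrite mule_ge0 ?lee_fin ?powR_ge0 ?Lnorm_ge0.
have pwr (x : \bar R) : (0 <= x)%E -> ((x `^ r^-1 <= A%:E) <-> (x <= (A `^ r)%:E))%E.
  move=> x0; split=> h.
    rewrite -[leLHS]poweRe1// -(mulVf (lt0r_neq0 r0)) poweRrM -poweR_EFin.
    by apply: gt0_ler_poweR; rewrite ?in_itv/= ?leey ?poweR_ge0 ?lee_fin ?A0// ltW.
  apply: (@le_trans _ _ ((A `^ r)%:E `^ r^-1)%E).
    by apply: gt0_ler_poweR; rewrite ?in_itv/= ?leey ?x0 ?lee_fin ?powR_ge0// ltW.
  by rewrite poweR_EFin -powRrM mulfV ?gt_eqF// powRr1.
have e0 : (0 <= \esum_(j in [set: int]) (`|a j| `^ r))%E.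
  by apply: esum_ge0 => j _; exact: poweR_ge0.
split=> [[c [c0 hc _ cA]]|/(pwr _ e0) h].
  apply/(pwr _ e0).
  have := (esum_wsum (A `^ r) (fun j => powR_ge0 (c j) r)).2 cA; apply: le_trans.
  apply: le_esum => j _; rewrite -poweR_EFin; apply: gt0_ler_poweR.
  - exact: ltW.
  - by rewrite in_itv/= abse_ge0 leey.
  - by rewrite in_itv/= leey lee_fin c0.
  - rewrite gee0_abs//; have mb := lpb_measurable (hc j).
    have := (lpb_Lnorm p0 mb (lpb_ge0 (hc j))).1 (hc j).
    rewrite /a -/(pw s j) => hn.
    apply: (le_trans (lee_wpmul2l _ hn)); first by rewrite lee_fin.
    by rewrite -EFinM lee_fin mulrA pwK mul1r.
have afin j : (a j < +oo)%E.
  have : (`|a j| `^ r <= (A `^ r)%:E)%E.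
    apply: le_trans h; apply: esum_ge; exists [set j]; last by rewrite fsbig_set1.
    by split=> //; exact: finite_set1.
  rewrite gee0_abs//; case: (a j) (a0 j) => [t _ _|_ |//]; first exact: ltry.
  by rewrite poweRyr ?gt_eqF.
have aE j : a j = (fine (a j))%:E by rewrite fineK// ge0_fin_numE.
exists (fun j => fine (a j)); split=> //.
- by move=> j; rewrite fine_ge0.
- move=> j; have mb := blk_measurable lp j u.
  have B0 : 0 <= pw (- s) j * fine (a j) by rewrite mulr_ge0// fine_ge0.
  apply/(lpb_Lnorm p0 mb B0); rewrite EFinM -aE /a -/(pw s j) muleA -EFinM.
  by rewrite mulrC pwK mul1e.
- apply/esum_wsum => [j|]; first exact: powR_ge0.
  apply: le_trans h; apply: le_esum => j _.
  by rewrite -poweR_EFin -aE gee0_abs.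
Qed.

Lemma bes_term s p r u A : 1 <= p -> 1 <= r -> bes s p r u A ->
  forall j, lpb p (blk j u) (pw (- s) j * A).
Proof.
move=> p1 r1 [c [c0 hc A0 hA]] j; have r0 : 0 < r by exact: lt_le_trans r1.
apply: (lpb_weak (le_trans ler01 p1) (hc j)); rewrite ler_wpM2l//.
have h : c j `^ r <= A `^ r by exact: (@wsum_term _ (fun j => c j `^ r) j _ (fun j => powR_ge0 _ _) hA).
rewrite leNgt; apply/negP => Ac.
by have := gt0_ltr_powR r0 A0 (c0 j) Ac; rewrite ltNge h.
Qed.

(** Bounds on single blocks are made summable over Z in L^1 with weight [omega]: through L^p for j
    >= 0, where 2^(-j (3/p - 1)) decays because p < 3, and through L^oo for j < 0, where 2^j
    decays. *)
Lemma low_high_wl1 p : 1 <= p -> p < 3 -> exists2 G, 0 < G &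
  exists2 b : int -> R, (forall n, wsum b n <= G) &
  forall f j B, 0 <= B -> lpb p f (pw (- (3 / p - 1)) j * B) ->
    (forall x, `|f x| <= pw 1 j * B) -> wl1 f (B * b j).
Proof.
move=> p1 p3; have p0 : 0 < p by exact: lt_le_trans p1.
pose k := Num.min 1 (3 / p - 1).
have k0 : 0 < k by rewrite lt_min ltr01/= subr_gt0 ltr_pdivlMr// mul1r.
have [G G0 hG] := geo_wsum k0; pose W : R := 2 * womega R.
have W0 : 0 < W by rewrite mulr_gt0// (lt_le_trans ltr01)// womega_ge1.
exists (W * G); first exact: mulr_gt0.
exists (fun j => W * pw (- k) (absz j)%:Z).
  by move=> n; rewrite wsumZ ler_wpM2l// ltW.
move=> f j B B0 hL hS.
have le_pw1 (t : R) (i : nat) : k <= t -> pw (- t) i%:Z <= pw (- k) i%:Z.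
  by move=> kt; rewrite /pw ler_powR ?ler1n// ler_wpM2l ?lerN2// ler0z.
case: j hL hS => i hL hS.
  have [mf fi fb] := lpb_wl1 p1 hL; split=> //; apply: (le_trans fb).
  rewrite -/W [leLHS]mulrA [leRHS]mulrC ler_wpM2r// ler_wpM2l ?(ltW W0)//.
  by apply: le_pw1; rewrite /k ge_min lexx orbT.
have [mf fi fb] := bounded_wl1 (lpb_measurable hL) hS; split=> //; apply: (le_trans fb).
rewrite [leLHS]mulrA [leRHS]mulrC ler_wpM2r//.
apply: (@le_trans _ _ (W * pw 1 (Negz i))).
  by rewrite ler_wpM2r// /W ler_peMl ?ler1n// (le_trans ler01)// womega_ge1.
rewrite ler_wpM2l ?(ltW W0)//.
have -> : pw (1 : R) (Negz i) = pw (- 1) i.+1%:Z.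
  by rewrite /pw NegzE mulrN mulr1 rmorphN /= mulr1.
by apply: le_pw1; rewrite /k ge_min lexx.
Qed.

(** The functions [m j] are bounded by 2^(-j (3/p - 1)) in L^p and by 2^j in L^oo, so [low_high_wl1]
    sums them to a distribution w. The Besov bound on w then requires its blocks to be these
    functions. *)
Theorem inv_laplacian_exists p r : 1 <= p -> p < 3 -> 1 <= r -> exists2 C, 0 < C &
  forall v A, bes (3 / p - 3) p r v A -> exists w, [/\ inv_laplacian phi 1 v w,
    bes (3 / p - 1) p r w (C * A) & sums_to (fun j => blk j w) w].
Proof.
move=> p1 p3 r1; have p0 : 0 <= p by exact: le_trans p1.
have [C1 C10 h1] := inv_lpb lp p1; have [C2 C20 h2] := inv_sup lp p1.
have [G G0 [b hb wb]] := low_high_wl1 p1 p3.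
exists C1 => // v A hv; have A0 : 0 <= A by case: hv => c [].
have vA := bes_term p1 r1 hv.
pose m j := multiplier (invsq (dyadic phi j)) v.
pose C := C1 + C2; have C0 : 0 <= C by rewrite addr_ge0 ?ltW.
have B0 : 0 <= C * A by rewrite mulr_ge0.
have mb j : wl1 (m j) (C * A * b j).
  apply: wb => //.
    apply: (lpb_weak p0 (h1 _ _ _ (vA j))); rewrite [pw (- 2) j * _]mulrA -pwD.
    rewrite (_ : - 2 - (3 / p - 3) = - (3 / p - 1)); last by ring.
    by rewrite mulrCA ler_wpM2l// ler_wpM2r// /C lerDl ltW.
  move=> x; apply: (le_trans (h2 _ _ _ (vA j) x)); rewrite [pw _ j * (_ * _)]mulrA -pwD.
  rewrite (_ : 3 / p - 2 - (3 / p - 3) = 1); last by ring.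
  by rewrite mulrCA ler_wpM2l// ler_wpM2r// /C lerDr ltW.
have mS n : wsum (fun j => C * A * b j) n <= C * A * G by rewrite wsumZ ler_wpM2l.
pose w := realize mb mS; have ws : sums_to m w := sums_to_realize mb mS.
have sp j := invsq_phi_symbol lp j.
(* Testing w with the kernel of block k leaves the indices k - 1, k and k + 1 by disjointness of the
   annuli; the three symbols add up to [chi] at scale k, which is 1 on the annulus. *)
have bw k : blk k w = m k.
  apply/funext => x; have sk : schwartz (ker (dyadic phi k)) by apply: schwartz_ker; case: (symphi lp k).
  have sr := schwartz_reflect x sk.
  have h := ws _ sr.
  pose M j := multiplier (fun xi => dyadic phi k xi * invsq (dyadic phi j) xi) v x.
  have E1 j : \int[mu]_y (m j y * ker (dyadic phi k) (x - y)) = M j.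
    rewrite /M -multiplier_comp; [|exact: symphi|by case: (sp j)].
    by apply: Rint_eq => y; rewrite mulrC.
  have {}h : sumZ M (blk k w x) by apply: sumZ_ext h => j; exact: E1.
  have sM j : testfun (fun xi => dyadic phi k xi * invsq (dyadic phi j) xi).
    by case: (symbolM (symphi lp k) (sp j)).
  have hf := @sumZ_fin R M [:: k - 1; k; k + 1] (uniq_neighbours k).
  rewrite (sumZ_unique h (hf _)); last first.
    move=> j /notin_neighbours jk; rewrite /M (_ : (fun xi => _) = fun=> 0).
      by rewrite /multiplier /inv_fourier -[RHS](tdist0 v); congr (tdist_val v); apply/funext => y;
        rewrite (_ : \int[mu]_xi _ = 0) ?mulr0// -[RHS](Rint0 mu); apply: Rint_eq => xi; rewrite mulr0.
    apply/funext => xi; by rewrite /invsq mulrCA dyadic_orth ?mulr0.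
  rewrite !big_cons big_nil addr0 addrA /M -multiplier_symD//.
  rewrite -multiplier_symD//; last exact: testfunD.
  congr (multiplier _ v x); apply/funext => xi.
  rewrite /invsq -!mulrDr -dyadic_chiE mulrCA -[in RHS](dyadic_chi_phi lp).
  by rewrite [in LHS](mulrC (dyadic phi k xi)).
exists w; split.
- by move=> psi spsi; have := ws _ spsi; apply: sumZ_ext => j; apply: Rint_eq => x;
    congr (_ * _); rewrite /m; congr (multiplier _ v x); apply/funext => xi; rewrite mul1r.
- case: hv => c [c0 hc _ hA]; exists (fun j => C1 * c j); split.
  + by move=> j; rewrite mulr_ge0// ltW.
  + move=> j; rewrite bw; apply: (lpb_weak p0 (h1 _ _ _ (hc j))).
    rewrite [pw (- 2) j * _]mulrA -pwD (_ : - 2 - (3 / p - 3) = - (3 / p - 1)); last by ring.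
    by rewrite mulrCA.
  + by rewrite mulr_ge0// ltW.
  + move=> n; rewrite powRM ?(ltW C10)//.
    have -> : (fun j => (C1 * c j) `^ r) = fun j => C1 `^ r * c j `^ r.
      by apply/funext => j; rewrite powRM ?(ltW C10).
    by rewrite wsumZ ler_wpM2l// powR_ge0.
- by move=> psi spsi; have := ws _ spsi; apply: sumZ_ext => j; rewrite bw.
Qed.

End Besov.

(** * Symmetry of second derivatives *)

Section SymmetricDerivatives.
Variable R : realType.
Local Notation E := (R3 R).
Implicit Types (f g : E -> R) (x y z : E).

Lemma mvt_line f x v (t : R) : (forall s : R, derivable f (x + s *: v) v) -> 0 < t ->
  exists2 s : R, 0 < s < t & f (x + t *: v) - f x = 'D_v f (x + s *: v) * t.
Proof.
move=> df t0; pose g (s : R) := f (x + s *: v).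
have dg (s : R) : is_derive s 1 g ('D_v f (x + s *: v)).
  by apply/is_derive_line; apply: DeriveDef.
have cg : continuous g by move=> s; apply: differentiable_continuous; apply/derivable1_diffP; exact: ex_derive.
have [c ct h] := MVT t0 (fun s _ => dg s) (continuous_subspaceT cg).
exists c; first by move: ct; rewrite in_itv.
have -> : f x = g 0 by rewrite /g scale0r addr0.
by rewrite -[f (x + t *: v)]/(g t) h subr0.
Qed.

(** Two mean value theorems: along e_i for the increment y -> f(y + t e_k) - f(y), then along e_k
    for the i-th partial derivative. *)
Lemma mixed_difference f x i k (t : R) : smooth f -> 0 < t ->
  exists a b : R, [/\ 0 < a < t, 0 < b < t &
   f (x + t *: basis R i + t *: basis R k) - f (x + t *: basis R i)
     - (f (x + t *: basis R k) - f x) =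
   partial k (partial i f) (x + a *: basis R i + b *: basis R k) * t * t].
Proof.
move=> sf t0; pose g y := f (y + t *: basis R k) - f y.
have sh : smooth (fun y => f (y + t *: basis R k)).
  have := sf; have st s : partials s (fun y => f (y + t *: basis R k)) = fun y => partials s f (y + t *: basis R k).
    by rewrite -{1}(opprK (t *: basis R k)) partials_translate//; apply/funext => y; rewrite opprK.
  move=> _; apply: (@smooth_class R [set h | exists2 f', smooth f' & h = fun y => f' (y - - (t *: basis R k))]).
  - move=> _ [f' sf' ->] y; apply: (@continuous_comp _ _ _ (fun y : E => y - - (t *: basis R k)) f').
      by apply: cvgB; [exact: cvg_id|exact: cvg_cst].
    exact: smooth_continuous.
  - move=> _ [f' sf' ->] j y; apply: ex_derive; apply/is_derive_line0.
    have /is_derive_line0 := smooth_is_derive j (y - - (t *: basis R k)) sf'.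
    by congr is_derive; apply/funext => s; rewrite addrAC.
  - move=> _ [f' sf' ->] j; exists (partial j f'); first exact: smooth_partial.
    exact: (partials_translate [:: j] _ sf').
  - by exists f => //; apply/funext => y; rewrite opprK.
have dsh j y : partial j (fun y => f (y + t *: basis R k)) y = partial j f (y + t *: basis R k).
  have := partials_translate [:: j] (- (t *: basis R k)) sf.
  under eq_fun do rewrite opprK.
  by move=> /(congr1 (fun h => h y)) /=; rewrite opprK.
have dg y : is_derive y (basis R i) g (partial i f (y + t *: basis R k) - partial i f y).
  have := is_derive_add (smooth_is_derive i y sh) (is_derive_scale (-1) (smooth_is_derive i y sf)).
  rewrite dsh mulN1r; congr is_derive.
  by apply/funext => z; rewrite mulN1r.
have dgd (s : R) : derivable g (x + s *: basis R i) (basis R i).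
  by apply: ex_derive; exact: dg.
have [a at_ ha] := mvt_line dgd t0.
have dfd (s : R) : derivable (partial i f) (x + a *: basis R i + s *: basis R k) (basis R k).
  by apply: smooth_derivable; exact: smooth_partial.
have [b bt hb] := mvt_line dfd t0.
exists a, b; split=> //.
rewrite -[LHS]/(g (x + t *: basis R i) - g x) ha.
by rewrite (@derive_val _ _ _ _ _ _ _ (dg (x + a *: basis R i))) hb.
Qed.

Lemma common_quotient (a b c d t : R) : 0 < t -> c = a * t * t -> d = b * t * t -> c = d -> a = b.
Proof.
move=> t0 -> -> h; have tt : t != 0 by rewrite gt_eqF.
exact: (mulIf tt (mulIf tt h)).
Qed.

Lemma difference_swap (a b c d : R) : a - b - (c - d) = a - c - (b - d).
Proof. ring. Qed.

Lemma two_close (a b y e : R) : `|a - y| < e / 2 -> `|b - y| < e / 2 -> `|a - b| <= e.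
Proof.
move=> h1 h2; rewrite -(subrKA y) (le_trans (ler_normD _ _))//.
by rewrite [leRHS]splitr lerD ?ltW// distrC.
Qed.

Lemma pair_dist x i k (a b t : R) : 0 < a -> a < t -> 0 < b -> b < t ->
  enorm (x - (x + a *: basis R i + b *: basis R k)) < t + t.
Proof.
move=> a0 at_ b0 bt.
have -> : x - (x + a *: basis R i + b *: basis R k) = - (a *: basis R i + b *: basis R k).
  by rewrite !opprD !addrA subrr sub0r.
rewrite enormN (le_lt_trans (enormD _ _))// !enormZ !enorm_basis !mulr1.
by rewrite !gtr0_norm// ltrD.
Qed.

(** Schwarz's theorem: the second difference over a square of side t is symmetric in the two
    directions and equals t^2 times either mixed derivative at some point of the square; both
    derivatives are continuous as t tends to 0. *)
Lemma partialC i k f : smooth f -> partial i (partial k f) = partial k (partial i f).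
Proof.
move=> sf; apply/funext => x; apply/eqP; rewrite -subr_eq0 -normr_le0.
apply/ler_addgt0Pr => e e0; rewrite add0r.
have cont j l : continuous (partial j (partial l f)).
  by apply: smooth_continuous; do 2 apply: smooth_partial.
have e2 : 0 < e / 2 by rewrite divr_gt0.
have near_cont j l : exists2 d : R, 0 < d & forall y, enorm (x - y) < d ->
    `|partial j (partial l f) x - partial j (partial l f) y| < e / 2.
  have := cont j l x; move/cvgrPdist_lt => /(_ _ e2)/nbhs_ballP[d /= d0 hd].
  exists d => // y xy; apply: hd; rewrite -ball_normE /=.
  by rewrite (le_lt_trans (max_le_enorm _)).
have [d1 d10 h1] := near_cont i k; have [d2 d20 h2] := near_cont k i.
pose t := Num.min d1 d2 / 2.
have t0 : 0 < t by rewrite divr_gt0// lt_min d10.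
have [a [b [/andP[a0 at_] /andP[b0 bt] hab]]] := mixed_difference x i k sf t0.
have [a' [b' [/andP[a0' at_'] /andP[b0' bt'] hab']]] := mixed_difference x k i sf t0.
have E1 : partial k (partial i f) (x + a *: basis R i + b *: basis R k) =
    partial i (partial k f) (x + a' *: basis R k + b' *: basis R i).
  apply: (common_quotient t0 hab hab'); rewrite (addrAC x (t *: basis R k)).
  exact: difference_swap.
have close (c d : R) j l := @pair_dist x j l c d t.
have td : t + t = Num.min d1 d2 by rewrite -splitr.
rewrite td in close.
have c1 := close a b i k a0 at_ b0 bt; have c2 := close a' b' k i a0' at_' b0' bt'.
have m1 : Num.min d1 d2 <= d1 by rewrite ge_min le_refl.
have m2 : Num.min d1 d2 <= d2 by rewrite ge_min le_refl orbT.
have k1 := h2 _ (lt_le_trans c1 m2); have k2 := h1 _ (lt_le_trans c2 m1).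
by rewrite E1 in k1; exact: two_close k2 k1.
Qed.

End SymmetricDerivatives.

(** Cyclic enumeration from an arbitrary i, to match the indices modulo 3 in [curl]. *)
Lemma sum3 (V : nmodType) (F : 'I_3 -> V) (i : 'I_3) :
  \sum_(k < 3) F k = F i + F (i + 1) + F (i + 2).
Proof.
have e (a b : 'I_3) : val a = val b -> F a = F b by move=> /val_inj ->.
rewrite !big_ord_recl big_ord0 addr0.
set b := F (lift _ _); set c := F (lift _ _).
case: i => [[|[|[|//]]] hi].
- by rewrite addrA; congr (_ + _ + _); exact: e.
- rewrite addrC; congr (_ + _ + _); exact: e.
- by rewrite addrA addrC addrA; congr (_ + _ + _); exact: e.
Qed.

Lemma curl_curl_swap (V : zmodType) (a b c x y : V) : b - x - (y - c) = a + b + c - (a + x + y).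
Proof.
by rewrite -(addrA a b c) -(addrA a x y) opprB (opprD a) (addrACA a) subrr add0r opprD (addrACA b c).
Qed.

Lemma cyclic_difference (V : zmodType) (a b c : V) : a - b + (c - a) + (b - c) = 0.
Proof. by rewrite [a - b + _]addrC subrKA subrKA subrr. Qed.

(** * Vector calculus and the inverse Laplacian on distributions *)

Section Calculus.
Variables (R : realType) (phi : R3 R -> R).
Hypothesis lp : littlewood_paley phi.
Local Notation E := (R3 R).
Local Notation mu := (lebesgue3 R).
Local Notation vfield := ('I_3 -> tdist R).
Notation blk := (lp_block phi).
Implicit Types (f psi : E -> R) (x y : E) (nu : R) (i k : 'I_3) (j : int) (u v a b : tdist R).

Lemma tdist_ext u v : (forall psi, schwartz psi -> u psi = v psi) -> u = v.
Proof.
move=> h; apply: val_inj; apply/funext => psi /=.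
have [/asboolP sp|/asboolPn nsp] := boolP `[< schwartz psi >]; first exact: h.
have [_ _ zu] := tdist_tempered' u; have [_ _ zv] := tdist_tempered' v.
by rewrite zu// zv.
Qed.

Lemma tdist_val_add u v psi : (u + v) psi = u psi + v psi. Proof. by []. Qed.
Lemma tdist_val_opp u psi : (- u) psi = - u psi. Proof. by []. Qed.
Lemma tdist_val_scale (c : R) u psi : (c *: u) psi = c * u psi. Proof. by []. Qed.
Lemma tdist_val0 psi : (0 : tdist R) psi = 0. Proof. by []. Qed.

Lemma dpartialD i u v : dpartial i (u + v) = dpartial i u + dpartial i v.
Proof. by apply: tdist_ext => psi sp; rewrite tdist_val_add !dpartialE// tdist_val_add opprD. Qed.

Lemma dpartialZ i (c : R) u : dpartial i (c *: u) = c *: dpartial i u.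
Proof. by apply: tdist_ext => psi sp; rewrite tdist_val_scale !dpartialE// tdist_val_scale mulrN. Qed.

Lemma dpartial0 i : dpartial i 0 = 0 :> tdist R.
Proof. by have := dpartialZ i 0 (0 : tdist R); rewrite !scale0r. Qed.

Lemma dpartialN i u : dpartial i (- u) = - dpartial i u.
Proof. by have := dpartialZ i (-1) u; rewrite !scaleN1r. Qed.

Lemma dpartialB i u v : dpartial i (u - v) = dpartial i u - dpartial i v.
Proof. by rewrite dpartialD dpartialN. Qed.

Lemma dpartial_sum i I (r : seq I) (F : I -> tdist R) :
  dpartial i (\sum_(k <- r) F k) = \sum_(k <- r) dpartial i (F k).
Proof.
elim: r => [|k r IHr]; first by rewrite !big_nil dpartial0.
by rewrite !big_cons dpartialD IHr.
Qed.

Lemma dpartialC i k u : dpartial i (dpartial k u) = dpartial k (dpartial i u).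
Proof.
apply: tdist_ext => psi sp.
rewrite (dpartialE i _ sp) (dpartialE k _ sp) (dpartialE k _ (schwartz_partial i sp)).
by rewrite (dpartialE i _ (schwartz_partial k sp)) (partialC i k sp.1).
Qed.

Lemma sums_to_unique (F : int -> E -> R) u v : sums_to F u -> sums_to F v -> u = v.
Proof. by move=> hu hv; apply: tdist_ext => psi sp; exact: sumZ_unique (hu _ sp) (hv _ sp). Qed.

Lemma sums_to_lin (m : int -> E -> R) (c : R) u v a b : (forall j, testfun (m j)) ->
  sums_to (fun j => multiplier (m j) u) a -> sums_to (fun j => multiplier (m j) v) b ->
  sums_to (fun j => multiplier (m j) (c *: u + v)) (c *: a + b).
Proof.
move=> tm hu hv psi sp; have := sumZ_lin c (hu _ sp) (hv _ sp).
apply: sumZ_ext => j; have rp := schwartz_rapid sp.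
rewrite -RintZ; last by apply: rapid_integ; exact: rapid_multiplier.
rewrite -RintD; [|apply: rintegrableZ; apply: rapid_integ; exact: rapid_multiplier|apply: rapid_integ; exact: rapid_multiplier].
by apply: Rint_eq => x; rewrite multiplierD multiplierZ mulrDl mulrA.
Qed.

Lemma sums_to_dpartial (m : int -> E -> R) i u a : (forall j, testfun (m j)) ->
  sums_to (fun j => multiplier (m j) u) a ->
  sums_to (fun j => multiplier (m j) (dpartial i u)) (dpartial i a).
Proof.
move=> tm hu psi sp; rewrite (dpartialE _ _ sp).
have := sumZZ (-1) (hu _ (schwartz_partial i sp)); rewrite mulN1r.
by apply: sumZ_ext => j; rewrite multiplier_parts// mulN1r.
Qed.

Lemma lap_symbolE nu j : (fun xi : E => (nu * enorm xi ^+ 2)^-1 * dyadic phi j xi) =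
  fun xi => nu^-1 * invsq (dyadic phi j) xi.
Proof. by apply/funext => xi; rewrite invfM mulrA. Qed.

Lemma lap_testfun nu j : testfun (fun xi : E => (nu * enorm xi ^+ 2)^-1 * dyadic phi j xi).
Proof.
rewrite lap_symbolE; have [ti _] := invsq_phi_symbol lp j.
by apply: (testfunM (f := fun=> nu^-1)) => //; exact: smooth_cst.
Qed.

Lemma blk_testfun j : testfun (dyadic phi j). Proof. by case: (symphi lp j). Qed.

Lemma inv_laplacian_unique nu u a b :
  inv_laplacian phi nu u a -> inv_laplacian phi nu u b -> a = b.
Proof. exact: sums_to_unique. Qed.

Lemma inv_laplacian_lin nu (c : R) u v a b : inv_laplacian phi nu u a ->
  inv_laplacian phi nu v b -> inv_laplacian phi nu (c *: u + v) (c *: a + b).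
Proof. by apply: sums_to_lin => j; exact: lap_testfun. Qed.

Lemma inv_laplacian_dpartial nu i u a : inv_laplacian phi nu u a ->
  inv_laplacian phi nu (dpartial i u) (dpartial i a).
Proof. by apply: sums_to_dpartial => j; exact: lap_testfun. Qed.

Lemma inv_laplacian0 nu : inv_laplacian phi nu 0 0.
Proof.
move=> psi sp; rewrite tdist_val0; apply: sumZ_ext (sumZ0 R) => j.
rewrite -[LHS](Rint0 mu); apply: Rint_eq => x.
by rewrite /multiplier tdist_val0 mul0r.
Qed.

Lemma inv_laplacianD nu u v a b : inv_laplacian phi nu u a ->
  inv_laplacian phi nu v b -> inv_laplacian phi nu (u + v) (a + b).
Proof. by move=> hu hv; have := inv_laplacian_lin 1 hu hv; rewrite !scale1r. Qed.

Lemma inv_laplacianZ nu (c : R) u a : inv_laplacian phi nu u a ->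
  inv_laplacian phi nu (c *: u) (c *: a).
Proof. by move=> hu; have := inv_laplacian_lin c hu (inv_laplacian0 nu); rewrite !addr0. Qed.

Lemma inv_laplacianN nu u a : inv_laplacian phi nu u a -> inv_laplacian phi nu (- u) (- a).
Proof. by move=> /(inv_laplacianZ (-1)); rewrite !scaleN1r. Qed.

Lemma inv_laplacianB nu u v a b : inv_laplacian phi nu u a ->
  inv_laplacian phi nu v b -> inv_laplacian phi nu (u - v) (a - b).
Proof. by move=> hu /inv_laplacianN; exact: inv_laplacianD. Qed.

Lemma inv_laplacian_sum nu I (r : seq I) (F G : I -> tdist R) :
  (forall l : I, inv_laplacian phi nu (F l) (G l)) ->
  inv_laplacian phi nu (\sum_(l <- r) F l) (\sum_(l <- r) G l).
Proof.
move=> h; elim: r => [|i r IHr]; first by rewrite !big_nil; exact: inv_laplacian0.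
by rewrite !big_cons; exact: inv_laplacianD.
Qed.

Lemma inv_laplacian_mu nu u a : inv_laplacian phi 1 u a ->
  inv_laplacian phi nu u (nu^-1 *: a).
Proof.
move=> h psi sp; rewrite tdist_val_scale; have := sumZZ nu^-1 (h _ sp).
apply: sumZ_ext => j; rewrite -RintZ; last first.
  by apply: rapid_integ; apply: rapid_multiplier; [exact: lap_testfun|exact: schwartz_rapid].
have [ti _] := invsq_phi_symbol lp j.
by apply: Rint_eq => x; rewrite !lap_symbolE !multiplier_symZ// invr1 mul1r mulrA.
Qed.

Definition laplacian u : tdist R := \sum_(i < 3) dpartial i (dpartial i u).

Lemma partial_ker m i : testfun m ->
  partial i (ker m) = fun x => (2 * pi) ^- 3 * trig (0 + pi / 2) (fun xi => coord xi i * m xi) x.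
Proof.
move=> tm; apply/funext => x; apply: derive_val.
have := is_derive_scale ((2 * pi) ^- 3) (is_derive_trig 0 x i tm).
by rewrite (_ : (fun y => _ * trig 0 m y) = ker m)//; apply/funext => y; rewrite kerE.
Qed.

Lemma partial2_ker m i x : testfun m ->
  partial i (partial i (ker m)) x = - ker (fun xi => coord xi i * (coord xi i * m xi)) x.
Proof.
move=> tm; rewrite partial_ker//; have tm' := testfun_coordM i tm.
rewrite kerE -mulrN; apply: derive_val.
have := is_derive_scale ((2 * pi) ^- 3) (is_derive_trig (0 + pi / 2) x i tm').
set M := (fun xi : E => coord xi i * (coord xi i * m xi)).
rewrite (_ : trig (0 + pi / 2 + pi / 2) M x = - trig 0 M x)//.
rewrite /trig -RintN; last by apply: integ_cos; apply: testfun_integ; exact: testfun_coordM.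
apply: Rint_eq => xi; rewrite -mulNr; congr (_ * _).
rewrite -cosDpi; congr cos; rewrite -!addrA; congr (_ + (_ + _)).
by rewrite -splitr.
Qed.

Lemma multiplier_laplacian m u x : testfun m ->
  multiplier m (laplacian u) x = - multiplier (fun xi => enorm xi ^+ 2 * m xi) u x.
Proof.
move=> tm; have sk := schwartz_ker tm; have sr := schwartz_reflect x sk.
have t2 i : testfun (fun xi => coord xi i * (coord xi i * m xi)).
  by do 2 apply: testfun_coordM.
have E1 i : multiplier m (dpartial i (dpartial i u)) x =
    - multiplier (fun xi => coord xi i * (coord xi i * m xi)) u x.
  have sp1 := schwartz_reflect x (schwartz_partial i sk).
  rewrite (multiplier_dpartial _ _ _ tm) (dpartialE _ _ sp1).
  rewrite partial_reflect; last exact: (schwartz_partial i sk).1.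
  congr (- _); rewrite /multiplier -/(ker _); congr (tdist_val u); apply/funext => y.
  by rewrite partial2_ker// opprK.
rewrite /laplacian (sum3 _ ord0) !multiplierD !E1 -!opprD; congr (- _).
rewrite -multiplier_symD// -multiplier_symD//; last exact: testfunD.
congr (multiplier _ u x); apply/funext => xi.
by rewrite -dotxx /dot (sum3 _ ord0) !mulrDl !mulrA.
Qed.

(** That u is the sum of its blocks excludes nonzero harmonic polynomials, which have zero Laplacian
    and zero blocks. On the annuli the factor |xi|^2 cancels against its inverse. *)
Lemma inv_laplacian_laplacian u : sums_to (fun j => blk j u) u ->
  inv_laplacian phi 1 (laplacian u) (- u).
Proof.
move=> hu psi sp; rewrite tdist_val_opp; have := sumZZ (-1) (hu _ sp); rewrite mulN1r.
apply: sumZ_ext => j; rewrite -RintZ; last first.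
  by apply: rapid_integ; apply: rapid_multiplier; [exact: blk_testfun|exact: schwartz_rapid].
apply: Rint_eq => x; rewrite multiplier_laplacian; last exact: lap_testfun.
rewrite mulN1r -mulNr; congr (- _ * _).
rewrite /lp_block; congr (multiplier _ u x); apply/funext => xi.
have [->|x0] := eqVneq (dyadic phi j xi) 0; first by rewrite !mulr0.
have /andP[h _] := dyadic_supp lp x0.
have e0 : enorm xi != 0 by rewrite gt_eqF// (lt_le_trans _ h)// mulr_gt0// exp2_gt0.
by rewrite mul1r mulrA mulfV ?mul1r// expf_neq0.
Qed.

Lemma ord3D (i : 'I_3) : [/\ i + 2 + 1 = i, i + 2 + 2 = i + 1, i + 1 + 1 = i + 2 & i + 1 + 2 = i].
Proof. by split; apply: val_inj; case: i => [[|[|[|//]]] hi]. Qed.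

Lemma curl_curl (u : vfield) i : curl (curl u) i = dpartial i (div u) - laplacian (u i).
Proof.
have [e1 e2 e3 e4] := ord3D i.
rewrite /div /laplacian dpartial_sum !(sum3 _ i) /curl e1 e2 e3 e4 !dpartialB.
rewrite (dpartialC i (i + 1)) (dpartialC i (i + 2)).
set A := dpartial i (dpartial i _); set B := dpartial _ (dpartial i (u (i + 1))).
set C := dpartial _ (dpartial i (u (i + 2))).
exact: curl_curl_swap.
Qed.

Lemma div_curl (u : vfield) : div (curl u) = 0.
Proof.
pose i : 'I_3 := ord0; rewrite /div (sum3 _ i) /curl; clearbody i.
have [e1 e2 e3 e4] := ord3D i; rewrite e1 e2 e3 e4 !dpartialB.
rewrite (dpartialC (i + 1) i) (dpartialC (i + 2) i) (dpartialC (i + 2) (i + 1)).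
exact: cyclic_difference.
Qed.

End Calculus.

(** * Besov bounds under linear operations, and the Stokes operator *)

Section BesovCalculus.
Variables (R : realType) (phi : R3 R -> R).
Hypothesis lp : littlewood_paley phi.
Local Notation E := (R3 R).
Local Notation mu := (lebesgue3 R).
Local Notation vfield := ('I_3 -> tdist R).
Notation blk := (lp_block phi).
Notation bes := (bes phi).
Implicit Types (f g psi : E -> R) (x y z : E) (i k : 'I_3) (j : int) (u v w a : tdist R).

Lemma ler_powR_base (s t r : R) : 0 <= s -> 0 <= r -> s <= t -> s `^ r <= t `^ r.
Proof. by move=> s0 r0 st; apply: ge0_ler_powR => //; rewrite nnegrE// (le_trans s0). Qed.

Lemma bes_ge0 (s p r : R) u (A : R) : bes s p r u A -> 0 <= A.
Proof. by case=> c []. Qed.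

Lemma bes_weak (s p r : R) u (A B : R) : 0 <= r -> bes s p r u A -> A <= B -> bes s p r u B.
Proof.
move=> r0 [c [c0 hc A0 hA]] AB; exists c; split=> //; first exact: le_trans AB.
by move=> n; apply: (le_trans (hA n)); exact: ler_powR_base.
Qed.

Lemma powR_quasi (s t r : R) : 0 <= s -> 0 <= t -> 0 <= r ->
  (s + t) `^ r <= 2 `^ r * (s `^ r + t `^ r).
Proof.
move=> s0 t0 r0; wlog st : s t s0 t0 / s <= t.
  by move=> h; have [/h|/ltW/h] := leP s t; [exact|rewrite addrC [_ `^ r + _]addrC; exact].
apply: (@le_trans _ _ ((2 * t) `^ r)).
  by apply: ler_powR_base => //; [exact: addr_ge0|rewrite mulr_natl mulr2n lerD2r].
by rewrite powRM// ler_wpM2l ?powR_ge0// lerDr powR_ge0.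
Qed.

Lemma powR_superadd (s t r : R) : 0 <= s -> 0 <= t -> 1 <= r -> s `^ r + t `^ r <= (s + t) `^ r.
Proof.
move=> s0 t0 r1.
have h (x y : R) : 0 <= x -> 0 <= y -> x `^ r <= x * (x + y) `^ (r - 1).
  move=> x0 y0; have [->|xn] := eqVneq x 0.
    by rewrite mul0r powR0// gt_eqF// (lt_le_trans _ r1).
  have x1 : 0 < x by rewrite lt_neqAle eq_sym xn.
  rewrite (powR_split r 1 x1) powRr1// mulrC ler_wpM2l//.
  by apply: ler_powR_base; rewrite ?subr_ge0// lerDl.
apply: (le_trans (lerD (h _ _ s0 t0) (h _ _ t0 s0))).
rewrite [t + s]addrC -mulrDl; have [st0|stn] := eqVneq (s + t) 0.
  by rewrite st0 mul0r powR_ge0.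
have st1 : 0 < s + t by rewrite lt_neqAle eq_sym stn addr_ge0.
by rewrite (powR_split r 1 st1) powRr1 ?addr_ge0// mulrC.
Qed.

(** The factor 2 comes from (c + d)^r <= 2^r (c^r + d^r), used term by term in place of Minkowski's
    inequality in l^r; superadditivity of t^r then brings the two sums under one power. *)
Lemma besD (s p r : R) u v (A B : R) : 1 <= p -> 1 <= r -> bes s p r u A -> bes s p r v B ->
  bes s p r (u + v) (2 * (A + B)).
Proof.
move=> p1 r1 [c [c0 hc A0 hA]] [d [d0 hd B0 hB]]; have r0 : 0 <= r by exact: le_trans r1.
exists (fun j => c j + d j); split.
- by move=> j; rewrite addr_ge0.
- move=> j; rewrite mulrDr; have := lpbD p1 (hc j) (hd j); apply: eq_lpb => x.
  by rewrite /lp_block multiplierD.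
- by rewrite mulr_ge0// addr_ge0.
- move=> n; apply: (@le_trans _ _ (2 `^ r * (A `^ r + B `^ r))); last first.
    by rewrite powRM ?addr_ge0// ler_wpM2l ?powR_ge0// powR_superadd.
  apply: (@le_trans _ _ (wsum (fun j => 2 `^ r * (c j `^ r + d j `^ r)) n)).
    by apply: ler_wsum => j; exact: powR_quasi.
  rewrite wsumZ ler_wpM2l ?powR_ge0//.
  have -> : wsum (fun j => c j `^ r + d j `^ r) n = wsum (fun j => c j `^ r) n + wsum (fun j => d j `^ r) n.
    by rewrite !wsumE big_split.
  exact: lerD.
Qed.

Lemma besZ (s p r : R) (c : R) u (A : R) : 1 <= p -> 1 <= r -> bes s p r u A ->
  bes s p r (c *: u) (`|c| * A).
Proof.
move=> p1 r1 [d [d0 hd A0 hA]].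
exists (fun j => `|c| * d j); split.
- by move=> j; rewrite mulr_ge0.
- move=> j; rewrite mulrCA; have := lpbZ c (le_trans ler01 p1) (hd j); apply: eq_lpb => x.
  by rewrite /lp_block multiplierZ.
- by rewrite mulr_ge0.
- move=> n; rewrite powRM//; have -> : (fun j => (`|c| * d j) `^ r) = fun j => `|c| `^ r * d j `^ r.
    by apply/funext => j; rewrite powRM.
  by rewrite wsumZ ler_wpM2l// powR_ge0.
Qed.

Lemma besN (s p r : R) u (A : R) : 1 <= p -> 1 <= r -> bes s p r u A -> bes s p r (- u) A.
Proof. by move=> p1 r1 /(besZ (-1) p1 r1); rewrite normrN1 mul1r scaleN1r. Qed.

Lemma besB (s p r : R) u v (A B : R) : 1 <= p -> 1 <= r -> bes s p r u A -> bes s p r v B ->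
  bes s p r (u - v) (2 * (A + B)).
Proof. by move=> p1 r1 hu /(besN p1 r1); exact: besD. Qed.

Lemma bes_sum3 (s p r : R) (F : 'I_3 -> tdist R) (A : R) : 1 <= p -> 1 <= r ->
  (forall i, bes s p r (F i) A) -> bes s p r (\sum_(i < 3) F i) (10 * A).
Proof.
move=> p1 r1 h; rewrite (sum3 _ ord0).
have := besD p1 r1 (besD p1 r1 (h ord0) (h (ord0 + 1))) (h (ord0 + 2)).
by have -> : 2 * (2 * (A + A) + A) = 10 * A by ring.
Qed.

Lemma bes_dpartial (s p r : R) : 1 <= p -> 1 <= r -> exists2 C, 0 < C & forall i u (A : R),
  bes s p r u A -> bes (s - 1) p r (dpartial i u) (C * A).
Proof.
move=> p1 r1; have [C C0 h] := der_lpb lp p1; exists C => // i u A [c [c0 hc A0 hA]].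
have C0' := ltW C0.
exists (fun j => C * c j); split.
- by move=> j; rewrite mulr_ge0.
- move=> j; have := h i _ _ _ (hc j); have e : 1 - s = - (s - 1) by rewrite opprB.
  by rewrite (mulrA (pw 1 j)) -pwD e (mulrCA C).
- by rewrite mulr_ge0.
- move=> n; rewrite powRM//; have -> : (fun j => (C * c j) `^ r) = fun j => C `^ r * c j `^ r.
    by apply/funext => j; rewrite powRM.
  by rewrite wsumZ ler_wpM2l// powR_ge0.
Qed.

(** Inclusion of l^r in l^r': each term is at most A, hence c_j^r' <= A^(r' - r) c_j^r. *)
Lemma bes_exponent (s p r r' : R) u (A : R) : 1 <= r -> r <= r' -> bes s p r u A -> bes s p r' u A.
Proof.
move=> r1 rr [c [c0 hc A0 hA]]; exists c; split=> // n.
have r0 : 0 < r by exact: lt_le_trans r1.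
have cA j : c j <= A.
  have h := @wsum_term _ (fun j => c j `^ r) j _ (fun j => powR_ge0 _ _) hA.
  rewrite leNgt; apply/negP => Ac.
  by have := gt0_ltr_powR r0 A0 (c0 j) Ac; rewrite ltNge h.
have split_pow (t : R) : 0 <= t -> t `^ r' = t `^ (r' - r) * t `^ r.
  rewrite le_eqVlt => /predU1P[<-|]; last exact: powR_split.
  by rewrite [in RHS](@powR0 _ r) ?gt_eqF// mulr0 powR0// gt_eqF// (lt_le_trans r0).
rewrite (split_pow A)//.
apply: (@le_trans _ _ (wsum (fun j => A `^ (r' - r) * c j `^ r) n)); last first.
  by rewrite wsumZ ler_wpM2l ?powR_ge0.
apply: ler_wsum => j; rewrite split_pow// ler_wpM2r ?powR_ge0//.
by apply: ler_powR_base; rewrite ?subr_ge0.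
Qed.

Lemma sums_to0 (m : int -> E -> R) : sums_to (fun j => multiplier (m j) (0 : tdist R)) 0.
Proof.
move=> psi sp; rewrite tdist_val0; apply: sumZ_ext (sumZ0 R) => j.
rewrite -[LHS](Rint0 mu); apply: Rint_eq => x.
by rewrite /multiplier tdist_val0 mul0r.
Qed.

Lemma sums_to_sum (m : int -> E -> R) I (r : seq I) (F G : I -> tdist R) :
  (forall j, testfun (m j)) ->
  (forall l, sums_to (fun j => multiplier (m j) (F l)) (G l)) ->
  sums_to (fun j => multiplier (m j) (\sum_(l <- r) F l)) (\sum_(l <- r) G l).
Proof.
move=> tm h; elim: r => [|l r IHr]; first by rewrite !big_nil; exact: sums_to0.
by rewrite !big_cons; have := sums_to_lin 1 tm (h l) IHr; rewrite !scale1r.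
Qed.

Lemma inv_laplacian_bes (p r nu : R) : 1 <= p -> p < 3 -> 1 <= r -> exists2 C, 0 < C &
  forall v (A : R), bes (3 / p - 3) p r v A ->
   (exists w, inv_laplacian phi nu v w) /\
   forall w, inv_laplacian phi nu v w ->
     bes (3 / p - 1) p r w (C * A) /\ sums_to (fun j => blk j w) w.
Proof.
move=> p1 p3 r1; have [C C0 h] := inv_laplacian_exists lp p1 p3 r1.
exists ((1 + `|nu^-1|) * C); first by rewrite mulr_gt0// ltr_pwDl.
move=> v A hv; have [w [w1 w2 w3]] := h v A hv.
have w4 := inv_laplacian_mu lp nu w1; split; first by exists (nu^-1 *: w).
move=> w' /(inv_laplacian_unique w4) <-; split.
  apply: bes_weak (besZ nu^-1 p1 r1 w2) _; first exact: le_trans r1.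
  rewrite -mulrA ler_wpM2r ?(bes_ge0 w2)//; by rewrite lerDr.
have := sums_to_lin (nu^-1) (blk_testfun lp) w3 (sums_to0 (dyadic phi)).
by rewrite !addr0.
Qed.

Lemma is_leray_unique (f v v' : vfield) : is_leray phi f v -> is_leray phi f v' -> v = v'.
Proof. by move=> [q hq ->] [q' hq' ->]; rewrite (inv_laplacian_unique hq hq'). Qed.

Lemma is_stokes_unique (nu : R) (f w w' : vfield) :
  is_stokes phi nu f w -> is_stokes phi nu f w' -> w = w'.
Proof.
move=> [v hv hw] [v' hv' hw']; rewrite -(is_leray_unique hv hv') in hw'.
by apply/funext => i; exact: inv_laplacian_unique (hw i) (hw' i).
Qed.

Lemma divB (f g : vfield) : div (f - g) = div f - div g.
Proof. by rewrite /div -sumrB; apply: eq_bigr => i _; rewrite -dpartialB. Qed.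

Lemma divD (f g : vfield) : div (f + g) = div f + div g.
Proof. by rewrite /div -big_split /=; apply: eq_bigr => i _; rewrite -dpartialD. Qed.

Lemma divZ (c : R) (f : vfield) : div (c *: f) = c *: div f.
Proof. by rewrite /div scaler_sumr; apply: eq_bigr => i _; rewrite -dpartialZ. Qed.

Lemma curlB (f g : vfield) : curl (f - g) = curl f - curl g.
Proof.
apply/funext => i; rewrite /curl.
rewrite -[RHS]/((dpartial (i + 1) (f (i + 2)) - dpartial (i + 2) (f (i + 1))) -
  (dpartial (i + 1) (g (i + 2)) - dpartial (i + 2) (g (i + 1)))).
rewrite -[(f - g) (i + 2)]/(f (i + 2) - g (i + 2)) -[(f - g) (i + 1)]/(f (i + 1) - g (i + 1)).
by rewrite !dpartialB opprB opprD opprK !addrA addrAC -!addrA; congr (_ + _); rewrite !addrA addrAC addrC addrA.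
Qed.

Lemma is_stokesB (nu : R) (f g w z : vfield) : is_stokes phi nu f w -> is_stokes phi nu g z ->
  is_stokes phi nu (f - g) (w - z).
Proof.
move=> [v [q hq ->] hw] [v' [q' hq' ->] hw']; exists (f + grad q - (g + grad q')).
  exists (q - q'); first by rewrite divB; exact: inv_laplacianB.
  apply/funext => i; rewrite -[LHS]/((f i + dpartial i q) - (g i + dpartial i q')).
  by rewrite -[RHS]/(f i - g i + dpartial i (q - q')) dpartialB opprD addrACA.
by move=> i; exact: (inv_laplacianB lp (hw i) (hw' i)).
Qed.

(** The potential in the projector is here the inverse Laplacian of 0, which is 0 by uniqueness. *)
Lemma is_stokes_divfree (nu : R) (f w : vfield) : div f = 0 ->
  is_stokes phi nu f w <-> forall i, inv_laplacian phi nu (f i) (w i).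
Proof.
move=> f0; have e : f + grad 0 = f.
  by apply/funext => i; rewrite -[LHS]/(f i + dpartial i 0) dpartial0 addr0.
split=> [[v [q hq ->] hw]|h].
  rewrite f0 in hq; rewrite (inv_laplacian_unique hq (inv_laplacian0 phi 1)) in hw.
  by rewrite e in hw.
exists f => //; exists 0; first by rewrite f0; exact: inv_laplacian0.
by rewrite e.
Qed.

(** The divergence of f has regularity 3/p - 4, one below the range of [inv_laplacian_bes]. The
    Laplacian is therefore inverted on f first, giving a, and the potential is q = div a; its
    gradient is back at regularity 3/p - 3. *)
Theorem stokes_exists (p r nu : R) : 1 <= p -> p < 3 -> 1 <= r -> exists2 C, 0 < C &
  forall (f : vfield) (A : R), (forall i, bes (3 / p - 3) p r (f i) A) ->
  exists w : vfield, [/\ is_stokes phi nu f w, div w = 0 &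
    forall i, bes (3 / p - 1) p r (w i) (C * A) /\ sums_to (fun j => blk j (w i)) (w i)].
Proof.
move=> p1 p3 r1; have [C C0 h] := inv_laplacian_bes 1 p1 p3 r1.
have [C' C0' h'] := inv_laplacian_bes nu p1 p3 r1.
have [D1 D10 d1] := bes_dpartial (3 / p - 1) p1 r1.
have [D2 D20 d2] := bes_dpartial (3 / p - 1 - 1) p1 r1.
have CC : 0 < C' * (2 * (1 + 10 * (D2 * (D1 * C)))).
  by rewrite !mulr_gt0// ltr_pwDl// !mulr_ge0// ltW.
exists (C' * (2 * (1 + 10 * (D2 * (D1 * C))))) => // f A hf.
have A0 : 0 <= A by exact: bes_ge0 (hf ord0).
have ha i : {a : tdist R | inv_laplacian phi 1 (f i) a}.
  by apply: cid; have [] := h _ _ (hf i).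
pose a i := sval (ha i); have ia i : inv_laplacian phi 1 (f i) (a i) := svalP (ha i).
have ba i : bes (3 / p - 1) p r (a i) (C * A) by have [_ /(_ _ (ia i))[]] := h _ _ (hf i).
have sa i : sums_to (fun j => blk j (a i)) (a i) by have [_ /(_ _ (ia i))[]] := h _ _ (hf i).
pose q := div a.
have iq : inv_laplacian phi 1 (div f) q.
  by apply: inv_laplacian_sum => // i; exact: inv_laplacian_dpartial.
have bq i : bes (3 / p - 3) p r (dpartial i q) (10 * (D2 * (D1 * (C * A)))).
  rewrite /q /div dpartial_sum; apply: bes_sum3 => // k.
  have := d2 i _ _ (d1 k _ _ (ba k)).
  by have -> : 3 / p - 1 - 1 - 1 = 3 / p - 3 by ring.
pose v : vfield := f + grad q.
have bv i : bes (3 / p - 3) p r (v i) (2 * (A + 10 * (D2 * (D1 * (C * A))))).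
  exact: (besD p1 r1 (hf i) (bq i)).
have hw i : {w : tdist R | inv_laplacian phi nu (v i) w}.
  by apply: cid; have [] := h' _ _ (bv i).
pose w i := sval (hw i); have iw i : inv_laplacian phi nu (v i) (w i) := svalP (hw i).
exists w; split.
- by exists v => //; exists q.
(* With c the inverse Laplacian of grad q, w = (a + c) / nu and div c = -q by
   [inv_laplacian_laplacian]; hence div w = (q - q) / nu = 0. *)
- have sq : sums_to (fun j => blk j q) q.
    apply: (sums_to_sum _ (blk_testfun lp)) => i.
    exact: (sums_to_dpartial i (blk_testfun lp) (sa i)).
  have hc i : {c : tdist R | inv_laplacian phi 1 (dpartial i q) c}.
    by apply: cid; have [] := h _ _ (bq i).
  pose c i := sval (hc i); have ic i : inv_laplacian phi 1 (dpartial i q) (c i) := svalP (hc i).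
  have wE : w = nu^-1 *: (a + c).
    apply/funext => i; apply: inv_laplacian_unique (iw i) _.
    have := inv_laplacian_mu lp nu (inv_laplacianD lp (ia i) (ic i)).
    by [].
  have dc : div c = - q.
    have := inv_laplacian_laplacian lp sq.
    apply: inv_laplacian_unique; apply: inv_laplacian_sum => // i.
    exact: inv_laplacian_dpartial.
  by rewrite wE divZ divD dc subrr scaler0.
- move=> i; have [_ /(_ _ (iw i))[h1 h2]] := h' _ _ (bv i); split=> //.
  have e : C' * (2 * (A + 10 * (D2 * (D1 * (C * A))))) = C' * (2 * (1 + 10 * (D2 * (D1 * C)))) * A by ring.
  by rewrite -e.
Qed.

End BesovCalculus.

(** * Products *)

Section LocalizedProducts.
Variables (R : realType) (phi : R3 R -> R).
Hypothesis lp : littlewood_paley phi.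
Local Notation E := (R3 R).
Local Notation mu := (lebesgue3 R).
Notation blk := (lp_block phi).
Implicit Types (f g : E -> R) (x y z : E) (j k l : int) (u v : tdist R).

Let K j := ker (dyadic phi j).
Let rK j : rapid (K j). Proof. by apply: rapid_ker; exact: blk_testfun. Qed.
Lemma rapid_mul f g : rapid f -> rapid g -> rapid (fun x => f x * g x).
Proof.
move=> rf rg; have [C C0 hC] := rapid_bounded rf.
apply: rapidM => //; first exact: rf.1.
by exists 0%N, C => x; rewrite expr0 mulr1.
Qed.

(** Duality: two uses of [multiplier_pair] move everything onto the kernels, where
    [trig_conv_product0] applies. The power -9 gathers three normalizations (2 pi)^(-3). *)
Lemma blk_product0 k l j u v x :
  (forall xi eta, dyadic phi l xi != 0 -> dyadic phi j eta != 0 ->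
     dyadic phi k (xi + eta) = 0 /\ dyadic phi k (xi - eta) = 0) ->
  sconv (K k) (fun y => blk l u y * blk j v y) x = 0.
Proof.
move=> h0.
have tl := blk_testfun lp l; have tj := blk_testfun lp j; have tk := blk_testfun lp k.
have rx := rapid_reflect x (rK k).
have rv : rapid (fun y => blk j v y * K k (x - y)) by exact: rapid_multiplier.
transitivity (\int[mu]_y (blk l u y * (blk j v y * K k (x - y)))).
  by apply: Rint_eq => y; rewrite mulrC mulrA.
rewrite (multiplier_pair u tl rv).
suff -> : sconv (ker (dyadic phi l)) (fun y => blk j v y * K k (x - y)) = fun=> 0 by exact: tdist0.
apply/funext => z; have rz := rapid_mul (rapid_reflect z (rK l)) rx.
transitivity (\int[mu]_y (blk j v y * (K l (z - y) * K k (x - y)))).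
  by apply: Rint_eq => y; rewrite mulrCA.
rewrite (multiplier_pair v tj rz).
suff -> : sconv (ker (dyadic phi j)) (fun y => K l (z - y) * K k (x - y)) = fun=> 0 by exact: tdist0.
apply/funext => b.
have := trig_conv_product0 0 0 x z b tk (symphi lp k).2 tl tj h0.
move=> /(congr1 ( *%R ((2 * pi) ^- 9))); rewrite mulr0 => <-.
rewrite -RintZ; last first.
  have rr n y : testfun n -> rapid (fun t => trig 0 n (t - y)).
    by move=> tn; apply: schwartz_rapid; apply: schwartz_translate; exact: trig_schwartz.
  apply: rapid_integ; apply: rapid_mul; last by apply: rapid_mul; exact: rr.
  by apply: rapid_reflect; apply: schwartz_rapid; exact: trig_schwartz.
apply: Rint_eq => y.
rewrite (ker_sub _ z y : K l (z - y) = _) -/(K l) (ker_sub _ b y) /K !kerE.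
have -> : ((2 : R) * pi) ^- 9 = (2 * pi) ^- 3 * ((2 * pi) ^- 3 * (2 * pi) ^- 3).
  by rewrite -!invfM -!exprD.
ring.
Qed.

Lemma exp2_split (a b : int) (n : nat) : a + n%:Z <= b -> (2 : R) ^ a * 2 ^+ n <= 2 ^ b.
Proof. exact: exp2_le. Qed.

(** Both frequencies are at most 8/3 * 2^(k - 4), and the sum of these two bounds, 2^k / 3, is below
    the inner radius 3/4 * 2^k. *)
Lemma supp_high k l j xi eta : l + 4 <= k -> j + 4 <= k ->
  dyadic phi l xi != 0 -> dyadic phi j eta != 0 ->
  dyadic phi k (xi + eta) = 0 /\ dyadic phi k (xi - eta) = 0.
Proof.
move=> lk jk /(dyadic_supp lp)/andP[_ h1] /(dyadic_supp lp)/andP[_ h2].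
have a1 := exp2_split lk; have a2 := exp2_split jk; have e0 := exp2_gt0 R k.
have e16 : (2 : R) ^+ 4 = 16 by ring.
rewrite e16 in a1 a2.
have far (t : E) : enorm t <= enorm xi + enorm eta -> dyadic phi k t = 0.
  move=> ht; apply/eqP; apply: contraT => /(dyadic_supp lp)/andP[h3 _].
  by move: h1 h2 h3 ht a1 a2 e0; lra.
by split; apply: far; [exact: enormD|exact: enormB].
Qed.

(** The higher frequency dominates: the sum and the difference are at least (3/4 - 1/12) 2^j, above
    the outer radius 8/3 * 2^k, which is at most 2^j / 6. *)
Lemma supp_low k l j xi eta : l + 5 <= j -> k + 4 <= j ->
  dyadic phi l xi != 0 -> dyadic phi j eta != 0 ->
  dyadic phi k (xi + eta) = 0 /\ dyadic phi k (xi - eta) = 0.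
Proof.
move=> lj kj /(dyadic_supp lp)/andP[_ h1] /(dyadic_supp lp)/andP[h2 _].
have a1 := exp2_split lj; have a2 := exp2_split kj; have e0 := exp2_gt0 R j.
have e16 : (2 : R) ^+ 4 = 16 by ring.
have e32 : (2 : R) ^+ 5 = 32 by ring.
rewrite e32 in a1; rewrite e16 in a2.
have far (t : E) : enorm eta <= enorm t + enorm xi -> dyadic phi k t = 0.
  move=> ht; apply/eqP; apply: contraT => /(dyadic_supp lp)/andP[_ h3].
  by move: h1 h2 h3 ht a1 a2 e0; lra.
split; apply: far.
  by have := enormB (xi + eta) xi; rewrite [xi + eta]addrC addrK.
by have := enormB xi (xi - eta); rewrite subKr addrC.
Qed.

Lemma blk_productC k l j u v : sconv (K k) (fun y => blk l u y * blk j v y) =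
  sconv (K k) (fun y => blk j v y * blk l u y).
Proof. by congr sconv; apply/funext => y; rewrite mulrC. Qed.

Section Estimates.
Variables (p : R) (p1 : 1 <= p) (p3 : p < 3).

Definition rho : R := Num.max p 2.
Definition sigma : R := 3 / p - 1.

Lemma sigmaE : sigma = 3 / p - 1. Proof. by []. Qed.

Let p0 : 0 < p. Proof. exact: lt_le_trans p1. Qed.
Lemma rho_ge_p : p <= rho. Proof. by rewrite le_max lexx. Qed.
Lemma rho_ge2 : 2 <= rho. Proof. by rewrite le_max lexx orbT. Qed.
Lemma rho_lt3 : rho < 3. Proof. by rewrite gt_max p3; lra. Qed.
Lemma rho_half : rho / 2 <= p.
Proof. by rewrite ler_pdivrMr// ge_max; apply/andP; split; move: p1; lra. Qed.
Let r0 : 0 < rho. Proof. exact: lt_le_trans p0 rho_ge_p. Qed.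
Lemma rho_half1 : 1 <= rho / 2. Proof. by rewrite ler_pdivlMr// mul1r rho_ge2. Qed.
(** The regularity of the blocks once they are measured in L^rho: Bernstein from L^p to L^rho turns
    3/p - 1 into 3/rho - 1. *)
Definition tau0 : R := 3 / rho - 1.
Lemma tau0_gt0 : 0 < tau0. Proof. by rewrite subr_gt0 ltr_pdivlMr// mul1r rho_lt3. Qed.
Lemma sigma_gt0 : 0 < sigma. Proof. by rewrite subr_gt0 ltr_pdivlMr// mul1r. Qed.

Lemma kernel_constant : exists2 C, 0 < C & forall k, kbound (K k) C (2 ^ k).
Proof. exact: kb_dyadic (lp_symbol lp).1. Qed.

Lemma blk_rho : exists2 C, 0 < C & forall u l (c : R), lpb p (blk l u) (pw (- sigma) l * c) ->
  lpb rho (blk l u) (C * (pw (- tau0) l * c)).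
Proof.
have [C C0 h] := blk_interp lp p1 rho_ge_p; exists C => // u l c hc.
have := h _ _ _ hc; rewrite [pw _ l * (_ * _)]mulrA -pwD.
have -> : 3 * (p^-1 - rho^-1) + - sigma = - tau0.
  by rewrite /sigma /tau0; field; rewrite !gt_eqF.
by [].
Qed.

Lemma blk_sigma_sup : exists2 C, 0 < C & forall u l (c : R), lpb p (blk l u) (pw (- sigma) l * c) ->
  forall x, `|blk l u x| <= C * (pw 1 l * c).
Proof.
have [C C0 h] := blk_sup lp p1; exists C => // u l c hc x.
have := h _ _ _ hc x; rewrite [pw _ l * (_ * _)]mulrA -pwD.
by have -> : 3 / p + - sigma = 1 by rewrite /sigma; ring.
Qed.

(** Both factors go up to L^rho, the product is in L^(rho/2) by Cauchy-Schwarz, and the localization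
    at frequency 2^k brings it to L^p at the cost 2^(3 k (2/rho - 1/p)). *)
Lemma near_product : exists2 C, 0 < C & forall k l j u v (c d : R),
  lpb p (blk l u) (pw (- sigma) l * c) -> lpb p (blk j v) (pw (- sigma) j * d) ->
  lpb p (sconv (K k) (fun y => blk l u y * blk j v y))
    (C * (pw (3 * (2 / rho - p^-1)) k * (pw (- tau0) l * pw (- tau0) j) * (c * d))).
Proof.
have [C1 C10 h1] := blk_rho; have [C2 C20 h2] := kernel_constant.
exists (2 * C2 * (C1 * C1)); first by rewrite !mulr_gt0.
move=> k l j u v c d hu hv.
have h := lpb_mul r0 (h1 _ _ _ hu) (h1 _ _ _ hv).
have := sconv_interp (exp2_gt0 R k) (h2 k) rho_half1 rho_half h.
rewrite pwE invf_div; set X := pw _ k; set Y := pw _ l; set Z := pw _ j.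
by have -> : 2 * C2 * (X * (C1 * (Y * c) * (C1 * (Z * d)))) =
  2 * C2 * (C1 * C1) * (X * (Y * Z) * (c * d)) by ring.
Qed.

Lemma bounded_product : exists2 C, 0 < C & forall k l j u v (S B : R),
  (forall x, `|blk l u x| <= S) -> lpb p (blk j v) B ->
  lpb p (sconv (K k) (fun y => blk l u y * blk j v y)) (C * (S * B)).
Proof.
have [C C0 h] := kernel_constant; exists (2 * C); first by rewrite mulr_gt0.
move=> k l j u v S B hS hB.
apply: (sconv_young (h k) p1).
by apply: lpb_bounded_mul => //; [exact: ltW|exact: blk_measurable].
Qed.

End Estimates.

End LocalizedProducts.

(** * Geometric sums and Schur's test *)

Section SequenceSums.
Variable R : realType.
Implicit Types (a c d : int -> R) (A B : R) (j k l M : int).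

Lemma sum_subseq a (s t : seq int) : uniq s -> uniq t -> {subset s <= t} ->
  (forall j, 0 <= a j) -> \sum_(j <- s) a j <= \sum_(j <- t) a j.
Proof.
move=> us ut st a0.
have -> : \sum_(j <- s) a j = \sum_(j <- t | j \in s) a j.
  rewrite -[RHS]big_filter; apply: perm_big; apply: uniq_perm => //; first exact: filter_uniq.
  by move=> j; rewrite mem_filter; case: (boolP (j \in s)) => //= /st ->.
by rewrite [leRHS](bigID (mem s)) /= lerDl sumr_ge0.
Qed.

Lemma sum_wsum a B (s : seq int) : uniq s -> (forall j, 0 <= a j) ->
  (forall n, wsum a n <= B) -> \sum_(j <- s) a j <= B.
Proof.
move=> us a0 h; pose n := (\max_(j <- s) absz j).+1.
apply: le_trans (h n); rewrite wsumE; apply: sum_subseq => //; first exact: window_uniq.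
by move=> j js; apply: mem_window; rewrite ltnS; exact: leq_bigmax_seq.
Qed.

Lemma geo_seq (t : R) : 0 < t -> exists2 G, 0 < G & forall M (s : seq int), uniq s ->
  \sum_(k <- s) pw (- t) (absz (k - M))%:Z <= G.
Proof.
move=> t0; have [G G0 hG] := geo_wsum t0; exists G => // M s us.
have := @sum_wsum (fun j => pw (- t) (absz j)%:Z) G [seq k - M | k <- s] _ (fun j => pw_ge0 _ _) hG.
rewrite big_map; apply.
by rewrite map_inj_uniq//; exact: addIr.
Qed.

(** The best t is B / A. If A or B is 0 it degenerates, and t tending to infinity or to 0 takes its
    place. *)
Lemma le_mulr_limit (X A B : R) : 0 <= A -> 0 <= B ->
  (forall t, 0 < t -> 2 * X <= t * A ^+ 2 + t^-1 * B ^+ 2) -> X <= A * B.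
Proof.
move=> A0 B0 h; have [AB|AB] := ltP 0 (A * B).
  have [A1 B1] : 0 < A /\ 0 < B.
    by split; rewrite lt_neqAle ?A0 ?B0 andbT eq_sym; apply: contraTneq AB => ->; rewrite ?mul0r ?mulr0 ltxx.
  have := h (B / A) (divr_gt0 B1 A1); rewrite invf_div !expr2.
  have -> : B / A * (A * A) + A / B * (B * B) = 2 * (A * B).
    by field; rewrite !gt_eqF.
  by rewrite ler_pM2l.
have AB0 : A * B = 0 by apply/eqP; rewrite eq_le AB mulr_ge0.
rewrite AB0; apply/ler_addgt0Pr => e e0; rewrite add0r.
have : A == 0 \/ B == 0 by move/eqP: AB0; rewrite mulf_eq0 => /orP.
move=> [/eqP A1|/eqP B1].
  have t0 : 0 < (B ^+ 2 + 1) / e by rewrite divr_gt0// ltr_wpDl// sqr_ge0.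
  have := h _ t0; rewrite A1 expr0n mulr0 add0r invf_div => h1.
  have : e / (B ^+ 2 + 1) * B ^+ 2 <= e.
    rewrite mulrAC ler_pdivrMr; last by rewrite ltr_wpDl// sqr_ge0.
    by rewrite ler_pM2l// lerDl.
  by move: h1; lra.
have t0 : 0 < e / (A ^+ 2 + 1) by rewrite divr_gt0// ltr_wpDl// sqr_ge0.
have := h _ t0; rewrite B1 expr0n mulr0 addr0 => h1.
have : e / (A ^+ 2 + 1) * A ^+ 2 <= e.
  rewrite mulrAC ler_pdivrMr; last by rewrite ltr_wpDl// sqr_ge0.
  by rewrite ler_pM2l// lerDl.
by move: h1; lra.
Qed.

(** Schur's test: 2 c d <= t c^2 + d^2 / t splits the bilinear sum into two, in each of which the
    kernel is summed over the free index. [le_mulr_limit] then optimizes t. *)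
Lemma schur_sum : exists2 G : R, 0 < G & forall c d A B (s : seq int), uniq s ->
  (forall j, 0 <= c j) -> (forall j, 0 <= d j) -> 0 <= A -> 0 <= B ->
  \sum_(l <- s) c l ^+ 2 <= A ^+ 2 -> \sum_(j <- s) d j ^+ 2 <= B ^+ 2 ->
  \sum_(l <- s) \sum_(j <- s) pw (- 1) (absz (l - j))%:Z * (c l * d j) <= G * (A * B).
Proof.
have [G G0 hG] := geo_seq (@ltr01 R); exists G => // c d A B s us c0 d0 A0 B0 hA hB.
have G0' := ltW G0.
rewrite mulrA; apply: le_mulr_limit; rewrite ?mulr_ge0// => t t0.
suff [H1 H2] : \sum_(l <- s) \sum_(j <- s) pw (- 1 : R) (absz (l - j))%:Z * c l ^+ 2 <= G * A ^+ 2 /\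
    \sum_(l <- s) \sum_(j <- s) pw (- 1 : R) (absz (l - j))%:Z * d j ^+ 2 <= G * B ^+ 2.
  pose t' := t * G; have t0' : 0 < t' by rewrite mulr_gt0.
  apply: (@le_trans _ _ (t' * (G * A ^+ 2) + t'^-1 * (G * B ^+ 2))); last first.
    rewrite /t' invfM le_eqVlt; apply/orP; left; apply/eqP; field.
    by rewrite !gt_eqF.
  apply: (@le_trans _ _ (t' * (\sum_(l <- s) \sum_(j <- s) pw (- 1 : R) (absz (l - j))%:Z * c l ^+ 2) +
     t'^-1 * (\sum_(l <- s) \sum_(j <- s) pw (- 1 : R) (absz (l - j))%:Z * d j ^+ 2))); last first.
    by rewrite lerD// ler_wpM2l// ?invr_ge0 ltW.
  rewrite !mulr_sumr -big_split /=; apply: ler_sum => l _.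
  rewrite !mulr_sumr -big_split /=; apply: ler_sum => j _.
  rewrite mulrCA [t' * _]mulrCA [t'^-1 * _]mulrCA -mulrDr ler_wpM2l//.
  have e : t' * c l ^+ 2 + t'^-1 * d j ^+ 2 - 2 * (c l * d j) = t'^-1 * (t' * c l - d j) ^+ 2.
    by rewrite !expr2; field; rewrite gt_eqF.
  by rewrite -subr_ge0 e mulr_ge0 ?sqr_ge0// invr_ge0 ltW.
split.
  apply: (@le_trans _ _ (\sum_(l <- s) G * c l ^+ 2)); last by rewrite -mulr_sumr ler_wpM2l.
  apply: ler_sum => l _; rewrite -mulr_suml ler_wpM2r ?sqr_ge0//.
  apply: le_trans (hG l s us); apply: ler_sum => j _.
  by rewrite -abszN opprB.
rewrite exchange_big /=.
apply: (@le_trans _ _ (\sum_(j <- s) G * d j ^+ 2)); last by rewrite -mulr_sumr ler_wpM2l.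
by apply: ler_sum => j _; rewrite -mulr_suml ler_wpM2r ?sqr_ge0//; exact: hG.
Qed.

Lemma pw_low_sum (t : R) : 0 < t -> exists2 G, 0 < G & forall M (s : seq int), uniq s ->
  \sum_(k <- s) (if k < M then pw t k else 0) <= G * pw t M.
Proof.
move=> t0; have [G G0 hG] := geo_seq t0; exists G => // M s us.
apply: (@le_trans _ _ (\sum_(k <- s) pw t M * pw (- t) (absz (k - M))%:Z)); last first.
  by rewrite -mulr_sumr mulrC ler_wpM2r// hG.
apply: ler_sum => k _; case: ifPn => kM; last by rewrite mulr_ge0.
have e : (absz (k - M))%:Z = M - k by lia.
rewrite e (_ : pw (- t) (M - k) = pw t (k - M)).
  by rewrite -pwDz addrC subrK.
by rewrite /pw -opprB rmorphN mulrNN.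
Qed.

Lemma pw_near_sum (t : R) : exists2 G, 0 < G & forall M (s : seq int), uniq s ->
  \sum_(k <- s) (if (M < k + 4) && (k < M + 4) then pw t k else 0) <= G * pw t M.
Proof.
have [G G0 hG] := geo_seq (@ltr01 R).
(* For |k - M| <= 3, the ratio 2^(t (k - M)) is at most 2^(3 |t|), and the factor 2^3 compensates
   the geometric weight 2^(-|k - M|). *)
pose H := (pw `|t| 3 : R) * pw 1 3.
exists (H * G); first by rewrite !mulr_gt0.
move=> M s us; apply: (@le_trans _ _ (\sum_(k <- s) H * pw t M * pw (- 1) (absz (k - M))%:Z)); last first.
  by rewrite -mulr_sumr [leRHS]mulrAC; apply: ler_wpM2l; [rewrite !mulr_ge0|exact: hG].
apply: ler_sum => k _; case: ifPn => [/andP[h1 h2]|_]; last by rewrite !mulr_ge0.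
have -> : pw t k = pw t M * pw t (k - M) by rewrite -pwDz addrC subrK.
rewrite -mulrA mulrCA ler_wpM2l// /H -mulrA.
rewrite -[leLHS]mulr1; apply: ler_pM => //.
  rewrite /pw ler_powR ?ler1n// (le_trans (ler_norm _))// normrM ler_wpM2r//.
  by rewrite -intr_norm ler_int; lia.
rewrite -[leLHS](pwK (1 : R) 3) ler_wpM2l//.
rewrite /pw ler_powR ?ler1n// !mulrN1 lerN2 ler_int; lia.
Qed.

End SequenceSums.

Lemma max_add4 (l j k : int) : Num.max l j + 4 <= k -> l + 4 <= k /\ j + 4 <= k.
Proof. by rewrite maxEle; case: ifP; lia. Qed.

Lemma far_high (l j k : int) : l + 5 <= j -> j + 4 <= k -> l + 4 <= k.
Proof. lia. Qed.

Lemma absz_far (l j : int) : l + 5 <= j -> (absz (l - j))%:Z = j - l.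
Proof. lia. Qed.

Lemma absz_near (l j : int) : ~~ (l + 5 <= j) -> ~~ (j + 5 <= l) -> (absz (l - j))%:Z <= 4.
Proof. lia. Qed.

Lemma absz_max (l j : int) : - l + - j + (Num.max l j + Num.max l j) = (absz (l - j))%:Z.
Proof. by rewrite maxEle; case: ifP; lia. Qed.

(** * Bounds on the blocks of a product *)

Section ProductLaws.
Variables (R : realType) (phi : R3 R -> R).
Hypothesis lp : littlewood_paley phi.
Notation blk := (lp_block phi).
Notation bes := (bes phi).
Implicit Types (j k l : int) (u v : tdist R).

Let K j := ker (dyadic phi j).

(* [e k l j] bounds the L^p norm of the block [k] of the product of the blocks [l]
   of [u] and [j] of [v]. *)
Definition prod_bound (s p : R) u v (T : R) := exists e : int -> int -> int -> R,
  [/\ forall k l j, 0 <= e k l j,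
      forall k l j, lpb p (sconv (K k) (fun y => blk l u y * blk j v y)) (e k l j)
    & forall sk t : seq int, uniq sk -> uniq t ->
      \sum_(k <- sk) pw s k * (\sum_(l <- t) \sum_(j <- t) e k l j) <= T].

Variables (p : R) (p1 : 1 <= p) (p3 : p < 3).
Let p0 : 0 < p. Proof. exact: lt_le_trans p1. Qed.
Let p0' : 0 <= p. Proof. exact: ltW. Qed.
Notation sigma := (sigma p).
Notation rho := (rho p).
Notation tau0 := (tau0 p).

Lemma lpb_vanish f B : 0 <= B -> (forall x, f x = 0) -> lpb p f B.
Proof. by move=> B0 /funext f0; rewrite (_ : f = fun=> 0)//; exact: lpb0. Qed.

(** The sums are finite, so the output index k can be summed first, which leaves a kernel in (l,
    j). *)
Lemma exchange_bound (s : R) (e : int -> int -> int -> R) (m : int -> int -> R) (T : R) :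
  (forall (sk : seq int) l j, uniq sk -> \sum_(k <- sk) pw s k * e k l j <= m l j) ->
  (forall t, uniq t -> \sum_(l <- t) \sum_(j <- t) m l j <= T) ->
  forall sk t : seq int, uniq sk -> uniq t ->
      \sum_(k <- sk) pw s k * (\sum_(l <- t) \sum_(j <- t) e k l j) <= T.
Proof.
move=> hm hT sk t usk ut; apply: le_trans (hT t ut).
have -> : \sum_(k <- sk) pw s k * (\sum_(l <- t) \sum_(j <- t) e k l j) =
    \sum_(l <- t) \sum_(j <- t) \sum_(k <- sk) pw s k * e k l j.
  rewrite (eq_bigr (fun k => \sum_(l <- t) \sum_(j <- t) pw s k * e k l j)); last first.
    by move=> k _; rewrite mulr_sumr; apply: eq_bigr => l _; rewrite mulr_sumr.
  by rewrite exchange_big /=; apply: eq_bigr => l _; rewrite exchange_big.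
by apply: ler_sum => l _; apply: ler_sum => j _; exact: hm.
Qed.

(** The exponents close up. Far terms with l the lower index leave 2^l 2^(-sigma j) 2^((sigma - 1)
    j) = 2^(-|l - j|). In near terms sigma - 1 + 3 (2/rho - 1/p) = 2 tau0 > 0, so the sum over k is
    governed by its largest index, about max(l, j), and compensates 2^(-tau0 (l + j)) up to a
    constant, since |l - j| <= 4. *)
Lemma product_law1 : exists2 C, 0 < C & forall u v (A B : R),
  bes sigma p 2 u A -> bes sigma p 2 v B -> prod_bound (sigma - 1) p u v (C * (A * B)).
Proof.
have [C1 C10 h1] := near_product lp p1.
have [C2 C20 h2] := blk_sigma_sup lp p1.
have [C3 C30 h3] := bounded_product lp p1.
have tau2 : 0 < 2 * tau0 by rewrite mulr_gt0// tau0_gt0.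
have [G1 G10 g1] := pw_low_sum tau2.
have [G2 G20 g2] := @pw_near_sum R (sigma - 1).
have [G3 G30 g3] := @schur_sum R.
(* The three powers of index 4 come from the upper limit max(l, j) + 4 of the sum over k, from
   2^(tau0 |l - j|) with |l - j| <= 4, and from inserting the kernel 2^(-|l - j|) that near terms do
   not produce by themselves. *)
pose Cn : R := C1 * G1 * pw (2 * tau0) 4 * pw tau0 4 * pw 1 4.
pose Cf : R := C3 * C2 * G2.
have Cn0 : 0 < Cn by rewrite !mulr_gt0.
have Cf0 : 0 < Cf by rewrite !mulr_gt0.
exists ((Cn + Cf) * G3); first by rewrite mulr_gt0// addr_gt0.
move=> u v A B [c [c0 hc A0 hA]] [d [d0 hd B0 hB]].
(* The zero branches are those where the Fourier supports annihilate the block: |k - j| >= 4 when l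
   + 5 <= j, and k >= max(l, j) + 4 in the near case. *)
pose far k l j (a b : R) : R := if (j < k + 4) && (k < j + 4)
  then C3 * (C2 * (pw 1 l * a) * (pw (- sigma) j * b)) else 0.
pose near k l j : R := if k < Num.max l j + 4
  then C1 * (pw (3 * (2 / rho - p^-1)) k * (pw (- tau0) l * pw (- tau0) j) * (c l * d j)) else 0.
pose e k l j := if l + 5 <= j then far k l j (c l) (d j)
  else if j + 5 <= l then far k j l (d j) (c l) else near k l j.
have C3' := ltW C30; have C2' := ltW C20; have C1' := ltW C10.
have far0 k l j (a b : R) : 0 <= a -> 0 <= b -> 0 <= far k l j a b.
  by move=> a0 b0; rewrite /far; case: ifP => // _; rewrite !mulr_ge0.
have e0 k l j : 0 <= e k l j.
  rewrite /e; case: ifP => _; first exact: far0.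
  case: ifP => _; first exact: far0.
  by rewrite /near; case: ifP => // _; rewrite !mulr_ge0.
exists e; split=> //.
- move=> k l j; rewrite /e.
  have farP (l' j' : int) (u' v' : tdist R) (a b : R) : l' + 5 <= j' ->
      lpb p (blk l' u') (pw (- sigma) l' * a) -> lpb p (blk j' v') (pw (- sigma) j' * b) ->
      0 <= a -> 0 <= b ->
      lpb p (sconv (K k) (fun y => blk l' u' y * blk j' v' y)) (far k l' j' a b).
    move=> lj ha hb a0 b0; rewrite /far; case: ifPn => [_|].
      by apply: h3 => // x; exact: h2.
    rewrite negb_and -!leNgt => /orP[kj|jk].
      by apply: lpb_vanish => // x; apply: blk_product0 => // xi eta; exact: supp_low lj kj.
    apply: lpb_vanish => // x; apply: blk_product0 => // xi eta; exact: supp_high (far_high lj jk) jk.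
  case: ifPn => [lj|_]; first exact: farP.
  case: ifPn => [jl|_].
    rewrite -/(K k) (blk_productC phi k l j u v); exact: farP.
  rewrite /near; case: ifPn => [_|]; first exact: h1.
  rewrite -leNgt => hk; apply: lpb_vanish => // x; apply: blk_product0 => // xi eta.
  by have [hl hj] := max_add4 hk; exact: supp_high hl hj.
apply: (@exchange_bound _ e (fun l j => (Cn + Cf) * (pw (- 1) (absz (l - j))%:Z * (c l * d j)))).
  move=> sk l j usk.
  have farS (l' j' : int) (a b : R) : l' + 5 <= j' -> 0 <= a -> 0 <= b ->
      \sum_(k <- sk) pw (sigma - 1) k * far k l' j' a b <= Cf * (pw (- 1) (absz (l' - j'))%:Z * (a * b)).
    move=> lj a0 b0; pose X := C3 * (C2 * (pw 1 l' * a) * (pw (- sigma) j' * b)).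
    have X0 : 0 <= X by rewrite !mulr_ge0.
    apply: (@le_trans _ _ (X * \sum_(k <- sk) (if (j' < k + 4) && (k < j' + 4) then pw (sigma - 1) k else 0))).
      rewrite mulr_sumr; apply: ler_sum => k _; rewrite /far.
      by case: ifP => _; rewrite ?mulr0// mulrC.
    apply: (le_trans (ler_wpM2l X0 (g2 j' sk usk))).
    have ez := absz_far lj.
    have e1 : pw (- 1 : R) (absz (l' - j'))%:Z = pw 1 l' * (pw (- sigma) j' * pw (sigma - 1) j').
      rewrite ez -pwD (_ : - sigma + (sigma - 1) = - 1); last by ring.
      by rewrite pwDz mulrC; congr (_ * _); rewrite /pw rmorphN mulrNN.
    rewrite e1 /X /Cf le_eqVlt; apply/orP; left; apply/eqP; ring.
  have m0 : 0 <= pw (- 1 : R) (absz (l - j))%:Z * (c l * d j) by rewrite !mulr_ge0.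
  case: (boolP (l + 5 <= j)) => lj.
    rewrite (eq_bigr (fun k => pw (sigma - 1) k * far k l j (c l) (d j))); last by move=> k _; rewrite /e lj.
    by apply: (le_trans (farS _ _ _ _ lj (c0 l) (d0 j))); rewrite ler_wpM2r// lerDr ltW.
  case: (boolP (j + 5 <= l)) => jl.
    rewrite (eq_bigr (fun k => pw (sigma - 1) k * far k j l (d j) (c l))); last first.
      by move=> k _; rewrite /e (negbTE lj) jl.
    apply: (le_trans (farS _ _ _ _ jl (d0 j) (c0 l))).
    by rewrite (mulrC (d j)) -(abszN (j - l)) opprB ler_wpM2r// lerDr ltW.
  rewrite (eq_bigr (fun k => pw (sigma - 1) k * near k l j)); last first.
    by move=> k _; rewrite /e (negbTE lj) (negbTE jl).
  pose Y := C1 * (pw (- tau0) l * pw (- tau0) j * (c l * d j)).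
  have Y0 : 0 <= Y by rewrite !mulr_ge0.
  apply: (@le_trans _ _ (Y * \sum_(k <- sk) (if k < Num.max l j + 4 then pw (2 * tau0) k else 0))).
    rewrite mulr_sumr; apply: ler_sum => k _; rewrite /near; case: ifP => _; rewrite ?mulr0//.
    have -> : pw (2 * tau0) k = pw (sigma - 1) k * pw (3 * (2 / rho - p^-1)) k.
      by rewrite -pwD; congr (pw _ k); rewrite /sigma /tau0; ring.
    by rewrite /Y le_eqVlt; apply/orP; left; apply/eqP; ring.
  apply: (le_trans (ler_wpM2l Y0 (g1 _ sk usk))).
  have key : pw (- tau0) l * pw (- tau0) j * pw (2 * tau0) (Num.max l j + 4) <=
      pw (2 * tau0) 4 * pw tau0 4 * pw 1 4 * pw (- 1) (absz (l - j))%:Z.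
    have e2 : pw (2 * tau0) (Num.max l j) = pw tau0 (Num.max l j) * pw tau0 (Num.max l j).
      by rewrite mulr_natl mulr2n pwD.
    have q1 : pw (- tau0) l * pw (- tau0) j * (pw tau0 (Num.max l j) * pw tau0 (Num.max l j)) =
        pw tau0 (absz (l - j))%:Z.
      have n x : pw (- tau0) x = pw tau0 (- x) by rewrite /pw rmorphN mulrN mulNr.
      by rewrite !n -!pwDz absz_max.
    have t0 := tau0_gt0 p1 p3.
    have q2 : pw tau0 (absz (l - j))%:Z <= pw tau0 4 by apply: ler_pw; [exact: ltW|exact: absz_near].
    have q3 : 1 <= pw (1 : R) 4 * pw (- 1) (absz (l - j))%:Z.
      rewrite -[leLHS](pwK (1 : R) 4) ler_wpM2l// /pw ler_powR ?ler1n// !mulrN1 lerN2 ler_int.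
      exact: absz_near.
    rewrite -q1 in q2; rewrite pwDz e2.
    set P4 := pw (2 * tau0) 4.
    rewrite [leLHS](_ : _ = P4 * (pw (- tau0) l * pw (- tau0) j * (pw tau0 (Num.max l j) * pw tau0 (Num.max l j)))); last by ring.
    rewrite [leRHS](_ : _ = P4 * (pw tau0 4 * (pw 1 4 * pw (- 1) (absz (l - j))%:Z))); last by ring.
    rewrite ler_wpM2l//; first exact: pw_ge0.
    by apply: (le_trans q2); rewrite ler_peMr.
  have -> : Y * (G1 * pw (2 * tau0) (Num.max l j + 4)) =
    C1 * G1 * (c l * d j) * (pw (- tau0) l * pw (- tau0) j * pw (2 * tau0) (Num.max l j + 4)).
    by rewrite /Y; ring.
  apply: (@le_trans _ _ (Cn * (pw (- 1) (absz (l - j))%:Z * (c l * d j)))); last first.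
    by rewrite ler_wpM2r// lerDl ltW.
  have Z0 : 0 <= C1 * G1 * (c l * d j) by rewrite !mulr_ge0// ltW.
  apply: (le_trans (ler_wpM2l Z0 key)).
  by rewrite /Cn le_eqVlt; apply/orP; left; apply/eqP; ring.
move=> t ut; have CC : 0 <= Cn + Cf by rewrite ltW// addr_gt0.
under eq_bigr do rewrite -mulr_sumr; rewrite -mulr_sumr -[leRHS]mulrA ler_wpM2l//.
have sq (f : int -> R) (B' : R) : 0 <= B' -> (forall j, 0 <= f j) ->
    (forall n, wsum (fun j => f j `^ 2) n <= B' `^ 2) -> \sum_(l <- t) f l ^+ 2 <= B' ^+ 2.
  move=> B0' f0 hf; rewrite -powR_mulrn//; under eq_bigr do rewrite -powR_mulrn//.
  by apply: (sum_wsum ut _ hf) => j; exact: powR_ge0.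
by apply: g3 => //; exact: sq.
Qed.

(** The sup norm goes to the factor of lower index. The blocks of v are bounded without loss since
    sigma + 1 = 3/p, and those of u lose 2^l, which 2^(-j) compensates when l < j. As sigma > 0, the
    sum over k is governed by its largest index; no kernel is left, and l^1 times l^1 is enough. *)
Lemma product_law2 : exists2 C, 0 < C & forall u v (A B : R),
  bes sigma p 1 u A -> bes (sigma + 1) p 1 v B -> prod_bound sigma p u v (C * (A * B)).
Proof.
have [C2 C20 h2] := blk_sigma_sup lp p1.
have [C3 C30 h3] := bounded_product lp p1.
have [C4 C40 h4] := blk_sup lp p1.
have s0 := sigma_gt0 p1 p3.
have [G1 G10 g1] := pw_low_sum s0.
have C3' := ltW C30; have C2' := ltW C20; have C4' := ltW C40; have G1' := ltW G10.
pose C := C3 * (C2 + C4) * G1 * pw sigma 4.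
have C0 : 0 < C by rewrite !mulr_gt0// addr_gt0.
exists C => // u v A B [c [c0 hc A0 hA]] [d [d0 hd B0 hB]].
pose m l j : R := if j <= l then C4 * d j * (pw (- sigma) l * c l)
  else C2 * (pw 1 l * c l) * (pw (- (sigma + 1)) j * d j).
have m0 l j : 0 <= m l j by rewrite /m; case: ifP => _; rewrite !mulr_ge0.
pose e k l j := if k < Num.max l j + 4 then C3 * m l j else 0.
exists e; split.
- by move=> k l j; rewrite /e; case: ifP => // _; rewrite mulr_ge0.
- move=> k l j; rewrite /e; case: ifPn => [_|]; last first.
    rewrite -leNgt => hk; apply: lpb_vanish => // x; apply: blk_product0 => // xi eta.
    by have [hl hj] := max_add4 hk; exact: supp_high hl hj.
  rewrite /m; case: ifPn => _; last by apply: h3 => // x; exact: h2.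
  rewrite (blk_productC phi k l j u v); apply: h3 => // x.
  apply: (le_trans (h4 _ _ _ (hd j) x)); rewrite ler_wpM2l// mulrA -pwD.
  have -> : 3 / p - (sigma + 1) = 0 by rewrite /sigma; ring.
  by rewrite pw0 mul1r.
apply: (@exchange_bound _ e (fun l j => C * (c l * d j))).
  move=> sk l j usk.
  apply: (@le_trans _ _ (C3 * m l j * \sum_(k <- sk) (if k < Num.max l j + 4 then pw sigma k else 0))).
    rewrite mulr_sumr; apply: ler_sum => k _; rewrite /e.
    by case: ifP => _; rewrite ?mulr0// mulrC.
  have X0 : 0 <= C3 * m l j by rewrite mulr_ge0.
  apply: (le_trans (ler_wpM2l X0 (g1 _ sk usk))).
  have key : m l j * pw sigma (Num.max l j) <= (C2 + C4) * (c l * d j).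
    rewrite /m maxEle; case: (leP j l) => jl.
      have -> : (if l <= j then j else l) = l by case: ifP => // lj; apply/eqP; rewrite eq_le jl lj.
      have -> : C4 * d j * (pw (- sigma) l * c l) * pw sigma l = C4 * (c l * d j) * (pw sigma l * pw (- sigma) l) by ring.
      by rewrite pwK mulr1 ler_wpM2r ?mulr_ge0// lerDr.
    rewrite (ltW jl).
    have -> : C2 * (pw 1 l * c l) * (pw (- (sigma + 1)) j * d j) * pw sigma j =
       C2 * (c l * d j) * (pw 1 l * (pw (- (sigma + 1)) j * pw sigma j)) by ring.
    rewrite -pwD (_ : - (sigma + 1) + sigma = - 1); last by ring.
    have h : pw (1 : R) l * pw (- 1) j <= 1.
      by rewrite -[leRHS](pwK (1 : R) j) ler_wpM2r// ler_pw// ltW.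
    apply: (@le_trans _ _ (C2 * (c l * d j) * 1)); first by rewrite ler_wpM2l ?mulr_ge0.
    by rewrite mulr1 ler_wpM2r ?mulr_ge0// lerDl.
  rewrite pwDz.
  have -> : C3 * m l j * (G1 * (pw sigma (Num.max l j) * pw sigma 4)) =
    C3 * G1 * pw sigma 4 * (m l j * pw sigma (Num.max l j)) by ring.
  have Z0 : 0 <= C3 * G1 * pw sigma 4 by rewrite !mulr_ge0.
  apply: (le_trans (ler_wpM2l Z0 key)).
  by rewrite /C le_eqVlt; apply/orP; left; apply/eqP; ring.
move=> t ut; under eq_bigr do rewrite -mulr_sumr -mulr_sumr; rewrite -mulr_sumr ler_wpM2l ?(ltW C0)//.
have sm (f : int -> R) (B' : R) : 0 <= B' -> (forall j, 0 <= f j) ->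
    (forall n, wsum (fun j => f j `^ 1) n <= B' `^ 1) -> \sum_(l <- t) f l <= B'.
  move=> B0' f0 hf; apply: sum_wsum => // n.
  have := hf n; rewrite powRr1//; congr (_ <= _); congr (wsum _ n).
  by apply/funext => j; rewrite powRr1.
rewrite -mulr_suml; apply: ler_pM; rewrite ?sumr_ge0//; exact: sm.
Qed.

End ProductLaws.

(** * Null sets and domination almost everywhere *)

Section NullSets.
Variable R : realType.
Local Notation E := (R3 R).
Local Notation RM := (measurableTypeR R).
Local Notation mu := (lebesgue3 R).
Implicit Types (f g : E -> R) (x : E).

(** Setting f to 0 on Z turns statements that hold almost everywhere into statements at every
    point. *)
Definition off (Z : set E) f x : R := \1_(~` Z) x * f x.

Definition null_set (Z : set E) := @measurable _ (R3 RM) Z /\ mu Z = 0%E.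

Lemma measurable_off Z f : null_set Z -> measurable3 f -> measurable3 (off Z f).
Proof.
move=> [mZ _] mf; apply: measurable3M => //; apply: measurable3_indic.
exact: measurableC.
Qed.

Lemma off_ae Z f : null_set Z ->
  ae_eq mu setT (fun x : R3 RM => (f x)%:E) (fun x => (off Z f x)%:E).
Proof.
move=> [mZ Z0]; exists Z; split=> // x /= /not_implyP[_ h].
apply: contrapT => nZ; apply: h; rewrite /off indicE mem_set ?mul1r//.
Qed.

Lemma integ_off Z f : null_set Z -> integ f -> integ (off Z f).
Proof.
move=> nZ fi; apply: (rintegrable_mul_bounded fi _ (C := 1)).
  by apply: measurable3_indic; apply: measurableC; case: nZ.
by move=> x; rewrite indicE; case: (_ \in _); rewrite /= ?normr1 ?normr0.
Qed.

Lemma Rint_off Z f : null_set Z -> measurable3 f -> \int[mu]_x off Z f x = \int[mu]_x f x.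
Proof.
move=> nZ mf; rewrite /Rintegral; congr fine; apply/esym.
apply: ae_eq_integral => //.
- exact/measurable_EFinP.
- by apply/measurable_EFinP; exact: measurable_off.
- exact: off_ae.
Qed.

Lemma off_id Z f x : ~ Z x -> off Z f x = f x.
Proof. by move=> nZ; rewrite /off indicE mem_set ?mul1r. Qed.

Lemma off_eq0 Z f x : Z x -> off Z f x = 0.
Proof. by move=> Zx; rewrite /off indicE memNset ?mul0r//; apply. Qed.

(** By monotone convergence the limit of the [k n] has a finite weighted integral. It is thus finite
    off a null set, and its finite part is the dominating function. *)
Lemma weighted_monotone (k : nat -> E -> R) (C : R) :
  (forall n x, 0 <= k n x) -> (forall x, {homo (k^~ x) : m n / (m <= n)%N >-> m <= n}) ->
  (forall n, measurable3 (k n)) -> (forall n, integ (fun x => omega x * k n x)) ->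
  (forall n, \int[mu]_x (omega x * k n x) <= C) ->
  exists Z, null_set Z /\ exists H, [/\ measurable3 H, integ (fun x => omega x * H x) &
    forall n x, ~ Z x -> k n x <= H x].
Proof.
move=> k0 kh mk ik kC.
pose g n (x : R3 RM) : \bar R := (omega x * k n x)%:E.
have g0 n x : (0 <= g n x)%E by rewrite /g lee_fin mulr_ge0// omega_ge0.
have mg n : measurable_fun setT (g n).
  by apply/measurable_EFinP; exact: rintegrable_measurable (ik n).
have hg (x : R3 RM) : {homo (g^~ x) : m n / (m <= n)%N >-> (m <= n)%E}.
  by move=> m n mn; rewrite lee_fin ler_wpM2l ?omega_ge0// kh.
pose L (x : R3 RM) := limn (g^~ x).
have cL x : (g^~ x) @ \oo --> L x by apply: ereal_nondecreasing_is_cvgn.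
have mL : measurable_fun setT L by apply: (emeasurable_fun_cvg g).
have L0 x : (0 <= L x)%E by apply: lime_ge; [exact: cL|exact: nearW].
have LE x : L x = ereal_sup (range (g^~ x)).
  by apply/cvg_lim => //; exact: ereal_nondecreasing_cvgn.
have gL n x : (g n x <= L x)%E by rewrite LE; apply: ereal_sup_ubound; exists n.
have iL : (\int[mu]_x L x <= C%:E)%E.
  rewrite /L (monotone_convergence mu measurableT mg) //.
  apply: lime_le.
    by apply: ereal_nondecreasing_is_cvgn => m n mn; apply: ge0_le_integral => // x _; exact: hg.
  by apply: nearW => n; rewrite -EFin_Rint// lee_fin.
have intL : mu.-integrable setT L.
  apply/integrableP; split=> //; under eq_integral do rewrite gee0_abs//.
  by rewrite (le_lt_trans iL)// ltry.
pose Z := L @^-1` [set +oo%E].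
have mZ : @measurable _ (R3 RM) Z by rewrite -[Z]setTI; exact: mL.
have Z0 : mu Z = 0%E.
  have [N [mN N0 ZN]] := integrable_ae measurableT intL.
  apply/eqP; rewrite -measure_le0 -N0 le_measure ?inE// => x Zx; apply: ZN => /= /(_ I).
  by rewrite Zx.
exists Z; split=> //; exists (fun x => fine (L x) / omega x); split.
- have mfL : measurable3 (fun x => fine (L x)).
    by apply: (measurableT_comp (f := fine)) => //; exact: fine_measurable.
  apply: measurable3M; first exact: mfL.
  rewrite (_ : (fun x => _) = fun x => wt x ^+ 6); first by apply: measurable3X; exact: measurable_wt.
  by apply/funext => x; rewrite /omega invrK.
- have ifL : integ (fun x => fine (L x)).
    apply: rintegrable_ge0P.
    + by apply: (measurableT_comp (f := fine)) => //; exact: fine_measurable.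
    + by move=> x; exact: fine_ge0.
    + apply: (@le_lt_trans _ _ (\int[mu]_x L x)%E); last by rewrite (le_lt_trans iL)// ltry.
      apply: ge0_le_integral => //.
      * by move=> x _; rewrite lee_fin fine_ge0.
      * by apply/measurable_EFinP; exact: measurableT_comp.
      * by move=> x _; case: (L x) (L0 x) => [t||]//= _; exact: leey.
  by apply: (eq_integ _ ifL) => x; rewrite mulrC divfK// gt_eqF// omega_gt0.
- move=> n x nZ; rewrite ler_pdivlMr ?omega_gt0// -lee_fin fineK.
    by rewrite mulrC; exact: gL.
  rewrite ge0_fin_numE// lt_neqAle leey andbT; exact/eqP.
Qed.

End NullSets.

Section SeriesProducts.
Variable R : realType.
Local Notation E := (R3 R).
Local Notation mu := (lebesgue3 R).
Implicit Types (f g a : E -> R) (x y : E).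

Definition psum (u : int -> E -> R) n x : R := wsum (fun j => u j x) n.

Lemma wsum_mono (c : int -> R) : (forall j, 0 <= c j) -> {homo wsum c : m n / (m <= n)%N >-> m <= n}.
Proof.
move=> c0 m n mn; rewrite /wsum -!(big_mkord xpredT (fun i => c (Posz i) + c (Negz i))).
by rewrite (big_cat_nat _ mn)//= lerDl sumr_ge0// => i _; rewrite addr_ge0.
Qed.

Lemma psum_norm u n x : `|psum u n x| <= psum (fun j y => `|u j y|) n x.
Proof.
rewrite /psum /wsum (le_trans (ler_norm_sum _ _ _))//.
by apply: ler_sum => i _; exact: ler_normD.
Qed.

Lemma measurable_psum u n : (forall j, measurable3 (u j)) -> measurable3 (psum u n).
Proof. by move=> mu'; apply: measurable3_sum => i _; exact: measurable3D. Qed.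

Lemma psum_cvg u x (H : R) : (forall n, psum (fun j y => `|u j y|) n x <= H) ->
  cvgn (fun n => psum u n x).
Proof.
move=> h; have [l hl _] := @sumZ_abs R (fun j => u j x) H h.
by apply/cvg_ex; exists l; exact: sumZ_wsum.
Qed.

Lemma Rint_psum u n a : (forall j, integ (fun x => u j x * a x)) ->
  integ (fun x => psum u n x * a x) /\
  \int[mu]_x (psum u n x * a x) = wsum (fun j => \int[mu]_x (u j x * a x)) n.
Proof.
move=> h; have e x : psum u n x * a x = \sum_(i < n) (u (Posz i) x * a x + u (Negz i) x * a x).
  by rewrite /psum /wsum mulr_suml; apply: eq_bigr => i _; rewrite mulrDl.
have i1 (i : 'I_n) : integ (fun x => u (Posz i) x * a x + u (Negz i) x * a x).
  exact: rintegrableD.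
split.
  by apply: (eq_integ (fun x => esym (e x))); apply: rintegrable_sum.
transitivity (\int[mu]_x \sum_(i < n) (u (Posz i) x * a x + u (Negz i) x * a x)).
  exact: Rint_eq.
by rewrite Rint_sum// /wsum; apply: eq_bigr => i _; rewrite RintD.
Qed.

Variables (u v : int -> E -> R) (b b' : int -> R) (C : R) (D B' : R).
Hypothesis D0 : 0 <= D.
Hypotheses (b0 : forall j, 0 <= b j) (b0' : forall j, 0 <= b' j).
Hypotheses (ub : forall j, wl1 (u j) (b j)) (vb : forall j, wl1 (v j) (b' j)).
Hypotheses (uvb : forall l j, wl1 (fun x => u l x * v j x) (D * (b l * b' j))).
Hypotheses (bC : forall n, wsum b n <= C) (bC' : forall n, wsum b' n <= B').

Let mu_ j : measurable3 (u j). Proof. by case: (ub j). Qed.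
Let mv j : measurable3 (v j). Proof. by case: (vb j). Qed.
Let P := psum (fun j y => `|u j y|).
Let Q := psum (fun j y => `|v j y|).

Let wnorm f (B : R) : wl1 f B -> integ (fun x => `|f x| * omega x) /\
  \int[mu]_x (`|f x| * omega x) <= B.
Proof.
move=> [mf fi fb]; have i : integ (fun x => `|f x| * omega x).
  by apply: (eq_integ _ (rintegrable_norm fi)) => x; rewrite normrM (ger0_norm (omega_ge0 x)) mulrC.
by split=> //; apply: le_trans fb; rewrite le_eqVlt; apply/orP; left; apply/eqP;
  apply: Rint_eq => x; rewrite mulrC.
Qed.

Let Pbound n : integ (fun x => P n x * omega x) /\ \int[mu]_x (P n x * omega x) <= C.
Proof.
have [i e] := @Rint_psum (fun j y => `|u j y|) n (@omega R) (fun j => (wnorm (ub j)).1).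
split=> //; rewrite e; apply: le_trans (bC n); apply: ler_wsum => j; exact: (wnorm (ub j)).2.
Qed.

Let Qbound n : integ (fun x => Q n x * omega x) /\ \int[mu]_x (Q n x * omega x) <= B'.
Proof.
have [i e] := @Rint_psum (fun j y => `|v j y|) n (@omega R) (fun j => (wnorm (vb j)).1).
split=> //; rewrite e; apply: le_trans (bC' n); apply: ler_wsum => j; exact: (wnorm (vb j)).2.
Qed.

Let PQbound n : integ (fun x => P n x * Q n x * omega x) /\
  \int[mu]_x (P n x * Q n x * omega x) <= D * (C * B').
Proof.
have i1 l j : integ (fun x => `|u l x| * `|v j x| * omega x).
  by apply: (eq_integ _ (wnorm (uvb l j)).1) => x; rewrite normrM.
have h1 l j : \int[mu]_x (`|u l x| * `|v j x| * omega x) <= D * (b l * b' j).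
  apply: le_trans (wnorm (uvb l j)).2; rewrite le_eqVlt; apply/orP; left; apply/eqP.
  by apply: Rint_eq => x; rewrite normrM.
have e x : P n x * Q n x * omega x =
    \sum_(l <- window n) \sum_(j <- window n) (`|u l x| * `|v j x| * omega x).
  rewrite /P /Q /psum !wsumE mulr_suml mulr_suml; apply: eq_bigr => l _.
  by rewrite mulr_sumr mulr_suml.
have i2 l : integ (fun x => \sum_(j <- window n) (`|u l x| * `|v j x| * omega x)).
  by apply: rintegrable_sum.
split; first by apply: (eq_integ (fun x => esym (e x))); apply: rintegrable_sum.
rewrite (_ : \int[mu]_x (P n x * Q n x * omega x) =
  \int[mu]_x \sum_(l <- window n) \sum_(j <- window n) (`|u l x| * `|v j x| * omega x)); last exact: Rint_eq.
rewrite Rint_sum//.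
apply: (@le_trans _ _ (\sum_(l <- window n) \sum_(j <- window n) D * (b l * b' j))).
  by apply: ler_sum => l _; rewrite Rint_sum//; exact: ler_sum.
have -> : \sum_(l <- window n) \sum_(j <- window n) D * (b l * b' j) = D * (wsum b n * wsum b' n).
  rewrite !wsumE mulr_suml mulr_sumr; apply: eq_bigr => l _.
  by rewrite !mulr_sumr.
by rewrite ler_wpM2l// ler_pM// sumr_ge0// => i _; rewrite addr_ge0.
Qed.

(* The partial sums of u, v and u v are dominated off a null set, outside which
   the two series converge absolutely to [f] and [g]. *)
Theorem series_product : exists f g, [/\ measurable3 f, measurable3 g,
  wl1 (fun x => f x * g x) (D * (C * B')) &
  forall a (K : R), measurable3 a -> (forall x, wt x ^+ 6 * `|a x| <= K) ->
   [/\ integ (fun x => f x * a x), integ (fun x => g x * a x), integ (fun x => f x * g x * a x) &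
   [/\ \int[mu]_x (psum u n x * a x) @[n --> \oo] --> \int[mu]_x (f x * a x),
       \int[mu]_x (psum v n x * a x) @[n --> \oo] --> \int[mu]_x (g x * a x) &
       \int[mu]_x (psum u n x * psum v n x * a x) @[n --> \oo] --> \int[mu]_x (f x * g x * a x)]]].
Proof.
have P0 n x : 0 <= P n x by apply: sumr_ge0 => i _; rewrite addr_ge0.
have Q0 n x : 0 <= Q n x by apply: sumr_ge0 => i _; rewrite addr_ge0.
(* One increasing sequence controls the partial sums of u, those of v and their products, so a
   single null set and a single dominating function serve all three. *)
pose k n x := P n x + Q n x + P n x * Q n x.
have k0 n x : 0 <= k n x by rewrite !addr_ge0 ?mulr_ge0.
have Ph x m n : (m <= n)%N -> P m x <= P n x by apply: wsum_mono.
have Qh x m n : (m <= n)%N -> Q m x <= Q n x by apply: wsum_mono.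
have kh x : {homo (k^~ x) : m n / (m <= n)%N >-> m <= n}.
  by move=> m n mn; rewrite !lerD ?ler_pM ?Ph ?Qh.
have mP n : measurable3 (P n) by apply: measurable_psum => j; exact: measurable3_norm.
have mQ n : measurable3 (Q n) by apply: measurable_psum => j; exact: measurable3_norm.
have mk n : measurable3 (k n) by apply: measurable3D; [exact: measurable3D|exact: measurable3M].
have ke n x : omega x * k n x = P n x * omega x + Q n x * omega x + P n x * Q n x * omega x.
  by rewrite mulrC /k !mulrDl.
have ik n : integ (fun x => omega x * k n x).
  apply: (eq_integ (fun x => esym (ke n x))).
  by apply: rintegrableD; [apply: rintegrableD; [case: (Pbound n)|case: (Qbound n)]|case: (PQbound n)].
have kC n : \int[mu]_x (omega x * k n x) <= C + B' + D * (C * B').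
  have [p1 p2] := Pbound n; have [q1 q2] := Qbound n; have [r1 r2] := PQbound n.
  rewrite (_ : \int[mu]_x (omega x * k n x) = \int[mu]_x (P n x * omega x + Q n x * omega x + P n x * Q n x * omega x)); last exact: Rint_eq.
  by rewrite RintD//; [rewrite RintD// !lerD|exact: rintegrableD].
have [Z [nZ [H [mH iH hH]]]] := weighted_monotone k0 kh mk ik kC.
have PH n x : ~ Z x -> P n x <= H x.
  by move=> zx; apply: le_trans (hH n x zx); rewrite /k -addrA lerDl addr_ge0// mulr_ge0.
have QH n x : ~ Z x -> Q n x <= H x.
  by move=> zx; apply: le_trans (hH n x zx); rewrite /k addrAC lerDr addr_ge0// mulr_ge0.
have PQH n x : ~ Z x -> P n x * Q n x <= H x.
  by move=> zx; apply: le_trans (hH n x zx); rewrite /k lerDr addr_ge0.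
pose S n := off Z (psum u n); pose T n := off Z (psum v n).
have mS n : measurable3 (S n) by apply: measurable_off => //; exact: measurable_psum.
have mT n : measurable3 (T n) by apply: measurable_off => //; exact: measurable_psum.
have cS x : cvgn (fun n => S n x).
  have [zx|zx] := pselect (Z x).
    by rewrite (_ : (fun n => S n x) = fun=> 0); [exact: is_cvg_cst|by apply/funext => n; exact: off_eq0].
  rewrite (_ : (fun n => S n x) = fun n => psum u n x); last by apply/funext => n; exact: off_id.
  by apply: (@psum_cvg u x (H x)) => n; exact: PH.
have cT x : cvgn (fun n => T n x).
  have [zx|zx] := pselect (Z x).
    by rewrite (_ : (fun n => T n x) = fun=> 0); [exact: is_cvg_cst|by apply/funext => n; exact: off_eq0].
  rewrite (_ : (fun n => T n x) = fun n => psum v n x); last by apply/funext => n; exact: off_id.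
  by apply: (@psum_cvg v x (H x)) => n; exact: QH.
pose f x := limn (fun n => S n x); pose g x := limn (fun n => T n x).
have Sf x : S n x @[n --> \oo] --> f x by exact: cS.
have Tg x : T n x @[n --> \oo] --> g x by exact: cT.
have mf : measurable3 f by apply: (measurable_fun_cvg mS) => x _; exact: Sf.
have mg : measurable3 g by apply: (measurable_fun_cvg mT) => x _; exact: Tg.
have bS n x : `|S n x| <= off Z H x.
  have [zx|zx] := pselect (Z x); first by rewrite /S !off_eq0// normr0.
  by rewrite /S !off_id// (le_trans (psum_norm _ _ _))// PH.
have bT n x : `|T n x| <= off Z H x.
  have [zx|zx] := pselect (Z x); first by rewrite /T !off_eq0// normr0.
  by rewrite /T !off_id// (le_trans (psum_norm _ _ _))// QH.
have bST n x : `|S n x * T n x| <= off Z H x.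
  have [zx|zx] := pselect (Z x); first by rewrite /S /T !off_eq0// mulr0 normr0.
  rewrite /S /T !off_id// normrM (le_trans _ (PQH n x zx))// ler_pM//; exact: psum_norm.
have iHo : integ (fun x => omega x * off Z H x).
  by apply: (eq_integ _ (integ_off nZ iH)) => x; rewrite /off mulrCA.
have dom a (K : R) (F : nat -> E -> R) (F' : E -> R) : measurable3 a ->
    (forall x, wt x ^+ 6 * `|a x| <= K) -> (forall n, measurable3 (F n)) ->
    (forall n x, `|F n x| <= off Z H x) -> (forall x, F n x @[n --> \oo] --> F' x) ->
    integ (fun x => F' x * a x) /\
    \int[mu]_x (F n x * a x) @[n --> \oo] --> \int[mu]_x (F' x * a x).
  move=> ma aK mF bF cF.
  have aK' x : `|a x| <= K * omega x by rewrite /omega ler_pdivlMr ?exprn_gt0// mulrC.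
  apply: (@Rint_dominated _ _ _ mu (fun n x => F n x * a x) (fun x => F' x * a x)
    (fun x => K * (omega x * off Z H x))).
  - by move=> n; exact: measurable3M.
  - by move=> x; apply: cvgM => //; exact: cvg_cst.
  - exact: rintegrableZ.
  - by move=> n x; rewrite normrM mulrC mulrA ler_pM.
have offM n x a : off Z (fun y => psum u n y * psum v n y * a y) x = S n x * T n x * a x.
  have [zx|zx] := pselect (Z x); first by rewrite /S /T !off_eq0// mul0r mul0r.
  by rewrite /S /T !off_id.
exists f, g; split=> //.
  have mo : measurable3 (@omega R) by exact: measurable_wtVn.
  have oK x : wt x ^+ 6 * `|omega x| <= 1.
    by rewrite ger0_norm ?omega_ge0// /omega mulfV// expf_neq0// gt_eqF.
  have [i c] := dom (@omega R) 1 (fun n x => S n x * T n x) (fun x => f x * g x) mo oK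
    (fun n => measurable3M (mS n) (mT n)) bST (fun x => cvgM (Sf x) (Tg x)).
  have bST' n x : `| (`|S n x * T n x|) | <= off Z H x by rewrite normr_id.
  have [i' c'] := dom (@omega R) 1 (fun n x => `|S n x * T n x|) (fun x => `|f x * g x|) mo oK
    (fun n => measurable3_norm (measurable3M (mS n) (mT n)))
    bST' (fun x => cvg_norm (cvgM (Sf x) (Tg x))).
  split; first exact: measurable3M.
    by apply: (eq_integ _ i) => x; rewrite mulrC.
  rewrite (_ : \int[mu]_x (omega x * _) = \int[mu]_x (`|f x * g x| * omega x)); last first.
    by apply: Rint_eq => x; rewrite mulrC.
  apply: (ler_cvg_to c' (cvg_cst (D * (C * B')))); apply: nearW => n.
  have [r1 r2] := PQbound n; apply: le_trans r2; apply: Rint_le => //.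
    apply: (rintegrable_le _ r1).
      by apply: measurable3M => //; apply: measurable3_norm; exact: measurable3M.
    move=> x; rewrite normrM normr_id (ger0_norm (omega_ge0 x)) ler_wpM2r ?omega_ge0//.
    have [zx|zx] := pselect (Z x); first by rewrite /S /T !off_eq0// mulr0 normr0 mulr_ge0.
    by rewrite /S /T !off_id// normrM ler_pM//; exact: psum_norm.
  move=> x; rewrite ler_wpM2r ?omega_ge0//.
  have [zx|zx] := pselect (Z x); first by rewrite /S /T !off_eq0// mulr0 normr0 mulr_ge0.
  by rewrite /S /T !off_id// normrM ler_pM//; exact: psum_norm.
move=> a K ma aK.
have [i1 c1] := dom a K S f ma aK mS bS Sf.
have [i2 c2] := dom a K T g ma aK mT bT Tg.
have [i3 c3] := dom a K (fun n x => S n x * T n x) (fun x => f x * g x) ma aK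
    (fun n => measurable3M (mS n) (mT n)) bST (fun x => cvgM (Sf x) (Tg x)).
split; [exact: i1|exact: i2|exact: i3|split].
- apply: cvg_trans c1; apply: near_eq_cvg; apply: nearW => n.
  rewrite -(Rint_off nZ (measurable3M (measurable_psum n mu_) ma)).
  by apply: Rint_eq => x; rewrite /S /off mulrA.
- apply: cvg_trans c2; apply: near_eq_cvg; apply: nearW => n.
  rewrite -(Rint_off nZ (measurable3M (measurable_psum n mv) ma)).
  by apply: Rint_eq => x; rewrite /T /off mulrA.
- apply: cvg_trans c3; apply: near_eq_cvg; apply: nearW => n.
  rewrite -(Rint_off nZ (measurable3M (measurable3M (measurable_psum n mu_) (measurable_psum n mv)) ma)).
  by apply: Rint_eq => x; rewrite offM.
Qed.

End SeriesProducts.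

(** * Existence of the product *)

Section ProductExists.
Variables (R : realType) (phi : R3 R -> R).
Hypothesis lp : littlewood_paley phi.
Local Notation E := (R3 R).
Local Notation mu := (lebesgue3 R).
Notation blk := (lp_block phi).
Notation bes := (bes phi).
Implicit Types (i j k l : int) (u v w : tdist R) (f g psi : E -> R).

Variables (p : R) (p1 : 1 <= p) (p3 : p < 3).
Let p0 : 0 < p. Proof. exact: lt_le_trans p1. Qed.
Notation sigma := (sigma p).
Notation rho := (rho p).
Notation tau0 := (tau0 p).
Let K j := ker (dyadic phi j).
Let W : R := 2 * womega R.
Let W1 : 1 <= womega R. Proof. exact: womega_ge1. Qed.
Let W0 : 0 <= womega R. Proof. exact: le_trans ler01 W1. Qed.

(** Blocks of low frequency are bounded and those of high frequency are in L^rho. A product of two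
    such functions lies in L^1 with weight [omega] in each of the four cases, the last one because
    rho/2 >= 1. *)
Definition tame f (X : R) := [/\ measurable3 f, 0 <= X & (forall x, `|f x| <= X) \/ lpb rho f X].

Let rho1 : 1 <= rho. Proof. exact: le_trans p1 (rho_ge_p p). Qed.

Lemma wl1_weak f (A B : R) : wl1 f A -> A <= B -> wl1 f B.
Proof. by move=> [mf fi fA] AB; split=> //; exact: le_trans AB. Qed.

Lemma tame_wl1 f X : tame f X -> wl1 f (W * X).
Proof.
move=> [mf X0 [fX|fX]]; last exact: lpb_wl1 rho1 fX.
apply: wl1_weak (bounded_wl1 mf fX) _.
by rewrite /W -mulrA ler_peMl ?mulr_ge0// ler1n.
Qed.

Lemma tame_mul f g X Y : tame f X -> tame g Y -> wl1 (fun x => f x * g x) (W * (X * Y)).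
Proof.
have r0 : 0 <= rho by exact: le_trans ler01 rho1.
move=> [mf X0 [fX|fX]] [mg Y0 [gY|gY]].
- apply: wl1_weak (bounded_wl1 (B := X * Y) (measurable3M mf mg) _) _.
    by move=> x; rewrite normrM ler_pM.
  by rewrite /W -mulrA ler_peMl ?mulr_ge0// ler1n.
- exact: lpb_wl1 rho1 (lpb_bounded_mul r0 mf fX gY).
- have := lpb_wl1 rho1 (lpb_bounded_mul r0 mg gY fX); rewrite (mulrC Y).
  by under eq_fun do rewrite mulrC.
- have r00 : 0 < rho by exact: lt_le_trans rho1.
  exact: lpb_wl1 (rho_half1 p) (lpb_mul r00 fX gY).
Qed.

(** The rate t is the smaller of 1, from the factor 2^l in L^oo for l < 0, and of [tau0], from
    2^(-tau0 l) in L^rho for l >= 0. *)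
Lemma tame_blocks : exists2 t : R, 0 < t & exists2 C, 0 < C & forall u (A : R) l,
  bes sigma p 2 u A -> tame (blk l u) (C * (A * pw (- t) (absz l)%:Z)).
Proof.
have [C1 C10 h1] := blk_rho lp p1; have [C2 C20 h2] := blk_sigma_sup lp p1.
pose t : R := Num.min 1 tau0.
have t0 : 0 < t by rewrite lt_min ltr01 tau0_gt0.
exists t => //; exists (C1 + C2); first exact: addr_gt0.
move=> u A l hu; have A0 := bes_ge0 hu.
have hl := bes_term p1 (ler1n R 2) hu l.
have CC : 0 <= C1 + C2 by rewrite addr_ge0 ?ltW.
have le_pw1 (s : R) (i : nat) : t <= s -> pw (- s) i%:Z <= pw (- t) i%:Z.
  by move=> ts; rewrite /pw ler_powR ?ler1n// ler_wpM2l ?lerN2// ler0z.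
have X0 : 0 <= (C1 + C2) * (A * pw (- t) (absz l)%:Z) by rewrite !mulr_ge0.
split=> //; first exact: blk_measurable.
case: l hl X0 => i hl X0; [right|left].
  apply: (lpb_weak (le_trans ler01 rho1) (h1 _ _ _ hl)).
  apply: ler_pM; [exact: ltW|exact: mulr_ge0|by rewrite lerDl ltW|].
  by rewrite mulrC ler_wpM2l// le_pw1// ge_min lexx orbT.
move=> x; apply: (le_trans (h2 _ _ _ hl x)).
apply: ler_pM; rewrite ?mulr_ge0 ?(ltW C20)//; first by rewrite lerDr ltW.
rewrite mulrC ler_wpM2l//.
have -> : pw (1 : R) (Negz i) = pw (- 1) i.+1%:Z.
  by rewrite /pw NegzE mulrN mulr1 rmorphN /= mulr1.
by apply: le_pw1; rewrite ge_min lexx.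
Qed.

Definition mul_fun (h : E -> R) psi : R :=
  if `[< schwartz psi >] then \int[mu]_x (h x * psi x) else 0.

Lemma mul_fun_tempered h (B : R) : wl1 h B -> mul_fun h \in @tempered R.
Proof.
move=> hB; have s0 f : schwartz f -> 0 <= fine (schwartz_seminorm 6 f).
  by move=> sf; rewrite fine_ge0 ?seminorm_ge0.
have hp f (sf : schwartz f) := wl1_pair hB (schwartz_rapid sf).1 (s0 _ sf) (fun x => schwartz_wt6 x sf).
apply/asboolP; split.
- move=> a f g sf sg; rewrite /mul_fun !asboolT//; last exact: schwartz_lin.
  rewrite -RintZ; last exact: (hp _ sf).1.
  rewrite -RintD; [|apply: rintegrableZ; exact: (hp _ sf).1|exact: (hp _ sg).1].
  by apply: Rint_eq => x; rewrite mulrDr mulrCA.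
- exists B, 6%N => f sf.
  have /fineK <- : schwartz_seminorm 6 f \is a fin_num.
    by rewrite ge0_fin_numE ?seminorm_ge0//; case: sf => _; exact.
  by rewrite -EFinM lee_fin mulrC /mul_fun asboolT//; exact: (hp _ sf).2.
- by move=> f nf; rewrite /mul_fun asboolF.
Qed.

Lemma psum_mul_conv k u v n x : sconv (K k) (fun y => psum (fun l => blk l u) n y * psum (fun j => blk j v) n y) x =
  \sum_(l <- window n) \sum_(j <- window n) sconv (K k) (fun y => blk l u y * blk j v y) x.
Proof.
have rK : rapid (fun y => K k (x - y)) by apply: rapid_reflect; apply: rapid_ker; exact: blk_testfun.
have ig l j : integ (fun y => K k (x - y) * (blk l u y * blk j v y)).
  have := rapid_integ (rapid_multiplier u (blk_testfun lp l) (rapid_multiplier v (blk_testfun lp j) rK)).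
  by apply: eq_integ => y; rewrite /lp_block mulrA mulrC.
have e y : K k (x - y) * (psum (fun l => blk l u) n y * psum (fun j => blk j v) n y) =
   \sum_(l <- window n) \sum_(j <- window n) K k (x - y) * (blk l u y * blk j v y).
  rewrite /psum !wsumE mulr_suml mulr_sumr; apply: eq_bigr => l _.
  by rewrite mulr_sumr mulr_sumr.
rewrite /sconv (_ : \int[mu]_y _ =
  \int[mu]_y (\sum_(l <- window n) \sum_(j <- window n) K k (x - y) * (blk l u y * blk j v y))); last exact: Rint_eq.
rewrite Rint_sum; last by move=> l _; apply: rintegrable_sum.
by apply: eq_bigr => l _; rewrite Rint_sum.
Qed.

(** w is constructed once, as a pointwise product, and only then is a [prod_bound] of arbitrary
    regularity applied to it; the two product laws can therefore be used for one and the same w. *)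
Theorem product_exists u v (A B : R) : bes sigma p 2 u A -> bes sigma p 2 v B ->
  sums_to (fun j => blk j u) u -> sums_to (fun j => blk j v) v ->
  exists w, is_product u v w /\
    forall s T, 0 <= T -> prod_bound phi s p u v T -> bes s p 1 w T.
Proof.
move=> hu hv su sv; have [t t0 [C C0 tame]] := tame_blocks.
have [G G0 hG] := geo_wsum t0.
have A0 := bes_ge0 hu; have B0 := bes_ge0 hv; have C0' := ltW C0.
have WW : 0 <= W by rewrite mulr_ge0.
pose b l := C * (A * pw (- t) (absz l)%:Z); pose b' l := C * (B * pw (- t) (absz l)%:Z).
have b0 l : 0 <= b l by rewrite !mulr_ge0.
have b0' l : 0 <= b' l by rewrite !mulr_ge0.
have sb (D : R) n : 0 <= D -> wsum (fun l => W * (C * (D * pw (- t) (absz l)%:Z))) n <= W * (C * (D * G)).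
  by move=> D0; rewrite wsumZ ler_wpM2l// wsumZ ler_wpM2l// wsumZ ler_wpM2l.
have tu l := tame u A l hu; have tv j := tame v B j hv.
pose W' := if W == 0 then 0 else W^-1.
have W00 : W != 0 by rewrite mulf_neq0// gt_eqF// (lt_le_trans ltr01).
(* Each factor is bounded with a constant W, and so is the product, whereas [series_product]
   compares the product with the product of the two bounds; hence D = 1 / W. *)
have uvb l j : wl1 (fun x => blk l u x * blk j v x) (W^-1 * ((W * b l) * (W * b' j))).
  have := tame_mul (tu l) (tv j); rewrite (_ : W * _ = W^-1 * ((W * b l) * (W * b' j)))//.
  by rewrite /b /b'; field.
have WV : 0 <= W^-1 by rewrite invr_ge0.
have [f [g [mf mg wfg H]]] := series_product WV (fun l => mulr_ge0 WW (b0 l)) (fun l => mulr_ge0 WW (b0' l))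
  (fun l => tame_wl1 (tu l)) (fun j => tame_wl1 (tv j)) uvb (fun n => sb A n A0) (fun n => sb B n B0).
pose w := TDist (mul_fun_tempered wfg).
have wE psi : schwartz psi -> w psi = \int[mu]_x (f x * g x * psi x).
  by move=> sp; rewrite /w /= /mul_fun asboolT.
have Hs psi (sp : schwartz psi) := H psi _ (schwartz_rapid sp).1 (fun x => schwartz_wt6 x sp).
have rep (z : tdist R) h : sums_to (fun j => blk j z) z -> measurable3 h ->
    (forall psi, schwartz psi -> integ (fun x => h x * psi x) /\
      \int[mu]_x (psum (fun j => blk j z) n x * psi x) @[n --> \oo] --> \int[mu]_x (h x * psi x)) ->
    represents h z.
  move=> sz mh hh; split=> // psi sp; have [i c] := hh psi sp; split=> //.
  have := sumZ_wsum (sz psi sp).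
  have ij j : integ (fun x => blk j z x * psi x).
    by apply: rapid_integ; apply: rapid_multiplier; [exact: blk_testfun|exact: schwartz_rapid].
  rewrite (_ : (fun n => wsum _ n) = fun n => \int[mu]_x (psum (fun j => blk j z) n x * psi x)); last first.
    by apply/funext => n; rewrite (Rint_psum n ij).2.
  by move=> c'; exact: (cvg_unique (@Rhausdorff R) c' c).
exists w; split.
  exists f, g; split.
  - by apply: rep => // psi sp; have [? _ _ [? _ _]] := Hs psi sp.
  - by apply: rep => // psi sp; have [_ ? _ [_ ? _]] := Hs psi sp.
  - split; first exact: measurable3M.
    by move=> psi sp; have [_ _ ? _] := Hs psi sp; split=> //; exact: wE.
move=> s T T0 [e [e0 he hT]].
pose b2 k n := \sum_(l <- window n) \sum_(j <- window n) e k l j.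
have b2_0 k n : 0 <= b2 k n by rewrite sumr_ge0// => l _; rewrite sumr_ge0.
have sub m n : (m <= n)%N -> {subset window m <= window n}.
  move=> mn j; rewrite !mem_cat => /orP[/mapP[i hi ->]|/mapP[i hi ->]]; apply/orP; [left|right];
    apply: map_f; move: hi; rewrite !mem_iota !add0n => /andP[_ hi]; exact: leq_trans mn.
have b2h k : {homo b2 k : m n / (m <= n)%N >-> m <= n}.
  move=> m n mn; apply: (@le_trans _ _ (\sum_(l <- window m) \sum_(j <- window n) e k l j)).
    by apply: ler_sum => l _; apply: sum_subseq; rewrite ?window_uniq//; exact: sub.
  apply: (@sum_subseq _ (fun l => \sum_(j <- window n) e k l j)); rewrite ?window_uniq//; first exact: sub.
  by move=> l; rewrite sumr_ge0.
have b2T k n : pw s k * b2 k n <= T.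
  have := hT [:: k] (window n) isT (window_uniq n).
  by rewrite big_seq1.
have b2c k : cvgn (b2 k).
  apply: nondecreasing_is_cvgn => //; exists ((pw s k)^-1 * T) => _ [n _ <-].
  by rewrite ler_pdivlMl.
(* The bounds on the double partial sums increase with the window and stay below T after the weight.
   Their limit bounds block k of w by [lpb_fatou]. *)
pose c k := pw s k * limn (b2 k).
have lim_ge k n : b2 k n <= limn (b2 k) by apply: nondecreasing_cvgn_le.
have c0 k : 0 <= c k by rewrite mulr_ge0//; exact: le_trans (b2_0 k 0%N) (lim_ge k 0%N).
exists c; split=> //.
- move=> k; rewrite /c mulrA [pw (- s) k * _]mulrC pwK mul1r.
  pose F n x := \sum_(l <- window n) \sum_(j <- window n) sconv (K k) (fun y => blk l u y * blk j v y) x.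
  have hF n : lpb p (F n) (limn (b2 k)).
    apply: (lpb_weak (ltW p0) _ (lim_ge k n)).
    by apply: lpb_sum => // l; apply: lpb_sum => // j; exact: he.
  apply: (lpb_fatou p1 hF) => x.
  have sr : schwartz (fun y => K k (x - y)).
    by apply: schwartz_reflect; apply: schwartz_ker; exact: blk_testfun.
  have [_ _ _ [_ _ cc]] := Hs _ sr.
  have -> : blk k w x = \int[mu]_y (f y * g y * K k (x - y)) by exact: wE.
  apply: cvg_trans cc; apply: near_eq_cvg; apply: nearW => n.
  by rewrite /F -psum_mul_conv; apply: Rint_eq => y; rewrite mulrC.
- move=> n; rewrite powRr1//.
  rewrite (_ : (fun j => c j `^ 1) = c); last by apply/funext => j; rewrite powRr1.
  have cw : (fun m => \sum_(k <- window n) pw s k * b2 k m) @ \oo --> wsum c n.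
    rewrite wsumE; elim: (window n) => [|k r IH].
      by rewrite big_nil; under eq_fun do rewrite big_nil; exact: cvg_cst.
    by rewrite big_cons; under eq_fun do rewrite big_cons; apply: cvgD => //; apply: cvgM; [exact: cvg_cst|exact: b2c].
  apply: (ler_cvg_to cw (cvg_cst T)); apply: nearW => m.
  by apply: hT; exact: window_uniq.
Qed.

End ProductExists.

(** Dynkin's argument: the sets A over which the integral vanishes form a lambda-system, stable
    under increasing unions by dominated convergence, and it contains the pi-system G. *)
Lemma dynkin_integral d1 d2 (T : measurableType d1) (U : measurableType d2) (R : realType)
    (m : {measure set T -> \bar R}) (f : T -> R) (pr : T -> U) (G : set (set U)) :
  rintegrable m f -> measurable_fun setT pr -> setI_closed G ->
  @measurable d2 U = <<s G >> -> \int[m]_x f x = 0 ->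
  (forall A, G A -> \int[m]_x (\1_A (pr x) * f x) = 0) ->
  forall A, measurable A -> \int[m]_x (\1_A (pr x) * f x) = 0.
Proof.
move=> fi mpr GI GE f0 fG A; rewrite GE; move: A.
pose H := [set A : set U | measurable A /\ \int[m]_x (\1_A (pr x) * f x) = 0].
have mind A : measurable A -> measurable_fun setT (fun x => \1_A (pr x) : R).
  by move=> mA; apply: (measurableT_comp (f := \1_A : U -> R)) => //; exact: measurable_indic.
have ind1 A (x : U) : `|\1_A x : R| <= 1 by rewrite indicE; case: (_ \in _); rewrite ?normr1 ?normr0.
have ii A : measurable A -> rintegrable m (fun x => \1_A (pr x) * f x).
  by move=> mA; apply: (rintegrable_mul_bounded (C := 1) fi (mind _ mA)) => x; exact: ind1.
suff : <<s G >> `<=` H by move=> GH A /GH[].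
apply: (@lambda_system_subset _ G GI setT H) => //; last first.
  by move=> A GA; split; [rewrite GE; exact: sub_sigma_algebra|exact: fG].
split=> //.
- by split=> //; rewrite -[RHS]f0; apply: Rint_eq => x; rewrite indicT mul1r.
- move=> A B BA [mA A0] [mB B0]; split; first exact: measurableD.
  rewrite (_ : \int[m]_x _ = \int[m]_x (\1_A (pr x) * f x - \1_B (pr x) * f x)).
    by rewrite RintB ?A0 ?B0 ?subrr//; exact: ii.
  apply: Rint_eq => x; rewrite -mulrBl; congr (_ * _).
  rewrite !indicE in_setD; case: (boolP (pr x \in B)) => [xB|_]; rewrite ?andbT ?subr0//=.
  by rewrite (mem_set (BA _ (set_mem xB))) subrr.
- move=> F ndF HF; split; first by apply: bigcup_measurable => i _; case: (HF i).
  have cF x : (\1_(F n) (pr x) : R) * f x @[n --> \oo] --> \1_(\bigcup_i F i) (pr x) * f x.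
    apply: cvgM; last exact: cvg_cst.
    have [[i _ Fi]|nF] := pselect ((\bigcup_i F i) (pr x)).
      rewrite indicE mem_set; last by exists i.
      apply: cvg_near_cst; near=> n.
      have Fn : F n (pr x).
        have ni : (i <= n)%N by near: n; exact: nbhs_infty_ge.
        by have /subsetPset := ndF i n ni; apply; exact: Fi.
      by rewrite indicE mem_set.
    rewrite indicE memNset//; apply: cvg_near_cst; near=> n.
    by rewrite indicE memNset// => Fn; apply: nF; exists n.
  have [] := @Rint_dominated _ _ _ m (fun n x => \1_(F n) (pr x) * f x)
    (fun x => \1_(\bigcup_i F i) (pr x) * f x) (fun x => `|f x|) _ cF.
  + by move=> n; apply: rintegrable_measurable; apply: ii; case: (HF n).
  + exact: rintegrable_norm.
  + by move=> n x; rewrite normrM ler_piMl.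
  move=> _ c; apply: (cvg_unique (@Rhausdorff R) c).
  by rewrite (_ : (fun n => _) = fun=> 0); [exact: cvg_cst|apply/funext => n; case: (HF n)].
Unshelve. all: by end_near.
Qed.

(** * Uniqueness of the representing function *)

Section BoxUniqueness.
Variable R : realType.
Local Notation E := (R3 R).
Local Notation RM := (measurableTypeR R).
Local Notation mu := (lebesgue3 R).
Implicit Types (f h : E -> R) (A B C : set R).

Definition prod_ind A B C (x : E) : R := \1_A x.1.1 * \1_B x.1.2 * \1_C x.2.

Lemma measurable_prod_ind A B C : @measurable _ RM A -> @measurable _ RM B -> @measurable _ RM C ->
  measurable3 (prod_ind A B C).
Proof.
move=> mA mB mC.
have mi D (pr : R3 RM -> RM) : @measurable _ RM D -> measurable_fun setT pr -> measurable3 (fun x => \1_D (pr x)).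
  by move=> mD mp; apply: (measurableT_comp (f := \1_D : RM -> R)) => //; exact: measurable_indic.
apply: measurable3M; first apply: measurable3M; apply: mi => //; exact: measurableT_comp.
Qed.

(** Dynkin's argument is run on one coordinate after the other, from intervals to Borel sets, then
    from rectangles to measurable sets of R^2 and of R^3. Truncation to the boxes [f n] makes h
    integrable meanwhile. *)
Lemma boxes_ae0 h : measurable3 h ->
  (forall A B C, ocitv A -> ocitv B -> ocitv C -> integ (fun x => prod_ind A B C x * h x) /\
     \int[mu]_x (prod_ind A B C x * h x) = 0) ->
  exists Z, null_set Z /\ forall x, ~ Z x -> h x = 0.
Proof.
move=> mh hb.
pose N n : set R := `]- n.+1%:R, n.+1%:R]%classic.
have oN n : ocitv (N n) by exists (- n.+1%:R, n.+1%:R).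
pose f n x := prod_ind (N n) (N n) (N n) x * h x.
have fi n : integ (f n) by case: (hb _ _ _ (oN n) (oN n) (oN n)).
have oc_meas A : ocitv A \/ A = setT -> @measurable _ RM A.
  by case=> [oA|->]; [apply: sub_sigma_algebra|exact: measurableT].
have ind1 A (x : R) : `|\1_A x : R| <= 1 by rewrite indicE; case: (_ \in _); rewrite ?normr1 ?normr0.
have pf n A B C : prod_ind A B C =1 fun x => prod_ind A B C x by [].
have base n A B C : ocitv A \/ A = setT -> ocitv B \/ B = setT -> ocitv C \/ C = setT ->
    \int[mu]_x (prod_ind A B C x * f n x) = 0.
  move=> hA hB hC.
  have oI D : ocitv D \/ D = setT -> ocitv (D `&` N n).
    by case=> [oD|->]; [exact: ocitvI|rewrite setTI].
  have [_ <-] := hb _ _ _ (oI _ hA) (oI _ hB) (oI _ hC).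
  by apply: Rint_eq => x; rewrite /f /prod_ind !indicI /=; ring.
have pm1 (pr : R3 RM -> RM) : measurable_fun setT pr -> forall D, @measurable _ RM D -> measurable3 (fun x => \1_D (pr x)).
  by move=> mp D mD; apply: (measurableT_comp (f := \1_D : RM -> R)) => //; exact: measurable_indic.
have m1 : @measurable_fun _ _ (R3 RM) RM setT (fun x => x.1.1) by exact: measurableT_comp.
have m2 : @measurable_fun _ _ (R3 RM) RM setT (fun x => x.1.2) by exact: measurableT_comp.
have m3 : @measurable_fun _ _ (R3 RM) RM setT (fun x => x.2) by exact: measurable_snd.
have ip n A B C : @measurable _ RM A -> @measurable _ RM B -> @measurable _ RM C -> integ (fun x => prod_ind A B C x * f n x).
  move=> mA mB mC; apply: (rintegrable_mul_bounded (C := 1) (fi n)); first exact: measurable_prod_ind.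
  move=> x; rewrite /prod_ind !normrM -[leRHS]mulr1 -[X in _ <= X * _]mulr1.
  by rewrite !ler_pM ?mulr_ge0.
have RMT : @measurable _ RM setT by exact: measurableT.
have s1 n A B C : @measurable _ RM A -> ocitv B \/ B = setT -> ocitv C \/ C = setT ->
    \int[mu]_x (prod_ind A B C x * f n x) = 0.
  move=> mA hB hC; rewrite -[RHS](dynkin_integral (G := @ocitv R)
    (ip n setT B C RMT (oc_meas _ hB) (oc_meas _ hC)) m1 (@ocitvI R) erefl _ _ mA).
  - by apply: Rint_eq => x; rewrite /prod_ind indicT mul1r !mulrA.
  - by apply: base => //; right.
  - move=> D oD; rewrite -[RHS](base n D B C)//; last by left.
    by apply: Rint_eq => x; rewrite /prod_ind indicT mul1r !mulrA.
have s2 n A B C : @measurable _ RM A -> @measurable _ RM B -> ocitv C \/ C = setT ->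
    \int[mu]_x (prod_ind A B C x * f n x) = 0.
  move=> mA mB hC; rewrite -[RHS](dynkin_integral (G := @ocitv R)
    (ip n A setT C mA RMT (oc_meas _ hC)) m2 (@ocitvI R) erefl _ _ mB).
  - by apply: Rint_eq => x; rewrite /prod_ind indicT mulr1; ring.
  - by apply: s1 => //; right.
  - move=> D oD; rewrite -[RHS](s1 n A D C)//; last by left.
    by apply: Rint_eq => x; rewrite /prod_ind indicT mulr1; ring.
have s3 n A B C : @measurable _ RM A -> @measurable _ RM B -> @measurable _ RM C ->
    \int[mu]_x (prod_ind A B C x * f n x) = 0.
  move=> mA mB mC; rewrite -[RHS](dynkin_integral (G := @ocitv R)
    (ip n A B setT mA mB RMT) m3 (@ocitvI R) erefl _ _ mC).
  - by apply: Rint_eq => x; rewrite /prod_ind indicT mulr1; ring.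
  - by apply: s2 => //; right.
  - move=> D oD; rewrite -[RHS](s2 n A B D)//; last by left.
    by apply: Rint_eq => x; rewrite /prod_ind indicT mulr1; ring.
have rectI d1 d2 (T1 : measurableType d1) (T2 : measurableType d2) :
    setI_closed [set A `*` B | A in @measurable _ T1 & B in @measurable _ T2].
  move=> _ _ [A mA [B mB <-]] [A' mA' [B' mB' <-]].
  by exists (A `&` A'); [exact: measurableI|exists (B `&` B'); [exact: measurableI|rewrite setXI]].
have indX (T1 T2 : Type) (A : set T1) (B : set T2) x : (\1_(A `*` B) x : R) = \1_A x.1 * \1_B x.2.
  by rewrite !indicE in_setX; case: (_ \in _); case: (_ \in _); rewrite /= ?mulr1 ?mulr0.
have ind2 (D : set (R * R)) C n : @measurable _ (RM * RM)%type D -> @measurable _ RM C ->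
    \int[mu]_x (\1_D x.1 * (\1_C x.2 * f n x)) = 0.
  move=> mD mC; apply: (dynkin_integral (pr := fst) _ _ (@rectI _ _ RM RM)
     (measurable_prod_measurableType _ _) _ _ mD).
  - by apply: (eq_integ _ (ip n setT setT C RMT RMT mC)) => x; rewrite /prod_ind !indicT !mul1r.
  - exact: measurable_fst.
  - rewrite -[RHS](s3 n setT setT C)//; apply: Rint_eq => x.
    by rewrite /prod_ind !indicT !mul1r.
  - move=> _ [A mA [B mB <-]]; rewrite -[RHS](s3 n A B C)//.
    by apply: Rint_eq => x; rewrite indX /prod_ind !mulrA.
have ind3 (D : set E) n : @measurable _ (R3 RM) D -> \int[mu]_x (\1_D x * f n x) = 0.
  move=> mD; apply: (dynkin_integral (pr := fun x => x) _ _ (@rectI _ _ (RM * RM)%type RM)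
     (measurable_prod_measurableType _ _) _ _ mD).
  - exact: fi.
  - exact: measurable_id.
  - rewrite -[RHS](s3 n setT setT setT)//; apply: Rint_eq => x.
    by rewrite /prod_ind !indicT !mul1r.
  - move=> _ [A mA [B mB <-]]; rewrite -[RHS](ind2 A B n)//.
    by apply: Rint_eq => x; rewrite indX !mulrA.
have ae0 n : ae_eq mu setT (fun x : R3 RM => (f n x)%:E) (cst 0%E).
  apply: integral_ae_eq => //; first exact: fi.
  move=> D _ mD; rewrite integral0 integral_mkcond.
  have -> : ((fun x : R3 RM => (f n x)%:E) \_ D) = fun x => (\1_D x * f n x)%:E.
    by apply/funext => x; rewrite patchE indicE; case: (_ \in _); rewrite ?mul1r ?mul0r.
  rewrite -EFin_Rint ?ind3//; apply: (rintegrable_mul_bounded (C := 1) (fi n)); first exact: measurable3_indic.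
  by move=> x; rewrite indicE; case: (_ \in _); rewrite ?normr1 ?normr0.
have /choice[Zn hZ] : forall n, exists Zn : set E, null_set Zn /\ forall x, ~ Zn x -> f n x = 0.
  move=> n; have [Zn [mZ Z0 sZ]] := ae0 n; exists Zn; split=> // x nx.
  by have := contra_notP (sZ x) nx; rewrite /= => /(_ I) [].
exists (\bigcup_n Zn n); split.
  split; first by apply: bigcup_measurable => n _; case: (hZ n) => [[]].
  have nZ n : measurable (Zn n : set (R3 RM)) by case: (hZ n) => [[]].
  have : mu.-negligible (\bigcup_n Zn n).
    by apply: negligible_bigcup => n; apply/negligibleP => //; case: (hZ n) => [[]].
  by move/negligibleP; apply; exact: bigcup_measurable.
move=> x nx; pose n := Num.trunc (enorm x).
have en : enorm x < n.+1%:R by rewrite /n truncnS_gt.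
have nn (t : R) : `|t| <= enorm x -> (\1_(N n) t : R) = 1.
  move=> ht; rewrite indicE mem_set//= /N /= in_itv /=.
  have /ltr_normlP[h1 h2] : `|t| < n.+1%:R by exact: le_lt_trans en.
  by rewrite ltrNl h1 (ltW h2).
have := (hZ n).2 x (fun z => nx (ex_intro2 _ _ n I z)).
by rewrite /f /prod_ind !nn ?le_coord1 ?le_coord2 ?le_coord3// !mul1r.
Qed.

End BoxUniqueness.

(** * Mollification, and uniqueness of products *)

Section Mollify.
Variables (R : realType) (phi : R3 R -> R).
Hypothesis lp : littlewood_paley phi.
Local Notation E := (R3 R).
Local Notation RM := (measurableTypeR R).
Local Notation mu := (lebesgue3 R).
Implicit Types (f g h psi : E -> R) (u v w : tdist R).

Lemma testfun_schwartz (m : E -> R) : testfun m -> schwartz m.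
Proof.
apply: schwartz_class => {}m tm.
- exact: smooth_continuous tm.1.
- by move=> i x; exact: smooth_derivable tm.1.
- by move=> i; exact: testfun_partial.
- by move=> N; exact: (testfun_rapid tm).2.
Qed.

Lemma norm_sqr_split (t d : R) : 0 < d -> t <= d + d^-1 * (t * t).
Proof.
move=> d0; rewrite -(ler_pM2l d0) mulrDr mulVKf ?gt_eqF//.
have := sqr_ge0 (t - d); have := sqr_ge0 t; have := sqr_ge0 d; rewrite !expr2; nra.
Qed.

(** If this integral vanished, so would that of |phi|, hence [trig 0 phi], hence phi by inversion,
    against the partition of unity. The square of phi can then be normalized into a bump
    function. *)
Lemma Rint_sqr_gt0 : 0 < \int[mu]_x (phi x * phi x).
Proof.
have [tp ep] := lp_symbol lp; have ip := testfun_integ tp.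
have i2 : integ (fun x => phi x * phi x) by apply: testfun_integ; exact: testfunM tp.1 tp.
have I0 : 0 <= \int[mu]_x (phi x * phi x) by apply: Rint_ge0 => x; exact: sqr_ge0.
rewrite lt_neqAle I0 andbT eq_sym; apply/negP => /eqP I00.
have n0 : \int[mu]_x `|phi x| = 0.
  apply/eqP; rewrite eq_le Rint_ge0// andbT; apply/ler_addgt0Pr => e e0; rewrite add0r.
  (* On the support of phi the weight is at most 1 + 8/3, hence at most 4, so 4^6 times [omega] is
     at least 1 there. *)
  pose W := 4 ^+ 6 * womega R.
  have W0 : 0 < W by rewrite mulr_gt0 ?exprn_gt0// (lt_le_trans ltr01)// womega_ge1.
  pose d := e / W; have d0 : 0 < d by exact: divr_gt0.
  have bnd x : `|phi x| <= d * 4 ^+ 6 * omega x + d^-1 * (phi x * phi x).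
    have [->|px] := eqVneq (phi x) 0.
      by rewrite normr0 mulr0 mulr0 addr0 mulr_ge0 ?omega_ge0// mulr_ge0 ?exprn_ge0 ?ltW.
    have /andP[_ h] := lp_supp lp px.
    have w1 : 1 <= 4 ^+ 6 * omega x.
      rewrite /omega -ler_pdivrMr ?invr_gt0 ?exprn_gt0// invrK mul1r lerXn2r ?nnegrE// /wt.
      by apply: le_trans (lerD (lexx 1) h) _; lra.
    apply: (@le_trans _ _ (d + d^-1 * (phi x * phi x))); last first.
      by rewrite lerD2r -mulrA ler_peMr ?(ltW d0).
    have -> : phi x * phi x = `|phi x| * `|phi x| by rewrite -normrM ger0_norm// sqr_ge0.
    exact: norm_sqr_split.
  have iR : integ (fun x => d * 4 ^+ 6 * omega x + d^-1 * (phi x * phi x)).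
    by apply: rintegrableD; apply: rintegrableZ => //; exact: integ_omega.
  apply: (le_trans (Rint_le (rintegrable_norm ip) iR bnd)).
  rewrite RintD; [|by apply: rintegrableZ; exact: integ_omega|exact: rintegrableZ].
  rewrite (RintZ (d * 4 ^+ 6) (integ_omega R)) (RintZ d^-1 i2) I00 mulr0 addr0.
  have -> : e = d * 4 ^+ 6 * womega R by rewrite -mulrA /d divfK// gt_eqF.
  by apply: ler_wpM2l; [rewrite mulr_ge0 ?exprn_ge0 ?(ltW d0)|rewrite /womega lerDr].
have t0 x : trig 0 phi x = 0.
  by apply/eqP; rewrite -normr_le0 -n0; exact: trig_bound.
have p0 x : phi x = 0.
  have := trig_inversion0 x tp ep.
  rewrite (_ : \int[mu]_y _ = 0); last by rewrite -[RHS](Rint0 mu); apply: Rint_eq => y; rewrite t0 mul0r.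
  by move/esym/eqP; rewrite mulf_eq0 expf_eq0 (negbTE (twopi_neq0 R)) andbF => /eqP.
have [_ _ _ /(_ (basis R 0))] := lp.
have b0 : basis R 0 != 0 by apply/eqP => b; have := enorm_basis R 0; rewrite b enorm0 => /eqP; rewrite eq_sym oner_eq0.
move=> /(_ b0) s1; have := sumZ_unique (sumZ_ext (fun j => p0 _) s1) (sumZ0 R).
by move/eqP; rewrite oner_eq0.
Qed.

(* Supported in the positive octant, so that convolving the indicator of a product
   of intervals ]a, b] with its dilates converges everywhere, also on the faces. *)
Lemma bump_exists : exists c : E -> R, [/\ testfun c, forall x, 0 <= c x, \int[mu]_x c x = 1 &
  forall x, c x != 0 -> [/\ 0 < x.1.1, 0 < x.1.2 & 0 < x.2]].
Proof.
have [tp _] := lp_symbol lp.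
(* 4 exceeds 8/3, so the support of phi moved to the point (4, 4, 4) lies in the open positive
   octant. *)
pose a : E := (-4, -4, -4) ; pose I := \int[mu]_x (phi x * phi x).
have I0 : 0 < I := Rint_sqr_gt0.
have t2 : testfun (fun x => phi x * phi x) by exact: testfunM tp.1 tp.
have i2 := testfun_integ t2.
exists (fun x => I^-1 * (phi (a + 1 *: x) * phi (a + 1 *: x))); split.
- split.
    apply: smoothZ; apply: (schwartz_smooth (f := fun x => phi (a + 1 *: x) * phi (a + 1 *: x))).
    exact: (@schwartz_affine _ a 1 (fun x => phi x * phi x) (oner_neq0 R) (testfun_schwartz t2)).
  have [rho hr] := t2.2; exists (rho + enorm a) => x hx.
  have -> : phi (a + 1 *: x) * phi (a + 1 *: x) = 0.
    apply: (hr (a + 1 *: x)); rewrite scale1r.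
    have := enormB (a + x) a; rewrite addrC addKr => h.
    by rewrite -(lerD2r (enorm a)) (le_trans hx).
  by rewrite mulr0.
- by move=> x; rewrite mulr_ge0 ?invr_ge0 ?(ltW I0)// sqr_ge0.
- rewrite RintZ; last exact: (integrable_affine a (oner_neq0 R) i2).
  rewrite (Rint_affine a (oner_neq0 R) i2) normr1 expr1n invr1 mul1r mulVf// gt_eqF//.
- move=> x cx; have px : phi (a + 1 *: x) != 0 by apply: contra cx => /eqP ->; rewrite mulr0 mulr0.
  have /andP[_ h] := lp_supp lp px; rewrite scale1r in h.
  have c1 := le_trans (le_coord1 _) h; have c2 := le_trans (le_coord2 _) h; have c3 := le_trans (le_coord3 _) h.
  move: c1 c2 c3; rewrite /a /=.
  have key (t : R) : `|-4 + t| <= 8 / 3 -> 0 < t by move=> /ler_normlP[h1 h2]; lra.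
  by move=> /key ? /key ? /key ?.
Qed.


Lemma prod_ind_01 (A B C : set R) x : 0 <= prod_ind A B C x <= 1.
Proof.
have i01 (D : set R) (t : R) : 0 <= (\1_D t : R) <= 1 by rewrite indicE; case: (_ \in _); rewrite ?lexx ler01.
move: (i01 A x.1.1) (i01 B x.1.2) (i01 C x.2) => /andP[a0 a1] /andP[b0 b1] /andP[c0 c1].
by rewrite /prod_ind !mulr_ge0//= mulr_ile1// ?mulr_ge0// mulr_ile1.
Qed.

Lemma itv_ind (a b t : R) : (\1_(`]a, b]%classic) t : R) = (a < t <= b)%R%:R.
Proof. by rewrite indicE mem_setE /= in_itv. Qed.

Lemma itv_far (a b t : R) : `|a| + `|b| < `|t| -> (\1_(`]a, b]%classic) t : R) = 0.
Proof.
move=> h; rewrite itv_ind; case: (boolP (a < t <= b)) => // /andP[at_ tb].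
have := ler_norm b; have := ler_norm (- a); rewrite normrN => h1 h2.
have ha := normr_ge0 a; have hb := normr_ge0 b.
suff : `|t| <= `|a| + `|b| by rewrite leNgt h.
by rewrite ler_norml; apply/andP; split; lra.
Qed.

Lemma box_far (a1 b1 a2 b2 a3 b3 : R) : exists2 r : R, 0 <= r & forall x,
  r < enorm x -> prod_ind `]a1, b1] `]a2, b2] `]a3, b3] x = 0.
Proof.
exists ((`|a1| + `|b1|) + (`|a2| + `|b2|) + (`|a3| + `|b3|)); first by rewrite !addr_ge0.
move=> x /lt_le_trans/(_ (enorm_le_sum x)) h; rewrite /prod_ind.
have [h1|h1] := ltP (`|a1| + `|b1|) `|x.1.1|; first by rewrite itv_far// !mul0r.
have [h2|h2] := ltP (`|a2| + `|b2|) `|x.1.2|; first by rewrite (itv_far h2) mulr0 mul0r.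
have [h3|h3] := ltP (`|a3| + `|b3|) `|x.2|; first by rewrite (itv_far h3) mulr0.
by move: h; rewrite ltNge !lerD.
Qed.

(** The indicator of ]a, b] is continuous from the left, end points included. *)
Lemma itv_left_cvg (a b t z : R) : 0 < z ->
  (\1_(`]a, b]%classic) (t - n.+1%:R^-1 * z) : R) @[n --> \oo] --> (\1_(`]a, b]%classic) t : R).
Proof.
move=> z0; apply: cvg_near_cst.
have small (d : R) : 0 < d -> \forall n \near \oo, n.+1%:R^-1 * z < d.
  move=> d0; near=> n; rewrite -ltr_pdivlMr//; near: n.
  by apply: (near_infty_natSinv_lt (PosNum (divr_gt0 d0 z0))).
have p n : 0 < n.+1%:R^-1 * z by rewrite mulr_gt0.
have [ta|ta] := leP t a.
  near=> n; rewrite !itv_ind; apply/eqP.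
  have -> : (a < t) = false by rewrite ltNge ta.
  have := p n; set q := _ * z => q0.
  by have -> : (a < t - q) = false by apply/negbTE; rewrite -leNgt; lra.
have [tb|tb] := leP t b.
  near=> n; rewrite !itv_ind ta tb.
  have h : n.+1%:R^-1 * z < t - a by near: n; apply: small; rewrite subr_gt0.
  have := p n; move: h; set q := _ * z => h q0.
  have -> : a < t - q by lra.
  by have -> : t - q <= b by lra.
near=> n; rewrite !itv_ind.
have -> : (t <= b) = false by rewrite leNgt tb.
have h : n.+1%:R^-1 * z < t - b by near: n; apply: small; rewrite subr_gt0.
move: h; set q := _ * z => h.
have -> : (t - q <= b) = false by apply/negbTE; rewrite -ltNge; lra.
by rewrite !andbF.
Unshelve. all: by end_near.
Qed.

(** The [G n] are mollifications of the indicator by dilates of the bump. They are at most 1 and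
    vanish outside a common ball, on which the dominating psi, the mollification of a larger box,
    equals 1. *)
Lemma box_approx (A B C : set R) : ocitv A -> ocitv B -> ocitv C ->
  exists (G : nat -> E -> R) psi, [/\ forall n, schwartz (G n), schwartz psi,
    forall n x, `|G n x| <= `|psi x| & forall x, G n x @[n --> \oo] --> prod_ind A B C x].
Proof.
move=> [[a1 b1] _ <-] [[a2 b2] _ <-] [[a3 b3] _ <-] /=.
have [c [tc c0 c1 cpos]] := bump_exists.
have rc := testfun_rapid tc; have sc := testfun_schwartz tc; have ic := rapid_integ rc.
have [rho hrho] := tc.2.
have mbox (u1 v1 u2 v2 u3 v3 : R) : measurable3 (prod_ind `]u1, v1] `]u2, v2] `]u3, v3]).
  by apply: measurable_prod_ind.
have rbox (u1 v1 u2 v2 u3 v3 : R) : rapid (prod_ind `]u1, v1] `]u2, v2] `]u3, v3]).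
  split=> // N; have [r r0 hr] := box_far u1 v1 u2 v2 u3 v3.
  exists ((1 + r) ^+ N) => x; have [h|h] := ltP r (enorm x).
    by rewrite hr// normr0 mulr0 exprn_ge0// addr_ge0.
  have /andP[p0 p1] := prod_ind_01 `]u1, v1] `]u2, v2] `]u3, v3] x.
  rewrite (ger0_norm p0) -[leRHS]mulr1 ler_pM ?exprn_ge0//.
  by rewrite lerXn2r ?nnegrE ?addr_ge0// lerD2l.
pose Q := prod_ind `]a1, b1] `]a2, b2] `]a3, b3].
have [r r0 hr] := box_far a1 b1 a2 b2 a3 b3.
pose s n : R := n.+1%:R^-1.
have s0 n : 0 < s n by rewrite invr_gt0.
have sN n : s n != 0 by rewrite gt_eqF.
have s1 n : s n <= 1 by rewrite invf_le1// ler1n.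
pose cn n x := (s n) ^- 3 * c ((s n)^-1 *: x).
have scn n : schwartz (cn n).
  apply: schwartzZ; have := schwartz_affine 0 (invr_neq0 (sN n)) sc.
  by rewrite (_ : (fun x => _) = fun x => c ((s n)^-1 *: x))//; apply/funext => x; rewrite add0r.
have convE n (P : E -> R) x : rapid P -> sconv (cn n) P x = \int[mu]_z (c z * P (x - s n *: z)).
  move=> rP; have ig : integ (fun y => cn n (x - y) * P y).
    by apply: sconv_integ; [exact: schwartz_rapid|exact: rapid_integ].
  have e0 : - s n != 0 by rewrite oppr_eq0.
  have := Rint_affine x e0 ig; rewrite /sconv normrN (gtr0_norm (s0 n)) => h.
  have -> : \int[mu]_y (cn n (x - y) * P y) = s n ^+ 3 * \int[mu]_z (cn n (x - (x + - s n *: z)) * P (x + - s n *: z)).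
    by rewrite h mulVKf ?expf_neq0.
  rewrite -RintZ; last exact: (integrable_affine x e0 ig).
  apply: Rint_eq => z; rewrite /cn scaleNr opprB addrC subrK scalerA mulVf// scale1r mulrA mulrA.
  by rewrite mulfV ?expf_neq0// mul1r.
have iP n (P : E -> R) x : rapid P -> integ (fun z => c z * P (x - s n *: z)).
  move=> rP; have [K K0 hK] := rapid_bounded rP.
  have e0 : - s n != 0 by rewrite oppr_eq0.
  have := rintegrable_mul_bounded (C := K) ic (measurable3_affine x (- s n) rP.1).
  move=> h; apply: (eq_integ _ (h _)) => [z|z]; last exact: hK.
  by rewrite mulrC scaleNr.
pose L := r + `|rho| + `|rho| + 1.
pose P := prod_ind `]- L, L] `]- L, L] `]- L, L].
exists (fun n => sconv (cn n) Q), (sconv (cn 0%N) P); split.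
- by move=> n; apply: sconv_schwartz (scn n) (rbox _ _ _ _ _ _).
- exact: sconv_schwartz (scn _) (rbox _ _ _ _ _ _).
- move=> n x; rewrite !convE; [|exact: rbox|exact: rbox].
  have bQ : `|\int[mu]_z (c z * Q (x - s n *: z))| <= 1.
    rewrite -c1; apply: (Rint_norm_le (iP n Q x (rbox _ _ _ _ _ _)) ic) => z.
    have /andP[q0 q1] := prod_ind_01 `]a1, b1] `]a2, b2] `]a3, b3] (x - s n *: z).
    by rewrite normrM (ger0_norm (c0 z)) (ger0_norm q0) ler_piMr.
  have cz z : c z != 0 -> enorm z <= `|rho|.
    move=> h; rewrite leNgt; apply/negP => hz; move/eqP: h; apply; apply: hrho.
    by apply: le_trans (ltW hz); exact: ler_norm.
  have [hx|hx] := leP (enorm x) (r + `|rho|).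
    rewrite (_ : \int[mu]_z (c z * P _) = 1) ?normr1//.
    rewrite -c1; apply: Rint_eq => z; have [->|h] := eqVneq (c z) 0; first by rewrite mul0r.
    have := cz z h => hz.
    rewrite (_ : P _ = 1) ?mulr1// /P /prod_ind.
    have key (t : R) : `|t| <= enorm (x - s 0%N *: z) -> (\1_(`]- L, L]%classic) t : R) = 1.
      move=> ht; have : `|t| < L.
        apply: (le_lt_trans ht); apply: (le_lt_trans (enormB _ _)).
        have -> : s 0%N *: z = z by rewrite /s invr1 scale1r.
        by apply: (le_lt_trans (lerD hx hz)); rewrite /L ltrDl.
      by move=> /ltr_normlP[h1 h2]; rewrite itv_ind ltrNl h1 (ltW h2).
    by rewrite !key ?mulr1 ?le_coord1 ?le_coord2 ?le_coord3.
  rewrite (_ : \int[mu]_z (c z * Q _) = 0) ?normr0//.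
  rewrite -[RHS](Rint0 mu); apply: Rint_eq => z.
  have [->|h] := eqVneq (c z) 0; first by rewrite mul0r.
  have hz := cz z h; rewrite (_ : Q _ = 0) ?mulr0//; apply: hr.
  have h1 : enorm (s n *: z) <= `|rho|.
    by rewrite enormZ (gtr0_norm (s0 n)) (le_trans _ hz)// ler_piMl// enorm_ge0.
  have := enormD (x - s n *: z) (s n *: z); rewrite subrK => h2.
  by rewrite -(ltrD2r `|rho|); apply: (lt_le_trans hx); apply: (le_trans h2); rewrite lerD2l.
- move=> x; rewrite (_ : (fun n => _) = fun n => \int[mu]_z (c z * Q (x - s n *: z))); last first.
    by apply/funext => n; exact: convE (rbox _ _ _ _ _ _).
  have -> : prod_ind `]a1, b1] `]a2, b2] `]a3, b3] x = \int[mu]_z (c z * Q x).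
    by rewrite RintZr// c1 mul1r.
  have [] := @Rint_dominated _ _ _ mu (fun n z => c z * Q (x - s n *: z)) (fun z => c z * Q x) c _ _ ic.
  + by move=> n; apply: rintegrable_measurable; exact: iP (rbox _ _ _ _ _ _).
  + move=> z; have [->|h] := eqVneq (c z) 0.
      by rewrite mul0r; under eq_fun do rewrite mul0r; exact: cvg_cst.
    have [z1 z2 z3] := cpos z h.
    apply: cvgM; first exact: cvg_cst.
    by apply: cvgM; [apply: cvgM|]; exact: itv_left_cvg.
  + move=> n z; have /andP[q0 q1] := prod_ind_01 `]a1, b1] `]a2, b2] `]a3, b3] (x - s n *: z).
    by rewrite normrM (ger0_norm (c0 z)) (ger0_norm q0) ler_piMr.
  by [].
Qed.

(** Indicators of boxes are dominated limits of Schwartz functions, so the vanishing of all pairings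
    extends to them. *)
Lemma schwartz_null h : measurable3 h -> (forall psi, schwartz psi ->
    integ (fun x => h x * psi x) /\ \int[mu]_x (h x * psi x) = 0) ->
  exists Z, null_set Z /\ forall x, ~ Z x -> h x = 0.
Proof.
move=> mh hh; apply: boxes_ae0 => // A B C oA oB oC.
have [G [psi [sG sp Gp GQ]]] := box_approx oA oB oC.
have [] := @Rint_dominated _ _ _ mu (fun n x => G n x * h x) (fun x => prod_ind A B C x * h x)
  (fun x => `|h x * psi x|).
- by move=> n; apply: measurable3M => //; exact: smooth_measurable (sG n).1.
- by move=> x; apply: cvgM => //; exact: cvg_cst.
- by apply: rintegrable_norm; case: (hh _ sp).
- by move=> n x; rewrite !normrM mulrC ler_wpM2l.
move=> ii c; split=> //; apply: (cvg_unique (@Rhausdorff R) c).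
rewrite (_ : (fun n => _) = fun=> 0); first exact: cvg_cst.
apply/funext => n; rewrite -[RHS](hh _ (sG n)).2; by apply: Rint_eq => x; rewrite mulrC.
Qed.

Definition ae_same f g := exists Z, null_set Z /\ forall x, ~ Z x -> f x = g x.

Lemma represents_ae f g u : represents f u -> represents g u -> ae_same f g.
Proof.
move=> [mf hf] [mg hg].
have [|psi sp|Z [nZ hZ]] := @schwartz_null (fun x => f x - g x).
- exact: measurable3B.
- have [i1 e1] := hf _ sp; have [i2 e2] := hg _ sp.
  have e x : f x * psi x - g x * psi x = (f x - g x) * psi x by rewrite mulrBl.
  split; first by apply: (eq_integ e); exact: rintegrableB.
  rewrite (_ : \int[mu]_x _ = \int[mu]_x (f x * psi x - g x * psi x)); last by apply: Rint_eq => x; rewrite e.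
  by rewrite RintB// -e1 -e2 subrr.
- by exists Z; split=> // x /hZ /eqP; rewrite subr_eq0 => /eqP.
Qed.

Lemma represents_eq_ae f g u v : represents f u -> represents g v -> ae_same f g -> u = v.
Proof.
move=> [mf hf] [mg hg] [Z [nZ hZ]]; apply: tdist_ext => psi sp.
have [i1 ->] := hf _ sp; have [i2 ->] := hg _ sp.
rewrite -(Rint_off nZ (rintegrable_measurable i1)) -(Rint_off nZ (rintegrable_measurable i2)).
apply: Rint_eq => x; have [zx|zx] := pselect (Z x); first by rewrite !off_eq0.
by rewrite !off_id// hZ.
Qed.

Lemma null_setU (Z Z' : set E) : null_set Z -> null_set Z' -> null_set (Z `|` Z').
Proof.
move=> [mZ Z0] [mZ' Z0']; split; first exact: measurableU.
by rewrite -[RHS]Z0; exact: (@measureU0 _ _ _ mu (Z : set (R3 RM)) Z').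
Qed.

Lemma ae_sameM f f' g g' : ae_same f f' -> ae_same g g' -> ae_same (fun x => f x * g x) (fun x => f' x * g' x).
Proof.
move=> [Z [nZ hZ]] [Z' [nZ' hZ']]; exists (Z `|` Z'); split; first exact: null_setU.
by move=> x /not_orP[h h']; rewrite hZ// hZ'.
Qed.

Lemma represents_lin (c : R) f g u v : represents f u -> represents g v ->
  represents (fun x => c * f x + g x) (c *: u + v).
Proof.
move=> [mf hf] [mg hg]; split; first by apply: measurable3D => //; apply: measurable3M => //; exact: measurable3_cst.
move=> psi sp; have [i1 e1] := hf _ sp; have [i2 e2] := hg _ sp.
have e x : c * (f x * psi x) + g x * psi x = (c * f x + g x) * psi x by rewrite mulrDl mulrA.
split; first by apply: (eq_integ e); apply: rintegrableD => //; exact: rintegrableZ.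
rewrite (_ : \int[mu]_x _ = \int[mu]_x (c * (f x * psi x) + g x * psi x)); last by apply: Rint_eq => x; rewrite e.
by rewrite RintD ?RintZ ?(rintegrableZ c i1)// -e1 -e2.
Qed.

Lemma is_product_unique u v w w' : is_product u v w -> is_product u v w' -> w = w'.
Proof.
move=> [f [g [fu gv fg]]] [f' [g' [fu' gv' fg']]].
by apply: (represents_eq_ae fg fg'); apply: ae_sameM; [exact: represents_ae fu fu'|exact: represents_ae gv gv'].
Qed.

Lemma is_productC u v w : is_product u v w -> is_product v u w.
Proof.
move=> [f [g [fu gv fg]]]; exists g, f; split=> //.
by rewrite (_ : g \* f = f \* g)//; apply/funext => x; rewrite /= mulrC.
Qed.

Lemma represents_transfer f g u : represents f u -> measurable3 g -> ae_same f g -> represents g u.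
Proof.
move=> [mf hf] mg [Z [nZ hZ]]; split=> // psi sp; have [i ->] := hf _ sp.
have mp := smooth_measurable sp.1.
have e : off Z (fun x => f x * psi x) = off Z (fun x => g x * psi x).
  by apply/funext => x; have [zx|zx] := pselect (Z x); [rewrite !off_eq0|rewrite !off_id// hZ].
have ig : integ (fun x => g x * psi x).
  have io := integ_off nZ i; rewrite e in io.
  have mm := measurable3M mg mp; apply/integrableP; split; first exact/measurable_EFinP.
  have /integrableP[_] := io; apply: le_lt_trans; rewrite le_eqVlt; apply/orP; left; apply/eqP.
  apply: ge0_ae_eq_integral => //.
  - by apply: measurableT_comp => //; exact/measurable_EFinP.
  - by apply: measurableT_comp => //; apply/measurable_EFinP; exact: measurable_off.
  - have [Y [mY Y0 sY]] := @off_ae _ Z (fun x => g x * psi x) nZ.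
    exists Y; split=> // x /= hx; apply: sY => /= h; apply: hx => _; by move: (h I) => [->].
split=> //; rewrite -(Rint_off nZ (rintegrable_measurable i)) e.
exact: Rint_off (rintegrable_measurable ig).
Qed.

(** The two products may use different representatives of v; these agree almost everywhere, and
    [represents_transfer] absorbs the difference. *)
Lemma is_productB u u' v w w' : is_product u v w -> is_product u' v w' ->
  is_product (u - u') v (w - w').
Proof.
move=> [f [g [fu gv fg]]] [f' [g' [fu' gv' fg']]].
have sub (a b : E -> R) (a' b' : tdist R) : represents a a' -> represents b b' -> represents (fun x => -1 * b x + a x) (a' - b').
  by move=> ha hb; have := represents_lin (-1) hb ha; rewrite scaleN1r addrC.
exists (fun x => -1 * f' x + f x), g; split=> //; first exact: sub.
apply: (represents_transfer (sub _ _ _ _ fg fg')).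
  apply: measurable3M; last by case: gv.
  by apply: measurable3D; [apply: measurable3M; [exact: measurable3_cst|case: fu']|case: fu].
have [Z [nZ hZ]] := represents_ae gv gv'; exists Z; split=> // x zx.
by rewrite /= mulrDl -(hZ x zx) mulrA.
Qed.

End Mollify.

(** * Contraction *)

Section Contraction.
Variables (R : realType) (VD VS : zmodType).
Variables (D : set VD) (nD : VD -> \bar R) (S : set VS) (nS : VS -> \bar R).
Variables (L : VD -> VS -> Prop) (N : VS -> VS -> VS -> Prop).
(* [inS U A] stands for "U lies in S with size at most A". *)
Variables (inD : VD -> R -> Prop) (inS : VS -> R -> Prop) (K CL CN : R).
Hypotheses (K0 : 0 < K) (CL0 : 0 < CL) (CN0 : 0 < CN).
Hypothesis inS_weak : forall U A B, inS U A -> A <= B -> inS U B.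
Hypothesis inSD : forall U V A B, inS U A -> inS V B -> inS (U + V) (2 * (A + B)).
Hypothesis inSB : forall U V A B, inS U A -> inS V B -> inS (U - V) (2 * (A + B)).
Hypothesis inS0 : inS 0 0.
Hypothesis inS_eq0 : forall U, (forall e, 0 < e -> inS U e) -> U = 0.
Hypothesis inS_series : forall (X : nat -> VS) A, 0 < A ->
  (forall n, inS (X n) (A * 8^-1 ^+ n)) ->
  exists U, forall n, inS (U - \sum_(i < n) X i) (4 * (A * 8^-1 ^+ n)).
Hypothesis inD_nD : forall F A, D F -> (nD F <= A%:E)%E -> inD F A.
Hypothesis inS_nS : forall U A, S U -> (nS U <= A%:E)%E -> inS U A.
Hypothesis nS_inS : forall U A, inS U A -> S U /\ (nS U <= (K * A)%:E)%E.
Hypothesis D_B : forall F G, D F -> D G -> D (F - G).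
Hypothesis L_exists : forall F A, inD F A -> exists2 V, L F V & inS V (CL * A).
Hypothesis L_unique : forall F V V', L F V -> L F V' -> V = V'.
Hypothesis L_B : forall F G V W, L F V -> L G W -> L (F - G) (V - W).
Hypothesis N_exists : forall U V A B, inS U A -> inS V B -> exists2 W, N U V W & inS W (CN * (A * B)).
Hypothesis N_unique : forall U V W W', N U V W -> N U V W' -> W = W'.
Hypothesis N_Bl : forall U U' V W W', N U V W -> N U' V W' -> N (U - U') V (W - W').
Hypothesis N_Br : forall U V V' W W', N U V W -> N U V' W' -> N U (V - V') (W - W').

(** The ratio 1/8 outweighs the factor 2 that each addition costs: 2 (A + 4 A / 8) = 3 A <= 4 A. *)
Let inS_sum (X : nat -> VS) n : forall A, (forall i, (i < n)%N -> inS (X i) (A * 8^-1 ^+ i)) -> 0 <= A ->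
  inS (\sum_(i < n) X i) (4 * A).
Proof.
elim: n X => [|n IH] X A h A0.
  by rewrite big_ord0; apply: inS_weak inS0 _; rewrite mulr_ge0.
rewrite big_ord_recl /=.
have h1 : inS (\sum_(i < n) X i.+1) (4 * (A * 8^-1)).
  apply: (IH (fun i => X i.+1)); last by rewrite mulr_ge0// invr_ge0.
    by move=> i hi; rewrite -mulrA -exprS; apply: h.
have := inSD (h 0%N isT) h1; rewrite expr0 mulr1 => h2.
by apply: inS_weak h2 _; lra.
Qed.

(** Polarization: the difference is N(U - U', U) + N(U', U - U'). *)
Let N_diff U U' W W' A B : N U U W -> N U' U' W' -> inS U A -> inS U' A -> inS (U - U') B ->
  inS (W - W') (4 * (CN * A) * B).
Proof.
move=> nW nW' hU hU' hB.
have [W3 n3 _] := N_exists hU' hU; have [W1 n1 h1] := N_exists hB hU; have [W2 n2 h2] := N_exists hU' hB.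
have e1 := N_unique n1 (N_Bl nW n3); have e2 := N_unique n2 (N_Br n3 nW').
have -> : W - W' = W1 + W2 by rewrite e1 e2 addrA subrK.
have -> : 4 * (CN * A) * B = 2 * (CN * (B * A) + CN * (A * B)) by ring.
exact: inSD.
Qed.

Let geo_small (c e : R) : 0 < e -> exists n, c * 8^-1 ^+ n <= e.
Proof.
move=> e0; have c0 : `|c| * 8^-1 ^+ n @[n --> \oo] --> (0 : R).
  rewrite -[X in _ --> X](mulr0 `|c|); apply: cvgM; first exact: cvg_cst.
  by apply: cvg_expr; rewrite gtr0_norm ?invr_gt0// invf_lt1// ltr1n.
have /cvgr_lt/(_ e e0)[n _ h] := c0; exists n.
by apply: le_trans (ltW (h n (leqnn n))); rewrite ler_wpM2r ?exprn_ge0 ?invr_ge0 ?ler_norm.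
Qed.

(** The relation |Z| <= c + |Z| / 8 is iterated from the a priori bound B, since [inS] offers no
    exact norm to solve it for: the part in B is divided by 8 each time, and the part in c stays
    below 2 c because c + 2 c / 8 <= 2 c. *)
Let absorb Z B c e : inS Z B -> 0 <= c -> 0 < e -> (forall A, inS Z A -> inS Z (c + A / 8)) ->
  inS Z (2 * c + e).
Proof.
move=> hB c0 e0 step; have [n hn] := geo_small B e0.
have h k : inS Z (2 * c + B * 8^-1 ^+ k).
  elim: k => [|k IH]; first by apply: inS_weak hB _; rewrite expr0 mulr1 lerDr mulr_ge0.
  apply: inS_weak (step _ IH) _; rewrite exprS; set t := _ ^+ k.
  have -> : B * (8^-1 * t) = B * t / 8 by rewrite mulrCA mulrC.
  by set s := B * t; lra.
by apply: inS_weak (h n) _; rewrite lerD2l.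
Qed.

(** On this ball [N_diff] contracts by 4 CN delta = 1/16, that is by 1/8 after the factor 2 of an
    addition. *)
Let delta : R := (64 * CN)^-1.
Let delta0 : 0 < delta. Proof. by rewrite invr_gt0; exact: mulr_gt0. Qed.
(** The first bound makes the contraction ratio 16 CN CL eps at most 1/8 at size 4 CL eps, which the
    iterates never exceed; the second one places size 4 CL eps inside the ball of radius delta for
    the norm, K being the constant of comparison. *)
Let eps : R := Num.min (128 * CN * CL)^-1 (delta / (8 * K * CL)).
Let eps0 : 0 < eps.
Proof.
rewrite lt_min; apply/andP; split; first by rewrite invr_gt0; apply: mulr_gt0 => //; exact: mulr_gt0.
by apply: divr_gt0 => //; apply: mulr_gt0 => //; exact: mulr_gt0.
Qed.

Let in_ball U : oball S nS delta U -> inS U delta.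
Proof. by move=> [SU nU]; apply: inS_nS => //; exact: ltW. Qed.

Let contract (A : R) : 4 * (CN * delta) * A = A / 16.
Proof. by rewrite /delta; field; rewrite gt_eqF. Qed.

Let exists_solution F : oball D nD eps F -> exists2 U, oball S nS delta U & solution S L N F U.
Proof.
move=> [DF nF]; have [V LV hV] := L_exists (inD_nD DF (ltW nF)).
pose a := CL * eps; have a0 : 0 < a by rewrite mulr_gt0.
have aC : 128 * CN * a <= 1.
  have : eps <= (128 * CN * CL)^-1 by rewrite /eps ge_min lexx.
  rewrite -[leRHS]mul1r ler_pdivlMr; last by apply: mulr_gt0 => //; exact: mulr_gt0.
  by rewrite /a mulrA mulrC.
pose step U := V + xget 0 [set W | N U U W].
have stepP U A : inS U A -> exists2 W, N U U W & step U = V + W.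
  move=> hU; have [W nW _] := N_exists hU hU; exists W => //; rewrite /step.
  by congr (_ + _); apply: (N_unique _ nW); have := @xgetPex _ 0 [set W | N U U W]; apply; exists W.
pose U n := iter n step V.
(* The increments of the Picard iteration; their decay like 8^(-n) is the hypothesis of
   [inS_series]. *)
pose X n := if n is n'.+1 then U n - U n' else V.
have sumX n : \sum_(i < n.+1) X i = U n.
  elim: n => [|n IH]; first by rewrite big_ord1.
  by rewrite big_ord_recr /= IH addrC subrK.
have hX n : inS (X n) (a * 8^-1 ^+ n).
  elim/ltn_ind: n => -[|[|n]] IH; first by rewrite expr0 mulr1.
    have [W nW e] := stepP V _ hV; rewrite /X /U /= e addrC addKr.
    have [W' nW' hW] := N_exists hV hV; rewrite (N_unique nW nW').
    apply: inS_weak hW _; rewrite expr1 -/a mulrA mulrC ler_wpM2l ?(ltW a0)//.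
    by rewrite -(@ler_pM2l _ 128)// mulrA; apply: le_trans aC _; lra.
  have hU m : (m <= n.+1)%N -> inS (U m) (4 * a).
    move=> mn; rewrite -sumX; apply: inS_sum; last exact: ltW.
    by move=> i im; apply: IH; apply: (leq_trans im); rewrite ltnS.
  have [W nW e] := stepP _ _ (hU n.+1 (leqnn _)); have [W' nW' e'] := stepP _ _ (hU n (leqnSn n)).
  have -> : X n.+2 = W - W'.
    rewrite /X; have -> : U n.+2 = V + W by rewrite -e.
    have -> : U n.+1 = V + W' by rewrite -e'.
    by rewrite opprD addrACA subrr add0r.
  apply: inS_weak (N_diff nW nW' (hU _ (leqnn _)) (hU _ (leqnSn n)) (IH n.+1 (leqnn _))) _.
  rewrite [in leRHS]exprS; set t := _ ^+ n.+1.
  have t0 : 0 <= a * t by rewrite mulr_ge0 ?(ltW a0)// exprn_ge0// invr_ge0.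
  have -> : 4 * (CN * (4 * a)) * (a * t) = (128 * CN * a) * (8^-1 * (a * t)) by field.
  by rewrite [leRHS]mulrCA; apply: ler_piMl => //; rewrite mulr_ge0 ?invr_ge0.
have [Z hZ] := inS_series a0 hX.
have hZ0 : inS Z (4 * a) by have := hZ 0%N; rewrite big_ord0 subr0 expr0 mulr1.
have hU n : inS (U n) (4 * a) by rewrite -sumX; apply: inS_sum => [i _|]; [exact: hX|exact: ltW].
have [W nW hW] := N_exists hZ0 hZ0.
(* This difference is Z - U_(n+1) minus N(Z, Z) - N(U_n, U_n), and both are of order 8^(-n). *)
have e : Z - (V + W) = 0.
  apply: inS_eq0 => e e0; have [n hn] := geo_small (20 * a) e0.
  have [Wn nWn en] := stepP _ _ (hU n).
  have d1 : inS (Z - U n) (4 * (a * 8^-1 ^+ n.+1)) by have := hZ n.+1; rewrite sumX.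
  have d2 : inS (Z - U n.+1) (4 * (a * 8^-1 ^+ n.+2)) by have := hZ n.+2; rewrite sumX.
  have d3 := N_diff nW nWn hZ0 (hU n) d1.
  have -> : Z - (V + W) = (Z - U n.+1) - (W - Wn).
    have -> : U n.+1 = V + Wn by rewrite -en.
    by rewrite !opprD opprK !addrA [RHS]addrAC subrK.
  apply: inS_weak (inSB d2 d3) _; apply: le_trans hn.
  rewrite !exprS; set t := _ ^+ n.
  have t0 : 0 <= a * t by rewrite mulr_ge0 ?(ltW a0)// exprn_ge0// invr_ge0.
  have -> : 4 * (CN * (4 * a)) * (4 * (a * (8^-1 * t))) = (128 * CN * a) * (a * t / 16) by field.
  have h1 : (128 * CN * a) * (a * t / 16) <= a * t / 16 by rewrite ler_piMl// divr_ge0.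
  have -> : 4 * (a * (8^-1 * (8^-1 * t))) = a * t / 16 by field.
  by move: h1 t0; rewrite -(mulrA 20); set s := a * t; set q := _ * (_ / 16) => h1 t0; lra.
have eZ : Z = V + W by apply/eqP; rewrite -subr_eq0 e.
have [SZ nZ] := nS_inS hZ0; have [SV _] := nS_inS hV; have [SW _] := nS_inS hW.
exists Z; last by exists V, W.
split=> //; apply: (le_lt_trans nZ); rewrite lte_fin.
apply: (@le_lt_trans _ _ (delta / 2)); last by rewrite ltr_pdivrMr// ltr_pMr// ltr1n.
have : eps <= delta / (8 * K * CL) by rewrite /eps ge_min lexx orbT.
rewrite ler_pdivlMr ?mulr_gt0// /a => h.
have -> : K * (4 * (CL * eps)) = eps * (8 * K * CL) / 2 by field.
by rewrite ler_pM2r// invr_gt0.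
Qed.

(** Serves uniqueness and continuity alike: V is 0 when the data coincide and of size CL |F - F'| in
    general, and [absorb] removes the term B / 8. *)
Let solution_diff F F' U U' : oball S nS delta U -> oball S nS delta U' ->
  solution S L N F U -> solution S L N F' U' -> exists2 V, L (F - F') V &
  forall A B, inS V A -> inS (U - U') B -> inS (U - U') (2 * A + B / 8).
Proof.
move=> hU hU' [V [W [_ _ LV nW eU]]] [V' [W' [_ _ LV' nW' eU']]].
exists (V - V'); first exact: L_B.
move=> A B hV hB; have hW := N_diff nW nW' (in_ball hU) (in_ball hU') hB.
have -> : U - U' = (V - V') + (W - W') by rewrite eU eU' opprD addrACA.
by apply: inS_weak (inSD hV hW) _; rewrite contract; lra.
Qed.

Theorem contraction_well_posed : well_posed D nD S nS L N.
Proof.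
exists eps, delta; split; [exact: eps0|exact: delta0|by move=> F; exact: exists_solution| |].
- move=> F U U' [DF nF] hU hU' sU sU'.
  have [V LV hd] := solution_diff hU hU' sU sU'.
  have V0 : V = 0.
    by have [Y LY _] := L_exists (inD_nD DF (ltW nF)); rewrite (L_unique LV (L_B LY LY)) subrr.
  apply/eqP; rewrite -subr_eq0; apply/eqP; apply: inS_eq0 => e e0.
  have h := absorb (inSB (in_ball hU) (in_ball hU')) (lexx 0) e0.
  have -> : e = 2 * 0 + e by rewrite mulr0 add0r.
  apply: h => A hA; have -> : 0 + A / 8 = 2 * 0 + A / 8 by rewrite mulr0.
  by apply: hd => //; rewrite V0.
- move=> Phi hPhi F hF eta eta0.
  (* [absorb] with c = 2 CL theta and e = CL theta gives 5 CL theta, hence at most 5/8 eta in the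
     norm. *)
  pose theta := eta / (8 * K * CL); exists theta; first by rewrite divr_gt0 ?mulr_gt0.
  have th0 : 0 < theta by rewrite divr_gt0 ?mulr_gt0.
  move=> F' hF' nF.
  have [hU sU] := hPhi F hF; have [hU' sU'] := hPhi F' hF'.
  have [V LV hd] := solution_diff hU' hU sU' sU.
  have [DF _] := hF; have [DF' _] := hF'.
  have [Y LY hY] := L_exists (inD_nD (D_B DF' DF) (ltW nF)).
  rewrite (L_unique LY LV) in hY.
  have c0 : 0 < CL * theta by rewrite mulr_gt0.
  have c2 : 0 <= 2 * (CL * theta) by rewrite mulr_ge0// ltW.
  have h := absorb (inSB (in_ball hU') (in_ball hU)) c2 c0 (fun A => hd _ A hY).
  have [_ hn] := nS_inS h; apply: (le_lt_trans hn); rewrite lte_fin.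
  have -> : K * (2 * (2 * (CL * theta)) + CL * theta) = 5 / 8 * eta.
    by rewrite /theta; field; rewrite !gt_eqF.
  by lra.
Qed.

End Contraction.

Lemma subr_swap (V : zmodType) (a b c d : V) : (a - b) - (c - d) = (a - c) - (b - d).
Proof. by rewrite !opprB addrACA [- b - c]addrC addrACA. Qed.

(** * The Hall-MHD operators *)

Section Bilinear.
Variables (R : realType) (phi : R3 R -> R).
Hypothesis lp : littlewood_paley phi.
Local Notation vfield := ('I_3 -> tdist R).
Local Notation pair_field := (vfield * vfield)%type.
Implicit Types (u v w : vfield) (U V W F G : pair_field).

Lemma is_tensor_unique u v T T' : is_tensor u v T -> is_tensor u v T' -> T = T'.
Proof.
move=> h h'; apply/funext => j; apply/funext => k.
exact: (is_product_unique lp (h j k) (h' j k)).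
Qed.

Lemma is_tensorBl u u' v T T' : is_tensor u v T -> is_tensor u' v T' -> is_tensor (u - u') v (T - T').
Proof. by move=> h h' j k; exact: (is_productB lp (h j k) (h' j k)). Qed.

Lemma is_tensorC u v T : is_tensor u v T -> is_tensor v u (fun j k => T k j).
Proof. by move=> h j k; apply: is_productC. Qed.

Lemma is_tensorBr u v v' T T' : is_tensor u v T -> is_tensor u v' T' -> is_tensor u (v - v') (T - T').
Proof. by move=> h h'; exact: (is_tensorC (is_tensorBl (is_tensorC h) (is_tensorC h'))). Qed.

Lemma is_cross_unique u v w w' : is_cross u v w -> is_cross u v w' -> w = w'.
Proof. by move=> [T h ->] [T' h' ->]; rewrite (is_tensor_unique h h'). Qed.

Lemma cross_of_difference (T T' : 'I_3 -> vfield) (i : 'I_3) :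
  (T (i + 1) (i + 2) - T (i + 2) (i + 1)) - (T' (i + 1) (i + 2) - T' (i + 2) (i + 1)) =
  (T - T') (i + 1) (i + 2) - (T - T') (i + 2) (i + 1).
Proof.
exact: subr_swap.
Qed.

Lemma is_crossBl u u' v w w' : is_cross u v w -> is_cross u' v w' -> is_cross (u - u') v (w - w').
Proof.
move=> [T h ->] [T' h' ->]; exists (T - T'); first exact: is_tensorBl.
by apply/funext => i; exact: cross_of_difference.
Qed.

Lemma is_crossBr u v v' w w' : is_cross u v w -> is_cross u v' w' -> is_cross u (v - v') (w - w').
Proof.
move=> [T h ->] [T' h' ->]; exists (T - T'); first exact: is_tensorBr.
by apply/funext => i; exact: cross_of_difference.
Qed.

Lemma div_tensorB (T T' : 'I_3 -> vfield) : div_tensor (T - T') = div_tensor T - div_tensor T'.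
Proof.
apply/funext => j; rewrite -[RHS]/(div_tensor T j - div_tensor T' j) /div_tensor -sumrB.
by apply: eq_bigr => k _; rewrite -dpartialB.
Qed.

Variables mu nu h : R.
Notation L := (hall_mhd_linear phi mu nu).
Notation N := (hall_mhd_bilinear phi mu nu h).

Lemma hall_linear_unique F V V' : L F V -> L F V' -> V = V'.
Proof.
move=> [h1 h2] [h1' h2']; case: V V' h1 h2 h1' h2' => [a b] [a' b'] /= h1 h2 h1' h2'.
by rewrite (is_stokes_unique h1 h1') (is_stokes_unique h2 h2').
Qed.

Lemma hall_linearB F G V W : L F V -> L G W -> L (F - G) (V - W).
Proof. by move=> [h1 h2] [h1' h2']; split; exact: is_stokesB. Qed.

Lemma hall_bilinear_unique U V W W' : N U V W -> N U V W' -> W = W'.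
Proof.
move=> [[Tu [TB [a b c]]] [X d e]] [[Tu' [TB' [a' b' c']]] [X' d' e']].
move: c' e' d'; rewrite (is_tensor_unique a' a) (is_tensor_unique b' b) => c' e' d'.
rewrite (is_cross_unique d' d) in e'.
case: W W' c e c' e' => [w1 w2] [w1' w2'] /= c e c' e'.
rewrite (is_stokes_unique c c'); congr (_, _); apply/funext => i.
exact: (inv_laplacian_unique (e i) (e' i)).
Qed.

Let combine (Tu TB Tu' TB' : 'I_3 -> vfield) :
  - (Tu - Tu') + (TB - TB') = (- Tu + TB) - (- Tu' + TB').
Proof. by rewrite opprB [Tu' - Tu]addrC addrACA opprD opprK. Qed.

Let slip U U' : (U - U').1 - h *: curl (U - U').2 =
  (U.1 - h *: curl U.2) - (U'.1 - h *: curl U'.2).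
Proof.
case: U U' => [a b] [a' b'].
have -> : ((a, b) - (a', b')).1 = a - a' by [].
have -> : ((a, b) - (a', b')).2 = b - b' by [].
by rewrite curlB scalerBr subr_swap.
Qed.

Lemma hall_bilinearBl U U' V W W' : N U V W -> N U' V W' -> N (U - U') V (W - W').
Proof.
move=> [[Tu [TB [a b c]]] [X d e]] [[Tu' [TB' [a' b' c']]] [X' d' e']]; split.
  exists (Tu - Tu'), (TB - TB'); split; [exact: is_tensorBl|exact: is_tensorBl|].
  by rewrite combine div_tensorB; exact: is_stokesB.
exists (X - X'); first by rewrite slip; exact: is_crossBl.
by move=> i; rewrite curlB; exact: (inv_laplacianB lp (e i) (e' i)).
Qed.

Lemma hall_bilinearBr U V V' W W' : N U V W -> N U V' W' -> N U (V - V') (W - W').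
Proof.
move=> [[Tu [TB [a b c]]] [X d e]] [[Tu' [TB' [a' b' c']]] [X' d' e']]; split.
  exists (Tu - Tu'), (TB - TB'); split; [exact: is_tensorBr|exact: is_tensorBr|].
  by rewrite combine div_tensorB; exact: is_stokesB.
exists (X - X'); first exact: is_crossBr.
by move=> i; rewrite curlB; exact: (inv_laplacianB lp (e i) (e' i)).
Qed.

End Bilinear.

(** * Vector fields: curl, divergence and regularity *)

Section FieldBounds.
Variables (R : realType) (phi : R3 R -> R).
Hypothesis lp : littlewood_paley phi.
Local Notation vfield := ('I_3 -> tdist R).
Notation blk := (lp_block phi).
Notation bes := (bes phi).

Definition vbes (s p r : R) (u : vfield) (A : R) := forall i, bes s p r (u i) A.

(** The choice of representative modulo polynomials, kept apart from the norm bounds, which do not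
    see polynomials. *)
Definition regular (u : vfield) := forall i, sums_to (fun j => blk j (u i)) (u i).

Lemma regular_curl u : regular u -> regular (curl u).
Proof.
move=> ru i; rewrite /curl.
have h k l := sums_to_dpartial k (blk_testfun lp) (ru l).
have := sums_to_lin (-1) (blk_testfun lp) (h (i + 2) (i + 1)) (h (i + 1) (i + 2)).
by rewrite scaleN1r addrC.
Qed.

Lemma regularB u v : regular u -> regular v -> regular (u - v).
Proof.
move=> ru rv i; have := sums_to_lin (-1) (blk_testfun lp) (rv i) (ru i).
by rewrite scaleN1r addrC.
Qed.

Variables (p : R) (p1 : 1 <= p).

Lemma vbes_curl s r : 1 <= r -> exists2 C, 0 < C &
  forall (u : vfield) A, vbes s p r u A -> vbes (s - 1) p r (curl u) (C * A).
Proof.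
move=> r1; have [C C0 h] := bes_dpartial lp s p1 r1.
exists (2 * (C + C)); first by rewrite mulr_gt0// addr_gt0.
move=> u A hu i; have -> : 2 * (C + C) * A = 2 * (C * A + C * A) by ring.
by apply: (besB p1 r1); exact: h.
Qed.

(** Each block of u is recovered from the same block of its Laplacian by 1 / |xi|^2. Nothing is
    summed over j, so every regularity s is allowed. *)
Lemma bes_laplacian s r : 1 <= r -> exists2 C, 0 < C &
  forall u A, bes s p r (laplacian u) A -> bes (s + 2) p r u (C * A).
Proof.
move=> r1; have [C C0 h] := inv_lpb lp p1; exists C => // u A [c [c0 hc A0 hA]].
exists (fun j => C * c j); split.
- by move=> j; rewrite mulr_ge0// ltW.
- move=> j; have := h _ _ _ (hc j).
  have e : C * (pw (-2) j * (pw (- s) j * c j)) = pw (- (s + 2)) j * (C * c j).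
    have -> : pw (- (s + 2)) j = pw (- s) j * pw (-2) j by rewrite -pwD opprD.
    by ring.
  rewrite e => hl; have := lpbZ (-1) (le_trans ler01 p1) hl.
  rewrite normrN normr1 mul1r; apply: eq_lpb => x.
  have [ti _] := invsq_phi_symbol lp j.
  rewrite multiplier_laplacian// mulN1r opprK /lp_block; congr (multiplier _ u x); apply/funext => xi.
  rewrite /invsq; have [->|x0] := eqVneq (dyadic phi j xi) 0; first by rewrite !mulr0.
  have /andP[hx _] := dyadic_supp lp x0.
  have e0 : enorm xi != 0 by rewrite gt_eqF// (lt_le_trans _ hx)// mulr_gt0// exp2_gt0.
  by rewrite mulVKf// expf_neq0.
- by rewrite mulr_ge0// ltW.
- move=> n; have -> : (fun j => (C * c j) `^ r) = fun j => C `^ r * c j `^ r.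
    by apply/funext => j; rewrite powRM// ltW.
  rewrite powRM ?(ltW C0)// wsumZ; apply: ler_wpM2l => //; exact: powR_ge0.
Qed.

(** As div B = 0, curl curl B is minus the Laplacian of B: the second curl spends one derivative and
    [bes_laplacian] returns two. *)
Lemma vbes_of_curl s r : 1 <= r -> exists2 C, 0 < C &
  forall (B : vfield) A, div B = 0 -> vbes s p r (curl B) A -> vbes (s + 1) p r B (C * A).
Proof.
move=> r1; have [C C0 h] := vbes_curl s r1; have [C' C0' h'] := bes_laplacian (s - 1) r1.
exists (C' * C); first exact: mulr_gt0.
move=> B A dB hB i; rewrite -mulrA (_ : s + 1 = s - 1 + 2); last by ring.
apply: h'; have := besN p1 r1 (h _ _ hB i).
by rewrite curl_curl dB dpartial0 sub0r opprK.
Qed.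

End FieldBounds.

(** * Bounds on the linear and bilinear operators *)

Section Estimates.
Variables (R : realType) (phi : R3 R -> R).
Hypothesis lp : littlewood_paley phi.
Local Notation vfield := ('I_3 -> tdist R).
Local Notation pair_field := (vfield * vfield)%type.
Notation bes := (bes phi).
Notation vbes := (vbes phi).
Variables (p r : R) (p1 : 1 <= p) (p3 : p < 3) (r1 : 1 <= r) (r2 : r <= 2).
Notation sigma := (sigma p).
Implicit Types (u v w : vfield) (U V W F : pair_field).

(** One bound for each component of each of the three fields instead of a sum of norms; the two
    sizes differ by a factor of at most 9, three fields of three components. *)
Definition in_S U (A : R) := [/\ vbes sigma p 1 U.1 A, vbes sigma p 1 (curl U.2) A,
  vbes sigma p r U.2 A & [/\ div U.1 = 0, div U.2 = 0, regular phi U.1 & regular phi U.2]].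

Definition in_D F (A : R) := [/\ vbes (3 / p - 3) p 1 F.1 A, vbes (3 / p - 3) p 1 (curl F.2) A,
  vbes (3 / p - 3) p r F.2 A & div F.2 = 0].

Lemma vbes_ge0 s q u A : vbes s p q u A -> 0 <= A.
Proof. by move=> /(_ ord0); exact: bes_ge0. Qed.

Lemma vbes_weak s q u A B : 1 <= q -> vbes s p q u A -> A <= B -> vbes s p q u B.
Proof. by move=> q1 h AB i; apply: bes_weak (h i) AB; exact: le_trans q1. Qed.

Lemma inv_laplacian_curl nu (f w : vfield) : (forall i, inv_laplacian phi nu (f i) (w i)) ->
  forall i, inv_laplacian phi nu (curl f i) (curl w i).
Proof. by move=> h i; apply: inv_laplacianB => //; exact: inv_laplacian_dpartial. Qed.

Lemma inv_laplacian_div nu (f w : vfield) : (forall i, inv_laplacian phi nu (f i) (w i)) ->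
  inv_laplacian phi nu (div f) (div w).
Proof. by move=> h; apply: inv_laplacian_sum => // i; exact: inv_laplacian_dpartial. Qed.

Lemma hall_linear_exists mu nu : exists2 C, 0 < C & forall F A, in_D F A ->
  exists2 V, hall_mhd_linear phi mu nu F V & in_S V (C * A).
Proof.
have [C1 C10 h1] := stokes_exists lp mu p1 p3 (lexx 1).
have [C2 C20 h2] := stokes_exists lp nu p1 p3 r1.
have [C3 C30 h3] := inv_laplacian_bes lp nu p1 p3 (lexx 1).
exists (C1 + (C2 + C3)); first by rewrite !addr_gt0.
move=> F A [hF hc hg dF]; have A0 := vbes_ge0 hF.
have [w1 [s1 d1 k1]] := h1 _ _ hF; have [w2 [s2 d2 k2]] := h2 _ _ hg.
exists (w1, w2) => //.
(* Since div g = 0 the projector acts as the identity, and curl commutes with the inverse Laplacian;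
   the l^1 bound on curl g thus passes to the curl of the solution. *)
have il := inv_laplacian_curl ((is_stokes_divfree phi nu w2 dF).1 s2).
have AC (C : R) : C <= C1 + (C2 + C3) -> C * A <= (C1 + (C2 + C3)) * A by exact: ler_wpM2r.
have c10 := ltW C10; have c20 := ltW C20; have c30 := ltW C30.
split.
- by move=> i; apply: (bes_weak ler01 (k1 i).1); apply: AC; rewrite lerDl addr_ge0.
- move=> i; have [_ /(_ _ (il i))[hb _]] := h3 _ _ (hc i).
  by apply: (bes_weak ler01 hb); apply: AC; rewrite addrA lerDr addr_ge0.
- move=> i; apply: (bes_weak (le_trans ler01 r1) (k2 i).1); apply: AC.
  by rewrite addrCA lerDl addr_ge0.
- by split=> //; [move=> i; exact: (k1 i).2|move=> i; exact: (k2 i).2].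
Qed.

(** Both estimates hold for one T, because the Hall term uses the first one to define its value and
    the second one to bound the curl of that value. *)
Lemma tensor_exists : exists2 C, 0 < C & forall u v A B, vbes sigma p 2 u A -> vbes sigma p 2 v B ->
  regular phi u -> regular phi v -> exists T, [/\ is_tensor u v T,
    forall j k, bes (sigma - 1) p 1 (T j k) (C * (A * B)) &
    forall A' B', vbes sigma p 1 u A' -> vbes (sigma + 1) p 1 v B' ->
      forall j k, bes sigma p 1 (T j k) (C * (A' * B'))].
Proof.
have [C C0 h] := product_law1 lp p1 p3; have [C' C0' h'] := product_law2 lp p1 p3.
exists (C + C'); first exact: addr_gt0.
have c0 := ltW C0; have c0' := ltW C0'.
move=> u v A B hu hv ru rv; have A0 := vbes_ge0 hu; have B0 := vbes_ge0 hv.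
have ex j k : {w : tdist R | is_product (u j) (v k) w /\
    forall s T, 0 <= T -> prod_bound phi s p (u j) (v k) T -> bes s p 1 w T}.
  apply: cid; have := product_exists lp p1 p3 (hu j) (hv k) (ru j) (rv k).
  exact.
exists (fun j k => sval (ex j k)); split.
- by move=> j k; case: (svalP (ex j k)).
- move=> j k; case: (svalP (ex j k)) => _ hb.
  have := hb _ _ _ (h _ _ _ _ (hu j) (hv k)); rewrite !mulr_ge0// => /(_ isT) hb'.
  by apply: (bes_weak ler01 hb'); rewrite ler_wpM2r ?mulr_ge0// lerDl.
- move=> A' B' hu' hv' j k; case: (svalP (ex j k)) => _ hb.
  have A0' := vbes_ge0 hu'; have B0' := vbes_ge0 hv'.
  have := hb _ _ _ (h' _ _ _ _ (hu' j) (hv' k)); rewrite !mulr_ge0// => /(_ isT) hb'.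
  by apply: (bes_weak ler01 hb'); rewrite ler_wpM2r ?mulr_ge0// lerDr.
Qed.

Lemma vbes_two s q u A : 1 <= q -> q <= 2 -> vbes s p q u A -> vbes s p 2 u A.
Proof. by move=> q1 q2 h i; exact: bes_exponent q1 q2 (h i). Qed.

(** The divergence takes the tensors from regularity sigma - 1 to sigma - 2 = 3/p - 3, where
    [stokes_exists] applies. *)
Lemma momentum_exists mu : exists2 C, 0 < C & forall U V A B, in_S U A -> in_S V B ->
  exists Tu TB w, [/\ is_tensor U.1 V.1 Tu, is_tensor U.2 V.2 TB,
    is_stokes phi mu (div_tensor (- Tu + TB)) w &
    [/\ vbes sigma p 1 w (C * (A * B)), div w = 0 & regular phi w]].
Proof.
have [C1 C10 h1] := tensor_exists.
have [C2 C20 h2] := bes_dpartial lp (sigma - 1) p1 (lexx 1).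
have [C3 C30 h3] := stokes_exists lp mu p1 p3 (lexx 1).
exists (C3 * (10 * (C2 * (2 * (C1 + C1))))); first by rewrite !mulr_gt0// addr_gt0.
move=> U V A B [hu _ hb [_ _ ru rb]] [hv _ hc [_ _ rv rc]].
have l12 : (1 : R) <= 2 by rewrite ler1n.
have [Tu [tu bu _]] := h1 _ _ _ _ (vbes_two (lexx 1) l12 hu) (vbes_two (lexx 1) l12 hv) ru rv.
have [TB [tb bb _]] := h1 _ _ _ _ (vbes_two r1 r2 hb) (vbes_two r1 r2 hc) rb rc.
have bT j : bes (3 / p - 3) p 1 (div_tensor (- Tu + TB) j)
    (10 * (C2 * (2 * (C1 * (A * B) + C1 * (A * B))))).
  rewrite /div_tensor; apply: bes_sum3 => // k.
  have := h2 k _ _ (besD p1 (lexx 1) (besN p1 (lexx 1) (bu j k)) (bb j k)).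
  by have -> : sigma - 1 - 1 = 3 / p - 3 by rewrite sigmaE; ring.
have [w [sw dw hw]] := h3 _ _ bT.
exists Tu, TB, w; split=> //; split=> //; last by move=> i; exact: (hw i).2.
move=> i; have [hwi _] := hw i.
have -> : C3 * (10 * (C2 * (2 * (C1 + C1)))) * (A * B) =
  C3 * (10 * (C2 * (2 * (C1 * (A * B) + C1 * (A * B))))) by ring.
exact: hwi.
Qed.

(** The velocity and h curl B have the same regularity sigma in l^1, so they are treated as one
    field e. The cross product X is estimated twice: at sigma - 1 for w, and at sigma, through
    [vbes_of_curl], for curl w. *)
Lemma induction_exists nu h : exists2 C, 0 < C & forall U V A B, in_S U A -> in_S V B ->
  exists X w, [/\ is_cross (U.1 - h *: curl U.2) V.2 X,
    forall i, inv_laplacian phi nu (curl X i) (w i), regular phi w, div w = 0 &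
    vbes sigma p 1 w (C * (A * B)) /\ vbes sigma p 1 (curl w) (C * (A * B))].
Proof.
have [C1 C10 h1] := tensor_exists.
have [C2 C20 h2] := vbes_of_curl lp p1 sigma (lexx 1).
have [C3 C30 h3] := vbes_curl lp p1 (sigma - 1) (lexx 1).
have [C4 C40 h4] := vbes_curl lp p1 sigma (lexx 1).
have [C5 C50 h5] := inv_laplacian_bes lp nu p1 p3 (lexx 1).
pose H := 2 * (1 + `|h|); have H0 : 0 < H by rewrite mulr_gt0// ltr_pwDl.
pose K := C5 * (C3 * (2 * (C1 * H + C1 * H))).
pose K' := C5 * (C3 * (C4 * (2 * (C1 * (H * C2) + C1 * (H * C2))))).
have K0 : 0 < K by rewrite !mulr_gt0// addr_gt0 ?mulr_gt0.
have K0' : 0 < K' by rewrite !mulr_gt0// addr_gt0 ?mulr_gt0.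
exists (K + K'); first exact: addr_gt0.
move=> U V A B [hu hcu hb [_ _ ru rb]] [_ hcc hc [_ dc _ rc]].
have A0 := vbes_ge0 hu; have B0 := vbes_ge0 hc.
have l12 : (1 : R) <= 2 by rewrite ler1n.
pose e : vfield := U.1 - h *: curl U.2.
have he : vbes sigma p 1 e (H * A).
  move=> i; have -> : H * A = 2 * (A + `|h| * A) by rewrite /H; ring.
  exact: (besB p1 (lexx 1) (hu i) (besZ h p1 (lexx 1) (hcu i))).
have re : regular phi e.
  move=> i; have := sums_to_lin (- h) (blk_testfun lp) (regular_curl lp rb i) (ru i).
  by rewrite scaleNr addrC.
have [T [tT b1 b2]] := h1 _ _ _ _ (vbes_two (lexx 1) l12 he) (vbes_two r1 r2 hc) re rc.
have b3 := b2 _ _ he (h2 _ _ dc hcc).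
pose X : vfield := fun i => T (i + 1) (i + 2) - T (i + 2) (i + 1).
have bX1 : vbes (sigma - 1) p 1 X (2 * (C1 * (H * A * B) + C1 * (H * A * B))).
  by move=> i; apply: (besB p1 (lexx 1)); exact: b1.
have bX2 : vbes sigma p 1 X (2 * (C1 * (H * A * (C2 * B)) + C1 * (H * A * (C2 * B)))).
  by move=> i; apply: (besB p1 (lexx 1)); exact: b3.
have es : sigma - 1 - 1 = 3 / p - 3 by rewrite sigmaE; ring.
have bcX := h3 _ _ bX1; rewrite es in bcX.
have bccX := h3 _ _ (h4 _ _ bX2); rewrite es in bccX.
have ex i : {w | inv_laplacian phi nu (curl X i) w} by apply: cid; have [] := h5 _ _ (bcX i).
pose w i := sval (ex i); have iw i : inv_laplacian phi nu (curl X i) (w i) := svalP (ex i).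
have AB0 : 0 <= A * B by exact: mulr_ge0.
exists X, w; split.
- by exists T.
- exact: iw.
- by move=> i; have [_ /(_ _ (iw i))[]] := h5 _ _ (bcX i).
- have := inv_laplacian_div iw; rewrite div_curl => i0.
  exact: (inv_laplacian_unique i0 (inv_laplacian0 phi nu)).
split=> i.
  have [_ /(_ _ (iw i))[hw _]] := h5 _ _ (bcX i); apply: (bes_weak ler01 hw).
  have -> : C5 * (C3 * (2 * (C1 * (H * A * B) + C1 * (H * A * B)))) = K * (A * B) by rewrite /K; ring.
  by apply: ler_wpM2r => //; rewrite lerDl ltW.
have [_ /(_ _ (inv_laplacian_curl iw i))[hw _]] := h5 _ _ (bccX i); apply: (bes_weak ler01 hw).
have -> : C5 * (C3 * (C4 * (2 * (C1 * (H * A * (C2 * B)) + C1 * (H * A * (C2 * B)))))) = K' * (A * B).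
  by rewrite /K'; ring.
by apply: ler_wpM2r => //; rewrite lerDr ltW.
Qed.

Lemma hall_bilinear_exists mu nu h : exists2 C, 0 < C & forall U V A B, in_S U A -> in_S V B ->
  exists2 W, hall_mhd_bilinear phi mu nu h U V W & in_S W (C * (A * B)).
Proof.
have [C1 C10 h1] := momentum_exists mu; have [C2 C20 h2] := induction_exists nu h.
exists (C1 + C2); first exact: addr_gt0.
move=> U V A B hU hV.
have AB0 : 0 <= A * B.
  by case: hU hV => [/vbes_ge0 A0 _ _ _] [/vbes_ge0 B0 _ _ _]; exact: mulr_ge0.
have [Tu [TB [w1 [a b c [d e f]]]]] := h1 _ _ _ _ hU hV.
have [X [w2 [a' b' c' d' [e' f']]]] := h2 _ _ _ _ hU hV.
exists (w1, w2); first by split; [exists Tu, TB|exists X].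
have le1 : C1 * (A * B) <= (C1 + C2) * (A * B) by apply: ler_wpM2r => //; rewrite lerDl ltW.
have le2 : C2 * (A * B) <= (C1 + C2) * (A * B) by apply: ler_wpM2r => //; rewrite lerDr ltW.
split.
- exact: vbes_weak (lexx 1) d le1.
- exact: vbes_weak (lexx 1) f' le2.
- by apply: (vbes_weak r1 _ le2) => i; exact: bes_exponent (lexx 1) r1 (e' i).
- by [].
Qed.

End Estimates.

(** * Geometric series of distributions *)

Section SeriesOfDistributions.
Variables (R : realType) (phi : R3 R -> R).
Hypothesis lp : littlewood_paley phi.
Local Notation E := (R3 R).
Local Notation vfield := ('I_3 -> tdist R).
Notation blk := (lp_block phi).
Notation bes := (bes phi).
Implicit Types (x y : nat -> tdist R) (u v z : tdist R) (psi : E -> R).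

Definition sumlim x u := forall psi, schwartz psi -> (\sum_(i < n) x i psi) @[n --> \oo] --> (u psi : R).

Lemma tdist_val_sum n x psi : (\sum_(i < n) x i) psi = \sum_(i < n) x i psi.
Proof. by elim: n => [|n IH]; rewrite ?big_ord0// !big_ord_recr -IH. Qed.

Lemma sumlimB x y u v : sumlim x u -> sumlim y v -> sumlim (fun i => x i - y i) (u - v).
Proof.
move=> h h' psi sp; rewrite tdist_val_add tdist_val_opp.
rewrite (_ : (fun n => _) = fun n => \sum_(i < n) x i psi - \sum_(i < n) y i psi).
  by apply: cvgB; [exact: h|exact: h'].
by apply/funext => n; rewrite -sumrB.
Qed.

Lemma sumlim_dpartial k x u : sumlim x u -> sumlim (fun i => dpartial k (x i)) (dpartial k u).
Proof.
move=> h psi sp; rewrite dpartialE//.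
rewrite (_ : (fun n => _) = fun n => - \sum_(i < n) x i (partial k psi)).
  by apply: cvgN; apply: h; exact: schwartz_partial.
by apply/funext => n; rewrite -sumrN; apply: eq_bigr => i _; rewrite dpartialE.
Qed.

Lemma sumlim_sum (x : nat -> 'I_3 -> tdist R) (u : 'I_3 -> tdist R) :
  (forall k, sumlim (fun i => x i k) (u k)) -> sumlim (fun i => \sum_(k < 3) x i k) (\sum_(k < 3) u k).
Proof.
move=> h psi sp; have e (f : 'I_3 -> tdist R) : (\sum_(k < 3) f k) psi = f ord0 psi + f (ord0 + 1) psi + f (ord0 + 2) psi.
  by rewrite (sum3 f ord0) !tdist_val_add.
rewrite e (_ : (fun n => _) = fun n => \sum_(i < n) x i ord0 psi + \sum_(i < n) x i (ord0 + 1) psi + \sum_(i < n) x i (ord0 + 2) psi).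
  by apply: cvgD; [apply: cvgD|]; exact: h.
by apply/funext => n; rewrite -!big_split; apply: eq_bigr => i _; rewrite e.
Qed.

Lemma sumlim_zero x u : (forall i, x i = 0) -> sumlim x u -> u = 0.
Proof.
move=> x0 h; apply: tdist_ext => psi sp; rewrite tdist_val0.
apply: (cvg_unique (@Rhausdorff R) (h psi sp)).
rewrite (_ : (fun n => _) = fun=> 0); first exact: cvg_cst.
by apply/funext => n; rewrite big1// => i _; rewrite x0 tdist_val0.
Qed.

Lemma sumlim_shift n x u : sumlim x u -> sumlim (fun i => x (n + i)%N) (u - \sum_(i < n) x i).
Proof.
move=> h psi sp; rewrite tdist_val_add tdist_val_opp tdist_val_sum.
rewrite (_ : (fun m => _) = fun m => \sum_(i < n + m) x i psi - \sum_(i < n) x i psi).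
  apply: cvgB; last exact: cvg_cst.
  rewrite (_ : (fun m => _) = fun m => \sum_(i < m + n) x i psi).
    by rewrite (cvg_shiftn n (fun m => \sum_(i < m) x i psi)); exact: h.
  by apply/funext => m; rewrite addnC.
by apply/funext => m; rewrite big_split_ord [RHS]addrC addKr.
Qed.

Lemma sumlim_exists x (C : R) : 0 <= C -> (forall n psi, schwartz psi ->
    `|x n psi| <= C * 8^-1 ^+ n * fine (schwartz_seminorm 6 psi)) -> exists u, sumlim x u.
Proof.
move=> C0 hx.
have s0 f : 0 <= fine (schwartz_seminorm 6 f) :> R by rewrite fine_ge0 ?seminorm_ge0.
have lim psi : schwartz psi -> exists2 l : R, (\sum_(i < n) x i psi) @[n --> \oo] --> l &
    `|l| <= C * 2 * fine (schwartz_seminorm 6 psi).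
  move=> sp; have [|l hl bl] := @series_abs_cvg R (fun i => x i psi) (C * 2 * fine (schwartz_seminorm 6 psi)).
    move=> n; apply: le_trans (ler_sum _ (fun (i : 'I_n) _ => hx i psi sp)) _.
    rewrite -mulr_suml ler_wpM2r// -mulr_sumr ler_wpM2l//.
    apply: (le_trans (geo_sum n _ _)); rewrite ?invr_ge0 ?invf_lt1 ?ltr1n//.
    by rewrite -[leRHS]invrK lef_pV2 ?posrE ?invr_gt0 ?subr_gt0 ?invf_lt1 ?ltr1n//; lra.
  exists l => //; rewrite (_ : (fun n => _) = series (fun i => x i psi))//.
  by apply/funext => n; rewrite /series /= big_mkord.
pose U psi : R := if `[< schwartz psi >] then limn (fun n => \sum_(i < n) x i psi) else 0.
have UP psi : schwartz psi -> (\sum_(i < n) x i psi) @[n --> \oo] --> U psi.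
  by move=> sp; have [l hl _] := lim psi sp; rewrite /U asboolT// (cvg_lim (@Rhausdorff R) hl).
have tU : U \in @tempered R.
  apply/asboolP; split.
  - move=> a f g sf sg; apply: (cvg_unique (@Rhausdorff R) (UP _ (schwartz_lin a sf sg))).
    rewrite (_ : (fun n => _) = fun n => a * \sum_(i < n) x i f + \sum_(i < n) x i g).
      by apply: cvgD; [apply: cvgM; [exact: cvg_cst|exact: UP]|exact: UP].
    apply/funext => n; rewrite mulr_sumr -big_split; apply: eq_bigr => i _.
    exact: (tdist_lin (x i) a sf sg).
  - exists (C * 2), 6%N => f sf.
    have /fineK <- : schwartz_seminorm 6 f \is a fin_num.
      by rewrite ge0_fin_numE ?seminorm_ge0//; case: sf => _; exact.
    rewrite -EFinM lee_fin; have [l hl bl] := lim f sf.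
    by rewrite (cvg_unique (@Rhausdorff R) (UP f sf) hl).
  - by move=> f nf; rewrite /U asboolF.
by exists (TDist tU) => psi sp; exact: UP.
Qed.

Lemma wsumD (a b : int -> R) n : wsum (fun j => a j + b j) n = wsum a n + wsum b n.
Proof. by rewrite /wsum -big_split; apply: eq_bigr => i _ /=; rewrite addrACA. Qed.

(* The ratio 1/8 beats the factor 2 of the quasi-triangle inequality. *)
Lemma geometric_lr (r : R) n : 1 <= r -> forall (c : nat -> int -> R) (A : R), 0 <= A ->
  (forall i j, 0 <= c i j) -> (forall i N, wsum (fun j => c i j `^ r) N <= (A * 8^-1 ^+ i) `^ r) ->
  forall N, wsum (fun j => (\sum_(i < n) c i j) `^ r) N <= (4 * A) `^ r.
Proof.
move=> r1; have r0 : 0 <= r by exact: le_trans r1.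
elim: n => [|n IH] c A A0 c0 hc N.
  rewrite (_ : wsum _ _ = 0) ?powR_ge0// /wsum big1// => i _.
  by rewrite !big_ord0 powR0 ?addr0// gt_eqF// (lt_le_trans ltr01).
pose d j := \sum_(i < n) c i.+1 j.
have d0 j : 0 <= d j by rewrite sumr_ge0.
have A80 : 0 <= A / 8 by rewrite divr_ge0.
have hd : wsum (fun j => d j `^ r) N <= (4 * (A / 8)) `^ r.
  apply: (IH (fun i => c i.+1)) => // i M.
  by have := hc i.+1 M; rewrite exprS mulrA.
apply: (@le_trans _ _ (wsum (fun j => 2 `^ r * (c 0%N j `^ r + d j `^ r)) N)).
  by apply: ler_wsum => j; rewrite big_ord_recl; apply: powR_quasi => //; exact: d0.
rewrite wsumZ wsumD; have h0 := hc 0%N N; rewrite expr0 mulr1 in h0.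
apply: (@le_trans _ _ (2 `^ r * (A + 4 * (A / 8)) `^ r)).
  apply: ler_wpM2l; first exact: powR_ge0.
  by apply: le_trans (lerD h0 hd) _; apply: powR_superadd => //; rewrite mulr_ge0.
rewrite -powRM//; last by rewrite addr_ge0// mulr_ge0.
apply: ler_powR_base => //; first by rewrite mulr_ge0// addr_ge0// mulr_ge0.
by lra.
Qed.

(** The partial sums of the block bounds increase to limits e j: [lpb_fatou] passes to the limit in
    each block, and the l^r bound passes to the limit window by window. *)
Lemma sumlim_bes (s p r : R) x u (A : R) : 1 <= p -> 1 <= r -> 0 <= A ->
  (forall n, bes s p r (x n) (A * 8^-1 ^+ n)) -> sumlim x u -> bes s p r u (4 * A).
Proof.
move=> p1 r1 A0 hx hu; have r0 : 0 < r by exact: lt_le_trans r1.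
have /choice[c hc] := hx.
have c0 i j : 0 <= c i j by case: (hc i).
pose d n j := \sum_(i < n) c i j.
have d0 n j : 0 <= d n j by rewrite sumr_ge0.
have A4 : 0 <= 4 * A by rewrite mulr_ge0.
have hd n N : wsum (fun j => d n j `^ r) N <= (4 * A) `^ r.
  by apply: geometric_lr => // i M; case: (hc i).
have dle n j : d n j <= 4 * A.
  have h := wsum_term j (fun j => powR_ge0 (d n j) r) (hd n).
  by rewrite leNgt; apply/negP => lt; move: h; rewrite leNgt gt0_ltr_powR// nnegrE.
have dh j : {homo d^~ j : m n / (m <= n)%N >-> m <= n}.
  move=> m n mn; rewrite /d -!(big_mkord xpredT (fun i => c i j)) (big_cat_nat _ mn)//= lerDl.
  by rewrite sumr_ge0.
have dc j : cvgn (d^~ j).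
  by apply: nondecreasing_is_cvgn => //; exists (4 * A) => _ [n _ <-].
pose e j := limn (d^~ j).
have de n j : d n j <= e j by apply: nondecreasing_cvgn_le.
have e0 j : 0 <= e j by exact: le_trans (d0 0%N j) (de 0%N j).
exists e; split=> //.
- move=> j; have pj := pw_ge0 (- s) j.
  pose F n (y : E) := \sum_(i < n) blk j (x i) y.
  have hF n : lpb p (F n) (pw (- s) j * e j).
    apply: (lpb_weak (le_trans ler01 p1) _ (ler_wpM2l pj (de n j))).
    by rewrite /d mulr_sumr; apply: lpb_sum => // i; case: (hc i).
  apply: (lpb_fatou p1 hF) => y.
  apply: hu; apply: schwartz_reflect; apply: schwartz_ker; exact: blk_testfun.
- move=> N; rewrite wsumE.
  have cw : (fun n => \sum_(j <- window N) d n j `^ r) @ \oo --> \sum_(j <- window N) e j `^ r.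
    elim: (window N) => [|j q IH]; first by rewrite big_nil; under eq_fun do rewrite big_nil; exact: cvg_cst.
    rewrite big_cons; under eq_fun do rewrite big_cons; apply: cvgD => //.
    have := cvg_powR_norm r1 (dc j); rewrite (ger0_norm (e0 j)).
    by under eq_fun do rewrite ger0_norm//.
  by apply: (ler_cvg_to cw (cvg_cst _)); apply: nearW => n; rewrite -wsumE.
Qed.

Variables (p r : R) (p1 : 1 <= p) (p3 : p < 3) (r1 : 1 <= r).
Notation sigma := (sigma p).

(** Besov bounds control a fixed Schwartz seminorm. The sum z of the blocks has its own name because
    u, unless it is regular, may differ from it. *)
Lemma bes_pairing : exists2 C, 0 < C & forall u A, bes sigma p r u A ->
  exists z, sums_to (fun j => blk j u) z /\
    forall psi, schwartz psi -> `|z psi| <= C * A * fine (schwartz_seminorm 6 psi).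
Proof.
have p0 : 0 <= p by exact: le_trans p1.
have [C1 C10 h1] := blk_sup lp p1; have [G G0 [b hb wb]] := low_high_wl1 p1 p3.
pose C := 1 + C1; have C0 : 0 < C by rewrite addr_gt0.
exists (2 * (C * G)); first by rewrite !mulr_gt0.
move=> u A hu; have A0 := bes_ge0 hu; have hj := bes_term p1 r1 hu.
have B0 : 0 <= C * A by rewrite mulr_ge0// ltW.
have mb j : wl1 (blk j u) (C * A * b j).
  apply: wb => //.
    by apply: (lpb_weak p0 (hj j)); rewrite ler_wpM2l// ler_peMl// /C lerDl ltW.
  move=> y; apply: (le_trans (h1 _ _ _ (hj j) y)).
  have -> : C1 * (pw (3 / p) j * (pw (- sigma) j * A)) = pw 1 j * (C1 * A).
    have e3 : 3 / p = 1 + sigma by rewrite sigmaE addrC subrK.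
    rewrite (_ : pw (3 / p) j = pw 1 j * pw sigma j); last by rewrite -pwD -e3.
    by rewrite [pw 1 j * _ * _]mulrA -(mulrA (pw 1 j)) pwK mulr1 mulrCA.
  by rewrite ler_wpM2l// ler_wpM2r// /C lerDr.
have mS n : wsum (fun j => C * A * b j) n <= C * A * G by rewrite wsumZ ler_wpM2l.
exists (realize mb mS); split; first exact: sums_to_realize.
move=> psi sp; have h : `|realize mb mS psi| <= _ := realize_fun_le mb mS sp (fun q : E => schwartz_wt6 q sp).
apply: (le_trans h).
by rewrite le_eqVlt; apply/orP; left; apply/eqP; ring.
Qed.

Lemma sums_to_tdist_sum x n : (forall i, sums_to (fun j => blk j (x i)) (x i)) ->
  sums_to (fun j => blk j (\sum_(i < n) x i)) (\sum_(i < n) x i).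
Proof. by move=> h; apply: (sums_to_sum _ (blk_testfun lp)) => i; exact: h. Qed.

Lemma sumlim_tail_bes s x u (A : R) n : 0 <= A -> (forall i, bes s p r (x i) (A * 8^-1 ^+ i)) ->
  sumlim x u -> bes s p r (u - \sum_(i < n) x i) (4 * (A * 8^-1 ^+ n)).
Proof.
move=> A0 hx hu; apply: (sumlim_bes p1 r1 _ _ (sumlim_shift hu)).
  by rewrite mulr_ge0// exprn_ge0// invr_ge0.
by move=> i; rewrite -mulrA -exprD.
Qed.

Lemma sumlim_regular x (A : R) : 0 <= A -> (forall n, bes sigma p r (x n) (A * 8^-1 ^+ n)) ->
  (forall n, sums_to (fun j => blk j (x n)) (x n)) ->
  exists u, sumlim x u /\ sums_to (fun j => blk j u) u.
Proof.
move=> A0 hx sx; have [C C0 hC] := bes_pairing.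
have CA : 0 <= C * A by rewrite mulr_ge0// ltW.
have [|u hu] := @sumlim_exists x (C * A) CA.
  move=> n psi sp; have [z [sz bz]] := hC _ _ (hx n).
  by rewrite (sums_to_unique (sx n) sz) -(mulrA C); exact: bz.
exists u; split=> //.
have [z [sz _]] := hC _ _ (sumlim_bes p1 r1 A0 hx hu).
(* The partial sums are equal to the sums of their own blocks, so [bes_pairing] applied to a tail
   bounds z minus the partial sum by a multiple of 8^(-n). *)
suff e : u = z by rewrite -e in sz.
apply: tdist_ext => psi sp; apply: (cvg_unique (@Rhausdorff R) (hu psi sp)).
have s0 : 0 <= fine (schwartz_seminorm 6 psi) :> R by rewrite fine_ge0 ?seminorm_ge0.
have bnd n : `|z psi - \sum_(i < n) x i psi| <= C * (4 * A) * fine (schwartz_seminorm 6 psi) * 8^-1 ^+ n.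
  have [zn [szn bzn]] := hC _ _ (sumlim_tail_bes n A0 hx hu).
  have := sums_to_lin (-1) (blk_testfun lp) (sums_to_tdist_sum n sx) sz.
  rewrite !scaleN1r [- _ + u]addrC [- _ + z]addrC => /(sums_to_unique szn) e.
  have := bzn psi sp; rewrite e tdist_val_add tdist_val_opp tdist_val_sum.
  by rewrite (_ : C * (4 * (A * 8^-1 ^+ n)) * _ = C * (4 * A) * fine (schwartz_seminorm 6 psi) * 8^-1 ^+ n)//; ring.
have g0 : C * (4 * A) * fine (schwartz_seminorm 6 psi) * 8^-1 ^+ n @[n --> \oo] --> (0 : R).
  rewrite -[X in _ --> X](mulr0 (C * (4 * A) * fine (schwartz_seminorm 6 psi))).
  apply: cvgM; first exact: cvg_cst.
  by apply: cvg_expr; rewrite gtr0_norm ?invr_gt0// invf_lt1// ltr1n.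
have d0 : z psi - \sum_(i < n) x i psi @[n --> \oo] --> (0 : R).
  apply: norm_cvg0; apply: (squeeze_cvgr _ (cvg_cst 0) g0); apply: nearW => n.
  by rewrite normr_ge0 bnd.
have h : (fun n => z psi - (z psi - \sum_(i < n) x i psi)) @ \oo --> z psi - 0 by exact: cvgB (cvg_cst _) d0.
rewrite subr0 (_ : (fun n => _) = fun n => \sum_(i < n) x i psi) in h; first exact: h.
by apply/funext => n; rewrite opprB addrC subrK.
Qed.

Lemma curl_sumlim (x : nat -> vfield) (u : vfield) : (forall k, sumlim (fun i => x i k) (u k)) ->
  forall k, sumlim (fun i => curl (x i) k) (curl u k).
Proof. by move=> h k; apply: sumlimB; exact: sumlim_dpartial. Qed.

Lemma div_sumlim (x : nat -> vfield) (u : vfield) : (forall k, sumlim (fun i => x i k) (u k)) ->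
  sumlim (fun i => div (x i)) (div u).
Proof.
move=> h; apply: (sumlim_sum (x := fun i k => dpartial k (x i k)) (u := fun k => dpartial k (u k))).
by move=> k; exact: sumlim_dpartial.
Qed.

End SeriesOfDistributions.

Section Completeness.
Variables (R : realType) (phi : R3 R -> R).
Hypothesis lp : littlewood_paley phi.
Local Notation vfield := ('I_3 -> tdist R).
Local Notation pair_field := (vfield * vfield)%type.
Notation blk := (lp_block phi).
Variables (p r : R) (p1 : 1 <= p) (p3 : p < 3) (r1 : 1 <= r).
Notation in_S := (in_S phi p r).

Lemma fst_sum (X : nat -> pair_field) n k : (\sum_(i < n) X i).1 k = \sum_(i < n) (X i).1 k.
Proof. by elim: n => [|n IH]; rewrite ?big_ord0// !big_ord_recr /= -IH. Qed.

Lemma snd_sum (X : nat -> pair_field) n k : (\sum_(i < n) X i).2 k = \sum_(i < n) (X i).2 k.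
Proof. by elim: n => [|n IH]; rewrite ?big_ord0// !big_ord_recr /= -IH. Qed.

(** Completeness stated for geometric series only, with tails of the size of their first term up to
    a factor 4. Limits are taken in S', where divergence and curl are continuous. *)
Lemma in_S_series (X : nat -> pair_field) A : 0 < A -> (forall n, in_S (X n) (A * 8^-1 ^+ n)) ->
  exists U, forall n, in_S (U - \sum_(i < n) X i) (4 * (A * 8^-1 ^+ n)).
Proof.
move=> /ltW A0 hX.
have ex1 k : {u | sumlim (fun i => (X i).1 k) u /\ sums_to (fun j => blk j u) u}.
  apply: cid; apply: (sumlim_regular lp p1 p3 (lexx 1) A0) => n; first by case: (hX n) => h _ _ _; exact: h.
  by case: (hX n) => _ _ _ [_ _ h _]; exact: h.
have ex2 k : {u | sumlim (fun i => (X i).2 k) u /\ sums_to (fun j => blk j u) u}.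
  apply: cid; apply: (sumlim_regular lp p1 p3 r1 A0) => n; first by case: (hX n) => _ _ h _; exact: h.
  by case: (hX n) => _ _ _ [_ _ _ h]; exact: h.
pose u : vfield := fun k => sval (ex1 k); pose b : vfield := fun k => sval (ex2 k).
have hu k : sumlim (fun i => (X i).1 k) (u k) by case: (svalP (ex1 k)).
have hb k : sumlim (fun i => (X i).2 k) (b k) by case: (svalP (ex2 k)).
exists (u, b) => n; set Y := _ - _.
have B0 : 0 <= A * 8^-1 ^+ n by rewrite mulr_ge0// exprn_ge0// invr_ge0.
have e1 k : Y.1 k = u k - \sum_(i < n) (X i).1 k by rewrite -fst_sum.
have e2 k : Y.2 k = b k - \sum_(i < n) (X i).2 k by rewrite -snd_sum.
have y1 k : sumlim (fun i => (X (n + i)%N).1 k) (Y.1 k) by rewrite e1; exact: (sumlim_shift (hu k)).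
have y2 k : sumlim (fun i => (X (n + i)%N).2 k) (Y.2 k) by rewrite e2; exact: (sumlim_shift (hb k)).
have hXn i : in_S (X (n + i)%N) (A * 8^-1 ^+ n * 8^-1 ^+ i) by rewrite -mulrA -exprD.
split.
- by move=> k; apply: (sumlim_bes lp p1 (lexx 1) B0 _ (y1 k)) => i; case: (hXn i) => h _ _ _; exact: h.
- move=> k; apply: (sumlim_bes lp p1 (lexx 1) B0 _ (curl_sumlim (x := fun i => (X (n + i)%N).2) y2 (k := k))) => i.
  by case: (hXn i) => _ h _ _; exact: h.
- by move=> k; apply: (sumlim_bes lp p1 r1 B0 _ (y2 k)) => i; case: (hXn i) => _ _ h _; exact: h.
- split.
  + by apply: (sumlim_zero _ (div_sumlim y1)) => i; case: (hXn i) => _ _ _ [].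
  + by apply: (sumlim_zero _ (div_sumlim y2)) => i; case: (hXn i) => _ _ _ [].
  + move=> k; rewrite e1; have s1 : sums_to (fun j => blk j (u k)) (u k) by case: (svalP (ex1 k)).
    have s2 : sums_to (fun j => blk j (\sum_(i < n) (X i).1 k)) (\sum_(i < n) (X i).1 k).
      by apply: (sums_to_tdist_sum lp (x := fun i => (X i).1 k)) => i; case: (hX i) => _ _ _ [_ _ h _]; exact: h.
    by have := sums_to_lin (-1) (blk_testfun lp) s2 s1; rewrite scaleN1r addrC.
  + move=> k; rewrite e2; have s1 : sums_to (fun j => blk j (b k)) (b k) by case: (svalP (ex2 k)).
    have s2 : sums_to (fun j => blk j (\sum_(i < n) (X i).2 k)) (\sum_(i < n) (X i).2 k).
      by apply: (sums_to_tdist_sum lp (x := fun i => (X i).2 k)) => i; case: (hX i) => _ _ _ [_ _ _ h]; exact: h.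
    by have := sums_to_lin (-1) (blk_testfun lp) s2 s1; rewrite scaleN1r addrC.
Qed.

End Completeness.

(** * Comparison with the norms of the statement, and the contraction hypotheses *)

Section Assembly.
Variables (R : realType) (phi : R3 R -> R).
Hypothesis lp : littlewood_paley phi.
Local Notation vfield := ('I_3 -> tdist R).
Notation blk := (lp_block phi).
Notation bes := (bes phi).
Notation vbes := (vbes phi).

Lemma bes0 (s p r : R) : 1 <= p -> 1 <= r -> bes s p r 0 0.
Proof.
move=> p1 r1; have r0 : r != 0 by rewrite gt_eqF// (lt_le_trans ltr01).
exists (fun=> 0); split=> //.
- move=> j; rewrite mulr0; apply: eq_lpb (lpb0 (lt_le_trans ltr01 p1) (lexx 0)) => x.
  by rewrite /lp_block /multiplier tdist_val0.
- by move=> n; rewrite powR0// /wsum big1// => i _; rewrite addr0.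
Qed.

Lemma besov_norm_ge0 (s p r : R) u : (0 <= besov_norm phi s p%:E r%:E u)%E.
Proof. exact: poweR_ge0. Qed.

Lemma besovP (s p r : R) u : 1 <= p -> 1 <= r ->
  besov phi s p%:E r%:E u <-> sums_to (fun j => blk j u) u /\ exists A, bes s p r u A.
Proof.
move=> p1 r1; split=> -[h1 h2]; split=> //.
  have f : besov_norm phi s p%:E r%:E u \is a fin_num by rewrite ge0_fin_numE// besov_norm_ge0.
  exists (fine (besov_norm phi s p%:E r%:E u)).
  by apply/(besP lp) => //; [rewrite fine_ge0// besov_norm_ge0|rewrite fineK].
have [A hA] := h2; apply: (@le_lt_trans _ _ A%:E); last exact: ltry.
by apply/(besP lp) => //; exact: bes_ge0 hA.
Qed.

Lemma vbesov_norm_ge0 (s p r : R) (u : vfield) : (0 <= vbesov_norm phi s p%:E r%:E u)%E.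
Proof. by apply: sume_ge0 => i _; exact: besov_norm_ge0. Qed.

Lemma vbesov_norm_vbes (s p r : R) (u : vfield) A : 1 <= p -> 1 <= r ->
  (vbesov_norm phi s p%:E r%:E u <= A%:E)%E -> vbes s p r u A.
Proof.
move=> p1 r1 h i; have A0 : 0 <= A by rewrite -lee_fin; apply: le_trans h; exact: vbesov_norm_ge0.
apply/(besP lp) => //; apply: le_trans h; rewrite /vbesov_norm (bigD1 i)//= leeDl// sume_ge0// => j _.
exact: besov_norm_ge0.
Qed.

Lemma vbes_vbesov_norm (s p r : R) (u : vfield) A : 1 <= p -> 1 <= r ->
  vbes s p r u A -> (vbesov_norm phi s p%:E r%:E u <= (3 * A)%:E)%E.
Proof.
move=> p1 r1 h; have A0 := vbes_ge0 h.
have h' i : (besov_norm phi s p%:E r%:E (u i) <= A%:E)%E by apply/(besP lp).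
have -> : ((3 * A)%:E = \sum_(i < 3) A%:E)%E.
  by rewrite sumEFin sumr_const card_ord mulr_natl.
by apply: lee_sum => i _.
Qed.

Lemma vbesovP (s p r : R) (u : vfield) : 1 <= p -> 1 <= r ->
  vbesov phi s p%:E r%:E u <-> regular phi u /\ exists A, vbes s p r u A.
Proof.
move=> p1 r1; split=> [h|[ru [A hA]] i]; last by apply/besovP => //; split=> //; exists A.
split=> [i|]; first by case: (h i).
have /choice[A hA] : forall i, exists A, bes s p r (u i) A.
  by move=> i; have /besovP-/(_ p1 r1)[] := h i.
exists (\sum_(i < 3) A i) => i; apply: bes_weak (hA i) _; first exact: le_trans r1.
by rewrite (bigD1 i)//= lerDl sumr_ge0// => j _; exact: bes_ge0 (hA j).
Qed.

Lemma curlD (u v : vfield) : curl (u + v) = curl u + curl v.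
Proof.
apply/funext => i; rewrite -[RHS]/(curl u i + curl v i) /curl.
by rewrite -[(u + v) _]/(u (i + 2) + v (i + 2)) -[(u + v) (i + 1)]/(u (i + 1) + v (i + 1)) !dpartialD opprD addrACA.
Qed.

Lemma regularD (u v : vfield) : regular phi u -> regular phi v -> regular phi (u + v).
Proof.
by move=> ru rv i; have := sums_to_lin 1 (blk_testfun lp) (ru i) (rv i); rewrite !scale1r.
Qed.

Lemma regular0 : regular phi (0 : vfield).
Proof. by move=> i; exact: sums_to0. Qed.

Variables (p r : R) (p1 : 1 <= p) (p3 : p < 3) (r1 : 1 <= r) (r2 : r <= 2).
Notation sigma := (sigma p).
Notation in_S := (in_S phi p r).
Notation in_D := (in_D phi p r).

Lemma in_SD U V A B : in_S U A -> in_S V B -> in_S (U + V) (2 * (A + B)).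
Proof.
move=> [a b c [d e f g]] [a' b' c' [d' e' f' g']].
have l1 : (1 : R) <= 1 by [].
split.
- by move=> i; exact: (besD p1 l1 (a i) (a' i)).
- by move=> i; rewrite (curlD U.2 V.2); exact: (besD p1 l1 (b i) (b' i)).
- by move=> i; exact: (besD p1 r1 (c i) (c' i)).
- split; [by rewrite (divD U.1 V.1) d d' addr0|by rewrite (divD U.2 V.2) e e' addr0|exact: regularD|exact: regularD].
Qed.

Lemma in_SB U V A B : in_S U A -> in_S V B -> in_S (U - V) (2 * (A + B)).
Proof.
move=> [a b c [d e f g]] [a' b' c' [d' e' f' g']].
have l1 : (1 : R) <= 1 by [].
split.
- by move=> i; exact: (besB p1 l1 (a i) (a' i)).
- by move=> i; rewrite (curlB U.2 V.2); exact: (besB p1 l1 (b i) (b' i)).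
- by move=> i; exact: (besB p1 r1 (c i) (c' i)).
- split; [by rewrite (divB U.1 V.1) d d' subr0|by rewrite (divB U.2 V.2) e e' subr0|exact: regularB|exact: regularB].
Qed.

Lemma curl0 : curl (0 : vfield) = 0.
Proof. by apply/funext => i; rewrite /curl !dpartial0 subr0. Qed.

Lemma div0 : div (0 : vfield) = 0.
Proof. by rewrite /div big1// => i _; rewrite dpartial0. Qed.

Lemma in_S0 : in_S 0 0.
Proof.
have l1 : (1 : R) <= 1 by [].
split; [by move=> i; exact: bes0|by move=> i; rewrite curl0; exact: bes0|by move=> i; exact: bes0|].
by split; [exact: div0|exact: div0|exact: regular0|exact: regular0].
Qed.

Lemma in_S_weak U A B : in_S U A -> A <= B -> in_S U B.
Proof.
by move=> [a b c d] AB; split=> //; [exact: vbes_weak a AB|exact: vbes_weak b AB|exact: vbes_weak c AB].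
Qed.

(** A regular field is the sum of its blocks, so by [bes_pairing] its pairings are as small as its
    Besov bounds. *)
Lemma regular_eq0 q (u : vfield) : 1 <= q -> regular phi u -> (forall e, 0 < e -> vbes sigma p q u e) -> u = 0.
Proof.
move=> q1 ru h; have [C C0 hC] := bes_pairing lp p1 p3 q1.
apply/funext => i; apply: tdist_ext => psi sp; rewrite tdist_val0.
have s0 : 0 <= fine (schwartz_seminorm 6 psi) :> R by rewrite fine_ge0 ?seminorm_ge0.
apply/eqP; rewrite -normr_le0; apply/ler_addgt0Pr => e e0; rewrite add0r.
pose d := e / (C * (1 + fine (schwartz_seminorm 6 psi))).
have c0 : 0 < C * (1 + fine (schwartz_seminorm 6 psi)) by rewrite mulr_gt0// ltr_pwDl.
have d0 : 0 < d by exact: divr_gt0.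
have [z [sz bz]] := hC _ _ (h d d0 i); rewrite (sums_to_unique (ru i) sz).
apply: (le_trans (bz psi sp)).
have -> : e = C * d * (1 + fine (schwartz_seminorm 6 psi)) by rewrite mulrAC mulrC /d divfK// gt_eqF.
by apply: ler_wpM2l; [rewrite mulr_ge0// ltW|rewrite lerDr].
Qed.

Lemma in_S_eq0 U : (forall e, 0 < e -> in_S U e) -> U = 0.
Proof.
move=> h; have [_ _ _ [_ _ ra rb]] := h 1 ltr01; case: U h ra rb => a b h ra rb.
have l1 : (1 : R) <= 1 by [].
have -> : a = 0 by apply: (regular_eq0 l1 ra) => e /h[].
have -> // : b = 0 by apply: (regular_eq0 r1 rb) => e /h[].
Qed.

Let sum3_le (x y z : \bar R) A : (0 <= x)%E -> (0 <= y)%E -> (0 <= z)%E -> (x + y + z <= A%:E)%E ->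
  [/\ (x <= A%:E)%E, (y <= A%:E)%E & (z <= A%:E)%E].
Proof.
move=> x0 y0 z0 h; split; apply: le_trans h.
- by rewrite -addeA leeDl// adde_ge0.
- by rewrite addeAC leeDr// adde_ge0.
- by rewrite leeDr// adde_ge0.
Qed.

Lemma D1_in_D F A : D1 phi p r F -> (D1_norm phi p r F <= A%:E)%E -> in_D F A.
Proof.
move=> [_ _ _ d] /sum3_le -/(_ (vbesov_norm_ge0 _ _ _ _) (vbesov_norm_ge0 _ _ _ _) (vbesov_norm_ge0 _ _ _ _))[a b c].
by split=> //; apply: vbesov_norm_vbes.
Qed.

Lemma S1_in_S U A : S1 phi p r U -> (S1_norm phi p r U <= A%:E)%E -> in_S U A.
Proof.
have l1 : (1 : R) <= 1 by [].
move=> [a' _ c' d e] /sum3_le -/(_ (vbesov_norm_ge0 _ _ _ _) (vbesov_norm_ge0 _ _ _ _) (vbesov_norm_ge0 _ _ _ _))[a b c].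
split; [exact: vbesov_norm_vbes a|exact: vbesov_norm_vbes b|exact: vbesov_norm_vbes c|].
split=> //; first by case: (vbesovP (3 / p - 1) U.1 p1 l1) => /(_ a')[].
by case: (vbesovP (3 / p - 1) U.2 p1 r1) => /(_ c')[].
Qed.

Lemma in_S_S1 U A : in_S U A -> S1 phi p r U /\ (S1_norm phi p r U <= (9 * A)%:E)%E.
Proof.
have l1 : (1 : R) <= 1 by [].
move=> [a b c [d e f g]]; split.
  split=> //; apply/vbesovP => //; split=> //; first by exists A.
  - exact: regular_curl.
  - by exists A.
  - by exists A.
have -> : ((9 * A)%:E = (3 * A)%:E + (3 * A)%:E + (3 * A)%:E)%E by rewrite -!EFinD; congr EFin; ring.
by apply: leeD; [apply: leeD|]; exact: vbes_vbesov_norm.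
Qed.

Lemma D1B F G : D1 phi p r F -> D1 phi p r G -> D1 phi p r (F - G).
Proof.
have l1 : (1 : R) <= 1 by [].
have sub s q (u v : vfield) : 1 <= q -> vbesov phi s p%:E q%:E u -> vbesov phi s p%:E q%:E v ->
    vbesov phi s p%:E q%:E (u - v).
  move=> q1 /(vbesovP _ _ p1 q1)[ru [A hA]] /(vbesovP _ _ p1 q1)[rv [B hB]].
  apply/vbesovP => //; split; first exact: regularB.
  by exists (2 * (A + B)) => i; exact: (besB p1 q1 (hA i) (hB i)).
move=> [a b c d] [a' b' c' d']; split.
- exact: (sub _ _ F.1 G.1).
- by rewrite (curlB F.2 G.2); exact: sub.
- exact: (sub _ _ F.2 G.2).
- by rewrite (divB F.2 G.2) d d' subr0.
Qed.

Lemma hall_mhd_well_posed_of_lp mu nu h : hall_mhd_well_posed phi mu nu h p r.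
Proof.
have [CL CL0 hL] := hall_linear_exists lp p1 p3 r1 mu nu.
have [CN CN0 hN] := hall_bilinear_exists lp p1 p3 r1 r2 mu nu h.
apply: (@contraction_well_posed _ _ _ _ _ _ _ _ _ in_D in_S 9 CL CN) => //.
- exact: in_S_weak.
- exact: in_SD.
- exact: in_SB.
- exact: in_S0.
- exact: in_S_eq0.
- exact: in_S_series.
- exact: D1_in_D.
- exact: S1_in_S.
- exact: in_S_S1.
- exact: D1B.
- by move=> F V V'; exact: hall_linear_unique.
- by move=> F G V W; exact: hall_linearB.
- by move=> U V W W'; exact: hall_bilinear_unique.
- by move=> U U' V W W'; exact: hall_bilinearBl.
- by move=> U V V' W W'; exact: hall_bilinearBr.
Qed.

End Assembly.

Theorem theorem1p1 (R : realType) (phi : R3 R -> R) (mu nu h p r : R) :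
  littlewood_paley phi ->
  0 < mu -> 0 < nu -> 0 < h -> 1 <= p -> p < 3 -> 1 <= r -> r <= 2 ->
  hall_mhd_well_posed phi mu nu h p r.
Proof. by move=> lp _ _ _ p1 p3 r1 r2; exact: hall_mhd_well_posed_of_lp. Qed.
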